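(* Let $\Phi$ be a Young function of class $\Delta_2\cap\nabla_2$ and let $\mathcal M$ be a smooth submanifold of $\mathbb R^3$ without boundary. Let $f:\mathbb R^3\times\mathbb R^{3\times3}\to\mathbb R$ be a Carathéodory function such that: (H1) for $\mathcal L^3$-a.e. $(x_\alpha,x_3)\in\mathbb R^2\times\mathbb R$ and every $\xi\in\mathbb R^{3\times3}$, $f(x_\alpha+\mathbf e_i,x_3,\xi)=f(x_\alpha,x_3,\xi)$ for $i=1,2$, where $\{\mathbf e_1,\mathbf e_2\}$ is the canonical basis of $\mathbb R^2$; (H2) there exist $0<\alpha\le\beta<+\infty$ such that $\alpha\Phi(|\xi|)\le f(y,\xi)\le\beta(1+\Phi(|\xi|))$ for a.e. $y\in\mathbb R^3$ and every $\xi\in\mathbb R^{3\times3}$. Let $Tf^0_{\rm hom}$, $\bar f$ and $\bar f^0_{\rm hom}$ be the functions defined in the context. Then: (i) For every $s\in\mathcal M$ and $\xi_\alpha\in[T_s(\mathcal M)]^2$, $Tf^0_{\rm hom}(s,\xi_\alpha)=\bar f^0_{\rm hom}(s,\xi_\alpha)$. (ii) $Tf^0_{\rm hom}$ is tangentially quasiconvex in the second variable, i.e. $$Tf^0_{\rm hom}(s,\xi_\alpha)\le\int_{Q'}Tf^0_{\rm hom}(s,\xi_\alpha+\nabla_\alpha\psi)\,dx_\alpha$$ for every $s\in\mathcal M$, $\xi_\alpha\in[T_s(\mathcal M)]^2$ and $\psi\in W^{1,\infty}_0(Q';T_s(\mathcal M))$. In particular, $Tf^0_{\rm hom}(s,\cdot)$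 is rank one convex. (iii) There exist $\beta'>\alpha'>0$ such that $\alpha'\Phi(|\xi_\alpha|)\le Tf^0_{\rm hom}(s,\xi_\alpha)\le\beta'(1+\Phi(|\xi_\alpha|))$ for every $s\in\mathcal M$ and $\xi_\alpha\in[T_s(\mathcal M)]^2$. Moreover, there exists $C>0$ such that for every $s\in\mathcal M$ and $\xi_\alpha,\xi_\alpha'\in[T_s(\mathcal M)]^2$ $$|Tf^0_{\rm hom}(s,\xi_\alpha)-Tf^0_{\rm hom}(s,\xi_\alpha')|\le C|\xi_\alpha-\xi_\alpha'|\,\big(1+\phi(|\xi_\alpha|+|\xi_\alpha'|)\big),$$ where $\phi:[0,+\infty)\to[0,+\infty)$ is the nondecreasing, right continuous function with $\Phi(t)=\int_0^t\phi(s)\,ds$, $\phi(0)=0$, $\phi(s)>0$ for $s>0$, $\lim_{s\to+\infty}\phi(s)=+\infty$.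
   Context: Young function: $\Phi:[0,\infty)\to[0,\infty)$ continuous, convex, $\Phi(t)>0$ for $t>0$, $\Phi(t)/t\to0$ as $t\to0$ and $\Phi(t)/t\to\infty$ as $t\to\infty$. $\Phi\in\Delta_2$ if there are $a>0$, $t_0\ge0$ with $\Phi(2t)\le a\Phi(t)$ for all $t\ge t_0$. $\Phi\in\nabla_2$ if the complementary function $\widetilde\Phi(t)=\sup_{s\ge0}\{st-\Phi(s)\}$ is in $\Delta_2$, i.e. there are $b>0$, $t_0>1$ with $\Phi(t)\le\frac1{2b}\Phi(bt)$ for all $t\ge t_0$. Carathéodory: measurable in the first variable, continuous in the second. Notation: $x=(x_\alpha,x_3)$, $x_\alpha=(x_1,x_2)$; $\nabla_\alpha=[\partial_1|\partial_2]$, $\nabla_3=\partial_3$; $\xi=[\xi_\alpha|\xi_3]\in\mathbb R^{3\times3}$ with $\xi_\alpha\in\mathbb R^{3\times2}$; $Q'=(-\tfrac12,\tfrac12)^2$; $A_{,1}=A\times(-\tfrac12,\tfrac12)$ for $A\subset\mathbb R^2$. $T_s(\mathcal M)$ is the tangent space to $\mathcal M$ at $s$; $[T_s(\mathcal M)]^m$ is the set of matrices with $m$ columns all in $T_s(\mathcal M)$. Rank one convexity of $Tf^0_{\rm hom}(s,\cdot)$ on $[T_s(\mathcal M)]^2$ means convexity along segments whose endpoints in $[T_s(\mathcal M)]^2$ differ by a matrix of rank at most one. Definitions. For $s\in\mathcal M$ and $\xi_\alpha\in[T_s(\mathcal M)]^2$, $$Tf^0_{\rm hom}(s,\xi_\alpha):=\liminf_{t\to+\infty}\inf_\varphi\Big\{\frac1{t^2}\int_{(tQ')_{,1}}f\big(x_\alpha,x_3,[\xi_\alpha+\nabla_\alpha\varphi\,|\,\nabla_3\varphi]\big)\,dx_\alpha\,dx_3\Big\},$$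 the infimum being over $\varphi\in W^{1,\infty}((tQ')_{,1};T_s(\mathcal M))$ with $\varphi=0$ on $\partial(tQ')\times(-\tfrac12,\tfrac12)$. Let $P_s:\mathbb R^3\to T_s(\mathcal M)$ be the orthogonal projection and $\mathbf P_s(\xi):=[P_s(\xi_1)|P_s(\xi_2)|P_s(\xi_3)]$ for $\xi=[\xi_1|\xi_2|\xi_3]\in\mathbb R^{3\times3}$. Set $$\bar f(x,s,\xi):=f(x,\mathbf P_s(\xi))+\Phi(|\xi-\mathbf P_s(\xi)|),\qquad x\in\mathbb R^3,\ s\in\mathcal M,\ \xi\in\mathbb R^{3\times3},$$ and $$\bar f^0_{\rm hom}(s,\xi_\alpha):=\lim_{t\to+\infty}\inf_\varphi\Big\{\frac1{t^2}\int_{(tQ')_{,1}}\bar f\big(x_\alpha,x_3,s,[\xi_\alpha+\nabla_\alpha\varphi\,|\,\nabla_3\varphi]\big)\,dx_\alpha\,dx_3\Big\},$$ the infimum being over $\varphi\in W^{1,\infty}((tQ')_{,1};\mathbb R^3)$ with $\varphi=0$ on $\partial(tQ')\times(-\tfrac12,\tfrac12)$. *)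

(* Defs.v *)
From HB Require Import structures.
From mathcomp Require Import all_boot all_order all_algebra.
From mathcomp Require Import all_classical all_reals all_analysis.

Set Implicit Arguments.
Unset Strict Implicit.
Unset Printing Implicit Defensive.

Import Order.TTheory GRing.Theory Num.Theory.
Import numFieldNormedType.Exports.

Local Open Scope classical_set_scope.
Local Open Scope ring_scope.

(* The library norm on matrices is the sup norm; |xi| is the Euclidean one. *)
Definition enorm (R : realType) (m n : nat) (A : 'M[R]_(m, n)) : R :=
  Num.sqrt (\sum_i \sum_j A i j ^+ 2).

Section YoungFunctions.
Variable R : realType.
Implicit Types (Phi phi : R -> R).

(* A function [0, +oo[ -> [0, +oo[ is a function R -> R of which only the
   values on [0, +oo[ are used. *)
Definition young Phi : Prop :=
  [/\ {within `[0, +oo[, continuous Phi},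
      convex_function (E := R^o) `[0, +oo[ Phi,
      (0 <= Phi 0 /\ forall t, 0 < t -> 0 < Phi t),
      Phi t / t @[t --> 0^'+] --> (0 : R)
    & Phi t / t @[t --> +oo] --> +oo].

Definition Delta2 Phi : Prop :=
  exists a t0 : R, [/\ 0 < a, 0 <= t0 &
    forall t, t0 <= t -> Phi (2 * t) <= a * Phi t].

(* The set is bounded above when Phi is a Young function and t >= 0, because
   Phi is superlinear. *)
Definition complementary Phi (t : R) : R :=
  sup [set s * t - Phi s | s in `[0, +oo[].

Definition Nabla2 Phi : Prop := Delta2 (complementary Phi).

Definition young_density Phi phi : Prop :=
  [/\ (forall t, 0 <= t ->
         (Phi t)%:E = (\int[lebesgue_measure]_(s in `[0%R, t]) (phi s)%:E)%E),
      {in `[0, +oo[ &, {homo phi : s t / s <= t}},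
      (forall t, 0 <= t -> phi x @[x --> t^'+] --> phi t),
      (phi 0 = 0 /\ forall s, 0 < s -> 0 < phi s)
    & phi s @[s --> +oo] --> +oo].

End YoungFunctions.

Section SmoothMaps.
Variables (R : realType) (V W : normedModType R).

(* C^k on an open set U: all iterated directional derivatives up to order k
   exist and are continuous on U. *)
Fixpoint Ck (k : nat) (U : set V) (f : V -> W) : Prop :=
  (forall x, U x -> {for x, continuous f}) /\
  if k is k'.+1 then
    forall v, (forall x, U x -> derivable f x v) /\ Ck k' U (fun x => 'D_v f x)
  else True.

Definition smooth_on (U : set V) (f : V -> W) : Prop := forall k, Ck k U f.

End SmoothMaps.

Section Submanifolds.
Variable R : realType.
Local Notation vec := ('cV[R]_3).

(* Slice charts: h is a smooth diffeomorphism of the open set U onto the open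
   set W (with inverse g), mapping M `&` U onto the points of W whose last
   3 - k coordinates vanish. *)
Definition submanifold (M : set vec) : Prop :=
  exists2 k : nat, (k <= 3)%N &
    forall s, M s -> exists (U W : set vec) (h g : vec -> vec),
      [/\ [/\ open U, U s & open W],
          smooth_on U h /\ smooth_on W g,
          (forall x, U x -> W (h x) /\ g (h x) = x),
          (forall y, W y -> U (g y) /\ h (g y) = y)
        & forall x, U x ->
            (M x <-> forall i : 'I_3, (k <= i)%N -> h x i 0 = 0)].

(* Velocities at s of the smooth curves in M through s. *)
Definition tangent (M : set vec) (s : vec) : set vec :=
  [set v | exists (gamma : R^o -> vec) (e : R),
    [/\ 0 < e, smooth_on (ball (0 : R^o) e) gamma,
        (forall t, ball (0 : R^o) e t -> M (gamma t)), gamma 0 = s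
      & is_derive (0 : R^o) 1 gamma v]].

(* [T]^m *)
Definition tangent_mx (T : set vec) {m : nat} : set 'M[R]_(3, m) :=
  [set A | forall j, T (col j A)].

(* The orthogonal projection onto a linear subspace T. *)
Definition orthproj (T : set vec) (v : vec) : vec :=
  xget 0 [set p | T p /\ forall w, T w -> \sum_i (v - p) i 0 * w i 0 = 0].

Definition orthproj_mx (T : set vec) (m : nat) (A : 'M[R]_(3, m)) :
    'M[R]_(3, m) :=
  \matrix_(i, j) orthproj T (col j A) i 0.

End Submanifolds.

(* R^2 and R^2 x R; R^o makes them normed spaces. *)
Notation plane2 R := (R^o * R^o)%type.
Notation space3 R := (plane2 R * R^o)%type.

Section Lebesgue.
Variable R : realType.

(* Lebesgue outer measures. The sigma-algebra of caratheodory_type L3 is that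
   of all Lebesgue measurable sets, on which L3 is a (complete) measure. *)
Definition L2 : {outer_measure set (plane2 R) -> \bar R} :=
  [the {outer_measure set _ -> \bar R} of
    ((@lebesgue_measure R \x @lebesgue_measure R)%E^*)%mu].

Definition L3 : {outer_measure set (space3 R) -> \bar R} :=
  [the {outer_measure set _ -> \bar R} of
    (((@lebesgue_measure R \x @lebesgue_measure R) \x
      @lebesgue_measure R)%E^*)%mu].

Definition basis2 (i : 'I_2) : plane2 R := ((i == 0%N :> nat)%:R, (i == 1%N :> nat)%:R).

Definition basis3 (i : 'I_3) : space3 R :=
  ((i == 0%N :> nat)%:R, (i == 1%N :> nat)%:R, (i == 2%N :> nat)%:R).

End Lebesgue.
Arguments L2 {R}.
Arguments L3 {R}.
Arguments basis2 {R}.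
Arguments basis3 {R}.

Section Sobolev.
Variables (R : realType) (V : normedModType R).
Variable mu : {outer_measure set V -> \bar R}.
Local Notation T := (caratheodory_type mu).
Local Notation muT := (mu : set T -> \bar R).

Definition Linfty (Om : set V) (g : V -> R) : Prop :=
  measurable_fun (Om : set T) (g : T -> R) /\
  exists c : R, {ae muT, forall x, Om x -> `|g x| <= c}.

Definition test_function (Om : set V) (theta : V -> R^o) : Prop :=
  [/\ smooth_on setT theta,
      compact (closure [set x | theta x != 0])
    & closure [set x | theta x != 0] `<=` Om].

Definition weak_derivative (Om : set V) (v : V) (u g : V -> R) : Prop :=
  forall theta, test_function Om theta ->
    (\int[muT]_(x in Om) (u x * 'D_v theta x)%:E =
     - \int[muT]_(x in Om) (g x * theta x)%:E)%E.

(* phi is in W^{1,oo}(Om; R^m), with weak gradient G with respect to the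
   coordinate directions e. *)
Definition W1oo (m n : nat) (e : 'I_n -> V) (Om : set V)
    (phi : V -> 'cV[R]_m) (G : V -> 'M[R]_(m, n)) : Prop :=
  forall i, Linfty Om (fun x => phi x i 0) /\
    forall j, Linfty Om (fun x => G x i j) /\
      weak_derivative Om (e j) (fun x => phi x i 0) (fun x => G x i j).

(* On the domains used below (bounded and convex), a class in W^{1,oo} has a
   unique representative continuous up to the boundary; phi is that
   representative, and boundary values are its values on Gamma. *)
Definition zero_on (m : nat) (Om Gamma : set V) (phi : V -> 'cV[R]_m.+1) : Prop :=
  {within closure Om, continuous phi} /\ forall x, Gamma x -> phi x = 0.

End Sobolev.

Section CellProblems.
Variable R : realType.
Local Notation vec := ('cV[R]_3).
Local Notation lebesgue2 := (L2 : set (caratheodory_type (@L2 R)) -> \bar R).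
Local Notation lebesgue3 := (L3 : set (caratheodory_type (@L3 R)) -> \bar R).

Definition frontier (X : topologicalType) (A : set X) : set X :=
  closure A `\` interior A.

(* t Q', where Q' = ]-1/2, 1/2[^2 *)
Definition square (t : R) : set (plane2 R) :=
  `](- (t / 2)), (t / 2)[ `*` `](- (t / 2)), (t / 2)[.

(* A_{,1} = A x ]-1/2, 1/2[ *)
Definition cylinder (A : set (plane2 R)) : set (space3 R) :=
  A `*` `](- 2^-1), 2^-1[.

(* phi in W^{1,oo}((tQ')_{,1}; T), phi = 0 on the lateral boundary,
   G = grad phi *)
Definition admissible (T : set vec) (t : R)
    (phi : space3 R -> vec) (G : space3 R -> 'M[R]_(3, 2 + 1)) : Prop :=
  [/\ W1oo L3 basis3 (cylinder (square t)) phi G,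
      (forall x, cylinder (square t) x -> T (phi x))
    & zero_on (cylinder (square t)) (cylinder (frontier (square t))) phi].

Definition cell (g : space3 R -> 'M[R]_(3, 2 + 1) -> R) (T : set vec)
    (xi : 'M[R]_(3, 2)) (t : R) : \bar R :=
  ereal_inf [set v | exists phi G, admissible T t phi G /\
    v = ((t ^- 2)%:E * \int[lebesgue3]_(x in cylinder (square t))
          (g x (row_mx (xi + lsubmx (G x)) (rsubmx (G x))))%:E)%E].

Definition Tfhom (f : space3 R -> 'M[R]_3 -> R) (M : set vec) (s : vec)
    (xi : 'M[R]_(3, 2)) : \bar R :=
  limf_einf (cell f (tangent M s) xi) (pinfty_nbhs R).

Definition fbar (f : space3 R -> 'M[R]_3 -> R) (Phi : R -> R) (M : set vec)
    (x : space3 R) (s : vec) (xi : 'M[R]_3) : R :=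
  f x (orthproj_mx (tangent M s) xi) +
  Phi (enorm (xi - orthproj_mx (tangent M s) xi)).

Definition fbar_cell (f : space3 R -> 'M[R]_3 -> R) (Phi : R -> R)
    (M : set vec) (s : vec) (xi : 'M[R]_(3, 2)) (t : R) : \bar R :=
  cell (fun x => fbar f Phi M x s) setT xi t.

Definition fbarhom (f : space3 R -> 'M[R]_3 -> R) (Phi : R -> R)
    (M : set vec) (s : vec) (xi : 'M[R]_(3, 2)) : \bar R :=
  lim (fbar_cell f Phi M s xi t @[t --> +oo]).

Definition caratheodory_fun (f : space3 R -> 'M[R]_3 -> R) : Prop :=
  (forall xi, measurable_fun [set: caratheodory_type (@L3 R)] (f ^~ xi)) /\
  (forall x, continuous (f x : 'M[R]_3 -> R^o)).

Definition inplane_periodic (f : space3 R -> 'M[R]_3 -> R) : Prop :=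
  {ae lebesgue3, forall x, forall (xi : 'M[R]_3) (i : 'I_2),
    f (x.1 + basis2 i, x.2) xi = f x xi}.

Definition Phi_growth (Phi : R -> R) (f : space3 R -> 'M[R]_3 -> R) : Prop :=
  exists alpha beta : R, 0 < alpha <= beta /\
    {ae lebesgue3, forall y, forall xi : 'M[R]_3,
      alpha * Phi (enorm xi) <= f y xi <= beta * (1 + Phi (enorm xi))}.

Definition tangentially_quasiconvex (M : set vec)
    (h : vec -> 'M[R]_(3, 2) -> \bar R) : Prop :=
  forall s, M s -> forall xi : 'M[R]_(3, 2), tangent_mx (tangent M s) xi ->
  forall (psi : plane2 R -> vec) (G : plane2 R -> 'M[R]_(3, 2)),
    W1oo L2 basis2 (square 1) psi G ->
    (forall x, square 1 x -> tangent M s (psi x)) ->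
    zero_on (square 1) (frontier (square 1)) psi ->
    (h s xi <= \int[lebesgue2]_(x in square 1) h s (xi + G x)%R)%E.

Definition rank_one_convex (T : set vec) (h : 'M[R]_(3, 2) -> \bar R) : Prop :=
  forall xi eta : 'M[R]_(3, 2), tangent_mx T xi -> tangent_mx T eta ->
    (\rank (xi - eta)%R <= 1)%N ->
  forall l : R, 0 <= l <= 1 ->
    (h (l *: xi + (1 - l) *: eta)%R <= l%:E * h xi + (1 - l)%:E * h eta)%E.

End CellProblems.

(* Main.v *)
(* For a tangent space T, let hom T xi be the infimum over k of the cell
   energies of the cells of integer size k.  Admissible fields extend by zero
   beyond the lateral boundary, so they can be translated, tiled and put in
   larger cells: tiling by periodicity and enlarging at the cost of a thin layer
   show that the cell energies converge to hom T xi.  Projecting a competitor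
   on T decreases the energy of fbar, hence the two cell problems have the same
   value for every t, which is (i).

   Tangential quasiconvexity: near each gradient a, one corrector of a large
   cell is almost optimal for all tangential gradients close to a.  The gradient
   of the test field takes values in a compact set, covered by finitely many
   such neighbourhoods, whose preimages are approximated by unions of squares of
   a fine grid.  Rescaling the test field and adding in each square the
   corrector of its label gives a competitor for hom T xi.

   Rank-one convexity: for xi +- a (x) n, use the test fields +-u(n.x) a cut off
   near the boundary, where u is a zigzag of slope +-1 obtained from the identity
   by repeated folding, so of arbitrarily small amplitude.  Adding the two
   inequalities gives midpoint convexity, and hom T is locally bounded. *)
Require Import Defs.
From HB Require Import structures.
From mathcomp Require Import all_boot all_order all_algebra.
From mathcomp Require Import all_classical all_reals all_analysis.
From mathcomp Require Import measurable_realfun lra ring.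

Set Implicit Arguments.
Unset Strict Implicit.
Unset Printing Implicit Defensive.

Import Order.TTheory GRing.Theory Num.Theory.
Import numFieldNormedType.Exports.

Local Open Scope classical_set_scope.
Local Open Scope ring_scope.

(** * Euclidean norm and Young functions *)

(** The integrand is merely measurable in x and the gradients of test fields merely bounded, so
    quasiconvexity does not go through piecewise affine approximation of the test field. The
    substitute is a corrector inequality quantified over all variable gradients B, with a penalty on
    the set where B is far from a; it survives tiling and asks of B only measurability, tangency and
    a bound. What is known only almost everywhere is disposed of once: the integrand is replaced by
    one that is periodic and satisfies the growth bounds at every point, and admissible pairs by
    pairs defined everywhere, bounded, tangential, with gradient zero off the cylinder. Lattice
    translations, sums and gluings then become pointwise identities. The Lipschitz estimate is
    proved on the cell problem itself, from the growth bounds and Delta_2. It comes with the factor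
    (1 + Phi(r))/(1 + r), at most 1 + phi(r) since Phi(r) <= r phi(r); its constant depends on Phi,
    alpha and beta only, hence is common to all tangent spaces. *)

Section EuclideanNorm.
Variables (R : realType) (m n : nat).
Implicit Types A B C : 'M[R]_(m, n).

Definition edot A B : R := \sum_i \sum_j A i j * B i j.

Lemma edotC A B : edot A B = edot B A.
Proof. by apply: eq_bigr => i _; apply: eq_bigr => j _; rewrite mulrC. Qed.

Lemma edotDl A B C : edot (A + B) C = edot A C + edot B C.
Proof.
rewrite /edot -big_split; apply: eq_bigr => i _; rewrite -big_split.
by apply: eq_bigr => j _; rewrite mxE mulrDl.
Qed.

Lemma edotZl (a : R) A B : edot (a *: A) B = a * edot A B.
Proof.
rewrite /edot mulr_sumr; apply: eq_bigr => i _; rewrite mulr_sumr.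
by apply: eq_bigr => j _; rewrite mxE mulrA.
Qed.

Lemma edotDr A B C : edot C (A + B) = edot C A + edot C B.
Proof. by rewrite edotC edotDl !(edotC C). Qed.

Lemma edotZr (a : R) A B : edot A (a *: B) = a * edot A B.
Proof. by rewrite edotC edotZl edotC. Qed.

Lemma edotBl A B C : edot (A - B) C = edot A C - edot B C.
Proof. by rewrite -scaleN1r edotDl edotZl mulN1r. Qed.

Lemma edot_ge0 A : 0 <= edot A A.
Proof.
by apply: sumr_ge0 => i _; apply: sumr_ge0 => j _; rewrite -expr2 sqr_ge0.
Qed.

Lemma enorm_sqr A : enorm A ^+ 2 = edot A A.
Proof.
rewrite sqr_sqrtr.
  by apply: eq_bigr => i _; apply: eq_bigr => j _; rewrite expr2.
by apply: sumr_ge0 => i _; apply: sumr_ge0 => j _; rewrite sqr_ge0.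
Qed.

Lemma enorm_ge0 A : 0 <= enorm A. Proof. exact: sqrtr_ge0. Qed.

Lemma normr_entry_le A i j : `|A i j| <= enorm A.
Proof.
rewrite -(ler_pXn2r (ltn0Sn 1)) ?nnegrE ?enorm_ge0// enorm_sqr.
rewrite real_normK ?num_real// /edot (bigD1 i)//= (bigD1 j)//= -expr2.
rewrite -addrA lerDl addr_ge0//.
  by apply: sumr_ge0 => k _; rewrite -expr2 sqr_ge0.
by apply: sumr_ge0 => k _; apply: sumr_ge0 => l _; rewrite -expr2 sqr_ge0.
Qed.

Lemma enorm_eq0 A : enorm A = 0 -> A = 0.
Proof.
move=> A0; apply/matrixP => i j; rewrite mxE; apply/eqP.
by rewrite -normr_le0 -A0 normr_entry_le.
Qed.

Lemma enorm0 : enorm (0 : 'M[R]_(m, n)) = 0.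
Proof.
rewrite /enorm big1 ?sqrtr0// => i _; rewrite big1// => j _.
by rewrite mxE expr0n.
Qed.

Lemma enormZ (a : R) A : enorm (a *: A) = `|a| * enorm A.
Proof.
apply/eqP; rewrite -(@eqrXn2 _ 2)// ?mulr_ge0 ?enorm_ge0//.
by rewrite exprMn !enorm_sqr edotZl edotZr real_normK ?num_real// mulrA -expr2.
Qed.

Lemma enormN A : enorm (- A) = enorm A.
Proof. by rewrite -scaleN1r enormZ normrN normr1 mul1r. Qed.

Lemma enormBC A B : enorm (A - B) = enorm (B - A).
Proof. by rewrite -enormN opprB. Qed.

(** Expanding the square of [enorm B *: A - enorm A *: B] gives 2ab(ab - A.B) >= 0, where a and b
    are the two norms; dividing by ab is why the zero norms are treated apart. *)
Lemma edot_le A B : edot A B <= enorm A * enorm B.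
Proof.
have [A0|A0] := eqVneq (enorm A) 0.
  rewrite (enorm_eq0 A0) enorm0 mul0r /edot big1// => i _.
  by rewrite big1// => j _; rewrite mxE mul0r.
have [B0|B0] := eqVneq (enorm B) 0.
  rewrite (enorm_eq0 B0) enorm0 mulr0 /edot big1// => i _.
  by rewrite big1// => j _; rewrite mxE mulr0.
have ab0 : 0 < enorm A * enorm B.
  by rewrite mulr_gt0// lt_def enorm_ge0 ?A0 ?B0.
have := edot_ge0 (enorm B *: A - enorm A *: B).
rewrite edotBl !edotZl !(edotC _ (_ - _)) !edotBl !edotZl (edotC B A).
rewrite -!enorm_sqr => h.
rewrite -subr_ge0 -(pmulr_rge0 _ ab0).
move: h; set a := enorm A; set b := enorm B; set c := edot A B => h; nra.
Qed.

Lemma enormD A B : enorm (A + B) <= enorm A + enorm B.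
Proof.
rewrite -(@ler_pXn2r _ 2)// ?nnegrE ?addr_ge0 ?enorm_ge0//.
rewrite enorm_sqr edotDl !edotDr (edotC B A) -!enorm_sqr sqrrD.
have := edot_le A B; lra.
Qed.

Lemma enorm_le_sum A : enorm A <= \sum_i \sum_j `|A i j|.
Proof.
set S := (X in _ <= X).
have S0 : 0 <= S by apply: sumr_ge0 => i _; exact: sumr_ge0.
rewrite -(@ler_pXn2r _ 2)// ?nnegrE ?enorm_ge0// enorm_sqr expr2.
rewrite {1}/S mulr_suml; apply: ler_sum => i _; rewrite mulr_suml.
apply: ler_sum => j _; apply: le_trans (ler_norm _) _; rewrite normrM.
apply: ler_wpM2l => //; rewrite /S (bigD1 i)//= (bigD1 j)//= -addrA lerDl.
by rewrite addr_ge0 ?sumr_ge0// => k _; exact: sumr_ge0.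
Qed.

End EuclideanNorm.

Lemma enorm_row_mx (R : realType) (m n p : nat) (A : 'M[R]_(m, n))
    (B : 'M[R]_(m, p)) :
  enorm (row_mx A B) ^+ 2 = enorm A ^+ 2 + enorm B ^+ 2.
Proof.
rewrite !enorm_sqr /edot -big_split; apply: eq_bigr => i _ /=.
rewrite big_split_ord /=; congr (_ + _); apply: eq_bigr => j _.
  by rewrite row_mxEl.
by rewrite row_mxEr.
Qed.

Lemma enorm_row_mx0 (R : realType) (m n p : nat) (A : 'M[R]_(m, n)) :
  enorm (row_mx A (0 : 'M[R]_(m, p))) = enorm A.
Proof.
apply/eqP; rewrite -(@eqrXn2 _ 2)// ?enorm_ge0//.
by rewrite enorm_row_mx enorm0 expr0n addr0.
Qed.

Section Young.
Variables (R : realType) (Phi : R -> R).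
Hypothesis yPhi : young Phi.

Lemma young_ge0 t : 0 <= t -> 0 <= Phi t.
Proof.
case: yPhi => _ _ [P0 Pp] _ _; rewrite le_eqVlt => /predU1P[<-//|/Pp/ltW//].
Qed.

(** Near [0^'+], Phi x = (Phi x / x) x is a product of two factors tending to 0, while continuity
    gives the limit Phi 0. *)
Lemma young0 : Phi 0 = 0.
Proof.
case: yPhi => cP _ _ P0 _.
have c0 : Phi x @[x --> 0^'+] --> Phi 0.
  move/continuous_within_itvcyP : cP => [_ //].
have P00 : Phi x @[x --> 0^'+] --> (0 * 0 : R).
  have idc : x @[x --> (0 : R)^'+] --> (0 : R).
    by apply: cvg_at_right_filter; exact: cvg_id.
  apply: (@cvg_trans _ ((fun x : R => Phi x / x * x) x @[x --> 0^'+])).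
    apply: near_eq_cvg; near=> x; rewrite mulfVK//.
  exact: cvgM.
rewrite mul0r in P00.
exact: (cvg_unique _ c0 P00).
Unshelve. all: by end_near. Qed.

Lemma young_convex x y l : 0 <= x -> 0 <= y -> 0 <= l <= 1 ->
  Phi (l * x + (1 - l) * y) <= l * Phi x + (1 - l) * Phi y.
Proof.
move=> x0 y0 /andP[l0 l1]; case: yPhi => _ cP _ _ _.
have := cP (Itv01 l0 l1) x y; rewrite !inE /= !in_itv/= !andbT => /(_ x0 y0).
by rewrite !convRE /= .
Qed.

Lemma young_scale t l : 0 <= t -> 0 <= l <= 1 -> Phi (l * t) <= l * Phi t.
Proof.
move=> t0 l01; have := young_convex t0 (lexx 0) l01.
by rewrite young0 !mulr0 !addr0.
Qed.

(** Convexity towards the origin, Phi(l t) <= l Phi(t), combined with Phi >= 0. *)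
Lemma young_le s t : 0 <= s -> s <= t -> Phi s <= Phi t.
Proof.
move=> s0 st; have [->//|nst] := eqVneq s t.
have t0 : 0 < t by rewrite (le_lt_trans s0)// lt_neqAle nst.
have l01 : 0 <= s / t <= 1.
  by rewrite divr_ge0 ?(ltW t0)//= ler_pdivrMr// mul1r.
have := young_scale (ltW t0) l01; rewrite divfK ?gt_eqF// => /le_trans; apply.
by rewrite ler_piMl ?young_ge0 ?(ltW t0)//; case/andP: l01.
Qed.

(** [Delta2] freed of its threshold: below [t1] monotonicity bounds the left side by a constant,
    absorbed by the 1 on the right; above it 1 + r <= 2r because [t1] >= 1, and the doubling
    inequality is applied twice. *)
Lemma young_delta2 : Delta2 Phi ->
  exists2 C, 0 < C & forall r, 0 <= r -> Phi (2 * (1 + r)) <= C * (1 + Phi r).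
Proof.
move=> [a [t0 [a0 t00 ha]]]; pose t1 := Num.max 1 t0.
have t11 : 1 <= t1 by rewrite le_max lexx.
have t1t0 : t0 <= t1 by rewrite le_max lexx orbT.
have P0 : 0 <= Phi (2 * (1 + t1)) by apply: young_ge0; lra.
exists (a ^+ 2 + Phi (2 * (1 + t1)) + 1); first by have := sqr_ge0 a; lra.
move=> r r0; have Pr := young_ge0 r0; have a2 := sqr_ge0 a.
have [rt|tr] := leP r t1.
  have : Phi (2 * (1 + r)) <= Phi (2 * (1 + t1)) by apply: young_le; lra.
  move=> /le_trans; apply; nra.
have : Phi (2 * (1 + r)) <= Phi (2 * (2 * r)) by apply: young_le; lra.
have h1 := ha (2 * r) ltac:(lra); have h2 := ha r ltac:(lra).
move=> /le_trans; apply; apply: (le_trans h1).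
have : a * Phi (2 * r) <= a ^+ 2 * Phi r by rewrite expr2 -mulrA ler_pM2l.
move=> /le_trans; apply; nra.
Qed.

(** The slope is the left derivative of [Phi] at [s], obtained as the supremum of the chord slopes
    on the left; convexity puts it below every chord slope on the right. At s = 0 the slope 0
    works. *)
Lemma young_subgradient s : 0 <= s ->
  exists2 c, 0 <= c & forall t, 0 <= t -> Phi s + c * (t - s) <= Phi t.
Proof.
rewrite le_eqVlt => /predU1P[<-|s0].
  exists 0 => // t t0; rewrite young0 mul0r addr0; exact: young_ge0.
pose D := [set (Phi s - Phi t) / (s - t) | t in `[0, s[].
have slope t u : 0 <= t < s -> s < u ->
    (Phi s - Phi t) / (s - t) <= (Phi u - Phi s) / (u - s).
  move=> /andP[t0 ts] su.
  pose l := (u - s) / (u - t).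
  have ut : 0 < u - t by lra.
  have l01 : 0 <= l <= 1.
    by rewrite divr_ge0 ?(ltW ut)//= ?ler_pdivrMr ?mul1r//; lra.
  have sE : l * t + (1 - l) * u = s.
    by rewrite /l; field; rewrite gt_eqF.
  have u0 : 0 <= u by lra.
  have := young_convex t0 u0 l01; rewrite sE => h.
  rewrite ler_pdivrMr; last lra.
  rewrite mulrAC ler_pdivlMr; last lra.
  have h2 : (u - t) * Phi s <= (u - s) * Phi t + (s - t) * Phi u.
    have e1 : (u - t) * l = u - s by rewrite /l mulrC divfK ?gt_eqF.
    have := ler_wpM2l (ltW ut) h.
    rewrite (_ : _ * (_ + _) = (u - t) * l * Phi t +
      (u - t - (u - t) * l) * Phi u); last by ring.
    by rewrite e1 (_ : u - t - (u - s) = s - t)//; ring.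
  nra.
have D0 : D !=set0.
  by exists ((Phi s - Phi 0) / (s - 0)), 0 => //=; rewrite in_itv/= lexx.
have Dub : has_ubound D.
  exists ((Phi (s + 1) - Phi s) / (s + 1 - s)) => _ [t /= + <-].
  rewrite in_itv/= => ts; apply: slope => //; lra.
exists (sup D).
  apply: (@le_trans _ _ ((Phi s - Phi 0) / (s - 0))).
    by rewrite divr_ge0 ?subr_ge0 ?young_le// ltW.
  by apply: ub_le_sup => //; exists 0 => //=; rewrite in_itv/= lexx.
move=> t t0; have [ts|st|->] := ltgtP t s; last by rewrite subrr mulr0 addr0.
  have : (Phi s - Phi t) / (s - t) <= sup D.
    by apply: ub_le_sup => //; exists t => //=; rewrite in_itv/= t0.
  rewrite ler_pdivrMr; last lra.
  lra.
have : sup D <= (Phi t - Phi s) / (t - s).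
  apply: ge_sup => // _ [u /= + <-]; rewrite in_itv/= => ?; exact: slope.
rewrite ler_pdivlMr; lra.
Qed.

Lemma young_density_le phi : young_density Phi phi ->
  forall r, 0 <= r -> 0 <= phi r /\ Phi r <= r * phi r.
Proof.
move=> [hP hmono _ [p0 pp] _] r r0.
have pge0 s : 0 <= s -> 0 <= phi s.
  by rewrite le_eqVlt => /predU1P[<-|/pp/ltW//]; rewrite p0.
split; first exact: pge0.
rewrite -lee_fin hP//.
have -> : (r * phi r)%:E =
    (\int[lebesgue_measure]_(s in `[0%R, r]) (phi r)%:E)%E.
  rewrite integral_cst//= lebesgue_measure_itv/= lte_fin.
  move: r0; rewrite le_eqVlt => /predU1P[<-|r0].
    by rewrite ltxx mul0r mule0.
  by rewrite r0 sube0 -EFinM mulrC.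
(* [phi] is monotone on the half-line only; [psi] is monotone on the whole line, hence
   measurable. *)
pose psi (s : R) := phi (Num.max 0 s).
have -> : (\int[lebesgue_measure]_(s in `[0%R, r]) (phi s)%:E =
    \int[lebesgue_measure]_(s in `[0%R, r]) (psi s)%:E)%E.
  apply: eq_integral => s; rewrite inE/= in_itv/= => /andP[s0 _].
  by rewrite /psi max_r.
have psi_homo : {homo psi : s t / s <= t}.
  move=> s t st; apply: hmono; rewrite ?in_itv/= ?andbT; [by rewrite le_max lexx..|].
  by rewrite ge_max !le_max lexx st /= orbT.
apply: ge0_le_integral => //=.
- by move=> s _; rewrite lee_fin pge0// le_max lexx.
- apply/measurable_EFinP; exact: nondecreasing_measurable.
- move=> s; rewrite in_itv/= => /andP[s0 sr]; rewrite lee_fin.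
  by rewrite /psi max_r// hmono// in_itv/= ?s0 ?r0.
Qed.

End Young.

(** * Orthogonal projection on a linear subspace of R^3 *)

Definition subspace (R : realType) (n : nat) (T : set 'cV[R]_n) : Prop :=
  T 0 /\ forall (a : R) u v, T u -> T v -> T (a *: u + v).

Section OrthogonalProjection.
Variables (R : realType) (T : set 'cV[R]_3).
Hypothesis sT : subspace T.
Implicit Types u v w : 'cV[R]_3.

Lemma subspaceZ (a : R) u : T u -> T (a *: u).
Proof. by case: sT => T0 TD Tu; rewrite -[a *: u]addr0; exact: TD. Qed.

Lemma subspaceD u v : T u -> T v -> T (u + v).
Proof. by case: sT => T0 TD Tu Tv; rewrite -[u]scale1r; exact: TD. Qed.

Lemma subspaceB u v : T u -> T v -> T (u - v).
Proof.
by move=> Tu Tv; rewrite -scaleN1r; apply: subspaceD => //; exact: subspaceZ.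
Qed.

Lemma subspace_sum (I : Type) (r : seq I) (P : pred I) (F : I -> 'cV[R]_3) :
  (forall i, P i -> T (F i)) -> T (\sum_(i <- r | P i) F i).
Proof.
move=> TF; elim/big_rec : _ => [|i x Pi Tx]; first by case: sT.
by apply: subspaceD => //; exact: TF.
Qed.

Lemma edot_col u v : edot u v = \sum_i u i 0 * v i 0.
Proof. by apply: eq_bigr => i _; rewrite big_ord1. Qed.

Lemma edot_suml (I : Type) (r : seq I) (P : pred I) (F : I -> 'cV[R]_3) v :
  edot (\sum_(i <- r | P i) F i) v = \sum_(i <- r | P i) edot (F i) v.
Proof.
elim/big_rec2 : _ => [|i y x Pi <-]; last by rewrite edotDl.
by rewrite /edot big1// => i _; rewrite big1// => j _; rewrite mxE mul0r.
Qed.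

(** The Gram matrix of the family is diagonal with nonzero diagonal, so the vectors are
    independent. *)
Lemma orthogonal_family_size (m : nat) (u : nat -> 'cV[R]_3) :
  (forall i, (i < m)%N -> u i != 0) ->
  (forall i j, (i < m)%N -> (j < m)%N -> i != j -> edot (u i) (u j) = 0) ->
  (m <= 3)%N.
Proof.
move=> u0 uo; pose A := \matrix_(i < m, k < 3) u i k 0.
suff : row_free A by move=> /eqP <-; exact: rank_leq_col.
apply/inj_row_free => w wA; apply/rowP => j; rewrite mxE.
have : (w *m A *m A^T) 0 j = 0 by rewrite wA mul0mx mxE.
have AAT i k : (A *m A^T) i k = edot (u i) (u k).
  rewrite mxE /edot; apply: eq_bigr => l _.
  by rewrite big_ord1 !mxE.
rewrite -mulmxA mxE (bigD1 j)//= big1 ?addr0; last first.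
  by move=> i ij; rewrite AAT uo ?mulr0// -val_eqE.
rewrite AAT -enorm_sqr => /eqP; rewrite mulf_eq0 => /orP[/eqP//|].
rewrite expf_eq0/= => /eqP /enorm_eq0 uj.
by have := u0 j (ltn_ord j); rewrite uj eqxx.
Qed.

(** Gram-Schmidt without a basis of [T]: for each m, either [T] contains m nonzero pairwise
    orthogonal vectors, or all projections exist. If the expansion [p] along a family of size m
    moves some w in [T], then w - p w enlarges the family; otherwise [p] is the projection. In
    dimension 3, m = 4 leaves the second alternative. *)
Lemma orthproj_ex v :
  exists p, T p /\ forall w, T w -> \sum_i (v - p) i 0 * w i 0 = 0.
Proof.
suff H m : (exists u : nat -> 'cV[R]_3, [/\ (forall i, (i < m)%N -> T (u i)),
    (forall i, (i < m)%N -> u i != 0) &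
    (forall i j, (i < m)%N -> (j < m)%N -> i != j -> edot (u i) (u j) = 0)])
   \/ (forall v, exists p, T p /\ forall w, T w -> edot (v - p) w = 0).
  case: (H 4%N) => [[u [_ u0 uo]]|/(_ v)[p [Tp pw]]].
    by have := orthogonal_family_size u0 uo.
  by exists p; split=> // w /pw; rewrite edot_col.
elim: m => [|m [[u [uT u0 uo]]|IH]]; [|..|by right].
  by left; exists (fun=> 0); split.
pose p x := \sum_(i < m) (edot x (u i) / edot (u i) (u i)) *: u i.
have Tp x : T (p x).
  by apply: subspace_sum => i _; apply: subspaceZ; exact: uT.
have pu x j : (j < m)%N -> edot (x - p x) (u j) = 0.
  move=> jm; rewrite edotBl edot_suml (bigD1 (Ordinal jm))//= edotZl.
  rewrite big1 ?addr0; last first.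
    move=> i; rewrite -val_eqE /= => ij; rewrite edotZl.
    have -> : edot (u i) (u j) = 0 by exact: (uo i j (ltn_ord i) jm ij).
    by rewrite mulr0.
  rewrite divfK ?subrr//; rewrite -enorm_sqr expf_eq0/=.
  by apply/eqP => /enorm_eq0 /eqP; apply/negP; exact: u0.
have [[w [Tw wp]]|all_p] := pselect (exists w, T w /\ p w != w).
  left; exists (fun i => if i == m then w - p w else u i); split.
  - move=> i; rewrite ltnS leq_eqVlt; case: eqP => //= _ im.
      exact: subspaceB.
    exact: uT.
  - move=> i; rewrite ltnS leq_eqVlt; case: eqP => //= _ im; last exact: u0.
    by rewrite subr_eq0 eq_sym.
  - move=> i j im jm ij.
    have lt k : (k < m.+1)%N -> k != m -> (k < m)%N.
      by move=> km kNm; rewrite ltn_neqAle kNm.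
    have [iE|iN] := boolP (i == m); have [jE|jN] := boolP (j == m).
    + by move: ij; rewrite (eqP iE) (eqP jE) eqxx.
    + exact/pu/lt.
    + by rewrite edotC; exact/pu/lt.
    + by apply: uo => //; exact: lt.
right=> x; exists (p x); split=> // w Tw.
have <- : p w = w.
  by apply/eqP; apply: contra_notT all_p => pw; exists w.
rewrite edotC edot_suml big1// => i _.
by rewrite edotZl (edotC (u i)) pu ?mulr0.
Qed.

Lemma orthprojP v :
  T (orthproj T v) /\ forall w, T w -> edot (v - orthproj T v) w = 0.
Proof.
have [Tp pw] := xgetPex 0 (orthproj_ex v).
by split=> // w /pw; rewrite edot_col.
Qed.

Lemma orthproj_uniq v p :
  T p -> (forall w, T w -> edot (v - p) w = 0) -> orthproj T v = p.
Proof.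
move=> Tp pw; have [Tq qw] := orthprojP v.
have TB : T (orthproj T v - p) by exact: subspaceB.
apply/eqP; rewrite -subr_eq0; apply/eqP/enorm_eq0.
apply/eqP; rewrite -sqrf_eq0 enorm_sqr; apply/eqP.
rewrite {1}(_ : orthproj T v - p = (v - p) - (v - orthproj T v)).
  by rewrite edotBl pw// qw// subrr.
by apply/matrixP => i j; rewrite !mxE; ring.
Qed.

Lemma orthproj_id v : T v -> orthproj T v = v.
Proof.
move=> Tv; apply: orthproj_uniq => // w _.
rewrite subrr /edot big1// => i _; rewrite big1// => j _.
by rewrite mxE mul0r.
Qed.

Lemma orthproj_linear (a : R) u v :
  orthproj T (a *: u + v) = a *: orthproj T u + orthproj T v.
Proof.
have [Tu uw] := orthprojP u; have [Tv vw] := orthprojP v.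
apply: orthproj_uniq; first by case: sT => _; apply.
move=> w Tw; rewrite opprD addrACA edotDl vw// addr0 -scalerBr edotZl uw//.
by rewrite mulr0.
Qed.

(** The projection as a left multiplication: tangency, linearity and continuity become matrix
    identities, and weak derivatives pass through it entry by entry. *)
Definition projmx : 'M[R]_3 := orthproj_mx T 1%:M.

Lemma projmxE v : projmx *m v = orthproj T v.
Proof.
have orthproj0 : orthproj T 0 = 0 by apply: orthproj_id; case: sT.
have projs (r : seq 'I_3) (c : 'I_3 -> R) (F : 'I_3 -> 'cV[R]_3) :
    orthproj T (\sum_(i <- r) c i *: F i) =
    \sum_(i <- r) c i *: orthproj T (F i).
  elim: r => [|i r IH]; first by rewrite !big_nil.
  by rewrite !big_cons orthproj_linear IH.
have -> : v = \sum_i v i 0 *: col i 1%:M.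
  apply/colP => k; rewrite summxE (bigD1 k)//= big1 ?addr0.
    by rewrite !mxE eqxx mulr1.
  by move=> i ik; rewrite !mxE eq_sym (negbTE ik) mulr0.
rewrite projs; apply/colP => k; rewrite mxE summxE; apply: eq_bigr => i _.
rewrite mulrC !mxE; congr (_ * _).
rewrite summxE (bigD1 i)//= big1 ?addr0.
  by rewrite !mxE eqxx mulr1.
by move=> j ji; rewrite !mxE eq_sym (negbTE ji) mulr0.
Qed.

Lemma orthproj_mxE (m : nat) (A : 'M[R]_(3, m)) :
  orthproj_mx T A = projmx *m A.
Proof.
apply/matrixP => i j; rewrite mxE -projmxE -[in RHS](mul1mx A).
by rewrite !mxE; apply: eq_bigr => k _; rewrite mul1mx !mxE.
Qed.

Lemma tangent_mxP (m : nat) (A : 'M[R]_(3, m)) :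
  tangent_mx T A <-> projmx *m A = A.
Proof.
have colE j : col j (projmx *m A) = orthproj T (col j A).
  by rewrite -projmxE !colE mulmxA.
split=> [TA|PA j]; last first.
  by rewrite -PA colE; exact: (orthprojP _).1.
apply/matrixP => i j; have /colP/(_ i) := colE j.
by rewrite orthproj_id// [LHS]mxE [RHS]mxE.
Qed.

Lemma tangent_mx_proj (m : nat) (A : 'M[R]_(3, m)) : tangent_mx T (projmx *m A).
Proof.
by move=> j; rewrite colE -mulmxA -colE projmxE; exact: (orthprojP _).1.
Qed.

Lemma projmx_idem : projmx *m projmx = projmx.
Proof. by apply/tangent_mxP; rewrite -[projmx]mulmx1; exact: tangent_mx_proj. Qed.

(** Column by column, the projection p of v satisfies |p|^2 = v.p <= |v| |p|. *)
Lemma enorm_projmx (m : nat) (A : 'M[R]_(3, m)) : enorm (projmx *m A) <= enorm A.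
Proof.
rewrite -(@ler_pXn2r _ 2)// ?nnegrE ?enorm_ge0// !enorm_sqr /edot.
rewrite exchange_big [leRHS]exchange_big /=; apply: ler_sum => j _.
have [Tq /(_ _ Tq)] := orthprojP (col j A).
rewrite -projmxE edotBl => /eqP; rewrite subr_eq0 => /eqP h.
have := edot_le (col j A) (projmx *m col j A).
rewrite h -enorm_sqr expr2 => h2.
have {}h2 : enorm (projmx *m col j A) <= enorm (col j A).
  have [->|n0] := eqVneq (enorm (projmx *m col j A)) 0; first exact: enorm_ge0.
  by rewrite -(@ler_pM2r _ (enorm (projmx *m col j A)))// lt_def n0 enorm_ge0.
have {}h2 : enorm (projmx *m col j A) ^+ 2 <= enorm (col j A) ^+ 2.
  by rewrite ler_pXn2r ?nnegrE ?enorm_ge0.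
move: h2; rewrite !enorm_sqr !edot_col => h2.
apply: le_trans (le_trans _ h2) _; last first.
  by rewrite le_eqVlt; apply/orP; left; apply/eqP/eq_bigr => i _; rewrite !mxE.
rewrite le_eqVlt; apply/orP; left; apply/eqP/eq_bigr => i _.
have -> // : (projmx *m col j A) i 0 = (projmx *m A) i j.
by rewrite colE mulmxA -colE mxE.
Qed.

End OrthogonalProjection.

(** * Tangent spaces of submanifolds *)

Section DirectionalDerivatives.
Variable R : realType.

(** The two difference quotients are the same function of h, so that existence and value of
    directional derivatives both transfer by rewriting, with no differentiability assumed. *)
Lemma affine_quotient (V V' W : normedModType R) (L : {linear V -> V'}) (a : V')
    (f : V' -> W) (x v : V) :
  (fun h : R => h^-1 *: (((fun y => f (a + L y)) \o shift x) (h *: v)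
                         - f (a + L x))) =
  (fun h : R => h^-1 *: ((f \o shift (a + L x)) (h *: L v) - f (a + L x))).
Proof.
apply/funext => h /=; congr (_ *: (f _ - _)).
by rewrite linearD linearZ addrCA.
Qed.

Lemma derive_affine (V V' W : normedModType R) (L : {linear V -> V'}) (a : V')
    (f : V' -> W) (x v : V) :
  'D_v (fun y => f (a + L y)) x = 'D_(L v) f (a + L x).
Proof. by rewrite /derive affine_quotient. Qed.

Lemma derivable_affine (V V' W : normedModType R) (L : {linear V -> V'})
    (a : V') (f : V' -> W) (x v : V) :
  derivable (fun y => f (a + L y)) x v = derivable f (a + L x) (L v).
Proof. by rewrite /derivable affine_quotient. Qed.

(** Packaged as a linear map so that restriction to a line is a composition with an affine map. *)
Definition scale_vec (V : normedModType R) (v : V) : R^o -> V := fun h => h *: v.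

Lemma scale_vec_linear (V : normedModType R) (v : V) : linear (scale_vec v).
Proof. by move=> a x y; rewrite /scale_vec scalerDl -scalerA. Qed.

HB.instance Definition _ (V : normedModType R) (v : V) :=
  GRing.isLinear.Build R R^o V _ (scale_vec v) (scale_vec_linear v).

Lemma is_derive_line (V W : normedModType R) (f : V -> W) (p e : V) (t : R) :
  derivable f (p + t *: e) e ->
  is_derive (t : R^o) 1 (fun s : R^o => f (p + s *: e)) ('D_e f (p + t *: e)).
Proof.
move=> df; have := @derivable_affine R^o V W (scale_vec e) p f t 1.
have := @derive_affine R^o V W (scale_vec e) p f t 1.
by rewrite /= /scale_vec scale1r => dE dbE; split; rewrite ?dbE.
Qed.

Lemma mean_value_bound (phi dphi : R^o -> R^o) (c l e : R) :
  (forall t : R, `|t| <= `|c| -> is_derive (t : R^o) 1 phi (dphi t)) ->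
  (forall t : R, `|t| <= `|c| -> `|dphi t - l| <= e) ->
  `|phi c - phi 0 - l * c| <= e * `|c|.
Proof.
move=> hd hb.
have cont (t : R) : `|t| <= `|c| -> {for (t : R^o), continuous phi}.
  move=> /hd dt; apply: differentiable_continuous.
  exact/derivable1_diffP.
have [c0|c0] := leP 0 c.
  have inI t : t \in `[0, c]%R -> `|t| <= `|c|.
    by rewrite in_itv/= => /andP[t0 tc]; rewrite !ger0_norm.
  have [t tI] := @MVT_segment R phi dphi 0 c c0
    (fun t tI => hd t (inI t (subset_itv_oo_cc tI)))
    ltac:(apply: derivable_within_continuous => t tI; apply: ex_derive;
          exact: hd (inI t tI)).
  rewrite subr0 => ->; rewrite -mulrBl normrM ler_wpM2r//.
  exact/hb/inI.
have inI t : t \in `[c, 0]%R -> `|t| <= `|c|.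
  rewrite in_itv/= => /andP[t0 tc]; rewrite !ler0_norm ?lerN2//.
  exact: ltW.
have [t tI] := @MVT_segment R phi dphi c 0 (ltW c0)
  (fun t tI => hd t (inI t (subset_itv_oo_cc tI)))
  ltac:(apply: derivable_within_continuous => t tI; apply: ex_derive;
        exact: hd (inI t tI)).
rewrite sub0r mulrN => h.
have -> : phi c - phi 0 = dphi t * c by rewrite -opprB h opprK.
rewrite -mulrBl normrM ler_wpM2r//; exact/hb/inI.
Qed.

Lemma mean_value_lipschitz (V : normedModType R) (f : V -> R^o) (p e : V)
    (K : R) (c : R) :
  (forall x, derivable f x e) -> (forall x, `|'D_e f x| <= K) ->
  `|f (p + c *: e) - f p| <= K * `|c|.
Proof.
move=> df dK.
have := @mean_value_bound (fun s => f (p + s *: e)) (fun s => 'D_e f (p + s *: e))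
  c 0 K.
rewrite scale0r addr0 mul0r subr0; apply.
  by move=> t _; apply: is_derive_line.
by move=> t _; rewrite subr0.
Qed.

End DirectionalDerivatives.

Section ContinuousSums.
Variables (R : realType) (V : topologicalType).

Lemma continuous_sum (I : Type) (r : seq I) (P : pred I) (F : I -> V -> R) :
  (forall i, continuous (F i)) ->
  continuous (fun x => \sum_(i <- r | P i) F i x).
Proof.
move=> cF; elim: r => [|k r IH] x.
  rewrite (_ : (fun _ => _) = cst 0); first exact: cst_continuous.
  by apply/funext => y; rewrite big_nil.
case Pk: (P k); last first.
  rewrite (_ : (fun _ => _) = (fun y => \sum_(k <- r | P k) F k y)).
    exact: IH.
  by apply/funext => y; rewrite big_cons Pk.
rewrite (_ : (fun _ => _) = F k \+ (fun y => \sum_(k <- r | P k) F k y)).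
  by apply: cvgD; [exact: cF|exact: IH].
by apply/funext => y; rewrite big_cons Pk.
Qed.

Lemma continuous_mull (a : R) (F : V -> R) :
  continuous F -> continuous (fun x => a * F x).
Proof. by move=> cF x; apply: cvgM; [exact: cvg_cst|exact: cF]. Qed.

End ContinuousSums.

Section MatrixLimits.
Variables (R : realType) (m n : nat).

Lemma norm_entry_le (A : 'M[R]_(m, n)) i j : `|A i j| <= `|A|.
Proof.
rewrite [leRHS]/Num.Def.normr/= mx_normrE.
exact: (le_bigmax _ (fun ij : 'I_m * 'I_n => `|A ij.1 ij.2|) (i, j)).
Qed.

Lemma norm_mx_le (A : 'M[R]_(m, n)) (e : R) :
  0 <= e -> (forall i j, `|A i j| <= e) -> `|A| <= e.
Proof.
move=> e0 h; rewrite /Num.Def.normr/= mx_normrE; apply: bigmax_le => // -[i j] _.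
Qed.

Lemma cvg_mx (T : Type) (F : set_system T) (FF : Filter F)
    (M : T -> 'M[R]_(m, n)) (L : 'M[R]_(m, n)) :
  (forall i j, M x i j @[x --> F] --> L i j) -> M x @[x --> F] --> L.
Proof.
move=> h; apply/cvgrPdist_le => e e0.
have : \forall x \near F, forall ij : 'I_m * 'I_n, `|L ij.1 ij.2 - M x ij.1 ij.2| <= e.
  apply: filter_forall => -[i j]; exact: (cvgrPdist_le _ _).1 (h i j) e e0.
apply: filterS => x H; apply: norm_mx_le => [|i j]; first exact: ltW.
by rewrite !mxE; exact: (H (i, j)).
Qed.

Lemma continuous_mx (V : topologicalType) (M : V -> 'M[R]_(m, n)) :
  (forall i j, continuous (fun x => M x i j : R)) -> continuous M.
Proof. by move=> h x; apply: cvg_mx => i j; exact: h. Qed.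

Lemma continuous_entry (V : topologicalType) (M : V -> 'M[R]_(m, n)) i j :
  continuous M -> continuous (fun x => M x i j : R).
Proof.
move=> h x; apply: (@continuous_comp _ _ _ M (fun A => A i j)); first exact: h.
exact: coord_continuous.
Qed.

End MatrixLimits.

Section ContinuouslyDifferentiable.
Variables (R : realType) (n : nat).
Local Notation vec := 'cV[R]_n.
Implicit Types (f : vec -> vec) (s v : vec).

Let e (j : 'I_n) : vec := delta_mx j 0.

Definition jacob f s : 'M[R]_n := \matrix_(i, j) 'D_(e j) f s i 0.

(** Go from s to s + v by changing one coordinate at a time: on each segment the mean value
    inequality applies with the partial derivative frozen at s, and the n errors add up. *)
Lemma C1_increment f (U : set vec) s : open U -> U s ->
  (forall j x, U x -> derivable f x (e j)) ->
  (forall j, {for s, continuous ('D_(e j) f)}) ->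
  forall eps : R, 0 < eps -> \forall v \near (0 : vec),
    `|f (s + v) - f s - jacob f s *m v| <= eps * `|v|.
Proof.
move=> oU Us df cf eps eps0.
(* The successor keeps the quotient meaningful when n = 0. *)
pose eps' := eps / n.+1%:R.
have eps'0 : 0 < eps' by rewrite divr_gt0.
have [d d0 hd] : exists2 d : R, 0 < d & forall v : vec, `|v| < d ->
    U (s + v) /\ forall j, `|'D_(e j) f (s + v) - 'D_(e j) f s| <= eps'.
  have h1 : \forall y \near s, U y by apply: open_nbhs_nbhs.
  have h2 : \forall y \near s, forall j, `|'D_(e j) f y - 'D_(e j) f s| <= eps'.
    apply: (@filter_forall _ _ _ (nbhs s)) => j.
    exact: (cvgrPdistC_le _ _).1 (cf j) _ eps'0.
  have /nbhs_ballP[d /= d0 hd] : nbhs s [set y | U y /\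
      forall j, `|'D_(e j) f y - 'D_(e j) f s| <= eps'].
    exact: filterI.
  exists d => // v vd; apply: hd.
  by rewrite -ball_normE /ball_ /= opprD addrA subrr sub0r normrN.
apply/nbhs_ballP; exists d => //= v; rewrite -ball_normE /ball_/= sub0r normrN => vd.
(* [tr k] keeps the first k coordinates of v: the vertices of the path from 0 to v. *)
pose tr (k : nat) : vec := \col_j (if (j < k)%N then v j 0 else 0).
have trle (w : vec) : (forall j, `|w j 0| <= `|v j 0|) -> `|w| <= `|v|.
  move=> h; apply: norm_mx_le => // i j; rewrite (ord1 j).
  exact: le_trans (h i) (norm_entry_le _ _ _).
apply: norm_mx_le => [|i j]; first by rewrite mulr_ge0// ltW.
rewrite (ord1 j) {j}.
pose F x : R^o := f x i 0.
have dF j x : U x -> derivable F x (e j).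
  by move=> Ux; exact: (derivable_mxP _ _ _).1 (df j x Ux) i 0.
have DF j x : U x -> 'D_(e j) F x = 'D_(e j) f x i 0.
  by move=> Ux; rewrite (derive_mx (df j x Ux)) mxE.
have step (k : 'I_n) : `|F (s + tr k.+1) - F (s + tr k) - 'D_(e k) F s * v k 0|
    <= eps' * `|v|.
  have trS : tr k.+1 = tr k + v k 0 *: e k.
    apply/colP => j; rewrite !mxE eqxx andbT ltnS leq_eqVlt.
    have [->|jk] := eqVneq j k; first by rewrite ltnn eqxx /= mulr1 add0r.
    by rewrite (negbTE (_ : (j : nat) != k))//= mulr0 addr0.
  have seg (t : R) : `|t| <= `|v k 0| -> `|tr k + t *: e k| <= `|v|.
    move=> tv; apply: trle => j; rewrite !mxE eqxx andbT.
    have [->|jk] := eqVneq j k; first by rewrite ltnn /= mulr1 add0r.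
    by rewrite mulr0 addr0; case: ifP => //; rewrite normr0.
  have := @mean_value_bound R (fun t => F ((s + tr k) + t *: e k))
    (fun t => 'D_(e k) F ((s + tr k) + t *: e k)) (v k 0) ('D_(e k) F s) eps'.
  rewrite scale0r addr0 -[s + tr k + v k 0 *: e k]addrA -trS => h.
  apply: le_trans (h _ _) _.
  - move=> t tv; apply: is_derive_line; apply: dF; rewrite -addrA.
    by apply: (hd _ _).1; exact: le_lt_trans (seg t tv) vd.
  - move=> t tv; rewrite -addrA.
    have [Ut ht] := hd _ (le_lt_trans (seg t tv) vd).
    rewrite !DF//; apply: le_trans (ht k).
    by have := norm_entry_le ('D_(e k) f (s + (tr k + t *: e k)) - 'D_(e k) f s) i 0;
       rewrite !mxE.
  - by rewrite ler_wpM2l ?norm_entry_le// ltW.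
have trn : tr n = v by apply/colP => j; rewrite mxE ltn_ord.
have tr0 : tr 0%N = 0 by apply/colP => j; rewrite !mxE.
have -> : (f (s + v) - f s - jacob f s *m v) i 0 =
    \sum_(k < n) (F (s + tr k.+1) - F (s + tr k) - 'D_(e k) F s * v k 0).
  rewrite sumrB ![in LHS]mxE; congr (_ - _).
    rewrite -(big_mkord xpredT (fun k => F (s + tr k.+1) - F (s + tr k))).
    rewrite (telescope_sumr (fun k => F (s + tr k)))// trn tr0 addr0.
    by [].
  by apply: eq_bigr => k _; rewrite mxE DF.
apply: le_trans (ler_norm_sum _ _ _) _.
apply: le_trans (ler_sum _ (fun k _ => step k)) _.
rewrite sumr_const card_ord -mulr_natl mulrA ler_wpM2r//.
rewrite /eps' mulrCA ger_pMr// ler_pdivrMr ?ltr0n// mul1r ler_nat.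
exact: leqnSn.
Qed.

Lemma mulmx_continuous (A : 'M[R]_n) : continuous (mulmx A : vec -> vec).
Proof.
apply: continuous_mx => i j; rewrite (ord1 j) {j}.
rewrite (_ : (fun _ : vec => _) = (fun y : vec => \sum_k A i k * y k 0 : R)).
  apply: continuous_sum => k; apply: continuous_mull; exact: coord_continuous.
by apply/funext => y; rewrite mxE.
Qed.

(** [Ck] only provides directional derivatives; continuity of the partial ones upgrades them to a
    Frechet differential, as the chain rule in charts requires. *)
Lemma C1_differentiable f (U : set vec) s : open U -> U s ->
  (forall j x, U x -> derivable f x (e j)) ->
  (forall j, {for s, continuous ('D_(e j) f)}) ->
  differentiable f s /\ 'd f s = mulmx (jacob f s) :> (vec -> vec).
Proof.
move=> oU Us df cf.
have h : f \o shift s = cst (f s) + (mulmx (jacob f s) : vec -> vec) +o_ (0 : vec) id.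
  apply/eqaddoP => _/posnumP[eps].
  have := C1_increment oU Us df cf [gt0 of eps%:num].
  apply: (@filterS _ (nbhs (0 : vec)) _) => v.
  rewrite /= opprD addrA.
  by rewrite -![(_ + _ : _ -> _) _]/(_ + _) -![(- _ : _ -> _) _]/(- _) /= (addrC v).
have dE := diff_unique (@mulmx_continuous (jacob f s)) h.
split=> //; apply/diff_locallyP; rewrite dE; split => //.
exact: mulmx_continuous.
Qed.

End ContinuouslyDifferentiable.

Section SmoothAffine.
Variable R : realType.

Lemma CkS (V W : normedModType R) k (U U' : set V) (f : V -> W) :
  U' `<=` U -> Ck k U f -> Ck k U' f.
Proof.
move=> UU'; elim: k f => [|k IH] f /= [cf df]; split => //.
- by move=> x /UU'; exact: cf.
- by move=> x /UU'; exact: cf.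
- by move=> v; have [dfv /IH] := df v; split => // x /UU'; exact: dfv.
Qed.

Lemma Ck_affine (V V' W : normedModType R) (L : {linear V -> V'}) (a : V')
    (f : V' -> W) (U : set V') k :
  continuous L -> Ck k U f ->
  Ck k ((fun y => a + L y) @^-1` U) (fun y => f (a + L y)).
Proof.
move=> cL; have caff : continuous (fun y => a + L y).
  by move=> y; apply: cvgD; [exact: cvg_cst|exact: cL].
elim: k f => [|k IH] f /= [cf df]; split => //.
- by move=> x Ux; apply: continuous_comp; [exact: caff|exact: cf].
- by move=> x Ux; apply: continuous_comp; [exact: caff|exact: cf].
- move=> v; have [dfv Dk] := df (L v); split.
    by move=> x Ux; rewrite derivable_affine; exact: dfv.
  have -> : (fun x => 'D_v (fun y => f (a + L y)) x) =
            (fun x => (fun y => 'D_(L v) f y) (a + L x)).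
    by apply/funext => x; rewrite derive_affine.
  exact: (IH _ Dk).
Qed.

Lemma scale_vec_continuous (V : normedModType R) (v : V) : continuous (scale_vec v).
Proof. by move=> x; rewrite /scale_vec; apply: cvgZr_tmp; exact: cvg_id. Qed.

End SmoothAffine.

Section TangentSpace.
Variables (R : realType) (M : set 'cV[R]_3).
Hypothesis hM : submanifold M.
Local Notation vec := 'cV[R]_3.

Lemma derive_near_eq (V W : normedModType R) (f g : V -> W) (x v : V) :
  (\forall y \near x, f y = g y) -> 'D_v f x = 'D_v g x.
Proof.
move=> fg; have [->|v0] := eqVneq v 0; first by rewrite !derive0.
exact: near_eq_derive.
Qed.

Lemma derive_comp (V1 V2 V3 : normedModType R) (f : V1 -> V2) (g : V2 -> V3)
    (x v : V1) : differentiable f x -> differentiable g (f x) ->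
  'D_v (g \o f) x = 'd g (f x) ('d f x v).
Proof.
move=> df dg; have dgf := differentiable_comp df dg.
by rewrite (deriveE v dgf) (diff_comp df dg).
Qed.

Lemma smooth_differentiable (f : vec -> vec) (U : set vec) (s : vec) :
  open U -> U s -> smooth_on U f ->
  differentiable f s /\ forall v, 'd f s v = jacob f s *m v.
Proof.
move=> oU Us /(_ 1%N) [_ sf].
have [df dE] : differentiable f s /\ 'd f s = mulmx (jacob f s) :> (vec -> vec).
  apply: (C1_differentiable oU Us).
    by move=> j x Ux; have [df _] := sf (delta_mx j 0); exact: df.
  by move=> j; have [_ [cf _]] := sf (delta_mx j 0); exact: cf.
by split=> // v; exact: (congr1 (fun F => F v) dE).
Qed.

(** In a slice chart h, v is tangent at s exactly when the coordinates of Dh(s)v of index at least k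
    vanish, which is a linear condition. Velocities satisfy it by differentiating h along the curve,
    which stays in the slice; conversely the inverse chart carries a straight segment of the slice
    to a curve of [M] with velocity v. *)
Lemma tangent_subspace (s : vec) : M s -> subspace (tangent M s).
Proof.
case: hM => k _ chart Ms.
have [U [W [h [g [[oU Us oW] [sh sg] hU gW hMk]]]]] := chart s Ms.
have [Whs ghs] := hU s Us.
have [dh dhE] := smooth_differentiable oU Us sh.
have [dg dgE] := smooth_differentiable oW Whs sg.
set H := jacob h s in dhE; set G := jacob g (h s) in dgE.
have nearU : \forall x \near s, U x by apply: open_nbhs_nbhs.
(* Chain rule for g \o h, which is the identity near s. *)
have GH (v : vec) : G *m (H *m v) = v.
  have -> : G *m (H *m v) = 'D_v (g \o h) s.
    apply/esym; apply: etrans (derive_comp v dh dg) _.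
    by apply: etrans (dgE _) _; congr (_ *m _); exact: dhE.
  rewrite -[RHS](derive_id s v); apply: derive_near_eq.
  by apply: filterS nearU => x /hU[].
have tangentE (v : vec) : tangent M s v <-> forall i : 'I_3, (k <= i)%N -> (H *m v) i 0 = 0.
  split.
    move=> [gam [e [e0 sgam gamM gam0 dgam]]] i ki.
    have d0 : derivable gam 0 1 by apply: ex_derive.
    have dfg : differentiable gam (0 : R^o) by exact/derivable1_diffP.
    have dh0 : differentiable h (gam 0) by rewrite gam0.
    have dhg : differentiable (h \o gam) (0 : R^o) by exact: differentiable_comp.
    have <- : 'D_1 (h \o gam) 0 = H *m v.
      apply: etrans (derive_comp (1 : R^o) dfg dh0) _.
      rewrite gam0; apply: etrans (dhE _) _; congr (_ *m _).
      by rewrite -(deriveE (1 : R^o) dfg); exact: derive_val.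
    rewrite derive_mx; last exact: diff_derivable.
    rewrite mxE -[RHS](derive_cst (0 : R) (0 : R^o) 1).
    apply: derive_near_eq.
    have n1 : \forall t \near (0 : R^o), U (gam t).
      have /differentiable_continuous cg := dfg.
      by apply: cg; rewrite gam0.
    have n2 : \forall t \near (0 : R^o), M (gam t).
      by near=> t; apply: gamM; near: t; exact: nbhsx_ballx.
    near=> t; have Ut : U (gam t) by near: t.
    by have Mt : M (gam t); [near: t|exact: (hMk _ Ut).1].
  move=> Hv; pose w := H *m v.
  (* The segment from h(s) in the direction Dh(s)v, which lies in the slice, brought back by the
     inverse chart. *)
  pose gam (t : R^o) := g (h s + scale_vec w t).
  have [e /= e0 he] : exists2 e : R, 0 < e & forall t : R^o, ball (0 : R^o) e t ->
      W (h s + scale_vec w t).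
    have : \forall t \near (0 : R^o), W (h s + scale_vec w t).
      have c0 : (fun t : R^o => h s + scale_vec w t) t @[t --> (0 : R^o)] -->
          h s + scale_vec w 0.
        by apply: cvgD; [exact: cvg_cst|exact: scale_vec_continuous].
      by apply: c0; rewrite /scale_vec scale0r addr0; exact: open_nbhs_nbhs.
    by move=> /nbhs_ballP[e /= e0 he]; exists e.
  exists gam, e; split=> //.
  - move=> n; apply: (@CkS _ _ _ _ ((fun t => h s + scale_vec w t) @^-1` W)) => //.
    by apply: Ck_affine; [exact: scale_vec_continuous|exact: sg].
  - move=> t /he Wt; have [Ug hg] := gW _ Wt; apply/(hMk _ Ug) => i ki.
    have Hvi : (H *m v) i 0 = 0 := Hv i ki.
    rewrite /gam hg /scale_vec mxE [X in _ + X]mxE Hvi mulr0 addr0.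
    exact: (hMk s Us).1.
  - by rewrite /gam /scale_vec scale0r addr0.
  - have db : derivable gam 0 1.
      rewrite /gam derivable_affine /= /scale_vec scale0r addr0.
      exact: diff_derivable.
    apply: DeriveDef => //.
    rewrite /gam derive_affine /= /scale_vec scale0r addr0 scale1r.
    by apply: etrans (deriveE w dg) _; apply: etrans (dgE w) _; exact: GH.
split; first by apply/tangentE => i _; rewrite mulmx0 mxE.
move=> a u v /tangentE Hu /tangentE Hv; apply/tangentE => i ki.
by rewrite mulmxDr -scalemxAr mxE [X in X + _]mxE Hu// Hv// mulr0 addr0.
Unshelve. all: by end_near. Qed.

End TangentSpace.

(** * Smooth cutoff functions *)

Section SmoothCalculus.
Variables (R : realType) (V : normedModType R).
Implicit Types (f g : V -> R^o) (k : nat).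

Local Notation CkT k f := (Ck k [set: V] (f : V -> R^o)).

Lemma Ck_continuous k f : CkT k f -> continuous f.
Proof. by case: k => [|k] /= [cf _] x; exact: cf. Qed.

Lemma CkW k f : CkT k.+1 f -> CkT k f.
Proof.
elim: k f => [|k IH] f [cf df]; first by split.
split => // v; have [d1 d2] := df v; split => //; exact: IH.
Qed.

Lemma Ck_cst k (a : R) : CkT k (fun=> a).
Proof.
elim: k a => [|k IH] a; split => //; try by move=> x _; exact: cst_continuous.
move=> v; split; first by move=> x _; exact: derivable_cst.
have -> : (fun x => 'D_v (fun _ : V => a : R^o) x) = (fun=> 0 : R^o).
  by apply/funext => x; exact: derive_cst.
exact: IH.
Qed.

Lemma CkD k f g : CkT k f -> CkT k g -> CkT k (fun x => f x + g x).
Proof.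
elim: k f g => [|k IH] f g [cf df] [cg dg].
  by split => // x _; apply: cvgD; [exact: cf|exact: cg].
split; first by move=> x _; apply: cvgD; [exact: cf|exact: cg].
move=> v; have [df1 df2] := df v; have [dg1 dg2] := dg v; split.
  by move=> x _; apply: derivableD; [exact: df1|exact: dg1].
have -> : (fun x => 'D_v (fun x => f x + g x) x) =
          (fun x => 'D_v f x + 'D_v g x).
  by apply/funext => x; rewrite -deriveD//; [exact: df1|exact: dg1].
exact: IH.
Qed.

Lemma CkM k f g : CkT k f -> CkT k g -> CkT k (fun x => f x * g x).
Proof.
elim: k f g => [|k IH] f g Cf Cg; have cf := Ck_continuous Cf;
  have cg := Ck_continuous Cg.
  by split => // x _; apply: cvgM; [exact: cf|exact: cg].
split; first by move=> x _; apply: cvgM; [exact: cf|exact: cg].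
move=> v; have [_ df] := Cf; have [_ dg] := Cg.
have [df1 df2] := df v; have [dg1 dg2] := dg v; split.
  by move=> x _; apply: derivableM; [exact: df1|exact: dg1].
have -> : (fun x => 'D_v (fun x => f x * g x) x) =
          (fun x => f x * 'D_v g x + g x * 'D_v f x).
  by apply/funext => x; apply: deriveM; [exact: df1|exact: dg1].
by apply: CkD; apply: IH => //; exact: CkW.
Qed.

(** The derivative is written with two separate factors f^-1, so that the induction hypothesis
    applies to each of them. *)
Lemma CkV k f : (forall x, f x != 0) -> CkT k f -> CkT k (fun x => (f x)^-1).
Proof.
move=> f0; elim: k => [|k IH] Cf; have cf := Ck_continuous Cf.
  by split => // x _; apply: cvgV => //; exact: cf.
split; first by move=> x _; apply: cvgV => //; exact: cf.
move=> v; have [_ df] := Cf; have [df1 df2] := df v.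
have isd x : is_derive x v (fun y => (f y)^-1 : R^o) (- (f x) ^- 2 *: 'D_v f x).
  split; first by apply: derivableV => //; exact: df1.
  by apply: deriveV => //; exact: df1.
split; first by move=> x _; apply: ex_derive.
have -> : (fun x => 'D_v (fun x => (f x)^-1 : R^o) x) =
          (fun x => -1 * ((f x)^-1 * (f x)^-1 * 'D_v f x)).
  apply/funext => x; have -> := @derive_val _ _ _ _ _ _ _ (isd x).
  by rewrite /GRing.scale/= expr2 invfM mulN1r mulNr.
apply: CkM; first exact: Ck_cst.
by apply: CkM => //; apply: CkM; apply: IH; exact: CkW.
Qed.

End SmoothCalculus.

Section SmoothStep.
Variable R : realType.

(** For n = 0 this is the smooth function exp(-1/x), flat at 0; the powers of 1/x make the family
    stable under differentiation. *)
Definition flat (n : nat) (x : R) : R^o :=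
  if 0 < x then x^-1 ^+ n * expR (- x^-1) else 0.

Lemma flat_ge0 n x : 0 <= flat n x.
Proof.
rewrite /flat; case: ifP => // x0.
by rewrite mulr_ge0 ?expR_ge0// exprn_ge0// invr_ge0 ltW.
Qed.

(** With y = 1/x, the exponential series gives y^(n+1) <= (n+1)! e^y. This linear bound yields the
    derivative 0 at the origin. *)
Lemma flat_le n x : flat n x <= (n.+1)`!%:R * `|x|.
Proof.
rewrite /flat; case: ifPn => [x0|_]; last by rewrite mulr_ge0.
have y0 : 0 < x^-1 by rewrite invr_gt0.
rewrite gtr0_norm// expRN ler_pdivrMr ?expR_gt0//.
have := expR_ge1Dxn n (ltW y0); set y := x^-1 in y0 * => h.
have {h} h : y ^+ n.+1 / (n.+1)`!%:R <= expR y by apply: le_trans h; rewrite lerDr.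
have f0 : 0 < ((n.+1)`!%:R : R) by rewrite ltr0n fact_gt0.
rewrite ler_pdivrMr// in h.
have -> : x = y^-1 by rewrite /y invrK.
rewrite mulrAC ler_pdivlMr// -exprSr; apply: le_trans h _.
by rewrite mulrC.
Qed.

Lemma flat_norm n x : `|flat n x| <= (n.+1)`!%:R * `|x|.
Proof. by rewrite ger0_norm ?flat_ge0 ?flat_le. Qed.

Lemma flatS n x : x != 0 -> x^-1 * flat n x = flat n.+1 x.
Proof.
by move=> x0; rewrite /flat; case: ifP; rewrite ?mulr0// => _; rewrite exprS mulrA.
Qed.

Lemma is_derive_flat n (x : R) :
  is_derive (x : R^o) 1 (flat n) (flat n.+2 x - n%:R * flat n.+1 x).
Proof.
have [x0|x0|<-] := ltgtP 0 x.
- pose g (y : R) : R^o := (y^-1) ^+ n * expR (- y^-1).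
  have xn0 : x != 0 by rewrite gt_eqF.
  have dV : is_derive (x : R^o) 1 (fun y : R^o => y^-1 : R^o) (- x ^- 2).
    have := @is_deriveV R id x 1 1 xn0 (is_derive_id _ _).
    by rewrite /GRing.scale/= mulr1.
  have dN : is_derive (x : R^o) 1 (fun y : R^o => - y^-1 : R^o) (x ^- 2).
    by have := is_deriveN dV; rewrite opprK.
  have dE : is_derive (x : R^o) 1 (fun y : R^o => expR (- y^-1) : R^o)
      (expR (- x^-1) * x ^- 2).
    by apply: (@is_derive1_comp R expR (fun y => - y^-1) x).
  have dX : is_derive (x : R^o) 1 (fun y : R^o => y^-1 ^+ n : R^o)
      (n%:R * x^-1 ^+ n.-1 * - x ^- 2).
    by have := @is_deriveX R _ (fun y : R^o => y^-1 : R^o) n x 1 _ dV;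
      rewrite exprfctE.
  have dg : is_derive (x : R^o) 1 g (flat n.+2 x - n%:R * flat n.+1 x).
    have := is_deriveM dX dE; rewrite /GRing.scale/= => h.
    apply: is_derive_eq h _; rewrite /flat x0 -exprVn.
    case: n {g dX} => [|n]; first by rewrite /= !mul0r !mulr0 subr0 addr0 expr0 mul1r mulrC.
    by rewrite /= !exprS; ring.
  have fg : {near (x : R^o), g =1 flat n}.
    by near=> y; rewrite /flat ifT//; near: y; exact: lt_nbhsr.
  split; first exact: near_eq_derivable fg (@ex_derive _ _ _ _ _ _ _ dg).
  rewrite -(derive_near_eq (1 : R^o) fg); exact: derive_val.
- have fg : {near (x : R^o), (fun=> 0 : R^o) =1 flat n}.
    near=> y; rewrite /flat ifF//; apply/negbTE; rewrite -leNgt ltW//.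
    by near: y; exact: lt_nbhsl.
  split; first exact: near_eq_derivable fg (derivable_cst _ _ _).
  rewrite -(derive_near_eq (1 : R^o) fg) derive_cst /flat.
  by rewrite ltNge ltW//= mulr0 subr0.
(* At the origin the difference quotient of [flat n] is [flat n.+1], which tends to 0 by the linear
   bound. *)
- have E0 m : flat m 0 = 0 by rewrite /flat ltxx.
  rewrite !E0 mulr0 subr0.
  have h : h^-1 *: ((flat n \o shift 0) (h *: 1) - flat n 0) @[h --> 0^'] --> (0 : R).
    apply/cvgrPdist_le => e e0; near=> h.
    have h0 : h != 0 by near: h; exact: nbhs_dnbhs_neq.
    rewrite sub0r normrN /= E0 subr0 addr0 /GRing.scale/= mulr1 flatS//.
    apply: le_trans (flat_norm _ _) _.
    rewrite -ler_pdivlMl ?ltr0n ?fact_gt0//.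
    near: h; apply: dnbhs0_le; rewrite mulr_gt0// invr_gt0 ltr0n fact_gt0//.
  split; first by apply/cvg_ex; exists 0.
  exact/cvg_lim.
Unshelve. all: by end_near. Qed.

Lemma derive_dir (f : R^o -> R^o) (x v d : R) :
  is_derive (x : R^o) 1 f d -> is_derive (x : R^o) v f (v * d).
Proof.
move=> fd; have df : differentiable f (x : R^o) by exact/derivable1_diffP.
split; first exact: diff_derivable.
have /= <- := @derive_val _ _ _ _ _ _ _ fd.
rewrite !deriveE// -[v in LHS]mulr1 -[v * 1]/(v *: (1 : R^o)).
by rewrite linearZ.
Qed.

Lemma Ck_flat k n : Ck k [set: R^o] (flat n : R^o -> R^o).
Proof.
have cflat m : continuous (flat m : R^o -> R^o).
  move=> x; apply: differentiable_continuous; apply/derivable1_diffP.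
  by apply: ex_derive; exact: is_derive_flat.
elim: k n => [|k IH] n; split => //; try by move=> x _; exact: cflat.
move=> v; split.
  by move=> x _; apply: ex_derive; exact: derive_dir (is_derive_flat n x).
have -> : (fun x => 'D_v (flat n : R^o -> R^o) x) =
          (fun x => v * (flat n.+2 x + - n%:R * flat n.+1 x)).
  apply/funext => x.
  have /= -> := @derive_val _ _ _ _ _ _ _ (derive_dir v (is_derive_flat n x)).
  by rewrite mulNr.
apply: CkM; first exact: Ck_cst.
by apply: CkD => //; apply: CkM => //; exact: Ck_cst.
Qed.

Lemma flat0_gt0 (x : R) : 0 < x -> 0 < flat 0 x.
Proof. by move=> x0; rewrite /flat x0 expr0 mul1r expR_gt0. Qed.

Lemma flat0_eq0 (x : R) : x <= 0 -> flat 0 x = 0.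
Proof. by move=> x0; rewrite /flat ltNge x0. Qed.

(** The standard smooth transition from 0 on y <= 0 to 1 on y >= 1; y and 1 - y are never both
    nonpositive, so the denominator does not vanish. *)
Definition step (y : R^o) : R^o := flat 0 y / (flat 0 y + flat 0 (1 - y)).

Lemma step_den_gt0 y : 0 < flat 0 y + flat 0 (1 - y).
Proof.
have [y0|y0] := ltP 0 y; first by rewrite ltr_pwDl ?flat_ge0 ?flat0_gt0.
by rewrite ltr_wpDl ?flat_ge0 ?flat0_gt0//; lra.
Qed.

Lemma step_ge0 y : 0 <= step y.
Proof. by rewrite divr_ge0 ?flat_ge0// ltW// step_den_gt0. Qed.

Lemma step_le1 y : step y <= 1.
Proof. by rewrite ler_pdivrMr ?step_den_gt0// mul1r lerDl flat_ge0. Qed.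

Lemma step_eq0 y : y <= 0 -> step y = 0.
Proof. by move=> y0; rewrite /step flat0_eq0// mul0r. Qed.

Lemma step_eq1 y : 1 <= y -> step y = 1.
Proof.
move=> y1; rewrite /step (@flat0_eq0 (1 - y)) ?addr0 ?divff//; last lra.
by rewrite gt_eqF// flat0_gt0//; lra.
Qed.

Lemma smooth_step : smooth_on [set: R^o] step.
Proof.
move=> k; have Ck1 : Ck k [set: R^o] (fun y : R^o => flat 0 (1 - y)).
  have : Ck k [set: R^o] (fun y : R^o => flat 0 (1 + scale_vec (-1 : R^o) y)) :=
    @Ck_affine R R^o R^o R^o (scale_vec (-1 : R^o)) 1 (flat 0) setT k
      (@scale_vec_continuous _ _ _) (Ck_flat k 0).
  have -> : (fun y : R^o => flat 0 (1 + scale_vec (-1 : R^o) y)) =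
            (fun y : R^o => flat 0 (1 - y)); last by [].
  by apply/funext => y; rewrite /scale_vec /GRing.scale/= mulrN1.
apply: CkM; first exact: Ck_flat.
apply: CkV; first by move=> y; rewrite gt_eqF ?step_den_gt0.
by apply: CkD => //; exact: Ck_flat.
Qed.

(** The derivative is continuous, hence bounded on [0, 1], and [step] is locally constant
    elsewhere. *)
Lemma step_derive_bounded : exists2 C : R, 0 < C &
  forall (y v : R^o), `|'D_v step y| <= C * `|v|.
Proof.
have [_ /(_ 1)[dstep [cdstep _]]] := smooth_step 1.
have := @compact_bounded _ _ _ (continuous_compact
  (continuous_subspaceT (fun x => cdstep x I)) (@segment_compact R 0 1)).
move=> [K [Kr hK]].
have {}hK := hK (`|K| + 1) (le_lt_trans (ler_norm _) (ltr_pwDr ltr01 (lexx _))).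
exists (`|K| + 1); first by rewrite ltr_wpDl.
have B1 y : `|'D_1 step y| <= `|K| + 1.
  have [yI|] := boolP (y \in `[0, 1]%R); first by apply: hK; exists y.
  rewrite in_itv/= negb_and -!ltNge => /orP[y0|y1].
    have -> : 'D_1 step y = 0.
      rewrite -(derive_cst (0 : R^o) y 1); apply: derive_near_eq; near=> z.
      by rewrite step_eq0// ltW//; near: z; exact: lt_nbhsl.
    by rewrite normr0 addr_ge0.
  have -> : 'D_1 step y = 0.
    rewrite -(derive_cst (1 : R^o) y 1); apply: derive_near_eq; near=> z.
    by rewrite step_eq1// ltW//; near: z; exact: lt_nbhsr.
  by rewrite normr0 addr_ge0.
move=> y v; have h := derivableP (dstep y I).
have /= -> := @derive_val _ _ _ _ _ _ _ (derive_dir v h).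
by rewrite normrM mulrC ler_wpM2r.
Unshelve. all: by end_near. Qed.

(** For a < b, an even smooth function equal to 1 on |y| <= a and to 0 on |y| >= b: a descending
    step times an ascending one. *)
Definition plateau (a b : R) (y : R^o) : R^o :=
  step ((b - y) / (b - a)) * step ((b + y) / (b - a)).

Lemma plateau_ge0 a b y : 0 <= plateau a b y.
Proof. by rewrite mulr_ge0 ?step_ge0. Qed.

Lemma plateau_le1 a b y : plateau a b y <= 1.
Proof. by rewrite mulr_ile1 ?step_ge0 ?step_le1. Qed.

Lemma plateau_eq1 a b y : a < b -> `|y| <= a -> plateau a b y = 1.
Proof.
rewrite ler_norml => ab /andP[h1 h2].
have ba : 0 < b - a by lra.
by rewrite /plateau !step_eq1 ?mulr1// ler_pdivlMr//; lra.
Qed.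

Lemma plateau_eq0 a b y : a < b -> b <= `|y| -> plateau a b y = 0.
Proof.
rewrite ler_normr => ab h.
have ba : 0 < b - a by lra.
case/orP: h => h; rewrite /plateau.
  by rewrite (@step_eq0 ((b - y) / _)) ?mul0r// pmulr_lle0 ?invr_gt0//; lra.
by rewrite (@step_eq0 ((b + y) / _)) ?mulr0// pmulr_lle0 ?invr_gt0//; lra.
Qed.

Let plateauE a b : plateau a b = fun y =>
  step (b / (b - a) + scale_vec (- (b - a)^-1 : R^o) y) *
  step (b / (b - a) + scale_vec ((b - a)^-1 : R^o) y).
Proof.
apply/funext => y; rewrite /plateau /scale_vec /GRing.scale/=.
by congr (step _ * step _); rewrite mulrDl ?mulrN// mulNr.
Qed.

Lemma smooth_plateau a b : smooth_on [set: R^o] (plateau a b).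
Proof.
move=> k; rewrite plateauE.
by apply: CkM; exact: (@Ck_affine R R^o R^o R^o _ (b / (b - a)) step setT k
    (@scale_vec_continuous _ _ _) (smooth_step k)).
Qed.

(** The constant is universal: a and b enter only through the scale 1/(b - a) of the two steps.
    Layers of varying width can thus be compared. *)
Lemma plateau_derive_bounded : exists2 C : R, 0 < C &
  forall (a b : R) (y v : R^o), a < b -> `|'D_v (plateau a b) y| <= C / (b - a) * `|v|.
Proof.
have [C C0 hC] := step_derive_bounded; exists (2 * C); first by rewrite mulr_gt0.
move=> a b y v ab; have ba : 0 < b - a by rewrite subr_gt0.
have [_ ds] := smooth_step 1.
rewrite plateauE.
set c := b / (b - a).
have dstep (L : R^o) : derivable (fun z : R^o => step (c + scale_vec L z)) y v.
  by rewrite derivable_affine; have [+ _] := ds (scale_vec L v); apply.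
have dle (L : R^o) : `|L| = (b - a)^-1 ->
    `|'D_v (fun z : R^o => step (c + scale_vec L z)) y| <= C / (b - a) * `|v|.
  move=> LE; rewrite derive_affine; apply: le_trans (hC _ _) _.
  by rewrite /scale_vec normrZ LE -mulrA (mulrC `|v|).
rewrite deriveM//; apply: le_trans (ler_normD _ _) _.
have -> : 2 * C / (b - a) * `|v| = C / (b - a) * `|v| + C / (b - a) * `|v| by ring.
have sN z : `|step z| <= 1 by rewrite ger0_norm ?step_ge0 ?step_le1.
have nN : `|(b - a)^-1| = (b - a)^-1 by rewrite gtr0_norm ?invr_gt0.
by rewrite lerD// normrZ -[leRHS]mul1r ler_pM// dle// normrN.
Qed.

End SmoothStep.

(** * Lebesgue measure on the slab *)

Section ProductSigmaFinite.
Context d1 d2 (T1 : measurableType d1) (T2 : measurableType d2) (R : realType).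
Variable m1 : {sigma_finite_measure set T1 -> \bar R}.
Variable m2 : {sigma_finite_measure set T2 -> \bar R}.

Lemma product_sigma_finite : sigma_finite setT (m1 \x m2)%E.
Proof.
have [F TF Foo] := sigma_finiteT m1; have [G TG Goo] := sigma_finiteT m2.
pose p (n : nat) : nat * nat := odflt (0, 0)%N (choice.unpickle n).
exists (fun n => F (p n).1 `*` G (p n).2).
  apply/seteqP; split=> // -[x y] _.
  have [i _ Fi] : (\bigcup_k F k) x by rewrite -TF.
  have [j _ Gj] : (\bigcup_k G k) y by rewrite -TG.
  by exists (choice.pickle (i, j)) => //; rewrite /p choice.pickleK.
move=> n; have [mF Fn] := Foo (p n).1; have [mG Gn] := Goo (p n).2.
split; first exact: measurableX.
by rewrite product_measure1E// lte_mul_pinfty// ge0_fin_numE.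
Qed.

(* The library's canonical structure for \x at this level is the one for
   subprobabilities, hence the explicit packing. *)
Definition sfprod : {sigma_finite_measure set (T1 * T2)%type -> \bar R} :=
  HB.pack (m1 \x m2)%E
    (Measure_isSigmaFinite.Build _ _ _ (m1 \x m2)%E product_sigma_finite).

Lemma sfprodE (A : set T1) (B : set T2) : measurable A -> measurable B ->
  sfprod (A `*` B) = (m1 A * m2 B)%E.
Proof. exact: product_measure1E. Qed.

(** The rescaled push-forward agrees with the product measure on rectangles, and the product measure
    is determined by them. *)
Lemma sfprod_preimage (f1 : T1 -> T1) (f2 : T2 -> T2) (a b : R) :
  0 < a -> 0 < b ->
  measurable_fun setT f1 -> measurable_fun setT f2 ->
  (forall A, measurable A -> m1 (f1 @^-1` A) = a%:E * m1 A)%E ->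
  (forall A, measurable A -> m2 (f2 @^-1` A) = b%:E * m2 A)%E ->
  forall A, measurable A ->
  sfprod ((fun x => (f1 x.1, f2 x.2)) @^-1` A) = ((a * b)%:E * sfprod A)%E.
Proof.
move=> a0 b0 mf1 mf2 f1E f2E A mA; pose f (x : T1 * T2) := (f1 x.1, f2 x.2).
have mf : measurable_fun setT f.
  apply/measurable_fun_pairP; split; first exact: (measurableT_comp mf1).
  exact: (measurableT_comp mf2).
have ab0 : 0 < a * b by rewrite mulr_gt0.
have iab0 : 0 <= (a * b)^-1 by rewrite invr_ge0 ltW.
pose P : {measure set _ -> \bar R} :=
  measure_function_pushforward__canonical__measure_function_Measure sfprod mf.
pose m' : {measure set _ -> \bar R} := mscale (NngNum iab0) P.
have m'E B : m' B = ((a * b)^-1%:E * sfprod (f @^-1` B))%E by [].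
have -> : sfprod A = m' A.
  apply: (@product_measure_unique _ _ _ _ _ m1 m2 m') mA => B C mB mC.
  rewrite m'E (_ : f @^-1` (B `*` C) = (f1 @^-1` B) `*` (f2 @^-1` C))//.
  rewrite sfprodE ?f1E ?f2E//; last 2 first.
  - by rewrite -[X in measurable X]setTI; exact: mf1.
  - by rewrite -[X in measurable X]setTI; exact: mf2.
  rewrite [X in (_ * X)%E = _]muleACA [LHS]muleA.
  have -> : (((a * b)^-1)%:E * (a%:E * b%:E) = 1)%E.
    by rewrite -!EFinM mulVf ?gt_eqF.
  by rewrite mul1e.
by rewrite m'E muleA -EFinM divff ?gt_eqF// mul1e.
Qed.

End ProductSigmaFinite.

(** * Measurability of superpositions with Caratheodory integrands *)

Section CaratheodoryComposition.
Context d (T : measurableType d) (R : realType) (m n : nat).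

(** F(x, A(x)) is the limit of F(x, A_k(x)), where A_k rounds the entries down to multiples of
    1/(k+1). Each A_k takes countably many values on measurable sets, and there the composition is a
    partial function F(., Z). *)
Lemma measurable_fun_caratheodory (D : set T) (F : T -> 'M[R]_(m, n) -> R)
    (A : T -> 'M[R]_(m, n)) :
  measurable D -> (forall Z, measurable_fun D (F ^~ Z)) ->
  (forall x, continuous (F x : 'M[R]_(m, n) -> R^o)) ->
  (forall i j, measurable_fun D (fun x => A x i j)) ->
  measurable_fun D (fun x => F x (A x)).
Proof.
move=> mD mF cF mA.
pose q k (Z : 'M[int]_(m, n)) : 'M[R]_(m, n) :=
  \matrix_(i, j) ((Z i j)%:~R / k.+1%:R).
pose fl k x : 'M[int]_(m, n) := \matrix_(i, j) Num.floor (A x i j * k.+1%:R).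
apply: (@measurable_fun_cvg _ _ _ _ (fun k x => F x (q k (fl k x)))); last first.
  move=> x Dx; apply: (@cvg_comp _ _ _ (fun k => q k (fl k x)) (F x) _ (nbhs (A x))).
    apply: cvg_mx => i j; apply/cvgrPdist_le => e e0.
    near=> k; rewrite !mxE.
    have k0 : 0 < k.+1%:R :> R by [].
    have /andP[h1 h2] := floor_itv (A x i j * k.+1%:R).
    rewrite intrD in h2.
    have ke : e^-1 <= k.+1%:R.
      near: k; exists (Num.truncn e^-1) => // k /= hk.
      by rewrite ltW// -truncn_le_nat.
    rewrite ger0_norm; last by rewrite subr_ge0 ler_pdivrMr.
    rewrite lerBlDr -(@ler_pM2r _ k.+1%:R)// mulrDl divfK ?gt_eqF//.
    apply: le_trans (ltW h2) _; rewrite addrC lerD2r.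
    by rewrite -ler_pdivrMl// mulr1.
  exact: cF.
move=> k _ B mB.
rewrite (_ : _ `&` _ = \bigcup_(Z in [set: 'M[int]_(m, n)])
   ((D `&` (F ^~ (q k Z)) @^-1` B) `&` (D `&` [set x | fl k x = Z]))).
  apply: countable_bigcupT_measurable => // Z.
  apply: measurableI; first exact: mF.
  rewrite (_ : _ `&` _ = D `&` \bigcap_(ij in [set: 'I_m * 'I_n])
     (D `&` (fun x => A x ij.1 ij.2) @^-1`
     `[(Z ij.1 ij.2)%:~R / k.+1%:R, (Z ij.1 ij.2 + 1)%:~R / k.+1%:R[)).
    apply: measurableI => //; apply: fin_bigcap_measurable => [|ij _].
      exact: finite_finset.
    by apply: mA => //; exact: measurable_itv.
  apply/seteqP; split=> [x [Dx /= fZ]|x [Dx /= fZ]]; split => //.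
    move=> ij _; split => //=; rewrite in_itv/= -fZ !mxE.
    by have := floor_itv (A x ij.1 ij.2 * k.+1%:R); rewrite ler_pdivrMr// ltr_pdivlMr.
  apply/matrixP => i j; rewrite mxE; apply/eqP; rewrite floor_eq.
  by have [_ /=] := fZ (i, j) I; rewrite in_itv/= ler_pdivrMr// ltr_pdivlMr.
apply/seteqP; split=> [x [Dx /= BF]|x [Z _ [[Dx /= BF] [_ /= fZ]]]].
  by exists (fl k x).
by rewrite fZ.
Unshelve. all: by end_near. Qed.

End CaratheodoryComposition.

Notation borel2 R := (measurableTypeR R * measurableTypeR R)%type.
Notation borel3 R := (measurableTypeR R * measurableTypeR R * measurableTypeR R)%type.
Notation leb3 R := (caratheodory_type (@L3 R)).
Notation mu3 := (L3 : set (leb3 _) -> \bar _).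

(** * Lebesgue measure under dilations of the plane and translations *)

Section LebesgueMeasure3.
Variable R : realType.
Local Notation lam := (@lebesgue_measure R).

Definition sflam : {sigma_finite_measure set (measurableTypeR R) -> \bar R} := lam.
Definition B2 := sfprod sflam sflam.
Definition B3 := sfprod B2 sflam.

Lemma L3_Borel (A : set (borel3 R)) : measurable A -> L3 A = B3 A.
Proof.
move=> mA; have -> : L3 A = (B3^*)%mu A by [].
exact: measurable_mu_extE.
Qed.

Lemma Borel_measurable (A : set (borel3 R)) :
  measurable A -> measurable (A : set (leb3 R)).
Proof.
move=> mA; apply: (@sub_caratheodory _ _ _ B3); exact: sub_sigma_algebra.
Qed.

Lemma Borel_measurable_funT d (T : measurableType d) (g : borel3 R -> T) :
  measurable_fun setT g -> measurable_fun setT (g : leb3 R -> T).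
Proof.
by move=> mg mD' B mB; apply: Borel_measurable; exact: (mg measurableT B mB).
Qed.

Lemma measurable_affine (r b : R) :
  measurable_fun setT (fun x : measurableTypeR R => r * x + b : measurableTypeR R).
Proof.
by apply: continuous_measurable_fun => x; apply: cvgD; [
  apply: cvgM; [exact: cvg_cst|exact: cvg_id]|exact: cvg_cst].
Qed.

(** Uniqueness of Lebesgue measure: the rescaled push-forward gives half-open intervals their
    length. *)
Lemma lam_affine (r b : R) (A : set (measurableTypeR R)) : 0 < r -> measurable A ->
  lam ((fun x => r * x + b) @^-1` A) = ((r^-1)%:E * lam A)%E.
Proof.
move=> r0 mA; have r0' := ltW r0.
pose P : {measure set _ -> \bar R} :=
  measure_function_pushforward__canonical__measure_function_Measure lam
    (measurable_affine r b).
pose m' : {measure set _ -> \bar R} := mscale (NngNum r0') P.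
have m'E (B : set (measurableTypeR R)) :
    m' B = (r%:E * lam ((fun x : R => (r * x + b)%R) @^-1` B))%E by [].
have -> : lam A = m' A.
  apply: (@lebesgue_measure_unique R m') mA => _ [[u v] /= _ <-].
  rewrite m'E (_ : _ @^-1` _ = `](u - b) / r, (v - b) / r]%classic); last first.
    apply/seteqP; split=> x /=; rewrite !in_itv/= ltr_pdivrMr// ler_pdivlMr//;
    by rewrite (mulrC x) ltrBlDr lerBrDr.
  rewrite !lebesgue_measure_itv/= !lte_fin ltr_pM2r ?invr_gt0// ltrD2r.
  case: ifP => _; last by rewrite mule0.
  by rewrite -!EFinB -EFinM; congr EFin; field; rewrite gt_eqF.
by rewrite m'E muleA -EFinM mulVf ?gt_eqF// mul1e.
Qed.

(** Dilation in the plane only, since cells have fixed height, followed by a translation. The factor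
    1 gives the third coordinate the same affine form as the other two. *)
Definition inplane (r : R) (b : space3 R) (x : space3 R) : space3 R :=
  ((r * x.1.1 + b.1.1, r * x.1.2 + b.1.2), 1 * x.2 + b.2).

Definition inplaneV (r : R) (b : space3 R) : space3 R :=
  ((- r^-1 * b.1.1, - r^-1 * b.1.2), - b.2).

Lemma inplaneK (r : R) (b : space3 R) : r != 0 ->
  cancel (inplane r b) (inplane r^-1 (inplaneV r b)).
Proof.
by move=> r0 [[x y] z]; rewrite /inplane/=; congr (_, _, _); (field || ring).
Qed.

Lemma inplaneVK (r : R) (b : space3 R) : r != 0 ->
  cancel (inplane r^-1 (inplaneV r b)) (inplane r b).
Proof.
by move=> r0 [[x y] z]; rewrite /inplane/=; congr (_, _, _); (field || ring).
Qed.

Lemma measurable_inplane_Borel r b :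
  measurable_fun setT (inplane r b : borel3 R -> borel3 R).
Proof.
apply/measurable_fun_pairP; split; last first.
  exact: (measurableT_comp (measurable_affine 1 b.2) measurable_snd).
apply/measurable_fun_pairP; split.
  apply: (measurableT_comp (measurable_affine r b.1.1)).
  exact: (measurableT_comp measurable_fst measurable_fst).
apply: (measurableT_comp (measurable_affine r b.1.2)).
exact: (measurableT_comp measurable_snd measurable_fst).
Qed.

Lemma B3_inplane r b (A : set (borel3 R)) : 0 < r -> measurable A ->
  B3 (inplane r b @^-1` A) = ((r ^- 2)%:E * B3 A)%E.
Proof.
move=> r0 mA; have ir0 : 0 < r^-1 by rewrite invr_gt0.
have h2 (C : set (borel2 R)) : measurable C ->
    B2 ((fun x => (r * x.1 + b.1.1, r * x.2 + b.1.2)) @^-1` C) =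
    ((r^-1 * r^-1)%:E * B2 C)%E.
  apply: (@sfprod_preimage _ _ _ _ R sflam sflam (fun x => r * x + b.1.1)
    (fun x => r * x + b.1.2) r^-1 r^-1 ir0 ir0 (measurable_affine r b.1.1)
    (measurable_affine r b.1.2)) => B mB; exact: lam_affine.
have h1 (C : set (measurableTypeR R)) : measurable C ->
    sflam ((fun x => 1 * x + b.2) @^-1` C) = (1%:E * sflam C)%E.
  by move=> mC; have := lam_affine b.2 (ltr01 : 0 < 1) mC; rewrite invr1.
have h3 := @sfprod_preimage _ _ _ _ R B2 sflam
  (fun x => (r * x.1 + b.1.1, r * x.2 + b.1.2)) (fun x => 1 * x + b.2)
  (r^-1 * r^-1) 1 _ _ _ (measurable_affine 1 b.2) h2 h1 A mA.
rewrite -exprVn expr2 -[r^-1 * r^-1]mulr1; apply: h3 => //.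
- by rewrite mulr_gt0.
- apply/measurable_fun_pairP; split.
    exact: (measurableT_comp (measurable_affine r b.1.1) measurable_fst).
  exact: (measurableT_comp (measurable_affine r b.1.2) measurable_snd).
Qed.

(** Stated for arbitrary sets: preimages of a Borel covering form a Borel covering, with measures
    scaled by the product formula. The inverse map then provides the other inequality. *)
Lemma L3_inplane_le r b (A : set (space3 R)) : 0 < r ->
  (L3 (inplane r b @^-1` A) <= (r ^- 2)%:E * L3 A)%E.
Proof.
move=> r0; have c0 : 0 < r ^- 2 by rewrite invr_gt0 exprn_gt0.
rewrite -lee_pdivrMl//; apply: le_ereal_inf_tmp => _ [F [mF AF] <-].
rewrite lee_pdivrMl//.
have -> : ((r ^- 2)%:E * \sum_(k <oo) (lam \x lam \x lam) (F k) =
           \sum_(k <oo) B3 (inplane r b @^-1` (F k)))%E.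
  rewrite -nneseriesZl//.
  by apply: eq_eseriesr => k _; rewrite B3_inplane.
apply: ereal_inf_lbound; exists (fun k => inplane r b @^-1` (F k)) => //.
split; last by rewrite -preimage_bigcup; exact: preimage_subset.
move=> k; rewrite -[X in measurable X]setTI; apply: measurable_inplane_Borel => //.
Qed.

Lemma L3_inplane r b (A : set (space3 R)) : 0 < r ->
  L3 (inplane r b @^-1` A) = ((r ^- 2)%:E * L3 A)%E.
Proof.
move=> r0; apply/eqP; rewrite eq_le L3_inplane_le//=.
have rn0 : r != 0 by rewrite gt_eqF.
have c0 : 0 < r ^- 2 by rewrite invr_gt0 exprn_gt0.
have ir0 : 0 < r^-1 by rewrite invr_gt0.
have := @L3_inplane_le r^-1 (inplaneV r b)
  (inplane r b @^-1` A) ir0.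
rewrite (_ : _ @^-1` (_ @^-1` A) = A); last first.
  by apply/seteqP; split=> x /=; rewrite inplaneVK.
by rewrite -lee_pdivlMl ?exprVn ?invrK// ?invr_gt0 ?exprn_gt0.
Qed.

(** Because the outer measure scales on all sets, Caratheodory's criterion for [A] pulls back to its
    preimage; Borel measurability of the map alone would not reach all Lebesgue measurable sets. *)
Lemma measurable_inplane r b : 0 < r ->
  measurable_fun setT (inplane r b : leb3 R -> leb3 R).
Proof.
move=> r0 _ A mA; rewrite setTI; have rn0 : r != 0 by rewrite gt_eqF.
have {}mA : L3.-caratheodory A := mA.
suff : L3.-caratheodory (inplane r b @^-1` A) by [].
move=> X.
have XE Y : Y = inplane r b @^-1` (inplane r^-1 (inplaneV r b) @^-1` Y).
  by apply/seteqP; split=> x /=; rewrite inplaneK.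
rewrite (XE X); set Y := _ @^-1` X.
have mAY : L3 Y = (L3 (Y `&` A) + L3 (Y `&` ~` A))%E := mA Y.
transitivity ((r ^- 2)%:E * (L3 (Y `&` A) + L3 (Y `&` ~` A)))%E.
  by rewrite -mAY; exact: L3_inplane.
rewrite ge0_muleDr ?outer_measure_ge0//.
by congr (_ + _)%E; apply/esym; exact: L3_inplane.
Qed.

Lemma ge0_integral_inplane r b (D : set (leb3 R)) (g : leb3 R -> \bar R) :
  0 < r -> measurable D -> measurable_fun D g -> (forall x, D x -> 0 <= g x)%E ->
  (\int[mu3]_(x in inplane r b @^-1` D) g (inplane r b x) =
   (r ^- 2)%:E * \int[mu3]_(x in D) g x)%E.
Proof.
move=> r0 mD mg g0; have c0 : 0 <= r ^- 2 by rewrite invr_ge0 exprn_ge0// ltW.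
have := @ge0_integral_pushforward _ _ _ _ R _ (measurable_inplane b r0)
  [the measure _ _ of mu3] D g mD mg.
have g0' : {in D, forall y, 0 <= g y}%E by move=> y; rewrite inE; exact: g0.
move=> /(_ g0') <-.
rewrite -(ge0_integral_mscale [the measure _ _ of mu3] mD (NngNum c0) mg g0).
pose P : {measure set _ -> \bar R} :=
  measure_function_pushforward__canonical__measure_function_Measure
    [the measure _ _ of mu3] (measurable_inplane b r0).
apply: (@eq_measure_integral _ _ _ _ (mscale (NngNum c0) [the measure _ _ of mu3]) P).
by move=> A mA _; exact: L3_inplane.
Qed.

Lemma integral_inplane r b (D : set (leb3 R)) (g : leb3 R -> \bar R) :
  0 < r -> measurable D -> mu3.-integrable D g ->
  (\int[mu3]_(x in inplane r b @^-1` D) g (inplane r b x) =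
   (r ^- 2)%:E * \int[mu3]_(x in D) g x)%E.
Proof.
move=> r0 mD ig; have /integrableP[mg _] := ig.
rewrite integralE [in RHS]integralE.
rewrite (_ : (fun x => g (inplane r b x))^\+%E = (fun x => g^\+%E (inplane r b x))); last first.
  exact: (funepos_comp g (inplane r b)).
rewrite (_ : (fun x => g (inplane r b x))^\-%E = (fun x => g^\-%E (inplane r b x))); last first.
  exact: (funeneg_comp g (inplane r b)).
rewrite !ge0_integral_inplane//; last 2 first.
- exact: measurable_funeneg.
- exact: measurable_funepos.
rewrite [RHS]muleBr//; apply: fin_num_adde_defr.
by apply: integrable_fin_num => //; exact: integrable_funepos.
Qed.

End LebesgueMeasure3.

Lemma continuous_pair (T U V : topologicalType) (f : T -> U) (g : T -> V) :
  continuous f -> continuous g -> continuous (fun x => (f x, g x)).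
Proof. by move=> cf cg x; apply: cvg_pair; [exact: cf|exact: cg]. Qed.

(** * The slab, its cylinders, and bounded measurable functions *)

Section Slab.
Variable R : realType.
Implicit Types (r t : R) (x : space3 R) (u g : space3 R -> R).

Definition slab : set (space3 R) := cylinder [set: plane2 R].

Lemma slabP x : slab x <-> `|x.2| < 2^-1.
Proof.
rewrite /slab /cylinder /setX/= in_itv/= ltr_norml.
by split => [[]|].
Qed.

Lemma squareP t (y : plane2 R) : square t y <-> `|y.1| < t / 2 /\ `|y.2| < t / 2.
Proof. by rewrite /square /setX/= !in_itv/= !ltr_norml. Qed.

Lemma cylP t x : cylinder (square t) x <->
  [/\ `|x.1.1| < t / 2, `|x.1.2| < t / 2 & `|x.2| < 2^-1].
Proof.
split=> [[/= /squareP[h1 h2] h3]|[h1 h2 h3]].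
  by split => //; apply/slabP.
by split=> /=; [exact/squareP|exact: ((slabP x).2 h3).2].
Qed.

Lemma cyl_slab t : cylinder (square t) `<=` slab.
Proof. by move=> x /cylP[_ _ h]; apply/slabP. Qed.

Lemma cyl_le t r : t <= r -> cylinder (square t) `<=` (cylinder (square r) : set (space3 R)).
Proof.
move=> tr x /cylP[h1 h2 h3]; apply/cylP; split=> //.
  by apply: lt_le_trans h1 _; rewrite ler_pM2r ?invr_gt0.
by apply: lt_le_trans h2 _; rewrite ler_pM2r ?invr_gt0.
Qed.

Lemma measurable_cyl t : measurable (cylinder (square t) : set (leb3 R)).
Proof.
apply: Borel_measurable; apply: measurableX; last exact: measurable_itv.
by apply: measurableX; exact: measurable_itv.
Qed.

Lemma measurable_slab : measurable (slab : set (leb3 R)).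
Proof.
apply: Borel_measurable; apply: measurableX; last exact: measurable_itv.
exact: measurableT.
Qed.

Lemma L3_cyl t : 0 <= t -> L3 (cylinder (square t)) = (t ^+ 2)%:E :> \bar R.
Proof.
move=> t0; have mI : measurable (`](- (t / 2)), (t / 2)[%classic : set (measurableTypeR R)).
  exact: measurable_itv.
rewrite L3_Borel; last first.
  by apply: measurableX; [apply: measurableX|]; exact: measurable_itv.
rewrite /cylinder sfprodE; [|exact: measurableX|exact: measurable_itv].
rewrite /square sfprodE//= /sflam/= !lebesgue_measure_itv/= !lte_fin.
have -> : - 2^-1 < 2^-1 :> R by lra.
move: t0; rewrite le_eqVlt => /predU1P[<-|t0].
  by rewrite mul0r oppr0 ltxx !mul0e expr0n.
have -> : - (t / 2) < t / 2 by lra.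
by rewrite -!EFinB -!EFinM; congr EFin; field.
Qed.

Lemma L3_cyl_lty t : (L3 (cylinder (square t)) < +oo :> \bar R)%E.
Proof.
have [t0|t0] := leP 0 t; first by rewrite L3_cyl// ltry.
rewrite (_ : cylinder _ = set0) ?outer_measure0 ?ltry//.
rewrite -subset0 => x /cylP[h1 _ _].
have := le_lt_trans (normr_ge0 _) h1; lra.
Qed.

Lemma measurable_coord1 : measurable_fun setT (fun x : leb3 R => x.1.1 : R).
Proof.
apply: (@Borel_measurable_funT R _ _ (fun x => x.1.1)).
exact: (measurableT_comp measurable_fst measurable_fst).
Qed.

Lemma measurable_coord2 : measurable_fun setT (fun x : leb3 R => x.1.2 : R).
Proof.
apply: (@Borel_measurable_funT R _ _ (fun x => x.1.2)).
exact: (measurableT_comp measurable_snd measurable_fst).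
Qed.

(** Here the sigma-algebra is the product of three one-dimensional ones: the point is encoded as a
    row of measurable entries and w becomes an integrand constant in x, so that the superposition
    lemma applies. *)
Lemma measurable_continuous_Borel3 (w : space3 R -> R) :
  continuous (w : space3 R -> R^o) -> measurable_fun setT (w : borel3 R -> R).
Proof.
move=> cw.
pose W (x : borel3 R) (A : 'rV[R]_3) : R := w ((A 0 0, A 0 1), A 0 2%:R).
pose A (x : borel3 R) : 'rV[R]_3 := \row_i [:: x.1.1; x.1.2; x.2]`_i.
have -> : w = fun x : borel3 R => W x (A x).
  by apply/funext => -[[a b] c]; rewrite /W /A !mxE.
apply: (@measurable_fun_caratheodory _ (borel3 R) R 1 3 setT W A).
- exact: measurableT.
- by move=> Z; exact: measurable_cst.
- move=> x B.
  apply: (@continuous_comp _ _ _ (fun A : 'rV[R]_3 => ((A 0 0, A 0 1), A 0 2%:R) : space3 R) w).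
    have c2 := @continuous_pair 'rV[R]_3 R R (fun A => A 0 0) (fun A => A 0 1)
      (@coord_continuous _ _ _ 0 0) (@coord_continuous _ _ _ 0 1).
    exact: (@continuous_pair 'rV[R]_3 _ R _ _ c2 (@coord_continuous _ _ _ 0 2%:R)).
  exact: cw.
- move=> i [[|[|[|k]]] lt3]; last by exfalso; move: lt3; rewrite !ltnS ltn0.
  + rewrite (_ : (fun x => _) = (fun x : borel3 R => x.1.1)).
      exact: (measurableT_comp measurable_fst measurable_fst).
    by apply/funext => x; rewrite /A mxE.
  + rewrite (_ : (fun x => _) = (fun x : borel3 R => x.1.2)).
      exact: (measurableT_comp measurable_snd measurable_fst).
    by apply/funext => x; rewrite /A mxE.
  + rewrite (_ : (fun x => _) = (fun x : borel3 R => x.2)).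
      exact: measurable_snd.
    by apply/funext => x; rewrite /A mxE.
Qed.

Lemma measurable_continuous3 (w : space3 R -> R) :
  continuous (w : space3 R -> R^o) -> measurable_fun setT (w : leb3 R -> R).
Proof.
by move=> cw; apply: Borel_measurable_funT; exact: measurable_continuous_Borel3.
Qed.

(** Bounded at every point, not only almost everywhere: sums, products, translations and
    superpositions then need no exceptional set. *)
Definition bmeas u := measurable_fun setT (u : leb3 R -> R) /\
  exists c : R, forall x, `|u x| <= c.

Lemma bmeasD u g : bmeas u -> bmeas g -> bmeas (fun x => u x + g x).
Proof.
move=> [mu [c hc]] [mg [d hd]]; split; first exact: measurable_funD.
by exists (c + d) => x; rewrite (le_trans (ler_normD _ _))// lerD.
Qed.

Lemma bmeasM u g : bmeas u -> bmeas g -> bmeas (fun x => u x * g x).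
Proof.
move=> [mu [c hc]] [mg [d hd]]; split; first exact: measurable_funM.
by exists (c * d) => x; rewrite normrM ler_pM.
Qed.

Lemma bmeas_cst (a : R) : bmeas (fun=> a).
Proof. by split; [exact: measurable_cst|exists `|a|]. Qed.

Lemma bmeas_sum (I : Type) (s : seq I) (P : pred I) (F : I -> space3 R -> R) :
  (forall i, bmeas (F i)) -> bmeas (fun x => \sum_(i <- s | P i) F i x).
Proof.
move=> bF; elim: s => [|i s IH].
  rewrite (_ : (fun _ => _) = fun=> 0); first exact: bmeas_cst.
  by apply/funext => x; rewrite big_nil.
case Pi : (P i).
  rewrite (_ : (fun _ => _) = fun x => F i x + \sum_(i <- s | P i) F i x).
    exact: bmeasD.
  by apply/funext => x; rewrite big_cons Pi.
rewrite (_ : (fun _ => _) = fun x => \sum_(i <- s | P i) F i x) //.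
by apply/funext => x; rewrite big_cons Pi.
Qed.

Lemma bmeas_integrable (D E : set (leb3 R)) u :
  measurable D -> measurable E -> (L3 E < +oo)%E -> bmeas u ->
  (forall x, D x -> ~ E x -> u x = 0) -> mu3.-integrable D (EFin \o u).
Proof.
move=> mD mE LE [mu [c hc]] u0; apply/integrableP; split.
  by apply/measurable_EFinP; exact: measurable_funTS.
have c0 : 0 <= c := le_trans (normr_ge0 _) (hc ((0, 0), 0)).
apply: (@le_lt_trans _ _ (\int[mu3]_(x in D) ((cst c%:E \_ E) x))%E).
  apply: ge0_le_integral; [exact: mD|by []|..].
  - by apply: measurableT_comp => //; apply/measurable_EFinP; exact: measurable_funTS.
  - apply: measurable_funTS; apply/(measurable_restrictT _ mE); exact: measurable_cst.
  - move=> x Dx; rewrite patchE /=; case: ifPn => [_|]; first by rewrite lee_fin.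
    by rewrite notin_setE => nE; rewrite u0// normr0.
rewrite -integral_mkcondr integral_cst; last exact: measurableI.
have LDE : (L3 (D `&` E) < +oo)%E.
  by apply: le_lt_trans LE; apply: le_outer_measure; exact: subIsetr.
by rewrite lte_mul_pinfty.
Qed.

Lemma bmeas_inplane (r : R) (b : space3 R) u : 0 < r -> bmeas u ->
  bmeas (fun x => u (inplane r b x)).
Proof.
move=> r0 [mu [c hc]]; split; last by exists c.
exact: (measurableT_comp mu (measurable_inplane b r0)).
Qed.

Lemma inplane_slab (r : R) (b : space3 R) x : b.2 = 0 -> slab (inplane r b x) <-> slab x.
Proof. by move=> b0; rewrite !slabP /= b0 mul1r addr0. Qed.

End Slab.

(** * Test functions and their derivatives *)

Section TestFunctions.
Variable R : realType.
Local Notation space := (space3 R).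
Implicit Types (theta : space -> R^o) (Om : set space).

Lemma test_continuous Om theta : test_function Om theta -> continuous theta.
Proof. by move=> [sth _ _]; exact: (Ck_continuous (sth 0%N)). Qed.

Lemma test_derivable Om theta x v : test_function Om theta -> derivable theta x v.
Proof. by move=> [sth _ _]; have [_ /(_ v)[dth _]] := sth 1%N; exact: dth. Qed.

Lemma test_derive_continuous Om theta v : test_function Om theta ->
  continuous ('D_v theta).
Proof.
by move=> [sth _ _] x; have [_ /(_ v)[_ [cth _]]] := sth 1%N; exact: cth.
Qed.

Lemma test_eq0 Om theta x : test_function Om theta -> ~ Om x -> theta x = 0.
Proof.
move=> [_ _ sOm] nOm; apply/eqP; apply: contra_notT nOm => th0.
by apply: sOm; exact: subset_closure.
Qed.

Lemma supp_open theta : continuous theta ->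
  forall x, ~ closure [set x | theta x != 0] x -> \forall y \near x, theta y = 0.
Proof.
move=> cth x nx.
have oC : open (~` closure [set x | theta x != 0]).
  by apply: closed_openC; exact: closed_closure.
have : nbhs x (~` closure [set x | theta x != 0]) by exact: open_nbhs_nbhs.
apply: filterS => y ny; apply/eqP; apply: contra_notT ny => th0.
exact: subset_closure.
Qed.

Lemma test_derive_eq0 Om theta x v : test_function Om theta -> ~ Om x ->
  'D_v theta x = 0.
Proof.
move=> tth nOm; have [_ _ sOm] := tth.
rewrite -[RHS](derive_cst (0 : R^o) x v); apply: derive_near_eq.
apply: (supp_open (test_continuous tth)) => /sOm; exact: nOm.
Qed.

Lemma bounded_space_coord (x : space) (r : R) : `|x| <= r ->
  [/\ `|x.1.1| <= r, `|x.1.2| <= r & `|x.2| <= r].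
Proof.
by rewrite !prod_normE !ge_max => /andP[/andP[]].
Qed.

Lemma test_support_cyl theta : test_function (@slab R) theta ->
  exists2 t : R, 0 < t & forall x, closure [set x | theta x != 0] x ->
    cylinder (square t) x.
Proof.
move=> [_ cK sK]; have [K [Kr hK]] := compact_bounded cK.
have K1 : K < `|K| + 1 by rewrite (le_lt_trans (ler_norm _))// ltrDl.
(* The factor 2 is there because [square t] has half side t / 2; the bound [|K| + 1] on the support
   is raised by one for strictness. *)
exists (2 * (`|K| + 2)); first by rewrite mulr_gt0// ltr_wpDl.
move=> x sx; have /slabP h3 := sK _ sx.
have /= /bounded_space_coord[h1 h2 _] := hK _ K1 _ sx.
have E : 2 * (`|K| + 2) / 2 = `|K| + 2 by field.
apply/cylP; split => //; rewrite E.
  by apply: le_lt_trans h1 _; rewrite ltrD2l ltrDl.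
by apply: le_lt_trans h2 _; rewrite ltrD2l ltrDl.
Qed.

Lemma compact_support_bounded theta : continuous theta ->
  compact (closure [set x | theta x != 0]) -> exists c : R, forall x, `|theta x| <= c.
Proof.
move=> cth cK.
have := compact_bounded (continuous_compact (continuous_subspaceT cth) cK).
move=> [K [Kr hK]]; exists (`|K| + 1) => x.
have K1 : K < `|K| + 1 by rewrite (le_lt_trans (ler_norm _))// ltrDl.
have [->|th0] := eqVneq (theta x) 0; first by rewrite normr0 addr_ge0.
by apply: (hK _ K1); exists x => //; exact: subset_closure.
Qed.

Lemma test_bmeas Om theta : test_function Om theta -> bmeas theta.
Proof.
move=> tth; have cth := test_continuous tth; have [_ cK _] := tth.
split; first exact: measurable_continuous3.
exact: compact_support_bounded.
Qed.

Lemma test_derive_bmeas Om theta v : test_function Om theta ->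
  bmeas (fun x => 'D_v theta x).
Proof.
move=> tth; have cth := test_derive_continuous (v := v) tth; have [_ cK _] := tth.
split; first exact: measurable_continuous3.
apply: compact_support_bounded => //.
apply: subclosed_compact cK _; first exact: closed_closure.
rewrite [X in _ `<=` X](iffLR (closure_id _) (@closed_closure _ _)).
apply: closure_subset => x /= Dx; apply: contrapT => nx.
move: Dx; rewrite -(derive_cst (0 : R^o) x v).
by rewrite (derive_near_eq v (supp_open (test_continuous tth) nx)) eqxx.
Qed.

End TestFunctions.

(** * Weak derivatives *)

Section WeakDerivatives.
Variable R : realType.
Local Notation space := (space3 R).
Local Notation slab := (@slab R).
Implicit Types (theta : space -> R^o) (Om D : set (leb3 R)) (u g : space -> R)
  (j : 'I_3) (b x : space).

(** Tested on the whole slab, across the lateral boundary of every cylinder: for a field extended by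
    zero this encodes both the gradient inside and the absence of a jump. *)
Definition wderiv j u g := weak_derivative (@L3 R) slab (basis3 j) u g.

Lemma test_functionS Om Om' theta : Om `<=` Om' ->
  test_function Om theta -> test_function Om' theta.
Proof. by move=> OO [h1 h2 h3]; split => //; exact: subset_trans h3 OO. Qed.

Lemma test_supp theta v : test_function slab theta -> exists2 t : R, 0 < t &
  forall x, ~ cylinder (square t) x -> theta x = 0 /\ 'D_v theta x = 0.
Proof.
move=> tth; have [t t0 ht] := test_support_cyl tth; exists t => // x nx.
have nsx : ~ closure [set x | theta x != 0] x by move=> /ht.
have nz := supp_open (test_continuous tth) nsx.
split; first exact: (nbhs_singleton nz).
by rewrite -[RHS](derive_cst (0 : R^o) x v); exact: derive_near_eq.
Qed.

Lemma test_integrable D theta u : measurable D -> test_function slab theta ->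
  bmeas u -> mu3.-integrable D (EFin \o (fun x => u x * theta x)).
Proof.
move=> mD tth bu; have [t t0 ht] := test_supp 0 tth.
apply: (bmeas_integrable mD (measurable_cyl t) (L3_cyl_lty t)).
  exact: (bmeasM bu (test_bmeas tth)).
by move=> x _ /ht[-> _]; rewrite mulr0.
Qed.

Lemma test_derive_integrable D theta u v : measurable D ->
  test_function slab theta ->
  bmeas u -> mu3.-integrable D (EFin \o (fun x => u x * 'D_v theta x)).
Proof.
move=> mD tth bu; have [t t0 ht] := test_supp v tth.
apply: (bmeas_integrable mD (measurable_cyl t) (L3_cyl_lty t)).
  exact: (bmeasM bu (test_derive_bmeas v tth)).
by move=> x _ /ht[_ ->]; rewrite mulr0.
Qed.

Lemma EFin_Rintegral D u : measurable D -> mu3.-integrable D (EFin \o u) ->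
  (\int[mu3]_(x in D) (u x)%:E = (\int[mu3]_(x in D) u x)%:E)%E.
Proof. by move=> mD iu; rewrite /Rintegral fineK// integrable_fin_num. Qed.

Lemma weak_derivativeP Om j u g : measurable Om -> Om `<=` slab ->
  bmeas u -> bmeas g ->
  weak_derivative (@L3 R) Om (basis3 j) u g <->
  forall theta, test_function Om theta ->
    \int[mu3]_(x in Om) (u x * 'D_(basis3 j) theta x) =
    - \int[mu3]_(x in Om) (g x * theta x).
Proof.
move=> mO sO bu bg; split=> H theta tth; have tth' := test_functionS sO tth;
  have := H theta tth.
  rewrite !EFin_Rintegral//; first by move=> [->].
    exact: test_integrable.
  exact: test_derive_integrable.
move=> E; rewrite !EFin_Rintegral ?E//.
  exact: test_integrable.
exact: test_derive_integrable.
Qed.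

Lemma wderivP j u g : bmeas u -> bmeas g ->
  wderiv j u g <-> forall theta, test_function slab theta ->
    \int[mu3]_(x in slab) (u x * 'D_(basis3 j) theta x) =
    - \int[mu3]_(x in slab) (g x * theta x).
Proof. by apply: weak_derivativeP => //; exact: measurable_slab. Qed.

Lemma wderiv0 j : wderiv j (fun=> 0) (fun=> 0).
Proof.
move=> theta _; rewrite !integral0_eq ?oppe0// => x _; rewrite mul0r//.
Qed.

Lemma wderiv_lin j (a : R) u g u' g' : bmeas u -> bmeas g -> bmeas u' ->
  bmeas g' -> wderiv j u g -> wderiv j u' g' ->
  wderiv j (fun x => a * u x + u' x) (fun x => a * g x + g' x).
Proof.
move=> bu bg bu' bg'; have ba := bmeas_cst a.
have bau : bmeas (fun x => a * u x) by exact: bmeasM.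
have bag : bmeas (fun x => a * g x) by exact: bmeasM.
move=> /(wderivP _ bu bg) H /(wderivP _ bu' bg') H'.
apply/(wderivP _ (bmeasD bau bu') (bmeasD bag bg')) => theta tth.
have ms := @measurable_slab R.
under eq_Rintegral do rewrite mulrDl -mulrA.
rewrite RintegralD//; last 2 first.
- by under eq_fun do rewrite mulrA; exact: test_derive_integrable.
- exact: test_derive_integrable.
rewrite RintegralZl//; last exact: test_derive_integrable.
under [in RHS]eq_Rintegral do rewrite mulrDl -mulrA.
rewrite RintegralD//; last 2 first.
- by under eq_fun do rewrite mulrA; exact: test_integrable.
- exact: test_integrable.
rewrite RintegralZl//; last exact: test_integrable.
by rewrite H// H'// opprD mulrN.
Qed.

Lemma wderiv_sum j (I : Type) (s : seq I) (a : I -> R) (U G : I -> space -> R) :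
  (forall i, bmeas (U i)) -> (forall i, bmeas (G i)) ->
  (forall i, wderiv j (U i) (G i)) ->
  wderiv j (fun x => \sum_(i <- s) a i * U i x) (fun x => \sum_(i <- s) a i * G i x).
Proof.
move=> bU bG H; elim: s => [|i s IH].
  rewrite (_ : (fun _ => _) = fun=> 0); last by apply/funext => x; rewrite big_nil.
  rewrite (_ : (fun x => \sum_(i <- [::]) a i * G i x) = fun=> 0); first exact: wderiv0.
  by apply/funext => x; rewrite big_nil.
have bs (F : I -> space -> R) : (forall i, bmeas (F i)) ->
    bmeas (fun x => \sum_(i <- s) a i * F i x).
  by move=> bF; apply: bmeas_sum => k; apply: bmeasM => //; exact: bmeas_cst.
have := wderiv_lin (a i) (bU i) (bG i) (bs _ bU) (bs _ bG) (H i) IH.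
rewrite (_ : (fun x => a i * U i x + _) = fun x => \sum_(k <- i :: s) a k * U k x); last first.
  by apply/funext => x; rewrite big_cons.
rewrite (_ : (fun x => a i * G i x + _) = fun x => \sum_(k <- i :: s) a k * G k x)//.
by apply/funext => x; rewrite big_cons.
Qed.

Definition dil (r : R) (x : space) : space := ((r * x.1.1, r * x.1.2), x.2).

Lemma dil_linear r : linear (dil r).
Proof.
move=> a [[x1 x2] x3] [[y1 y2] y3].
change (((r * (a * x1 + y1), r * (a * x2 + y2)), a * x3 + y3) =
  ((a * (r * x1) + r * y1, a * (r * x2) + r * y2), a * x3 + y3) :> space).
by congr (_, _, _); ring.
Qed.

HB.instance Definition _ r := GRing.isLinear.Build R space space _ (dil r) (dil_linear r).

Lemma inplaneE r b : inplane r b = fun x => b + dil r x.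
Proof.
apply/funext => -[[x1 x2] x3]; case: b => [[b1 b2] b3].
by rewrite /inplane /dil /GRing.add/=; congr (_, _, _); rewrite addrC ?mul1r.
Qed.

Lemma continuous_coords (f1 f2 f3 : space -> R^o) : continuous f1 ->
  continuous f2 -> continuous f3 -> continuous (fun x => ((f1 x, f2 x), f3 x) : space).
Proof. by move=> c1 c2 c3; do 2 (apply: continuous_pair => //). Qed.

Lemma continuous_coord1 : continuous (fun x : space => x.1.1).
Proof. by move=> x; apply: (@cvg_comp _ _ _ fst fst); exact: cvg_fst. Qed.

Lemma continuous_coord2 : continuous (fun x : space => x.1.2).
Proof. by move=> x; apply: (@cvg_comp _ _ _ fst snd); [exact: cvg_fst|exact: cvg_snd]. Qed.

Lemma continuous_coord3 : continuous (fun x : space => x.2).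
Proof. by move=> x; exact: cvg_snd. Qed.

Lemma dil_continuous r : continuous (dil r).
Proof.
apply: continuous_coords; last exact: continuous_coord3.
  exact: continuous_mull continuous_coord1.
exact: continuous_mull continuous_coord2.
Qed.

Lemma inplane_continuous r b : continuous (inplane r b).
Proof.
by rewrite inplaneE => x; apply: cvgD; [exact: cvg_cst|exact: dil_continuous].
Qed.

Lemma test_inplane r b Om theta : r != 0 -> test_function Om theta ->
  test_function (inplane r b @^-1` Om) (fun x => theta (inplane r b x)).
Proof.
move=> r0 [sth cK KO]; have cti := @inplane_continuous r^-1 (inplaneV r b).
have suppE : [set x | theta (inplane r b x) != 0] `<=`
    inplane r^-1 (inplaneV r b) @` closure [set x | theta x != 0].
  move=> x /= thx; exists (inplane r b x); last exact: inplaneK.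
  exact: subset_closure.
have cK' := continuous_compact (continuous_subspaceT cti) cK.
have clK' : closed (inplane r^-1 (inplaneV r b) @` closure [set x | theta x != 0]).
  by apply: compact_closed => //; exact: norm_hausdorff.
have sub : closure [set x | theta (inplane r b x) != 0] `<=`
    inplane r^-1 (inplaneV r b) @` closure [set x | theta x != 0].
  by rewrite [X in _ `<=` X](iffLR (closure_id _) clK'); exact: closure_subset.
split.
- move=> k; rewrite inplaneE.
  exact: (@Ck_affine _ _ _ _ _ _ _ _ k (@dil_continuous r) (sth k)).
- by apply: subclosed_compact cK' sub; exact: closed_closure.
- by move=> x /sub[y /KO Oy <-]; rewrite /preimage/= inplaneVK.
Qed.

Lemma derive_scale_dir (f : space -> R^o) x v (s : R) : derivable f x v ->
  'D_(s *: v) f x = s * 'D_v f x.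
Proof.
move=> df; have h : is_derive (0 : R^o) 1 (fun t : R^o => f (x + t *: v)) ('D_v f x).
  by have := @is_derive_line R _ _ f x v 0; rewrite scale0r addr0; apply.
have /= <- := @derive_val _ _ _ _ _ _ _ (derive_dir s h).
rewrite (_ : (fun t : R^o => f (x + t *: v)) = fun t : R^o => f (x + scale_vec v t))//.
by rewrite derive_affine /= /scale_vec scale0r addr0.
Qed.

(** The chain rule factor of the in-plane dilation: the third direction is not scaled. *)
Definition dil_factor (r : R) (j : 'I_3) : R := if j == 2%N :> nat then 1 else r.

Lemma dil_basis r j : dil r (basis3 j) = dil_factor r j *: basis3 j.
Proof.
have pairZ (c x1 x2 x3 : R) :
  c *: (((x1, x2), x3) : space) = ((c * x1, c * x2), c * x3) by [].
rewrite /dil /dil_factor /basis3/= pairZ.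
by case: j => -[|[|[|k]]] //= ?; rewrite ?mulr1 ?mulr0.
Qed.

(** Transport the test function by the inverse map and change variables on both sides. The slab is
    invariant because b has no vertical component. *)
Lemma wderiv_inplane r b j u g : 0 < r -> b.2 = 0 -> bmeas u -> bmeas g ->
  wderiv j u g -> wderiv j (fun x => u (inplane r b x))
    (fun x => dil_factor r j * g (inplane r b x)).
Proof.
move=> r0 b0 bu bg /(wderivP _ bu bg) H; have rn0 : r != 0 by rewrite gt_eqF.
have bu' := bmeas_inplane b r0 bu; have bg' := bmeas_inplane b r0 bg.
have bsg := bmeasM (bmeas_cst (dil_factor r j)) bg'.
apply/(wderivP _ bu' bsg) => theta tth.
pose th x := theta (inplane r^-1 (inplaneV r b) x).
have slabE : slab = inplane r b @^-1` slab.
  by apply/seteqP; split=> x; rewrite /preimage/= inplane_slab.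
have tth' : test_function slab th.
  have ir0 : r^-1 != 0 by rewrite invr_eq0.
  have := test_inplane (inplaneV r b) ir0 tth.
  rewrite (_ : _ @^-1` slab = slab)//; apply/seteqP; split=> x;
    by rewrite /preimage/= inplane_slab//= b0 oppr0.
have thE x : theta x = th (inplane r b x) by rewrite /th inplaneK.
have DthE x : 'D_(basis3 j) theta x =
    dil_factor r j * 'D_(basis3 j) th (inplane r b x).
  rewrite -derive_scale_dir; last exact: (test_derivable tth').
  rewrite -dil_basis (_ : theta = fun y => th (b + dil r y)); last first.
    by apply/funext => y; rewrite thE inplaneE.
  by rewrite derive_affine inplaneE.
have ms := @measurable_slab R.
have cv w : mu3.-integrable slab (EFin \o w) -> (forall x, w x = w x) ->
    \int[mu3]_(x in slab) w (inplane r b x) = r ^- 2 * \int[mu3]_(x in slab) w x.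
  move=> iw _; rewrite {1}slabE /Rintegral.
  rewrite (integral_inplane b r0 ms iw) fineM//.
  exact: integrable_fin_num.
have i1 := test_derive_integrable (basis3 j) ms tth' bu.
have i2 := test_integrable ms tth' bg.
under eq_Rintegral do rewrite DthE mulrCA.
under [in RHS]eq_Rintegral do rewrite thE -mulrA.
have intc w t : bmeas w -> (forall x, ~ cylinder (square t) x -> w x = 0) ->
    mu3.-integrable slab (EFin \o (fun x => w (inplane r b x))).
  move=> bw w0.
  have mE : measurable (inplane r b @^-1` cylinder (square t) : set (leb3 R)).
    rewrite -[X in measurable X]setTI; apply: measurable_inplane => //.
    exact: measurable_cyl.
  apply: (bmeas_integrable ms mE _ (bmeas_inplane b r0 bw)).
    rewrite L3_inplane// lte_mul_pinfty//; last exact: L3_cyl_lty.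
    by rewrite lee_fin invr_ge0 exprn_ge0// ltW.
  by move=> x _ nx; apply: w0.
have [t t0 ht] := test_supp (basis3 j) tth'.
rewrite !RintegralZl//; last 2 first.
- apply: (intc (fun x => u x * 'D_(basis3 j) th x) t
    (bmeasM bu (test_derive_bmeas (basis3 j) tth'))).
  by move=> x /ht[_ ->]; rewrite mulr0.
- apply: (intc (fun x => g x * th x) t (bmeasM bg (test_bmeas tth'))).
  by move=> x /ht[-> _]; rewrite mulr0.
rewrite (cv (fun x => u x * 'D_(basis3 j) th x))// (cv (fun x => g x * th x))//.
by rewrite H// !mulrN.
Qed.

Section Lipschitz.
Local Notation shiftj j h := (inplane 1 (h *: basis3 j)).

Lemma shiftjE j (h : R) x : shiftj j h x = x + h *: basis3 j.
Proof.
rewrite inplaneE addrC; congr (_ + _).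
by case: x => [[x1 x2] x3]; rewrite /dil/= !mul1r.
Qed.

Definition box (r : R) : set (leb3 R) :=
  [set x | [/\ `|x.1.1| < r, `|x.1.2| < r & `|x.2| < r]].

Lemma boxE r : box r = (`]-r, r[ `*` `]-r, r[) `*` `]-r, r[.
Proof.
apply/seteqP; split=> x /=; rewrite !in_itv/= -!ltr_norml.
  by move=> [h1 h2 h3].
by move=> [[h1 h2] h3].
Qed.

Lemma measurable_box r : measurable (box r).
Proof.
rewrite boxE; apply: Borel_measurable.
by apply: measurableX; [apply: measurableX|]; exact: measurable_itv.
Qed.

Lemma L3_box_lty r : (L3 (box r) < +oo)%E.
Proof.
rewrite boxE L3_Borel; last first.
  by apply: measurableX; [apply: measurableX|]; exact: measurable_itv.
rewrite sfprodE; [|apply: measurableX; exact: measurable_itv|exact: measurable_itv].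
rewrite sfprodE; [|exact: measurable_itv|exact: measurable_itv].
rewrite /= /sflam/= !lebesgue_measure_itv/= !lte_fin; case: ifP => _.
  by rewrite -!EFinB -!EFinM ltry.
by rewrite !mule0 ltry.
Qed.

Lemma Rintegral_slabT (w : space -> R) : (forall x, ~ slab x -> w x = 0) ->
  \int[mu3]_(x in slab) w x = \int[mu3]_x w x.
Proof.
move=> w0; rewrite Rintegral_mkcond; apply: eq_Rintegral => x _.
by rewrite patchE; case: ifPn => //; rewrite notin_setE => /w0.
Qed.

Lemma ae3S (P Q : leb3 R -> Prop) : (forall x, P x -> Q x) ->
  {ae mu3, forall x, P x} -> {ae mu3, forall x, Q x}.
Proof.
by move=> PQ; apply: (@filterS _ _ (ae_filter_ringOfSetsType [the measure _ _ of mu3])).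
Qed.

Lemma ae3I (P Q : leb3 R -> Prop) :
  {ae mu3, forall x, P x} -> {ae mu3, forall x, Q x} ->
  {ae mu3, forall x, P x /\ Q x}.
Proof. exact: (@filterI _ _ (ae_filter_ringOfSetsType [the measure _ _ of mu3])). Qed.

(** Dominated convergence with dominating function |K| on [E]; [E] is there because [D] may be the
    slab or the whole space, of infinite measure. *)
Lemma bounded_convergence D (E : set (leb3 R)) (w_ : nat -> space -> R) (w : space -> R) (K : R) :
  measurable D -> measurable E -> (L3 E < +oo)%E ->
  (forall n, measurable_fun setT (w_ n : leb3 R -> R)) ->
  measurable_fun setT (w : leb3 R -> R) ->
  (forall n x, D x -> `|w_ n x| <= K) ->
  (forall n x, D x -> ~ E x -> w_ n x = 0) ->
  {ae mu3, forall x, D x -> w_ n x @[n --> \oo] --> w x} ->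
  \int[mu3]_(x in D) w_ n x @[n --> \oo] --> \int[mu3]_(x in D) w x.
Proof.
move=> mD mE LE mw_ mw wK w0 wcvg.
pose g x := `|K| * \1_E x : R.
have bg : bmeas g.
  apply: bmeasM; first exact: bmeas_cst.
  split; first exact: measurable_indic.
  by exists 1 => x; rewrite indicE; case: (_ \in _); rewrite /= ?normr1 ?normr0.
have ig : mu3.-integrable D (EFin \o g).
  apply: (bmeas_integrable mD mE LE bg) => x _ nE.
  by rewrite /g indicE memNset// mulr0.
have [] := @dominated_convergence _ _ _ [the measure _ _ of mu3] D mD
  (fun n => EFin \o w_ n) (EFin \o w) (EFin \o g) _ _ _ ig.
- by move=> n; apply/measurable_EFinP; exact: measurable_funTS.
- by apply/measurable_EFinP; exact: measurable_funTS.
- by apply: ae3S wcvg => x wx Dx; apply: cvg_EFin; [exact: nearW|exact: wx].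
- apply: aeW => x n Dx; rewrite /= lee_fin /g indicE.
  case: (boolP (x \in E)) => xE /=.
    by rewrite mulr1; apply: le_trans (wK _ _ Dx) (ler_norm _).
  by rewrite w0 ?normr0 ?mulr0//; move: xE; rewrite notin_setE.
move=> iw _ h; rewrite /Rintegral; apply: fine_cvg.
by rewrite fineK ?integrable_fin_num.
Qed.

(* Difference quotients pass from the test function to [u] by translation
   invariance. *)
Lemma wderiv_lipschitz j u g (K : R) : bmeas u -> bmeas g ->
  (forall x (h : R), `|u (x + h *: basis3 j) - u x| <= K * `|h|) ->
  {ae mu3, forall x, is_derive (x : space) (basis3 j) (u : space -> R^o) (g x)} ->
  wderiv j u g.
Proof.
move=> bu bg lu du; apply/(wderivP _ bu bg) => theta tth.
set e := basis3 j.
have [t t0 ht] := test_supp e tth.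
pose h_ (n : nat) : R := n.+1%:R^-1.
have h0 n : 0 < h_ n by rewrite invr_gt0.
have h1 n : h_ n <= 1 by rewrite invf_le1// ler1n.
have mT : measurable [set: leb3 R] by exact: measurableT.
have h_cvg (s : R) : s != 0 -> s * h_ n @[n --> \oo] --> 0^'.
  move=> s0; have c0 : s * h_ n @[n --> \oo] --> (0 : R).
    rewrite -(mulr0 s); apply: cvgM; first exact: cvg_cst.
    exact: cvg_harmonic.
  move=> A nA; have : \forall n \near \oo, (s * h_ n != 0 -> A (s * h_ n)).
    exact: (c0 (fun y => y != 0 -> A y) nA).
  move=> H; suff : \forall n \near \oo, A (s * h_ n) by [].
  by apply: filterS H => n; apply; rewrite mulf_neq0// gt_eqF.
have diffq (f : space -> R^o) x d (s : R) : s != 0 -> is_derive x e f d ->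
    (f (x + (s * h_ n) *: e) - f x) / (s * h_ n) @[n --> \oo] --> d.
  move=> s0 [df <-]; 
  have := @cvg_comp _ _ _ (fun n => s * h_ n)
    (fun h : R => h^-1 *: ((f \o shift x) (h *: e) - f x)) \oo 0^' _
    (h_cvg s s0) df.
  rewrite (_ : _ \o _ = (fun n => (f (x + (s * h_ n) *: e) - f x) / (s * h_ n)))//.
  by apply/funext => n /=; rewrite /GRing.scale/= mulrC (addrC x).
(* Translates of the support by at most one unit in the direction e stay in this box, which is the
   set of finite measure needed for the passage to the limit. *)
have box_shift (s : R) x : `|s| <= 1 -> cylinder (square t) (x + s *: e) ->
    box (t + 2) x.
  move=> s1 /cylP[/= c1 c2 c3].
  have cb (y z : R) : `|z| <= 1 -> `|y + s * z| < t / 2 \/ `|y + s * z| < 2^-1 ->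
      `|y| < t + 2.
    move=> z1 H; have sz : `|s * z| <= 1 by rewrite normrM mulr_ile1.
    have := ler_normB (y + s * z) (s * z); rewrite addrK => h.
    by apply: le_lt_trans h _; case: H => H; lra.
  have e1 : `|e.1.1| <= 1 by rewrite /e/=; case: (_ == _); rewrite ?normr1 ?normr0.
  have e2 : `|e.1.2| <= 1 by rewrite /e/=; case: (_ == _); rewrite ?normr1 ?normr0.
  have e3 : `|e.2| <= 1 by rewrite /e/=; case: (_ == _); rewrite ?normr1 ?normr0.
  by split; [apply: (cb _ e.1.1)|apply: (cb _ e.1.2)|apply: (cb _ e.2)] => //;
    [left|left|right].
have th_off (s : R) x : `|s| <= 1 -> ~ box (t + 2) x -> theta (x + s *: e) = 0.
  by move=> s1 nb; apply: (ht _ _).1 => c; apply: nb; exact: box_shift s1 c.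
have th_off0 x : ~ box (t + 2) x -> theta x = 0.
  by move=> /(th_off 0 x); rewrite normr0 scale0r addr0; apply.
have hn1 n : `|h_ n| <= 1 by rewrite ger0_norm// ltW.
have mb := measurable_box (t + 2); have Lb := L3_box_lty (t + 2).
pose a_ n x := u x * ((theta (x + h_ n *: e) - theta x) / h_ n).
pose b_ n x := ((u (x - h_ n *: e) - u x) / h_ n) * theta x.
have [bth mth] := (test_bmeas tth, (test_bmeas tth).1).
have [Kth hKth] := (test_derive_bmeas e tth).2.
have [Ku hKu] := bu.2; have [Kt hKt] := bth.2.
have r1 : 0 < 1 :> R by [].
have bsh (v : space -> R) (s : R) : bmeas v -> bmeas (fun x => v (x + s *: e)).
  move=> bv; rewrite (_ : (fun x => _) = fun x => v (shiftj j s x)).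
    exact: bmeas_inplane.
  by apply/funext => x; rewrite shiftjE.
have bdiff (v : space -> R) (s : R) : bmeas v ->
    bmeas (fun x => (v (x + s *: e) - v x) / `|s|).
  move=> bv; apply: bmeasM; last exact: bmeas_cst.
  apply: bmeasD; first exact: bsh.
  by rewrite (_ : (fun x => _) = fun x => -1 * v x); [exact: (bmeasM (bmeas_cst _) bv)|
     apply/funext => x; rewrite mulN1r].
have ba n : bmeas (a_ n).
  apply: (bmeasM bu); have := bdiff theta (h_ n) (test_bmeas tth).
  by rewrite ger0_norm// ltW.
have bb n : bmeas (b_ n).
  apply: bmeasM; last exact: test_bmeas tth.
  have := bdiff u (- h_ n) bu; rewrite normrN ger0_norm; last exact: ltW.
  by under eq_fun do rewrite scaleNr.
(* Discrete integration by parts, from translation invariance of the integral. *)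
have ab n : \int[mu3]_x a_ n x = \int[mu3]_x b_ n x.
  pose w x := u (x - h_ n *: e) * theta x.
  have bu' : bmeas (fun x => u (x - h_ n *: e)).
    by have := bsh u (- h_ n) bu; under eq_fun do rewrite scaleNr.
  have iw := test_integrable mT tth bu'; have iu := test_integrable mT tth bu.
  have iw' : mu3.-integrable setT (EFin \o (fun x => u x * theta (x + h_ n *: e))).
    apply: (bmeas_integrable mT mb Lb).
      exact: (bmeasM bu (bsh _ _ (test_bmeas tth))).
    by move=> x _ /(th_off _ _ (hn1 n)) ->; rewrite mulr0.
  have -> : \int[mu3]_x a_ n x = (h_ n)^-1 *
      (\int[mu3]_x (u x * theta (x + h_ n *: e)) - \int[mu3]_x (u x * theta x)).
    rewrite -RintegralB// -RintegralZl//; last exact: (integrableB mT iw' iu).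
    by apply: eq_Rintegral => x _; rewrite /a_; ring.
  have -> : \int[mu3]_x b_ n x = (h_ n)^-1 *
      (\int[mu3]_x w x - \int[mu3]_x (u x * theta x)).
    rewrite -RintegralB// -RintegralZl//; last exact: (integrableB mT iw iu).
    by apply: eq_Rintegral => x _; rewrite /b_ /w; ring.
  congr (_ * (_ - _)); rewrite /Rintegral; congr fine.
  have := integral_inplane (h_ n *: e) r1 mT iw; rewrite expr1n invr1 mul1e => <-.
  rewrite preimage_setT; apply: eq_integral => x _.
  by rewrite shiftjE /= addrK.
have dt (x : space) : is_derive x e theta ('D_e theta x).
  by apply: DeriveDef => //; exact: test_derivable tth.
have acvg : \int[mu3]_x a_ n x @[n --> \oo] --> \int[mu3]_x (u x * 'D_e theta x).
  apply: (@bounded_convergence _ _ _ _ (Ku * Kth) mT mb Lb).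
  - by move=> n; exact: (ba n).1.
  - exact: (bmeasM bu (test_derive_bmeas e tth)).1.
  - move=> n x _; rewrite normrM ler_pM// normrM normfV (ger0_norm (ltW (h0 n))).
    rewrite ler_pdivrMr//; have := @mean_value_lipschitz R _ theta x e Kth (h_ n).
    by rewrite (ger0_norm (ltW (h0 n))); apply => // y; exact: test_derivable tth.
  - by move=> n x _ nb; rewrite /a_ th_off// th_off0// subrr mul0r mulr0.
  - apply: aeW => x _; apply: cvgM; first exact: cvg_cst.
    have n1 : (1 : R) != 0 by exact: oner_neq0.
    have := diffq theta x ('D_e theta x) 1 n1 (dt x).
    by under eq_fun do rewrite mul1r.
have bcvg : \int[mu3]_x b_ n x @[n --> \oo] --> \int[mu3]_x (- (g x * theta x)).
  apply: (@bounded_convergence _ _ _ _ (K * Kt) mT mb Lb).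
  - by move=> n; exact: (bb n).1.
  - have := (bmeasM (bmeas_cst (-1)) (bmeasM bg (test_bmeas tth))).1.
    by under eq_fun do rewrite mulN1r.
  - move=> n x _; rewrite normrM ler_pM// normrM normfV (ger0_norm (ltW (h0 n))).
    rewrite ler_pdivrMr//; have := lu x (- h_ n).
    by rewrite normrN (ger0_norm (ltW (h0 n))) scaleNr.
  - by move=> n x _ nb; rewrite /b_ th_off0// mulr0.
  - apply: ae3S du => x dx _; rewrite -mulNr; apply: cvgM; last exact: cvg_cst.
    have n10 : -1 != 0 :> R by rewrite oppr_eq0 oner_eq0.
    have := cvgN (@diffq u x _ (-1) n10 dx).
    rewrite (_ : - _ = (fun n => (u (x - h_ n *: e) - u x) / h_ n)); first by apply.
    by apply/funext => n; rewrite fctE mulN1r scaleNr invrN mulrN opprK.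
rewrite !Rintegral_slabT; last 2 first.
- by move=> x nx; rewrite (test_eq0 tth)// mulr0.
- by move=> x nx; rewrite (test_derive_eq0 _ tth)// mulr0.
have -> : - (\int[mu3]_x (g x * theta x)) = \int[mu3]_x (- (g x * theta x)).
  under [in RHS]eq_Rintegral do rewrite -mulN1r.
  by rewrite RintegralZl ?mulN1r//; exact: test_integrable.
move: bcvg; under eq_fun do rewrite -ab; move=> bcvg.
exact: (cvg_unique (@Rhausdorff R) acvg bcvg).
Qed.

End Lipschitz.

End WeakDerivatives.

(** * Linear forms and smooth cutoffs in the plane *)

Section LinearForms.
Variable R : realType.
Local Notation space := (space3 R).

(** The coordinates are special cases, so that functions of one coordinate inherit smoothness and
    derivatives from the affine composition lemmas. *)
Definition lform (c1 c2 c3 : R) (x : space) : R^o :=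
  c1 * x.1.1 + c2 * x.1.2 + c3 * x.2.

Lemma lform_linear c1 c2 c3 : linear (lform c1 c2 c3).
Proof.
move=> a [[x1 x2] x3] [[y1 y2] y3].
change (c1 * (a * x1 + y1) + c2 * (a * x2 + y2) + c3 * (a * x3 + y3) =
  a * (c1 * x1 + c2 * x2 + c3 * x3) + (c1 * y1 + c2 * y2 + c3 * y3)); ring.
Qed.

HB.instance Definition _ c1 c2 c3 :=
  GRing.isLinear.Build R space R^o _ (lform c1 c2 c3) (lform_linear c1 c2 c3).

Lemma lform_continuous c1 c2 c3 : continuous (lform c1 c2 c3).
Proof.
move=> x; have h1 := @continuous_mull _ _ c1 _ (@continuous_coord1 R) x.
have h2 := @continuous_mull _ _ c2 _ (@continuous_coord2 R) x.
have h3 := @continuous_mull _ _ c3 _ (@continuous_coord3 R) x.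
exact: cvgD (cvgD h1 h2) h3.
Qed.

Lemma Ck_lform c1 c2 c3 k (f : R^o -> R^o) : Ck k [set: R^o] f ->
  Ck k [set: space] ((fun x => f (lform c1 c2 c3 x)) : space -> R^o).
Proof.
move=> cf; have := @Ck_affine _ _ _ _ _ 0 _ _ k (@lform_continuous c1 c2 c3) cf.
by rewrite preimage_setT (_ : (fun y => _) = fun x => f (lform c1 c2 c3 x));
  last by apply/funext => y; rewrite add0r.
Qed.

Lemma derive_lform c1 c2 c3 (f : R^o -> R^o) x v :
  'D_v ((fun x => f (lform c1 c2 c3 x)) : space -> R^o) x =
  'D_(lform c1 c2 c3 v) f (lform c1 c2 c3 x).
Proof.
have := @derive_affine _ _ _ _ (lform c1 c2 c3 : {linear space -> R^o}) 0 f x v.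
by under eq_fun do rewrite add0r; rewrite add0r.
Qed.

Lemma derivable_lform c1 c2 c3 (f : R^o -> R^o) x v :
  derivable f (lform c1 c2 c3 x) (lform c1 c2 c3 v) ->
  derivable ((fun x => f (lform c1 c2 c3 x)) : space -> R^o) x v.
Proof.
have := @derivable_affine _ _ _ _ (lform c1 c2 c3 : {linear space -> R^o}) 0 f x v.
rewrite add0r (_ : (fun y => f (0 + _)) = fun x => f (lform c1 c2 c3 x)).
  by move=> ->.
by apply/funext => y; rewrite add0r.
Qed.

End LinearForms.

Section DeriveProduct.
Variables (R : realType) (V : normedModType R).

Lemma derive_prod (f g : V -> R^o) x v : derivable f x v -> derivable g x v ->
  derivable ((fun y => f y * g y) : V -> R^o) x v /\
  'D_v ((fun y => f y * g y) : V -> R^o) x = f x * 'D_v g x + g x * 'D_v f x.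
Proof.
move=> df dg; have h1 := derivableM df dg; have h2 := deriveM df dg.
by split; [exact: h1|exact: h2].
Qed.

End DeriveProduct.

Section Cutoff.
Variable R : realType.
Local Notation space := (space3 R).
Implicit Types (a b t : R) (x v : space).

(** Independent of the third coordinate. Since [|x.1|] is the sup norm, it is 1 over the square of
    half side a and 0 off the one of half side b. *)
Definition cutoff a b x : R^o := plateau a b x.1.1 * plateau a b x.1.2.

Lemma cutoffE a b : cutoff a b = fun x => plateau a b (lform 1 0 0 x) *
  plateau a b (lform 0 1 0 x).
Proof.
by apply/funext => x; rewrite /cutoff /lform !mul1r !mul0r !addr0 add0r.
Qed.

Lemma cutoff_ge0 a b x : 0 <= cutoff a b x.
Proof. by rewrite mulr_ge0// plateau_ge0. Qed.

Lemma cutoff_le1 a b x : cutoff a b x <= 1.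
Proof. by rewrite mulr_ile1// ?plateau_ge0// plateau_le1. Qed.

Lemma cutoff_norm a b x : `|cutoff a b x| <= 1.
Proof. by rewrite ger0_norm ?cutoff_ge0// cutoff_le1. Qed.

Lemma plane_normE (y : plane2 R) : `|y| = Num.max `|y.1| `|y.2|.
Proof. by rewrite prod_normE. Qed.

Lemma square_norm t (y : plane2 R) : square t y <-> `|y| < t / 2.
Proof. by rewrite squareP plane_normE gt_max; split => [[-> ->]|/andP[]]. Qed.

Lemma cutoff_eq1 a b x : a < b -> `|x.1| <= a -> cutoff a b x = 1.
Proof.
by move=> ab; rewrite plane_normE ge_max => /andP[h1 h2]; rewrite /cutoff !plateau_eq1// mulr1.
Qed.

Lemma cutoff_eq0 a b x : a < b -> b <= `|x.1| -> cutoff a b x = 0.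
Proof.
move=> ab; rewrite plane_normE le_max => /orP[h|h].
  by rewrite /cutoff plateau_eq0// mul0r.
by rewrite /cutoff (@plateau_eq0 _ _ _ x.1.2)// mulr0.
Qed.

Lemma smooth_cutoff a b : smooth_on [set: space] (cutoff a b).
Proof.
move=> k; rewrite cutoffE; apply: CkM; apply: Ck_lform; exact: smooth_plateau.
Qed.

Lemma cutoff_continuous a b : continuous (cutoff a b).
Proof. exact: (Ck_continuous (smooth_cutoff a b 0)). Qed.

Lemma cutoff_derivable a b x v : derivable (cutoff a b) x v.
Proof. by have [_ /(_ v)[+ _]] := smooth_cutoff a b 1; apply. Qed.

Lemma cutoff_derive_continuous a b v : continuous ('D_v (cutoff a b)).
Proof. by move=> x; have [_ /(_ v)[_ [+ _]]] := smooth_cutoff a b 1; apply. Qed.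

Lemma cutoff_derive_bounded : exists2 C : R, 0 < C &
  forall a b x v, a < b -> `|'D_v (cutoff a b) x| <= C / (b - a) * `|v|.
Proof.
have [C C0 hC] := @plateau_derive_bounded R; exists (2 * C); first by rewrite mulr_gt0.
move=> a b x v ab; rewrite cutoffE.
have dp c1 c2 c3 (y w : space) : derivable (plateau a b) (lform c1 c2 c3 y) (lform c1 c2 c3 w).
  by have [_ /(_ (lform c1 c2 c3 w))[+ _]] := smooth_plateau a b 1; apply.
have [_ ->] := derive_prod (derivable_lform (dp 1 0 0 x v)) (derivable_lform (dp 0 1 0 x v)).
rewrite !derive_lform; apply: le_trans (ler_normD _ _) _.
have pn y : `|plateau a b y| <= 1 by rewrite ger0_norm ?plateau_ge0// plateau_le1.
have [v1 v2 _] := @bounded_space_coord R v `|v| (lexx _).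
have l1 : `|lform 1 0 0 v| <= `|v| by rewrite /lform mul1r !mul0r !addr0.
have l2 : `|lform 0 1 0 v| <= `|v| by rewrite /lform mul1r !mul0r !addr0 add0r.
have Cab : 0 <= C / (b - a) by apply: divr_ge0; [exact: ltW|rewrite subr_ge0 ltW].
have -> : 2 * C / (b - a) * `|v| = 1 * (C / (b - a) * `|v|) + 1 * (C / (b - a) * `|v|).
  by ring.
by apply: lerD; rewrite normrM; apply: ler_pM => //;
  apply: le_trans (hC _ _ _ _ ab) _; rewrite ler_wpM2l.
Qed.

Lemma cutoff_derive_eq0 a b x v : a < b -> `|x.1| < a -> 'D_v (cutoff a b) x = 0.
Proof.
move=> ab xa; rewrite -[RHS](derive_cst (1 : R^o) x v); apply: derive_near_eq.
have cn : {for x, continuous (fun y : space => `|y.1| : R^o)}.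
  by apply: (@continuous_comp _ _ _ fst (fun y : plane2 R => `|y| : R^o));
    [exact: cvg_fst|exact: norm_continuous].
have : \forall y \near x, `|y.1| < a.
  by apply: (cn (fun z : R^o => z < a)); exact: lt_nbhsl.
by apply: filterS => y ya; rewrite cutoff_eq1// ltW.
Qed.

Lemma cutoff_derive_eq0r a b x v : a < b -> b < `|x.1| -> 'D_v (cutoff a b) x = 0.
Proof.
move=> ab xa; rewrite -[RHS](derive_cst (0 : R^o) x v); apply: derive_near_eq.
have cn : {for x, continuous (fun y : space => `|y.1| : R^o)}.
  by apply: (@continuous_comp _ _ _ fst (fun y : plane2 R => `|y| : R^o));
    [exact: cvg_fst|exact: norm_continuous].
have : \forall y \near x, b < `|y.1|.
  by apply: (cn (fun z : R^o => b < z)); exact: lt_nbhsr.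
by apply: filterS => y ya; rewrite cutoff_eq0// ltW.
Qed.

Lemma cutoff_bmeas a b : bmeas (cutoff a b).
Proof.
split; first exact: measurable_continuous3 (@cutoff_continuous a b).
by exists 1 => x; exact: cutoff_norm.
Qed.

Lemma cutoff_derive_bmeas a b v : a < b -> bmeas ('D_v (cutoff a b)).
Proof.
move=> ab; split; first exact: measurable_continuous3 (@cutoff_derive_continuous a b v).
have [C C0 hC] := cutoff_derive_bounded.
by exists (C / (b - a) * `|v|) => x; exact: hC.
Qed.

End Cutoff.

(** * Extension by zero across the lateral boundary *)

Section ZeroExtension.
Variable R : realType.
Local Notation space := (space3 R).
Local Notation slab := (@slab R).
Local Notation cyl t := (cylinder (square t) : set (space3 R)).
Implicit Types (u g w : space -> R) (D E : set (leb3 R)) (t : R).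

Lemma Rintegral_bound D E w (K : R) : measurable D -> measurable E ->
  (L3 E < +oo)%E -> bmeas w -> (forall x, D x -> `|w x| <= K) ->
  (forall x, D x -> ~ E x -> w x = 0) ->
  `|\int[mu3]_(x in D) w x| <= `|K| * fine (L3 E).
Proof.
move=> mD mE LE bw wK w0; have iw := bmeas_integrable mD mE LE bw w0.
apply: le_trans (le_normr_Rintegral mD iw) _.
pose k x : R := `|K| * \1_E x.
have bk : bmeas k.
  apply: bmeasM; first exact: bmeas_cst.
  split; first exact: measurable_indic.
  by exists 1 => x; rewrite indicE; case: (_ \in _); rewrite /= ?normr1 ?normr0.
have ik : mu3.-integrable setT (EFin \o k).
  apply: (bmeas_integrable measurableT mE LE bk) => x _ nE.
  by rewrite /k indicE memNset// mulr0.
have bnw : bmeas (fun x => `|w x|).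
  case: bw => mw [c hc]; split; first exact: measurableT_comp.
  by exists c => x; rewrite normr_id.
have inw : mu3.-integrable D (EFin \o (fun x => `|w x|)).
  by apply: (bmeas_integrable mD mE LE bnw) => x Dx nE; rewrite w0// normr0.
have E1 : \int[mu3]_x k x = `|K| * fine (L3 E).
  rewrite /Rintegral /k; under eq_integral do rewrite EFinM.
  rewrite integralZl//; last first.
    have := bmeas_integrable measurableT mE LE.
    apply; last by move=> x _ nE; rewrite indicE memNset.
    split; first exact: measurable_indic.
    by exists 1 => x; rewrite indicE; case: (_ \in _); rewrite /= ?normr1 ?normr0.
  rewrite integral_indic// setIT fineM// ge0_fin_numE//.
rewrite -E1 Rintegral_mkcond; apply: le_Rintegral => //.
  by have /(integrable_mkcond _ mD) := inw; rewrite restrict_EFin.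
move=> x _; rewrite patchE /k indicE; case: ifPn => [/set_mem Dx|_]; last first.
  by rewrite mulr_ge0.
case: (boolP (x \in E)) => xE /=.
  by rewrite mulr1; apply: le_trans (wK _ Dx) (ler_norm _).
by rewrite w0 ?normr0 ?mulr0//; move: xE; rewrite notin_setE.
Qed.

Lemma compact_box (r : R) : compact [set x : space | `|x| <= r].
Proof.
have E : [set x : space | `|x| <= r] =
    (`[- r, r] `*` `[- r, r]) `*` `[- r, r].
  apply/seteqP; split=> x /=; rewrite !in_itv/= -!ler_norml !prod_normE !ge_max.
    by move=> /andP[/andP[h1 h2] h3].
  by move=> [[-> ->] ->].
by rewrite E; apply: compact_setX; [apply: compact_setX|]; exact: segment_compact.
Qed.

(** On the compact set where |u| >= eps the distance to the boundary of the square is continuous and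
    positive, hence bounded below; closer to the boundary u must be smaller than eps. *)
Lemma layer_small t u : 0 < t -> continuous (u : space -> R^o) ->
  (forall x, ~ square t x.1 -> u x = 0) ->
  forall eps : R, 0 < eps -> exists2 d : R, 0 < d &
    forall x, `|x.2| <= 2^-1 -> t / 2 - d <= `|x.1| -> `|u x| <= eps.
Proof.
move=> t0 cu u0 eps e0.
have cnu : continuous (fun x => `|u x| : R^o).
  by move=> x; apply: cvg_norm; exact: cu.
pose K := [set x : space | `|x| <= t / 2 + 2^-1] `&` [set x | eps <= `|u x|].
have cK : compact K.
  apply: compact_closedI; first exact: compact_box.
  apply: (@closed_comp _ _ (fun x => `|u x| : R^o) [set y | eps <= y]).
    by move=> x _; exact: cnu.
  exact: closed_ge.
have K1 x : K x -> 0 < t / 2 - `|x.1|.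
  move=> [_ /= ux]; rewrite subr_gt0; apply: contraPT ux => nx.
  rewrite u0 ?normr0; first by apply/negP; rewrite -ltNge.
  by rewrite square_norm; exact/negP.
pose d (x : space) : R^o := (t / 2 - `|x.1|)^-1.
have cd : {within K, continuous d}.
  apply: continuous_in_subspaceT => x /set_mem /K1 x0.
  apply: cvgV; first by rewrite gt_eqF.
  apply: cvgB; first exact: cvg_cst.
  by apply: (@continuous_comp _ _ _ fst (fun y : plane2 R => `|y| : R^o));
    [exact: cvg_fst|exact: norm_continuous].
have [M [Mr hM]] := compact_bounded (continuous_compact cd cK).
pose N := `|M| + 1; have N0 : 0 < N by rewrite ltr_wpDl.
have MN : M < N by rewrite (le_lt_trans (ler_norm M))// ltrDl.
exists (2 * N)^-1; first by rewrite invr_gt0 mulr_gt0.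
move=> x x2 xd; rewrite leNgt; apply/negP => ux.
have [sx|sx] := pselect (square t x.1); last by move: ux; rewrite u0// normr0 ltNge ltW.
have Kx : K x.
  split; last exact: ltW.
  rewrite /= prod_normE ge_max; move/square_norm: sx => sx.
  by apply/andP; split; lra.
have x0 := K1 _ Kx.
have dN : d x <= N.
  by apply: le_trans (ler_norm _) _; exact: (hM _ MN _ (ex_intro2 _ _ x Kx erefl)).
have h : N^-1 <= t / 2 - `|x.1|.
  by rewrite -[leRHS]invrK lef_pV2 ?posrE ?invr_gt0//.
have : N^-1 <= (2 * N)^-1 by apply: le_trans h _; lra.
rewrite lef_pV2 ?posrE ?mulr_gt0//; lra.
Qed.

Lemma Rintegral_sub D D' w : D `<=` D' -> (forall x, D' x -> ~ D x -> w x = 0) ->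
  \int[mu3]_(x in D') w x = \int[mu3]_(x in D) w x.
Proof.
move=> DD w0; rewrite [LHS]Rintegral_mkcond [RHS]Rintegral_mkcond; apply: eq_Rintegral => x _.
rewrite !patchE; case: ifPn => [/set_mem D'x|]; case: ifPn => //.
  by rewrite notin_setE => /(w0 _ D'x).
by rewrite notin_setE => /set_mem /DD Dx; move=> /(_ Dx).
Qed.

Lemma L3_layer t a : 0 <= a -> 2 * a <= t ->
  fine (L3 (cyl t `\` cyl (2 * a))) = t ^+ 2 - (2 * a) ^+ 2.
Proof.
move=> a0 at0; have t0 : 0 <= t by apply: le_trans at0; rewrite mulr_ge0.
have := @measureD _ _ _ [the measure _ _ of mu3] (cyl t) (cyl (2 * a))
  (measurable_cyl t) (measurable_cyl (2 * a)) (L3_cyl_lty t).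
rewrite setIidr; last exact: cyl_le.
move=> /= ->; rewrite !L3_cyl ?mulr_ge0//.
Qed.

(** Multiply the test function by a cutoff [chi n] vanishing near the lateral boundary. The product
    rule leaves an extra term u theta D chi_n, supported in a layer of width of order [d_ n]: there
    D chi_n is of order 1 / [d_ n], compensated by the area, and u tends to 0 uniformly, so the term
    vanishes in the limit. *)
Lemma zero_extension t j u g : 0 < t -> continuous (u : space -> R^o) ->
  (forall x, ~ square t x.1 -> u x = 0) -> bmeas u -> bmeas g ->
  (forall x, ~ cyl t x -> g x = 0) ->
  weak_derivative L3 (cyl t) (basis3 j) u g -> wderiv j u g.
Proof.
move=> t0 cu u0 bu bg g0; have mc := @measurable_cyl R t.
move=> /(weak_derivativeP j mc (@cyl_slab R t) bu bg) H.
apply/(wderivP j bu bg) => theta tth; set e := basis3 j.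
have ms := @measurable_slab R.
have Lc := @L3_cyl_lty R t.
(* The cutoff descends over a width [d_ n] between half sides t/2 - 2 d_n and t/2 - d_n; the bound
   t/8 keeps the inner one nonnegative. *)
pose d_ (n : nat) : R := t / 8 * n.+1%:R^-1.
have d0 n : 0 < d_ n by rewrite mulr_gt0 ?invr_gt0// mulr_gt0// invr_gt0.
have d1 n : d_ n <= t / 8.
  by rewrite ler_piMr ?invf_le1 ?ler1n// ltW// mulr_gt0// invr_gt0.
pose b_ n := t / 2 - d_ n; pose a_ n := t / 2 - 2 * d_ n.
have ab n : a_ n < b_ n by have := d0 n; rewrite /a_ /b_; lra.
have a0 n : 0 <= a_ n by have := d1 n; rewrite /a_; lra.
have a2 n : 2 * a_ n <= t by have := d0 n; rewrite /a_; lra.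
pose chi n := cutoff (a_ n) (b_ n).
pose th n : space -> R^o := fun x => theta x * chi n x.
have [sth cK sK] := tth.
have tthn n : test_function (cyl t) (th n).
  have sub : closure [set x | th n x != 0] `<=`
      closure [set x | theta x != 0] `&` [set x | `|x.1| <= b_ n].
    have cl2 : closed [set x : space | `|x.1| <= b_ n].
      apply: (@closed_comp _ _ (fun x : space => `|x.1| : R^o) [set y | y <= b_ n]).
        move=> x _; apply: (@continuous_comp _ _ _ fst (fun y : plane2 R => `|y| : R^o));
          [exact: cvg_fst|exact: norm_continuous].
      exact: closed_le.
    have cl1 := closedI (@closed_closure _ [set x | theta x != 0]) cl2.
    rewrite [X in _ `<=` X](iffLR (closure_id _) cl1); apply: closure_subset.
    move=> x /= tx; split.
      apply: subset_closure => /=; apply: contraNneq tx; rewrite /th => ->.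
      by rewrite mul0r.
    rewrite /= leNgt; apply: contraNN tx => bx.
    by rewrite /th /chi cutoff_eq0 ?mulr0// ltW.
  split.
  - by move=> k; apply: CkM; [exact: sth|exact: smooth_cutoff].
  - apply: subclosed_compact cK _; first exact: closed_closure.
    by move=> x /sub[].
  - move=> x /sub[sx xb]; have [_ x3] := sK _ sx; split; last exact: x3.
    by apply/square_norm; apply: le_lt_trans xb _; have := d0 n; rewrite /b_; lra.
have bth := test_bmeas tth; have bDth := test_derive_bmeas e tth.
have bchi n : bmeas (chi n) := cutoff_bmeas _ _.
have bDchi n : bmeas (fun x => 'D_e (chi n) x) := cutoff_derive_bmeas e (ab n).
pose w1 n x := u x * (chi n x * 'D_e theta x).
pose w2 n x := u x * (theta x * 'D_e (chi n) x).
pose w3 n x := g x * (theta x * chi n x).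
have bw1 n : bmeas (w1 n) := bmeasM bu (bmeasM (bchi n) bDth).
have bw2 n : bmeas (w2 n) := bmeasM bu (bmeasM bth (bDchi n)).
have bw3 n : bmeas (w3 n) := bmeasM bg (bmeasM bth (bchi n)).
have off (v : space -> R) (w : space -> R) : (forall x, ~ square t x.1 -> v x = 0) ->
    forall x, slab x -> ~ cyl t x -> v x * w x = 0.
  move=> v0 x [_ sx] nx; rewrite v0 ?mul0r// => sq; apply: nx; split => //.
have goff (w : space -> R) : forall x, slab x -> ~ cyl t x -> g x * w x = 0.
  by move=> x _ /g0 ->; rewrite mul0r.
have DE n x : 'D_e (th n) x = theta x * 'D_e (chi n) x + chi n x * 'D_e theta x.
  have dch : derivable (chi n) x e by exact: cutoff_derivable.
  have dth : derivable theta x e by exact: (test_derivable tth).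
  exact: (derive_prod dth dch).2.
have id n : \int[mu3]_(x in slab) w1 n x + \int[mu3]_(x in slab) w2 n x =
    - \int[mu3]_(x in slab) w3 n x.
  have i1 : mu3.-integrable slab (EFin \o w1 n).
    by apply: (bmeas_integrable ms mc Lc (bw1 n)); exact: off.
  have i2 : mu3.-integrable slab (EFin \o w2 n).
    by apply: (bmeas_integrable ms mc Lc (bw2 n)); exact: off.
  rewrite -RintegralD//.
  rewrite (Rintegral_sub (@cyl_slab R t) (goff _)).
  rewrite -(H _ (tthn n)) -(Rintegral_sub (@cyl_slab R t)); last exact: off.
  by apply: eq_Rintegral => x _; rewrite /w1 /w2 DE -mulrDr addrC.
have chi1 x : square t x.1 -> \forall n \near \oo, chi n x = 1.
  move=> /square_norm xt.
  have p0 : 0 < (t / 2 - `|x.1|) / t by rewrite divr_gt0// subr_gt0.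
  have := near_infty_natSinv_lt (PosNum p0); apply: filterS => n /= nl.
  rewrite /chi cutoff_eq1// /a_ /d_; have := d0 n; rewrite /d_.
  move: nl; rewrite ltr_pdivlMr//; set z := n.+1%:R^-1 => nl.
  have -> : t / 8 * z = (z * t) / 8 by field.
  lra.
have c1 : \int[mu3]_(x in slab) w1 n x @[n --> \oo] -->
    \int[mu3]_(x in slab) (u x * 'D_e theta x).
  have [Ku hKu] := bu.2; have [Kd hKd] := bDth.2.
  apply: (@bounded_convergence _ _ _ _ _ (Ku * (1 * Kd)) ms mc Lc).
  - by move=> n; exact: (bw1 n).1.
  - exact: (bmeasM bu bDth).1.
  - move=> n x _; rewrite normrM ler_pM// normrM ler_pM//; exact: cutoff_norm.
  - by move=> n; exact: off.
  - apply: aeW => x _; have [sx|sx] := pselect (square t x.1); last first.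
      rewrite u0// mul0r (_ : (fun n => _) = fun=> 0); first exact: cvg_cst.
      by apply/funext => n; rewrite /w1 u0// mul0r.
    apply: cvg_near_cst; have := chi1 _ sx; apply: filterS => n c.
    by rewrite /w1 c mul1r.
have c3 : \int[mu3]_(x in slab) w3 n x @[n --> \oo] -->
    \int[mu3]_(x in slab) (g x * theta x).
  have [Kg hKg] := bg.2; have [Kd hKd] := bth.2.
  apply: (@bounded_convergence _ _ _ _ _ (Kg * (Kd * 1)) ms mc Lc).
  - by move=> n; exact: (bw3 n).1.
  - exact: (bmeasM bg bth).1.
  - move=> n x _; rewrite normrM ler_pM// normrM ler_pM//; exact: cutoff_norm.
  - by move=> n; exact: goff.
  - apply: aeW => x _; have [sx|sx] := pselect (square t x.1); last first.
      have gx : g x = 0 by apply: g0 => -[].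
      rewrite gx mul0r (_ : (fun n => _) = fun=> 0); first exact: cvg_cst.
      by apply/funext => n; rewrite /w3 gx mul0r.
    apply: cvg_near_cst; have := chi1 _ sx; apply: filterS => n c.
    by rewrite /w3 c mulr1.
have c2 : \int[mu3]_(x in slab) w2 n x @[n --> \oo] --> (0 : R).
  have [C C0 hC] := @cutoff_derive_bounded R.
  have [Kt hKt] := bth.2.
  have Kt0 : 0 <= Kt := le_trans (normr_ge0 _) (hKt 0).
  apply/cvgrPdist_le => eps eps0.
  (* Layer area 8 t d_n, gradient bound (C / d_n)|e| and [Kt] for theta multiply to N - 1, free of
     d_n; the extra 1 makes N positive. *)
  pose N := 8 * t * C * Kt * `|e| + 1.
  have N0 : 0 < N by rewrite ltr_wpDl// !mulr_ge0 ?normr_ge0// ltW.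
  have e'0 : 0 < eps / N by rewrite divr_gt0.
  have [del del0 hdel] := layer_small t0 cu u0 e'0.
  have p0 : 0 < del / t by rewrite divr_gt0.
  have := near_infty_natSinv_lt (PosNum p0); apply: filterS => n /= nl.
  have dn : 2 * d_ n <= del.
    have := d0 n; rewrite /d_; move: nl; rewrite ltr_pdivlMr//.
    set z := n.+1%:R^-1 => nl.
    have -> : t / 8 * z = (z * t) / 8 by field.
    lra.
  rewrite sub0r normrN.
  pose K := eps / N * (Kt * (C / d_ n * `|e|)).
  have ba : b_ n - a_ n = d_ n by rewrite /b_ /a_; ring.
  have K0 : 0 <= K.
    by rewrite !mulr_ge0 ?normr_ge0 ?invr_ge0// ltW.
  pose E := cyl t `\` cyl (2 * a_ n).
  have mE : measurable (E : set (leb3 R)).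
    by apply: measurableD; exact: measurable_cyl.
  have LE : (L3 E < +oo)%E.
    by apply: le_lt_trans Lc; apply: le_outer_measure; exact: subDsetl.
  have woff x : slab x -> ~ E x -> w2 n x = 0.
    move=> [_ sx] nE; have [sq|sq] := pselect (square t x.1); last first.
      by rewrite /w2 u0// mul0r.
    have [sa|sa] := pselect (square (2 * a_ n) x.1); last first.
      by exfalso; apply: nE; split; [split|move=> -[]].
    rewrite /w2 cutoff_derive_eq0 ?mulr0//.
    by move/square_norm: sa; congr (_ < _); field.
  have := Rintegral_bound (K := K) ms mE LE (bw2 n) _ woff.
  move=> /(_ _)/le_trans; apply.
    move=> x sx; have [Ex|nE] := pselect (E x); last by rewrite woff// normr0.
    rewrite /w2 normrM /K ler_pM//.
      apply: hdel; first by apply: ltW; exact/slabP.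
      case: Ex => -[_ /= _] nx.
      rewrite leNgt; apply/negP => xl; apply: nx; split; last by case: sx.
      apply/square_norm; apply: lt_le_trans xl _.
      by rewrite mulrAC divff// mul1r /a_ lerB.
    rewrite normrM ler_pM//.
    by have := hC _ _ x e (ab n); rewrite ba.
  rewrite ger0_norm// L3_layer//.
  have lay : t ^+ 2 - (2 * a_ n) ^+ 2 <= 8 * t * d_ n.
    rewrite /a_ -subr_ge0 (_ : _ - _ = (4 * d_ n) ^+ 2); first exact: sqr_ge0.
    by field.
  apply: le_trans (ler_wpM2l K0 lay) _.
  have -> : K * (8 * t * d_ n) = eps * ((N - 1) / N).
    have -> : N - 1 = 8 * t * C * Kt * `|e| by rewrite /N addrK.
    have Nn0 : N != 0 by rewrite gt_eqF.
    have dn0 : d_ n != 0 by rewrite gt_eqF.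
    clearbody N; rewrite /K; move: (d_ n) dn0 => d dn0; field; by rewrite Nn0.
  by rewrite ler_piMr ?ltW// ltr_pdivrMr// mul1r ltrBlDr ltrDl.
have cl : (- (\int[mu3]_(x in slab) w3 n x)) @[n --> \oo] -->
    \int[mu3]_(x in slab) (u x * 'D_e theta x).
  under eq_fun do rewrite -id.
  by have := cvgD c1 c2; rewrite addr0; exact.
exact: (cvg_unique (@Rhausdorff R) cl (cvgN c3)).
Qed.

End ZeroExtension.

Lemma null_caratheodory (R : realType) (V : pointedType)
    (mu : {outer_measure set V -> \bar R}) (S : set V) :
  mu S = 0%E -> measurable (S : set (caratheodory_type mu)).
Proof.
move=> S0; apply: le_caratheodory_measurable => X.
rewrite (_ : mu (X `&` S) = 0%E); last first.
  apply/eqP; rewrite eq_le outer_measure_ge0 andbT -S0.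
  by apply: le_outer_measure; exact: subIsetr.
by rewrite add0e; apply: le_outer_measure; exact: subIsetl.
Qed.

(** * Borel hulls of Lebesgue measurable sets *)

Section MeasurableHull.
Context d (T : measurableType d) (R : realType) (mu : {measure set T -> \bar R}).

(** Intersect over n the unions of countable coverings that are optimal up to 1/(n+1). *)
Lemma mu_ext_hull (A : set T) : ((mu^*)%mu A < +oo)%E ->
  exists2 B : set T, measurable B /\ A `<=` B & (mu^*)%mu B = (mu^*)%mu A.
Proof.
move=> Aoo.
have Afin : (mu^*)%mu A \is a fin_num by rewrite ge0_fin_numE ?mu_ext_ge0.
have H n : exists F : (set T)^nat, [/\ forall i, measurable (F i),
    A `<=` \bigcup_k F k &
    (\sum_(k <oo) mu (F k) <= (mu^*)%mu A + (n.+1%:R^-1)%:E)%E].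
  have e0 : 0 < n.+1%:R^-1 :> R by rewrite invr_gt0.
  have [_ [F [mF AF] <-] lF] := lb_ereal_inf_adherent e0 Afin.
  by exists F; split => //; exact: ltW.
pose F n := projT1 (cid (H n)).
have HF n := projT2 (cid (H n)).
exists (\bigcap_n \bigcup_k F n k).
  split; last by move=> x Ax n _; have [_ + _] := HF n; apply.
  apply: bigcapT_measurable => n; apply: bigcupT_measurable => k.
  by have [+ _ _] := HF n; apply.
apply/eqP; rewrite eq_le; apply/andP; split; last first.
  by apply: le_mu_ext => x Ax n _; have [_ + _] := HF n; apply.
apply/lee_addgt0Pr => e e0.
have := near_infty_natSinv_lt (PosNum e0) => -[n _ /(_ n (leqnn n)) /= ne].
have [mF AF lF] := HF n.
apply: (@le_trans _ _ ((mu^*)%mu (\bigcup_k F n k))).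
  by apply: le_mu_ext => x; apply.
have sub : ((mu^*)%mu (\bigcup_k F n k) <= \sum_(k <oo) (mu^*)%mu (F n k))%E.
  exact: mu_ext_sigma_subadditive.
apply: le_trans sub _.
rewrite (eq_eseriesr (fun k _ => measurable_mu_extE mu (mF k))).
by apply: le_trans lF _; rewrite leeD2l// lee_fin ltW.
Qed.

(** Caratheodory's criterion for [A], tested on the hull; finiteness of the measure allows the
    cancellation. *)
Lemma caratheodory_hull (A : set T) : (mu^*)%mu.-caratheodory A ->
  ((mu^*)%mu A < +oo)%E ->
  exists2 B : set T, measurable B /\ A `<=` B & (mu^*)%mu (B `\` A) = 0%E.
Proof.
move=> cA Aoo; have [B [mB AB] BA] := mu_ext_hull Aoo; exists B => //.
have Afin : (mu^*)%mu A \is a fin_num by rewrite ge0_fin_numE ?mu_ext_ge0.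
have := cA B; rewrite setIidr// setDE BA -(fineK Afin).
case: ((mu^*)%mu (B `&` ~` A)) => [y| |]//= [].
by rewrite -[LHS]addr0 => /addrI <-.
Qed.

End MeasurableHull.

(** * Open boxes and smooth approximations of their indicators *)

Section OpenBoxes.
Variable R : realType.
Local Notation space := (space3 R).
Local Notation cyl t := (cylinder (square t) : set (space3 R)).

Definition obox (a b : space) : set space :=
  (`]a.1.1, b.1.1[ `*` `]a.1.2, b.1.2[) `*` `]a.2, b.2[.

Definition oboxes : set (set space) := [set A | exists a b, A = obox a b].

Lemma itvoo_setI (a b c d : R) :
  `]a, b[%classic `&` `]c, d[%classic = `](Num.max a c), (Num.min b d)[%classic.
Proof.
apply/seteqP; split=> x /=; rewrite !in_itv/= gt_max lt_min.
  by move=> [/andP[-> ->] /andP[-> ->]].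
by move=> /andP[/andP[-> ->] /andP[-> ->]].
Qed.

Lemma oboxes_setI : setI_closed oboxes.
Proof.
move=> _ _ [a [b ->]] [a' [b' ->]].
exists ((Num.max a.1.1 a'.1.1, Num.max a.1.2 a'.1.2), Num.max a.2 a'.2).
exists ((Num.min b.1.1 b'.1.1, Num.min b.1.2 b'.1.2), Num.min b.2 b'.2).
by rewrite /obox/= -!itvoo_setI -!setXI.
Qed.

Lemma cyl_obox t : cyl t =
  obox ((- (t / 2), - (t / 2)), - 2^-1) ((t / 2, t / 2), 2^-1).
Proof. by []. Qed.

(** The coordinates are measurable for the sigma-algebra generated by boxes, a strip being a
    countable union of boxes; hence so is the identity into the product. *)
Lemma Borel3_oboxes (A : set (borel3 R)) : measurable A -> <<s oboxes >> A.
Proof.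
pose G := oboxes : set (set (borel3 R)).
have coord (f : space -> R) :
    (forall a b : R, <<s oboxes >> (f @^-1` `]a, b[)) ->
    measurable_fun setT (f : g_sigma_algebraType G -> measurableTypeR R).
  move=> H; apply: (@measurability _ _ (g_sigma_algebraType G) (measurableTypeR R) setT f _ (@RGenOpens.measurableE R)).
  by move=> _ [_ [a [b ->]] <-]; rewrite setTI; exact: H.
have bigN (F : nat -> set space) : (forall n, oboxes (F n)) -> <<s oboxes >> (\bigcup_n F n).
  move=> HF; apply: (@bigcupT_measurable _ (g_sigma_algebraType G)) => n.
  by apply: sub_sigma_algebra; exact: HF.
have inN (x : R) : exists n : nat, - n%:R < x < n%:R.
  exists (Num.truncn `|x|).+1; rewrite -ltr_norml.
  by rewrite truncnS_gt.
have H1 : measurable_fun setT ((fun x => x.1.1) : g_sigma_algebraType G -> measurableTypeR R).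
  apply: coord => a b.
  rewrite (_ : _ @^-1` _ = \bigcup_n obox ((a, - n%:R), - n%:R) ((b, n%:R), n%:R)).
    by apply: bigN => n; do 2 eexists.
  apply/seteqP; split=> [x /= xa|x [n _] [[/=]]//].
  have [n1 h1] := inN x.1.2; have [n2 h2] := inN x.2.
  exists (maxn n1 n2) => //; split; [split|] => //=; rewrite in_itv/=.
    move: h1 => /andP[h h']; rewrite (le_lt_trans _ h) ?(lt_le_trans h')//.
      by rewrite ler_nat leq_maxl.
    by rewrite lerN2 ler_nat leq_maxl.
  move: h2 => /andP[h h']; rewrite (le_lt_trans _ h) ?(lt_le_trans h')//.
    by rewrite ler_nat leq_maxr.
  by rewrite lerN2 ler_nat leq_maxr.
have H2 : measurable_fun setT ((fun x => x.1.2) : g_sigma_algebraType G -> measurableTypeR R).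
  apply: coord => a b.
  rewrite (_ : _ @^-1` _ = \bigcup_n obox ((- n%:R, a), - n%:R) ((n%:R, b), n%:R)).
    by apply: bigN => n; do 2 eexists.
  apply/seteqP; split=> [x /= xa|x [n _] [[/=]]//].
  have [n1 h1] := inN x.1.1; have [n2 h2] := inN x.2.
  exists (maxn n1 n2) => //; split; [split|] => //=; rewrite in_itv/=.
    move: h1 => /andP[h h']; rewrite (le_lt_trans _ h) ?(lt_le_trans h')//.
      by rewrite ler_nat leq_maxl.
    by rewrite lerN2 ler_nat leq_maxl.
  move: h2 => /andP[h h']; rewrite (le_lt_trans _ h) ?(lt_le_trans h')//.
    by rewrite ler_nat leq_maxr.
  by rewrite lerN2 ler_nat leq_maxr.
have H3 : measurable_fun setT ((fun x => x.2) : g_sigma_algebraType G -> measurableTypeR R).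
  apply: coord => a b.
  rewrite (_ : _ @^-1` _ = \bigcup_n obox ((- n%:R, - n%:R), a) ((n%:R, n%:R), b)).
    by apply: bigN => n; do 2 eexists.
  apply/seteqP; split=> [x /= xa|x [n _] [_ /=]//].
  have [n1 h1] := inN x.1.1; have [n2 h2] := inN x.1.2.
  exists (maxn n1 n2) => //; split; [split|] => //=; rewrite in_itv/=.
    move: h1 => /andP[h h']; rewrite (le_lt_trans _ h) ?(lt_le_trans h')//.
      by rewrite ler_nat leq_maxl.
    by rewrite lerN2 ler_nat leq_maxl.
  move: h2 => /andP[h h']; rewrite (le_lt_trans _ h) ?(lt_le_trans h')//.
    by rewrite ler_nat leq_maxr.
  by rewrite lerN2 ler_nat leq_maxr.
have Hid : measurable_fun setT (id : g_sigma_algebraType G -> borel3 R).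
  apply/measurable_fun_pairP; split; last exact: H3.
  by apply/measurable_fun_pairP; split; [exact: H1|exact: H2].
by move=> mA; have := Hid measurableT A mA; rewrite setTI preimage_id.
Qed.

Lemma obox_measurable a b : measurable (obox a b : set (borel3 R)).
Proof. by apply: measurableX; [apply: measurableX|]; exact: measurable_itv. Qed.

(** In each coordinate, a plateau around the midpoint of the interval, with radii the fractions 1 -
    h and 1 - h/2 of its half length. Taking h = 1/(n+2) keeps h at most 1/2. *)
Definition bump (a b : space) (n : nat) (x : space) : R^o :=
  let p (a b y : R) := let r := (b - a) / 2 in let h := n.+2%:R^-1 in
     plateau (r * (1 - h)) (r * (1 - h / 2)) (y - (a + b) / 2) in
  p a.1.1 b.1.1 x.1.1 * p a.1.2 b.1.2 x.1.2 * p a.2 b.2 x.2.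

Definition nondeg (a b : space) := [/\ a.1.1 < b.1.1, a.1.2 < b.1.2 & a.2 < b.2].

Lemma obox_degenerate a b : ~ nondeg a b -> obox a b = set0.
Proof.
move=> nab; rewrite -subset0 => x [[/=]]; rewrite !in_itv/=.
move=> /andP[h1 h1'] /andP[h2 h2'] /andP[h3 h3']; apply: nab; split.
- exact: lt_trans h1'.
- exact: lt_trans h2'.
- exact: lt_trans h3'.
Qed.

Section Bump.
Variables (n : nat).
Let h : R := n.+2%:R^-1.
Let p (a b y : R) := let r := (b - a) / 2 in
     plateau (r * (1 - h)) (r * (1 - h / 2)) (y - (a + b) / 2).

Let h0 : 0 < h. Proof. by rewrite invr_gt0. Qed.
Let h1 : h <= 2^-1.
Proof. by rewrite lef_pV2 ?posrE// ler_nat. Qed.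

Let bump_rad a b : a < b -> (b - a) / 2 * (1 - h) < (b - a) / 2 * (1 - h / 2).
Proof. by move=> ab; rewrite ltr_pM2l; [have := h0; lra|lra]. Qed.

Let bump1_ge0 a b y : 0 <= p a b y. Proof. exact: plateau_ge0. Qed.
Let bump1_le1 a b y : p a b y <= 1. Proof. exact: plateau_le1. Qed.

Let bump1_supp a b y : a < b -> p a b y != 0 ->
  `|y - (a + b) / 2| <= (b - a) / 2 * (1 - h / 2).
Proof.
move=> ab; apply: contraNT; rewrite -ltNge => H.
by rewrite /p plateau_eq0 ?bump_rad// ltW.
Qed.

Let bump1_itv a b y : a < b ->
  `|y - (a + b) / 2| <= (b - a) / 2 * (1 - h / 2) -> a < y < b.
Proof.
move=> ab H; have : `|y - (a + b) / 2| < (b - a) / 2.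
  by apply: le_lt_trans H _; rewrite gtr_pMr; [have := h0; lra|lra].
rewrite ltr_norml => /andP[H1 H2]; apply/andP; split; lra.
Qed.

Let smooth_bump1 c1 c2 c3 a b : smooth_on [set: space]
  ((fun x => p a b (lform c1 c2 c3 x)) : space -> R^o).
Proof.
move=> k; apply: (@Ck_lform R c1 c2 c3 k (fun y => p a b y)).
set r1 := (b - a) / 2 * (1 - h); set r2 := (b - a) / 2 * (1 - h / 2).
have cid : continuous ((idfun : {linear R^o -> R^o}) : R^o -> R^o) by move=> x; exact: cvg_id.
have := @Ck_affine _ _ _ _ _ (- ((a + b) / 2)) _ _ k cid (smooth_plateau r1 r2 k).
rewrite preimage_setT (_ : (fun y => _) = fun y : R^o => p a b y)//.
by apply/funext => y /=; rewrite /p addrC.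
Qed.

Let bumpE a b : bump a b n = fun x => p a.1.1 b.1.1 (lform 1 0 0 x) *
  p a.1.2 b.1.2 (lform 0 1 0 x) * p a.2 b.2 (lform 0 0 1 x).
Proof. by apply/funext => x; rewrite /bump /lform !mul1r !mul0r !addr0 !add0r. Qed.

Lemma bump_test a b : nondeg a b -> test_function (obox a b) (bump a b n).
Proof.
move=> [ab1 ab2 ab3].
pose K := [set x : space | [/\ `|x.1.1 - (a.1.1 + b.1.1) / 2| <= (b.1.1 - a.1.1) / 2 * (1 - h / 2),
   `|x.1.2 - (a.1.2 + b.1.2) / 2| <= (b.1.2 - a.1.2) / 2 * (1 - h / 2)
  & `|x.2 - (a.2 + b.2) / 2| <= (b.2 - a.2) / 2 * (1 - h / 2)]].
have cle (c r : R) : [set y : R | `|y - c| <= r] = `[c - r, c + r]%classic.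
  by apply/seteqP; split=> y /=; rewrite in_itv/= ler_norml => /andP[? ?]; apply/andP; split; lra.
have KE : K = ([set y | `|y - (a.1.1 + b.1.1) / 2| <= (b.1.1 - a.1.1) / 2 * (1 - h / 2)] `*`
   [set y | `|y - (a.1.2 + b.1.2) / 2| <= (b.1.2 - a.1.2) / 2 * (1 - h / 2)]) `*`
   [set y | `|y - (a.2 + b.2) / 2| <= (b.2 - a.2) / 2 * (1 - h / 2)].
  by apply/seteqP; split=> x /=; [move=> []|move=> [[]]].
have cK : compact K.
  by rewrite KE !cle; apply: compact_setX; [apply: compact_setX|]; exact: segment_compact.
have clK : closed K by apply: compact_closed => //; exact: norm_hausdorff.
have sub : closure [set x | bump a b n x != 0] `<=` K.
  rewrite [X in _ `<=` X](iffLR (closure_id _) clK); apply: closure_subset => x /=.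
  rewrite (_ : bump a b n x = p a.1.1 b.1.1 x.1.1 * p a.1.2 b.1.2 x.1.2 * p a.2 b.2 x.2)//.
  rewrite mulf_eq0 negb_or => /andP[]; rewrite mulf_eq0 negb_or => /andP[n1 n2] n3.
  by split; [exact: bump1_supp n1|exact: bump1_supp n2|exact: bump1_supp n3].
split.
- move=> k; rewrite bumpE.
  by apply: CkM; [apply: CkM|]; exact: smooth_bump1.
- by apply: subclosed_compact cK sub; exact: closed_closure.
- move=> x /sub [k1 k2 k3].
  by split; [split|]; rewrite /= in_itv/=; exact: bump1_itv.
Qed.

Lemma bump_norm a b x : `|bump a b n x| <= 1.
Proof.
rewrite (_ : bump a b n x = p a.1.1 b.1.1 x.1.1 * p a.1.2 b.1.2 x.1.2 * p a.2 b.2 x.2)//.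
have h12 : 0 <= p a.1.1 b.1.1 x.1.1 * p a.1.2 b.1.2 x.1.2 by exact: mulr_ge0.
rewrite ger0_norm; last exact: mulr_ge0.
by apply: mulr_ile1 => //; apply: mulr_ile1.
Qed.

Lemma bump_eq1 a b x : nondeg a b ->
  `|x.1.1 - (a.1.1 + b.1.1) / 2| <= (b.1.1 - a.1.1) / 2 * (1 - h) ->
  `|x.1.2 - (a.1.2 + b.1.2) / 2| <= (b.1.2 - a.1.2) / 2 * (1 - h) ->
  `|x.2 - (a.2 + b.2) / 2| <= (b.2 - a.2) / 2 * (1 - h) -> bump a b n x = 1.
Proof.
by move=> [ab1 ab2 ab3] k1 k2 k3; rewrite /bump/= !plateau_eq1 ?mulr1 ?bump_rad.
Qed.

End Bump.

(** At each point the sequence is eventually constant: always 0 outside the box, 1 inside as soon as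
    h is smaller than the relative distance to every face. *)
Lemma bump_cvg a b x : nondeg a b -> bump a b n x @[n --> \oo] --> (\1_(obox a b) x : R).
Proof.
move=> nab; apply: cvg_near_cst.
have [abx|abx] := pselect (obox a b x); last first.
  apply: nearW => n; rewrite (test_eq0 (bump_test n nab) abx).
  by rewrite indicE memNset.
have H (a' b' y : R) : a' < b' -> a' < y < b' ->
    \forall n \near \oo, `|y - (a' + b') / 2| <= (b' - a') / 2 * (1 - n.+2%:R^-1).
  move=> ab /andP[ay yb].
  have yr : `|y - (a' + b') / 2| < (b' - a') / 2 by rewrite ltr_norml; apply/andP; split; lra.
  have p0 : 0 < ((b' - a') / 2 - `|y - (a' + b') / 2|) / ((b' - a') / 2).
    by apply: divr_gt0; lra.
  have := near_infty_natSinv_lt (PosNum p0); apply: filterS => n /=.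
  rewrite ltr_pdivlMr; last by lra.
  move=> hn; have h2 : n.+2%:R^-1 <= n.+1%:R^-1 :> R by rewrite lef_pV2 ?posrE// ler_nat.
  have : n.+2%:R^-1 * ((b' - a') / 2) <= n.+1%:R^-1 * ((b' - a') / 2).
    by rewrite ler_wpM2r//; lra.
  by move: (n.+2%:R^-1) (n.+1%:R^-1) hn {h2} => u v; lra.
have [ab1 ab2 ab3] := nab; case: (abx) => -[/=]; rewrite !in_itv/= => x1 x2 x3.
near=> n; rewrite bump_eq1//; first by rewrite indicE mem_set.
- by near: n; exact: H.
- by near: n; exact: H.
- by near: n; exact: H.
Unshelve. all: by end_near. Qed.

End OpenBoxes.

(** * The fundamental lemma of the calculus of variations *)

Section FundamentalLemma.
Variable R : realType.
Local Notation space := (space3 R).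
Local Notation cyl t := (cylinder (square t) : set (space3 R)).
Implicit Types (g w : space -> R) (t : R).

Lemma bmeas_indic (A : set (leb3 R)) : measurable A -> bmeas (\1_A : space -> R).
Proof.
move=> mA; split; first exact: measurable_indic.
by exists 1 => x; rewrite indicE; case: (_ \in _); rewrite /= ?normr1 ?normr0.
Qed.

(** The set where the function is positive is only Lebesgue measurable, so it is replaced by a Borel
    hull differing by a null set; a positive function of zero integral there forces the set to be
    null. The same applied to the opposite function. *)
Lemma ae_eq0_Borel t g : bmeas g ->
  (forall A : set (borel3 R), measurable A ->
     \int[mu3]_(x in cyl t) (g x * \1_A x) = 0) ->
  {ae mu3, forall x, cyl t x -> g x = 0}.
Proof.
move=> bg H; have mc := @measurable_cyl R t; have Lc := @L3_cyl_lty R t.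
suff pos (w : space -> R) : bmeas w ->
    (forall A : set (borel3 R), measurable A ->
     \int[mu3]_(x in cyl t) (w x * \1_A x) = 0) ->
    {ae mu3, forall x, cyl t x -> w x <= 0}.
  have bNg : bmeas (fun x => -1 * g x) := bmeasM (bmeas_cst (-1)) bg.
  suff HN : forall A : set (borel3 R), measurable A ->
      \int[mu3]_(x in cyl t) (-1 * g x * \1_A x) = 0.
    apply: ae3S (ae3I (pos _ bNg HN) (pos _ bg H)) => x [h1 h2] cx.
    apply/eqP; rewrite eq_le h2//=.
    by have := h1 cx; rewrite mulN1r oppr_le0.
  move=> A mA; under eq_Rintegral do rewrite -mulrA.
  rewrite RintegralZl//; first by rewrite H// mulr0.
  have bgA := bmeasM bg (bmeas_indic (Borel_measurable mA)).
  by apply: (bmeas_integrable mc mc Lc bgA) => x cx /(_ cx).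
move=> bw Hw.
pose P : set (leb3 R) := [set x | 0 < w x] `&` cyl t.
have mP : measurable P.
  apply: measurableI => //; rewrite -[X in measurable X]setTI.
  rewrite (_ : [set x | 0 < w x] = w @^-1` `]0, +oo[); last first.
    by apply/seteqP; split=> x /=; rewrite in_itv/= andbT.
  by apply: bw.1 => //; exact: measurable_itv.
have LP : (L3 P < +oo)%E.
  by apply: le_lt_trans Lc; apply: le_outer_measure; exact: subIsetr.
have [B [mB PB] nB] : exists2 B : set (borel3 R), measurable B /\ P `<=` B & L3 (B `\` P) = 0%E.
  exact: (@caratheodory_hull _ _ _ (@B3 R) P mP LP).
have bwP : bmeas (fun x => w x * \1_P x) := bmeasM bw (bmeas_indic mP).
have iwP : mu3.-integrable (cyl t) (EFin \o (fun x => w x * \1_P x)).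
  by apply: (bmeas_integrable mc mc Lc bwP) => x cx /(_ cx).
have E : \int[mu3]_(x in cyl t) (w x * \1_P x) = 0.
  rewrite -(Hw _ mB) /Rintegral; congr fine.
  have m1 : measurable_fun (cyl t : set (leb3 R)) (fun x => (w x * \1_P x)%:E).
    by apply/measurable_EFinP; apply: measurable_funTS; exact: bwP.1.
  have m2 : measurable_fun (cyl t : set (leb3 R)) (fun x => (w x * \1_B x)%:E).
    apply/measurable_EFinP; apply: measurable_funTS.
    exact: (bmeasM bw (bmeas_indic (Borel_measurable mB))).1.
  apply: (@ae_eq_integral _ _ _ [the measure _ _ of mu3] _ (fun x => (w x * \1_B x)%:E) _ mc m1 m2).
    exists (B `\` P); split.
    - by apply: measurableD; [exact: Borel_measurable|exact: mP].
    - exact: nB.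
    move=> x /= nx; split.
      apply: contrapT => nBx; apply: nx => cx; rewrite !indicE.
      rewrite !memNset//; by move=> /PB.
    move=> Px; apply: nx => cx; rewrite !indicE !mem_set//; exact: PB.
have E0 : (\int[mu3]_(x in cyl t) `|(w x * \1_P x)%:E| = 0)%E.
  transitivity (\int[mu3]_(x in cyl t) (w x * \1_P x)%:E)%E; last first.
    by rewrite EFin_Rintegral// E.
  apply: eq_integral => x _ /=; congr EFin; rewrite ger0_norm// indicE.
  case: (boolP (x \in P)) => [/set_mem[/ltW p0 _]|]; rewrite ?mulr1 ?mulr0//.
have mwP : measurable_fun (cyl t : set (leb3 R)) (fun x => (w x * \1_P x)%:E).
  by apply/measurable_EFinP; apply: measurable_funTS; exact: bwP.1.
have := iffLR (ae_eq_integral_abs [the measure _ _ of mu3] mc mwP) E0.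
apply: ae3S => x hx cx; rewrite leNgt; apply/negP => wx.
have := hx cx; rewrite indicE mem_set ?mulr1; last by split.
by move=> [] w0; rewrite w0 ltxx in wx.
Qed.

(** Bumps give the identity for indicators of boxes. The sets whose indicator integrates to 0
    against g form a lambda-system, and boxes are stable under intersection and generate the Borel
    sets. *)
Lemma fundamental_lemma t g : bmeas g ->
  (forall theta, test_function (cyl t) theta ->
     \int[mu3]_(x in cyl t) (g x * theta x) = 0) ->
  {ae mu3, forall x, cyl t x -> g x = 0}.
Proof.
move=> bg Hg; have mc := @measurable_cyl R t; have Lc := @L3_cyl_lty R t.
have [Kg hKg] := bg.2.
have Hb A : oboxes A -> A `<=` cyl t -> \int[mu3]_(x in cyl t) (g x * \1_A x) = 0.
  move=> [a [b ->]] sub; have [nab|nab] := pselect (nondeg a b); last first.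
    rewrite obox_degenerate//; under eq_Rintegral do rewrite indicE in_set0 mulr0.
    by rewrite /Rintegral integral0_eq.
  have tb n : test_function (cyl t) (bump a b n).
    exact: test_functionS sub (bump_test n nab).
  have cv : \int[mu3]_(x in cyl t) (g x * bump a b n x) @[n --> \oo] -->
      \int[mu3]_(x in cyl t) (g x * \1_(obox a b) x).
    apply: (@bounded_convergence _ _ _ _ _ (Kg * 1) mc mc Lc).
    - by move=> n; exact: (bmeasM bg (test_bmeas (tb n))).1.
    - exact: (bmeasM bg (bmeas_indic (Borel_measurable (obox_measurable a b)))).1.
    - by move=> n x _; rewrite normrM ler_pM//; exact: bump_norm.
    - by move=> n x cx /(_ cx).
    - apply: aeW => x _; apply: cvgM; first exact: cvg_cst.
      exact: bump_cvg.
  move: cv; rewrite (_ : (fun n => _) = fun=> 0); last first.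
    by apply/funext => n; exact: Hg (tb n).
  by move=> cv; apply: (cvg_unique (@Rhausdorff R) cv); exact: cvg_cst.
have cb : oboxes (cyl t) by rewrite cyl_obox; do 2 eexists.
apply: ae_eq0_Borel => // A mA.
pose H (A : set (borel3 R)) : Prop := measurable A /\
  \int[mu3]_(x in cyl t) (g x * \1_A x) = 0.
suff [] : H A by [].
have igA (B : set (borel3 R)) : measurable B ->
    mu3.-integrable (cyl t) (EFin \o (fun x => g x * \1_B x)).
  move=> mB; have b := bmeasM bg (bmeas_indic (Borel_measurable mB)).
  by apply: (bmeas_integrable mc mc Lc b) => x cx /(_ cx).
have cI (B : set (borel3 R)) : \int[mu3]_(x in cyl t) (g x * \1_(B `&` cyl t) x) =
    \int[mu3]_(x in cyl t) (g x * \1_B x).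
  apply: eq_Rintegral => x /set_mem cx; congr (_ * _); rewrite !indicE in_setI.
  by rewrite (mem_set cx) andbT.
have GH (B : set (borel3 R)) : oboxes B -> H B.
  move=> oB; have mB : measurable (B : set (borel3 R)).
    by case: (oB) => a [b E]; rewrite E; exact: (@obox_measurable R a b).
  have B0 : \int[mu3]_(x in cyl t) (g x * \1_B x) = 0.
    by rewrite -cI; apply: Hb; [exact: oboxes_setI|exact: subIsetr].
  split; first exact: mB.
  exact: B0.
have lH : lambda_system setT H.
  split.
  - by move=> ? _.
  - by split; [exact: measurableT|rewrite -cI setTI; exact: (Hb _ cb)].
  - move=> B C CB [mB B0] [mC C0]; split; first exact: measurableD.
    transitivity (\int[mu3]_(x in cyl t) (g x * \1_B x) -
                  \int[mu3]_(x in cyl t) (g x * \1_C x)); last by rewrite B0 C0 subrr.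
    rewrite -RintegralB//; [|exact: igA|exact: igA].
    apply: eq_Rintegral => x _; rewrite -mulrBr; congr (_ * _).
    rewrite !indicE in_setD; case: (boolP (x \in C)) => [/set_mem/CB Bx|_].
      by rewrite andbF (mem_set Bx) subrr.
    by rewrite andbT subr0.
  - move=> F ndF HF; have mF n : measurable (F n) by case: (HF n).
    have mU : measurable (\bigcup_n F n) by exact: bigcupT_measurable.
    split => //.
    have cv : \int[mu3]_(x in cyl t) (g x * \1_(F n) x) @[n --> \oo] -->
        \int[mu3]_(x in cyl t) (g x * \1_(\bigcup_n F n) x).
      apply: (@bounded_convergence _ _ _ _ _ (Kg * 1) mc mc Lc).
      - by move=> n; exact: (bmeasM bg (bmeas_indic (Borel_measurable (mF n)))).1.
      - exact: (bmeasM bg (bmeas_indic (Borel_measurable mU))).1.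
      - move=> n x _; rewrite normrM ler_pM// indicE.
        by case: (_ \in _); rewrite /= ?normr1 ?normr0.
      - by move=> n x cx /(_ cx).
      - apply: aeW => x _; apply: cvgM; first exact: cvg_cst.
        apply: cvg_near_cst; have [[m _ Fx]|nU] := pselect ((\bigcup_n F n) x).
          exists m => // n /= mn; rewrite !indicE !mem_set//; first by exists m.
          by have /subsetPset := ndF _ _ mn; apply.
        apply: nearW => n; rewrite !indicE !memNset// => Fx; apply: nU.
        by exists n.
    move: cv; rewrite (_ : (fun n => _) = fun=> 0); last first.
      by apply/funext => n; exact: (HF n).2.
    by move=> cv; apply: (cvg_unique (@Rhausdorff R) cv); exact: cvg_cst.
apply: (lambda_system_subset (@oboxes_setI R) lH GH (D := setT)) => //.
exact: Borel3_oboxes.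
Qed.

End FundamentalLemma.

(** * Admissible fields *)

Lemma within_continuous_cvg (X Y : topologicalType) (A : set X) (w : X -> Y)
    (I : Type) (F : set_system I) (FF : Filter F) (z : I -> X) (y : X) :
  {within A, continuous w} -> A y -> (forall i, A (z i)) ->
  z i @[i --> F] --> y -> w (z i) @[i --> F] --> w y.
Proof.
move=> cw Ay Az zy B nB; have := cw y B nB.
rewrite /nbhs/= -nbhs_subspace_in// => /zy.
by rewrite /nbhs/=; apply: filterS => i; apply; exact: Az.
Qed.

Section Clamp.
Variable R : realType.
Local Notation space := (space3 R).
Local Notation cyl t := (cylinder (square t) : set (space3 R)).
Implicit Types (r t y : R) (x : space).

(** The projection of the line on [-r, r] for r >= 0, written with absolute values so that
    continuity is immediate. *)
Definition clamp1 r y : R := (`|y + r| - `|y - r|) / 2.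

Lemma clamp1_le r y : 0 <= r -> `|clamp1 r y| <= r.
Proof.
move=> r0; rewrite /clamp1 ler_norml.
by have [h1|h1] := ler0P (y + r); have [h2|h2] := ler0P (y - r);
  apply/andP; split; lra.
Qed.

Lemma clamp1_id r y : `|y| <= r -> clamp1 r y = y.
Proof.
rewrite ler_norml => /andP[h1 h2]; rewrite /clamp1 ger0_norm ?ler0_norm; lra.
Qed.

Lemma clamp1_out r y : 0 <= r -> r <= `|y| -> `|clamp1 r y| = r.
Proof.
move=> r0; rewrite /clamp1 ler_normr => /orP[h|h].
  by rewrite ger0_norm (@ger0_norm _ (y + r)) ?(@ger0_norm _ (y - r)); lra.
by rewrite ler0_norm (@ler0_norm _ (y + r)) ?(@ler0_norm _ (y - r)); lra.
Qed.

Lemma clamp1_continuous r : continuous (clamp1 r : R^o -> R^o).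
Proof.
move=> y; apply: cvgM; last exact: cvg_cst.
by apply: cvgB; apply: cvg_norm; [apply: cvgD|apply: cvgB];
  (exact: cvg_id || exact: cvg_cst).
Qed.

(** Retraction of the space on the closed cylinder: composing with it extends a function continuous
    on the closure to a continuous function everywhere. *)
Definition clamp t x : space :=
  ((clamp1 (t / 2) x.1.1, clamp1 (t / 2) x.1.2), clamp1 2^-1 x.2).

Lemma clamp_continuous t : continuous (clamp t).
Proof.
apply: continuous_coords => x.
- apply: (@continuous_comp _ _ _ (fun x : space => x.1.1 : R^o)); [exact: continuous_coord1|exact: clamp1_continuous].
- apply: (@continuous_comp _ _ _ (fun x : space => x.1.2 : R^o)); [exact: continuous_coord2|exact: clamp1_continuous].
- apply: (@continuous_comp _ _ _ (fun x : space => x.2 : R^o)); [exact: continuous_coord3|exact: clamp1_continuous].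
Qed.

Lemma clamp_id t x : cyl t x -> clamp t x = x.
Proof.
move=> /cylP[h1 h2 h3]; rewrite /clamp !clamp1_id ?ltW//.
by case: x {h1 h2 h3} => -[].
Qed.

(** Contraction factors tending to 1, which push points of the closed cylinder into the open one. *)
Let s_ (n : nat) : R := 1 - n.+1%:R^-1.
Let s_bound n : 0 <= s_ n < 1.
Proof.
by rewrite /s_ subr_ge0 invf_le1// ler1n/= gtrBl invr_gt0.
Qed.
Let s_cvg : s_ n @[n --> \oo] --> (1 : R).
Proof. by rewrite -[X in _ --> X]subr0; apply: cvgB; [exact: cvg_cst|exact: cvg_harmonic]. Qed.

Let s_lt n y r : 0 < r -> `|y| <= r -> `|s_ n * y| < r.
Proof.
move=> r0 yr; have /andP[s0 s1] := s_bound n.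
rewrite normrM ger0_norm//; apply: (@le_lt_trans _ _ (s_ n * r)).
  exact: ler_wpM2l.
by rewrite gtr_pMl.
Qed.

Let mulr_continuous (a : R) : continuous (fun s : R^o => s * a : R^o).
Proof. by move=> s; apply: cvgM; [exact: cvg_id|exact: cvg_cst]. Qed.

Lemma closure_cyl t x : 0 < t -> `|x.1| <= t / 2 -> `|x.2| <= 2^-1 ->
  closure (cyl t) x.
Proof.
move=> t0; rewrite plane_normE ge_max => /andP[h1 h2] h3.
have : ((s_ n * x.1.1, s_ n * x.1.2), s_ n * x.2) @[n --> \oo] --> x.
  rewrite [X in _ --> X](_ : x = ((x.1.1, x.1.2), x.2)); last by case: x {h1 h2 h3} => -[].
  have cF := @continuous_pair R^o (plane2 R) R^o _ _ (@continuous_pair R^o R^o R^o _ _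
    (@mulr_continuous x.1.1) (@mulr_continuous x.1.2)) (@mulr_continuous x.2).
  by have := cvg_comp _ _ s_cvg (cF 1); rewrite /= !mul1r.
apply: (closed_cvg (closure (cyl t))); first exact: closed_closure.
apply: nearW => n; apply: subset_closure; apply/cylP.
by split; apply: s_lt => //; rewrite ?divr_gt0// invr_gt0.
Qed.

Lemma frontier_square t (y : plane2 R) : 0 < t -> `|y| = t / 2 ->
  frontier (square t) y.
Proof.
move=> t0 yt; split; last first.
  by move=> /interior_subset /square_norm; rewrite yt ltxx.
have : (s_ n * y.1, s_ n * y.2) @[n --> \oo] --> y.
  rewrite [X in _ --> X](_ : y = (y.1, y.2)); last by case: y {yt}.
  have cF := @continuous_pair R^o R^o R^o _ _ (@mulr_continuous y.1) (@mulr_continuous y.2).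
  by have := cvg_comp _ _ s_cvg (cF 1); rewrite /= !mul1r.
apply: (closed_cvg (closure (square t))); first exact: closed_closure.
apply: nearW => n; apply: subset_closure; apply/squareP.
have : `|y| <= t / 2 by rewrite yt.
by rewrite plane_normE ge_max => /andP[h1 h2]; split; apply: s_lt => //; rewrite divr_gt0.
Qed.

(** [zero_on] prescribes the value 0 over the open vertical interval only; the top and bottom edges
    follow by continuity on the closure. *)
Lemma zero_on_lateral m t (phi : space -> 'cV[R]_m.+1) x : 0 < t ->
  zero_on (cyl t) (cylinder (frontier (square t))) phi ->
  `|x.1| = t / 2 -> `|x.2| <= 2^-1 -> phi x = 0.
Proof.
move=> t0 [cphi phi0] xt x2.
have cv : (x.1, s_ n * x.2) @[n --> \oo] --> x.
  rewrite [X in _ --> X](_ : x = (x.1, x.2)); last by case: x {xt x2}.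
  have cc : continuous ((fun=> x.1) : R^o -> plane2 R) by move=> y; exact: cvg_cst.
  have cF := @continuous_pair R^o (plane2 R) R^o (fun=> x.1) _ cc (@mulr_continuous x.2).
  by have := cvg_comp _ _ s_cvg (cF 1); rewrite /= !mul1r.
have h (n : nat) : `|s_ n * x.2| < 2^-1 by apply: s_lt => //; rewrite invr_gt0.
have cA n : closure (cyl t) (x.1, s_ n * x.2).
  by apply: closure_cyl => //=; [rewrite xt|exact: ltW].
have cx : closure (cyl t) x by apply: closure_cyl => //; rewrite xt.
have := within_continuous_cvg _ cphi cx cA cv.
rewrite (_ : (fun n => _) = fun=> 0); last first.
  apply/funext => n; apply: phi0; split; first exact: frontier_square.
  exact: ((slabP (x.1, s_ n * x.2)).2 (h n)).2.
move=> H; have h0 : (fun _ : nat => (0 : 'cV[R]_m.+1)) @ \oo --> (0 : 'cV[R]_m.+1).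
  exact: cvg_cst.
apply/esym; exact: (cvg_unique (@norm_hausdorff R _) h0 (H _)).
Qed.

Lemma clamp_closure t x : 0 < t -> closure (cyl t) (clamp t x).
Proof.
move=> t0; have t20 : 0 <= t / 2 by rewrite divr_ge0// ltW.
apply: closure_cyl => //=; last by apply: clamp1_le; rewrite invr_ge0.
by rewrite plane_normE/= ge_max !clamp1_le.
Qed.

Lemma clamp_out t x : 0 < t -> ~ square t x.1 -> `|(clamp t x).1| = t / 2.
Proof.
move=> t0 nx; have t20 : 0 <= t / 2 by rewrite divr_ge0// ltW.
have : t / 2 <= `|x.1| by rewrite leNgt; apply/negP => /square_norm.
rewrite !plane_normE/= le_max => /orP[h|h].
  by rewrite (clamp1_out t20 h) max_l// clamp1_le.
by rewrite (clamp1_out t20 h) max_r// clamp1_le.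
Qed.

Lemma clamp_box t x : 0 <= t -> `|clamp t x| <= t / 2 + 2^-1.
Proof.
move=> t0; have t20 : 0 <= t / 2 by rewrite divr_ge0.
rewrite !prod_normE !ge_max /=; apply/andP; split; [apply/andP; split|].
- by apply: le_trans (clamp1_le _ t20) _; rewrite lerDl.
- by apply: le_trans (clamp1_le _ t20) _; rewrite lerDl.
- have h : 0 <= 2^-1 :> R by rewrite invr_ge0.
  by apply: le_trans (clamp1_le _ h) _; rewrite lerDr.
Qed.

End Clamp.

Section Admissible.
Variable R : realType.
Local Notation space := (space3 R).
Local Notation slab := (@slab R).
Local Notation cyl t := (cylinder (square t) : set (space3 R)).
Local Notation vec := 'cV[R]_3.
Implicit Types (t : R) (T : set vec) (u : space -> R) (phi : space -> vec)
  (G : space -> 'M[R]_(3, 2 + 1)).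

(** The field vanishes laterally but is left free above and below the slab, where it has to remain
    continuous; its gradient is set to 0 off the cylinder. *)
Definition scalar_adm t u (g : 'I_3 -> space -> R) : Prop :=
  [/\ continuous (u : space -> R^o), (forall x, ~ square t x.1 -> u x = 0),
      bmeas u &
      forall j, [/\ bmeas (g j), (forall x, ~ cyl t x -> g j x = 0) & wderiv j u (g j)]].

(* Admissible pairs extended by zero to R^2 x ]-1/2, 1/2[; this class is stable
   under enlarging, translating and gluing cylinders. *)
Definition Adm T t phi G : Prop :=
  [/\ forall i, scalar_adm t (fun x => phi x i 0) (fun j x => G x i j),
      (forall x, T (phi x)) & forall x, projmx T *m G x = G x].

Lemma Adm_entry T t phi G i j : Adm T t phi G -> bmeas (fun x => G x i j).
Proof. by move=> [/(_ i)[_ _ _ /(_ j)[]]]. Qed.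

Lemma Adm_G0 T t phi G x : Adm T t phi G -> ~ cyl t x -> G x = 0.
Proof.
move=> [H _ _] nx; apply/matrixP => i j; rewrite mxE.
by have [_ _ _ /(_ j)[_ + _]] := H i; exact.
Qed.

Lemma ae_bounded_Linfty (Om : set (leb3 R)) u : bmeas u -> Linfty L3 Om u.
Proof.
move=> [mu [c hc]]; split; first exact: measurable_funTS.
by exists c; apply: aeW => x _; exact: hc.
Qed.

Lemma Adm_admissible T t phi G : Adm T t phi G -> admissible T t phi G.
Proof.
move=> [HG HT HP]; split.
- move=> i; have [cu u0 bu Hg] := HG i; split; first exact: ae_bounded_Linfty.
  move=> j; have [bg g0 wg] := Hg j; split; first exact: ae_bounded_Linfty.
  apply/(weak_derivativeP j (measurable_cyl t) (@cyl_slab R t) bu bg) => theta tth.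
  have tth' := test_functionS (@cyl_slab R t) tth.
  have := iffLR (wderivP j bu bg) wg theta tth'.
  rewrite !(@Rintegral_sub R (cyl t) slab) //; try exact: cyl_slab.
    by move=> x _ nx; rewrite (test_eq0 tth)// mulr0.
  by move=> x _ nx; rewrite (test_derive_eq0 _ tth)// mulr0.
- by move=> x _; exact: HT.
- split.
    apply: continuous_subspaceT; apply: continuous_mx => i j.
    by rewrite ord1; have [+ _ _ _] := HG i.
  move=> x [[_ nx] _]; apply/matrixP => i j; rewrite ord1 mxE.
  have [_ + _ _] := HG i; apply => sx; apply: nx.
  rewrite (iffLR (interior_id _))//.
  rewrite (_ : square t = (fun y : plane2 R => `|y| : R^o) @^-1` [set z | z < t / 2]).
    by apply: open_comp; [move=> y _; exact: norm_continuous|exact: open_lt].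
  by apply/seteqP; split=> y; rewrite /preimage/= => /square_norm.
Qed.

(** Replacing the values above the essential bound by 0 changes the function on a null set only. *)
Lemma Linfty_truncation t g : Linfty L3 (cyl t) g ->
  exists g1, [/\ bmeas g1, (forall x, ~ cyl t x -> g1 x = 0) &
    {ae mu3, forall x, cyl t x -> g1 x = g x}].
Proof.
move=> [mg [c hc]]; have mc := @measurable_cyl R t.
have mgp := iffLR (measurable_restrictT _ mc) mg.
pose gp : space -> R := g \_ (cyl t).
pose A : set (leb3 R) := [set x | `|gp x| <= c].
have mA : measurable A.
  rewrite (_ : A = gp @^-1` `[- c, c]); last first.
    by apply/seteqP; split=> x; rewrite /A/= in_itv/= ler_norml.
  by rewrite -[X in measurable X]setTI; apply: mgp => //; exact: measurable_itv.
exists (fun x => gp x * \1_A x); split.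
- split; first by apply: measurable_funM; [exact: mgp|exact: measurable_indic].
  exists `|c| => x; rewrite indicE normrM; case: (boolP (x \in A)) => [/set_mem h|_] /=.
    by rewrite normr1 mulr1; apply: le_trans h (ler_norm _).
  by rewrite normr0 mulr0.
- by move=> x nx; rewrite /gp patchE memNset// mul0r.
- apply: ae3S hc => x hx cx; have := hx cx; rewrite /gp patchE mem_set// => gc.
  rewrite indicE mem_set ?mulr1// /A/= /gp patchE mem_set//.
Qed.

Lemma compact_comp_clamp_bounded t u : 0 <= t -> continuous (u : space -> R^o) ->
  (forall x, u (clamp t x) = u x) -> bmeas u.
Proof.
move=> t0 cu uc; split; first exact: measurable_continuous3.
have [K [Kr hK]] := compact_bounded
  (continuous_compact (continuous_subspaceT cu) (@compact_box R (t / 2 + 2^-1))).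
exists (`|K| + 1) => x; rewrite -uc.
have K1 : K < `|K| + 1 by rewrite (le_lt_trans (ler_norm _))// ltrDl.
by apply: (hK _ K1); exists (clamp t x) => //=; exact: clamp_box.
Qed.

Lemma clamp1_clamp1 r y : 0 <= r -> clamp1 r (clamp1 r y) = clamp1 r y :> R.
Proof. by move=> r0; rewrite clamp1_id// clamp1_le. Qed.

Lemma clampK t x : 0 <= t -> clamp t (clamp t x) = clamp t x :> space.
Proof.
move=> t0; rewrite /clamp/= !clamp1_clamp1// ?invr_ge0// divr_ge0//.
Qed.

(** The clamp extends the field continuously. Outside the square the clamped point lies on the
    lateral boundary, where the field vanishes, so the conditional agrees with this extension while
    displaying the value 0. *)
Lemma admissible_scalar T t phi G : 0 < t -> admissible T t phi G ->
  exists2 G1 : 'I_3 -> 'I_3 -> space -> R,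
    (forall i, scalar_adm t (fun x => if x.1 \in square t then phi (clamp t x) i 0 else 0) (G1 i)) &
    forall i j, {ae mu3, forall x, cyl t x -> G1 i j x = G x i j}.
Proof.
move=> t0 [HW HT HZ]; have t0' := ltW t0; have mc := @measurable_cyl R t.
have H i j : exists g1, [/\ bmeas g1, (forall x, ~ cyl t x -> g1 x = 0) &
    {ae mu3, forall x, cyl t x -> g1 x = G x i j}].
  by apply: Linfty_truncation; have [_ /(_ j)[]] := HW i.
pose G1 i j := projT1 (cid (H i j)); have HG1 i j := projT2 (cid (H i j)).
exists G1; last by move=> i j; have [_ _ +] := HG1 i j.
move=> i.
have clE x : (if x.1 \in square t then phi (clamp t x) i 0 else 0) = phi (clamp t x) i 0.
  case: ifPn => //; rewrite notin_setE => nx.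
  rewrite (zero_on_lateral t0 HZ (clamp_out t0 nx)) ?mxE//.
  by apply: clamp1_le; rewrite invr_ge0.
under eq_fun do rewrite clE.
have cu : continuous (fun x => phi (clamp t x) i 0 : R^o).
  apply: (@continuous_entry R 3 1 _ (fun x => phi (clamp t x)) i 0).
  move=> x; have [cphi _] := HZ.
  apply: (@within_continuous_cvg _ _ _ _ _ (nbhs x) _ (clamp t) _ cphi).
  - exact: clamp_closure.
  - by move=> y; exact: clamp_closure.
  - exact: clamp_continuous.
have u0 x : ~ square t x.1 -> phi (clamp t x) i 0 = 0.
  by move=> nx; rewrite -clE; case: ifPn => // /set_mem.
have bu : bmeas (fun x => phi (clamp t x) i 0).
  by apply: (compact_comp_clamp_bounded t0' cu) => x; rewrite clampK.
split => // j; have [bg g0 gae] := HG1 i j; split => //.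
apply: (zero_extension t0 cu u0 bu bg g0) => theta tth.
have [_ /(_ j)[[mG _] wG]] := HW i; have tth' := test_functionS (@cyl_slab R t) tth.
transitivity (\int[mu3]_(x in cyl t) (phi x i 0 * 'D_(basis3 j) theta x)%:E)%E.
  by apply: eq_integral => x /set_mem cx; rewrite clamp_id.
rewrite (wG _ tth); congr (- _)%E.
have mth : measurable_fun (cyl t : set (leb3 R)) (theta : leb3 R -> R).
  by apply: measurable_funTS; exact: (test_bmeas tth).1.
have m1 : measurable_fun (cyl t : set (leb3 R)) (fun x => (G1 i j x * theta x)%:E).
  apply/measurable_EFinP; apply: measurable_funM => //.
  by apply: measurable_funTS; exact: bg.1.
have m2 : measurable_fun (cyl t : set (leb3 R)) (fun x => (G x i j * theta x)%:E).
  by apply/measurable_EFinP; apply: measurable_funM.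
apply: (@ae_eq_integral _ _ _ [the measure _ _ of mu3] _ (fun x => (G1 i j x * theta x)%:E) _ mc m2 m1).
by apply: ae3S gae => x gx cx; rewrite -gx.
Qed.

Lemma scalar_adm_sum t (I : Type) (s : seq I) (a : I -> R) (U : I -> space -> R)
    (g : I -> 'I_3 -> space -> R) : (forall k, scalar_adm t (U k) (g k)) ->
  scalar_adm t (fun x => \sum_(k <- s) a k * U k x)
    (fun j x => \sum_(k <- s) a k * g k j x).
Proof.
move=> H; split.
- apply: continuous_sum => k; have [cU _ _ _] := H k.
  exact: continuous_mull.
- move=> x nx; rewrite big1// => k _; have [_ U0 _ _] := H k.
  by rewrite U0// mulr0.
- apply: bmeas_sum => k; apply: bmeasM; first exact: bmeas_cst.
  by have [] := H k.
- move=> j; split.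
  + apply: bmeas_sum => k; apply: bmeasM; first exact: bmeas_cst.
    by have [_ _ _ /(_ j)[]] := H k.
  + move=> x nx; rewrite big1// => k _; have [_ _ _ /(_ j)[_ g0 _]] := H k.
    by rewrite g0// mulr0.
  + apply: wderiv_sum => k; first by have [] := H k.
      by have [_ _ _ /(_ j)[]] := H k.
    by have [_ _ _ /(_ j)[]] := H k.
Qed.

(** Both gradients have the same integral against every test function; the fundamental lemma is
    applied to their difference. *)
Lemma scalar_adm_unique t u g g' : scalar_adm t u g -> scalar_adm t u g' ->
  forall j, {ae mu3, forall x, cyl t x -> g j x = g' j x}.
Proof.
move=> [_ u0 bu /(_ _)Hg] [_ _ _ Hg'] j.
have [bg g0 wg] := Hg j; have [bg' g0' wg'] := Hg' j.
have bN := bmeasM (bmeas_cst (-1)) bg'.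
have bd := bmeasD bg bN.
have := @fundamental_lemma R t _ bd; move=> H.
have {H} : {ae mu3, forall x, cyl t x -> g j x + -1 * g' j x = 0}.
  apply: H => theta tth; have tth' := test_functionS (@cyl_slab R t) tth.
  have e1 := iffLR (wderivP j bu bg) wg theta tth'.
  have e2 := iffLR (wderivP j bu bg') wg' theta tth'.
  have mc := @measurable_cyl R t; have Lc := @L3_cyl_lty R t.
  have sub v : \int[mu3]_(x in slab) (v x * theta x) = \int[mu3]_(x in cyl t) (v x * theta x).
    apply: Rintegral_sub; first exact: cyl_slab.
    by move=> x _ nx; rewrite (test_eq0 tth)// mulr0.
  under eq_Rintegral do rewrite mulrDl mulN1r mulNr.
  rewrite RintegralB//; [|exact: test_integrable|exact: test_integrable].
  move: e1; rewrite e2 !sub => /oppr_inj ->; exact: subrr.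
by apply: ae3S => x H /H; rewrite mulN1r => /eqP; rewrite subr_eq0 => /eqP.
Qed.

(** Multiplication by a constant matrix commutes with weak derivatives, and it makes field and
    gradient tangential at every point. It serves both to correct null sets and to project arbitrary
    competitors. *)
Lemma Adm_projection T t (U : space -> vec) (G1 : 'I_3 -> 'I_3 -> space -> R) :
  subspace T ->
  (forall i, scalar_adm t (fun x => U x i 0) (G1 i)) ->
  Adm T t (fun x => projmx T *m U x)
    (fun x => projmx T *m (\matrix_(i, j) G1 i j x : 'M[R]_(3, 2 + 1))).
Proof.
move=> sT H; split.
- move=> i; have := scalar_adm_sum (index_enum 'I_3) (fun k => projmx T i k) H.
  rewrite (_ : (fun x => \sum_(k <- _) _) = fun x => (projmx T *m U x) i 0); last first.
    by apply/funext => x; rewrite mxE.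
  rewrite (_ : (fun j x => \sum_(k <- _) _) = fun j x =>
     (projmx T *m (\matrix_(i, j) G1 i j x : 'M[R]_(3, 2 + 1))) i j)//.
  apply/funext => j; apply/funext => x; rewrite mxE.
  by apply: eq_bigr => k _; congr (_ * _); rewrite mxE.
- move=> x; rewrite projmxE//; exact: (orthprojP sT _).1.
- by move=> x; rewrite mulmxA projmx_idem.
Qed.

(** The gradient of a field with values in [T] is tangential only almost everywhere, so it is
    projected. On the slab the field equals its projection, so both gradients are weak gradients of
    the same function and agree almost everywhere. *)
Lemma admissible_Adm T t phi G : subspace T -> 0 < t -> admissible T t phi G ->
  exists phi' G', Adm T t phi' G' /\ {ae mu3, forall x, cyl t x -> G' x = G x}.
Proof.
move=> sT t0 aG; have [G1 H1 ae1] := admissible_scalar t0 aG; have [_ HT _] := aG.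
pose U x : vec := if x.1 \in square t then phi (clamp t x) else 0.
have HU i : scalar_adm t (fun x => U x i 0) (G1 i).
  rewrite (_ : (fun x => _) = (fun x => if x.1 \in square t then phi (clamp t x) i 0 else 0))//.
  by apply/funext => x; rewrite /U; case: ifP => _; rewrite ?mxE.
have A := Adm_projection sT HU; do 2 eexists; split; first exact: A.
have [HA _ _] := A.
have ae2 i j : {ae mu3, forall x, cyl t x ->
    (projmx T *m (\matrix_(i, j) G1 i j x : 'M[R]_(3, 2 + 1))) i j = G1 i j x}.
  have [c1 z1 b1 K1] := HA i; have [c2 z2 b2 K2] := HU i.
  have eqU x : slab x -> (projmx T *m U x) i 0 = U x i 0.
    move=> [_ sx]; rewrite /U; case: ifPn => [/set_mem sq|_]; last by rewrite mulmx0.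
    have cx : cyl t x by [].
    rewrite clamp_id// projmxE// orthproj_id//; exact: HT.
  apply: (@scalar_adm_unique t (fun x => (projmx T *m U x) i 0) _ (G1 i) (HA i)).
  split => // k; have [b3 z3 w3] := K2 k; split => // theta tth.
  by rewrite -(w3 _ tth); apply: eq_integral => x /set_mem sx; rewrite eqU.
have aeall (P : 'I_3 -> 'I_3 -> leb3 R -> Prop) :
    (forall i j, {ae mu3, forall x, P i j x}) -> {ae mu3, forall x, forall i j, P i j x}.
  move=> HP; have H2 (Q : 'I_3 -> leb3 R -> Prop) : (forall i, {ae mu3, forall x, Q i x}) ->
      {ae mu3, forall x, forall i, Q i x}.
    move=> HQ; have := ae3I (HQ 0) (ae3I (HQ 1) (HQ 2%:R)); apply: ae3S.
    move=> x [q0 [q1 q2]] [[|[|[|k]]] lt3].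
    - by rewrite (_ : Ordinal lt3 = 0)//; exact: val_inj.
    - by rewrite (_ : Ordinal lt3 = 1)//; exact: val_inj.
    - by rewrite (_ : Ordinal lt3 = 2%:R)//; exact: val_inj.
    - by exfalso; move: lt3; rewrite !ltnS ltn0.
  by apply: (H2 _) => i; exact: (H2 _ (HP i)).
have := ae3I (aeall _ ae1) (aeall _ ae2); apply: ae3S => x [h1 h2] cx.
by apply/matrixP => i j; rewrite (h2 i j cx) h1.
Qed.

End Admissible.

(** * Cell energies *)

Section RintegralCylinder.
Variable R : realType.
Local Notation space := (space3 R).
Local Notation cyl t := (cylinder (square t) : set (space3 R)).
Implicit Types (t : R) (u w : space -> R).

Lemma bmeas_cyl_integrable t u : bmeas u -> mu3.-integrable (cyl t) (EFin \o u).
Proof.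
move=> bu; have mc := @measurable_cyl R t.
by apply: (bmeas_integrable mc mc (L3_cyl_lty t) bu) => x cx /(_ cx).
Qed.

Lemma Rintegral_cyl_le t u w : bmeas u -> bmeas w ->
  (forall x, cyl t x -> u x <= w x) ->
  \int[mu3]_(x in cyl t) u x <= \int[mu3]_(x in cyl t) w x.
Proof.
move=> bu bw uw; apply: le_Rintegral => //; first exact: measurable_cyl.
  exact: bmeas_cyl_integrable.
exact: bmeas_cyl_integrable.
Qed.

Lemma Rintegral_cyl_cst t (c : R) : 0 <= t ->
  \int[mu3]_(x in cyl t) c = c * t ^+ 2.
Proof.
move=> t0; rewrite Rintegral_cst; last exact: measurable_cyl.
by congr (_ * _); rewrite (_ : fine _ = fine ((t ^+ 2)%:E))// -L3_cyl.
Qed.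

Lemma Rintegral_cylD t u w : bmeas u -> bmeas w ->
  \int[mu3]_(x in cyl t) (u x + w x) =
  \int[mu3]_(x in cyl t) u x + \int[mu3]_(x in cyl t) w x.
Proof.
move=> bu bw; apply: RintegralD; first exact: measurable_cyl.
  exact: bmeas_cyl_integrable.
exact: bmeas_cyl_integrable.
Qed.

Lemma Rintegral_cylZ t (c : R) u : bmeas u ->
  \int[mu3]_(x in cyl t) (c * u x) = c * \int[mu3]_(x in cyl t) u x.
Proof.
move=> bu; apply: RintegralZl; first exact: measurable_cyl.
exact: bmeas_cyl_integrable.
Qed.

Lemma bmeasN u : bmeas u -> bmeas (fun x => - u x).
Proof.
move=> bu; rewrite (_ : (fun x => _) = fun x => -1 * u x).
  exact: (bmeasM (bmeas_cst (-1)) bu).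
by apply/funext => x; rewrite mulN1r.
Qed.

Lemma bmeasB u w : bmeas u -> bmeas w -> bmeas (fun x => u x - w x).
Proof. by move=> bu bw; exact: (bmeasD bu (bmeasN bw)). Qed.

End RintegralCylinder.

Section Integrand.
Variables (R : realType) (Phi : R -> R).
Hypothesis yPhi : young Phi.
Local Notation space := (space3 R).
Local Notation cyl t := (cylinder (square t) : set (space3 R)).
Local Notation mat := 'M[R]_(3, 2 + 1).
Implicit Types (f : space -> mat -> R) (t : R) (A : space -> mat).

Lemma enorm_continuous m n : continuous (@enorm R m n : 'M[R]_(m, n) -> R^o).
Proof.
have c2 : continuous (fun A : 'M[R]_(m, n) => \sum_i \sum_j A i j ^+ 2).
  apply: continuous_sum => i; apply: continuous_sum => j A.
  have ce := @coord_continuous R m n i j.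
  exact: (@cvgM R _ (nbhs A) _ (fun B : 'M[R]_(m, n) => B i j) (fun B => B i j)
    _ _ (ce A) (ce A)).
move=> A; apply: (@continuous_comp _ R^o R^o _ Num.sqrt); first exact: c2.
exact: sqrt_continuous.
Qed.

Lemma young_enorm_continuous m n :
  continuous (fun A : 'M[R]_(m, n) => Phi (enorm A) : R^o).
Proof.
move=> A; have [cP _ _ _ _] := yPhi.
apply: (@within_continuous_cvg R^o R^o `[0, +oo[ Phi _ (nbhs A) _ (@enorm R m n) _ cP).
- by rewrite /= in_itv/= andbT enorm_ge0.
- by move=> B; rewrite /= in_itv/= andbT enorm_ge0.
- exact: enorm_continuous.
Qed.

(** Periodicity and growth at every point, so that translating by a lattice vector or bounding the
    integrand needs no null set. *)
Definition good_integrand (alpha beta : R) f : Prop :=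
  [/\ caratheodory_fun f,
      forall x xi i, f (x.1 + basis2 i, x.2) xi = f x xi &
      forall y xi, alpha * Phi (enorm xi) <= f y xi <= beta * (1 + Phi (enorm xi))].

Lemma ae_null (P : space -> Prop) : {ae mu3, forall x, P x} -> L3 [set x | ~ P x] = 0%E.
Proof.
move=> [A [mA A0 PA]]; apply/eqP; rewrite eq_le outer_measure_ge0 andbT -A0.
exact: le_outer_measure.
Qed.

Definition lattice (ab : int * int) : space := ((ab.1%:~R, ab.2%:~R), 0).

(** The null set where periodicity or growth fails is saturated under integer translations: the
    union [S] is still null, and now periodic. On [S] the integrand is replaced by alpha Phi(|xi|),
    which satisfies both bounds as alpha <= beta. *)
Lemma regularize (alpha beta : R) (f : space -> 'M[R]_3 -> R) : 0 < alpha <= beta ->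
  caratheodory_fun f -> inplane_periodic f ->
  {ae mu3, forall y, forall xi : 'M[R]_3,
      alpha * Phi (enorm xi) <= f y xi <= beta * (1 + Phi (enorm xi))} ->
  exists2 f', good_integrand alpha beta f' & {ae mu3, forall x, f x = f' x}.
Proof.
move=> /andP[a0 ab] [mf cf] per gr.
pose Bad := [set x : space | ~ ((forall (xi : 'M[R]_3) (i : 'I_2),
    f (x.1 + basis2 i, x.2) xi = f x xi) /\ forall xi : 'M[R]_3,
      alpha * Phi (enorm xi) <= f x xi <= beta * (1 + Phi (enorm xi)))].
have Bad0 : L3 Bad = 0%E := ae_null (ae3I per gr).
pose tr ab : set space := inplane 1 (lattice ab) @^-1` Bad.
pose S := \bigcup_(ab in [set: int * int]) tr ab.
have S0 : L3 S = 0%E.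
  pose F (n : nat) : set space := if unpickle n is Some ab then tr ab else set0.
  have SF : S `<=` \bigcup_n F n.
    by move=> x [ab' _ xab]; exists (pickle ab'); [by []|rewrite /F pickleK; exact: xab].
  apply/eqP; rewrite eq_le outer_measure_ge0 andbT.
  apply: le_trans (le_outer_measure _ _ _ SF) _.
  apply: le_trans (outer_measure_sigma_subadditive _ F) _.
  rewrite eseries0// => n _ _; rewrite /F; case: (unpickle n) => [ab'|]; last exact: outer_measure0.
  by rewrite /tr L3_inplane// Bad0 mule0.
have mS := null_caratheodory S0.
have BadS x : Bad x -> S x.
  move=> bx; exists (0, 0) => //; rewrite /tr /preimage/= (_ : inplane _ _ x = x)//.
  rewrite /inplane/lattice/= !mul1r !addr0; by case: x {bx} => -[].
have Sper x (i : 'I_2) : S (x.1 + basis2 i, x.2) <-> S x.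
  split=> -[[a b] _]; rewrite /tr /preimage/= /inplane/= !mul1r => H.
    exists (a + (i == 0%N :> nat)%:Z, b + (i == 1%N :> nat)%:Z) => //.
    rewrite /tr /preimage/= /inplane/= !mul1r !intrD.
    by move: H; congr (Bad _); congr (_, _, _);
      rewrite -addrA; congr (_ + _); rewrite addrC.
  exists (a - (i == 0%N :> nat)%:Z, b - (i == 1%N :> nat)%:Z) => //.
  rewrite /tr /preimage/= /inplane/= !mul1r !intrB.
  by move: H; congr (Bad _); congr (_, _, _);
    rewrite -addrA; congr (_ + _); rewrite addrCA subrr addr0.
exists (fun x xi => if x \in S then alpha * Phi (enorm xi) else f x xi); last first.
  exists S; split => // x /= nfx; apply: contrapT => nS; apply: nfx.
  by apply/funext => xi; rewrite memNset.
split.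
- split=> [xi|x].
    have mI1 : measurable_fun setT (\1_S : leb3 R -> R).
      by apply: measurable_indic; exact: mS.
    have mI2 : measurable_fun setT (\1_(~` S) : leb3 R -> R).
      by apply: measurable_indic; exact: (measurableC mS).
    have m1 := measurable_funM (measurable_cst (alpha * Phi (enorm xi))) mI1.
    have m2 := measurable_funM (mf xi) mI2.
    have := measurable_funD m1 m2.
    rewrite (_ : (fun x => _) \+ (fun x => _) = fun x => if x \in S then alpha * Phi (enorm xi) else f x xi)//.
    apply/funext => x /=; rewrite !indicE in_setC.
    by case: (x \in S); rewrite /= ?mulr1 ?mulr0 ?addr0 ?add0r.
  case: (x \in S); last exact: cf.
  move=> xi; have cP := @young_enorm_continuous 3 3 xi.
  exact: (@cvgM R _ (nbhs xi) _ (fun=> alpha) _ _ _ (cvg_cst alpha) cP).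
- move=> x xi i; have -> : ((x.1 + basis2 i, x.2) \in S) = (x \in S).
    apply/idP/idP => /set_mem h; apply/mem_set.
      exact: (iffLR (Sper x i) h).
    exact: (iffRL (Sper x i) h).
  case: ifPn => //; rewrite notin_setE => nS.
  have := contra_not (BadS x) nS; rewrite /Bad/= => /contrapT[+ _]; exact.
- move=> y xi; case: ifPn => [_|].
    have P0 := young_ge0 yPhi (enorm_ge0 xi).
    rewrite lexx/= mulrDr; apply: le_trans (ler_wpM2r P0 ab) _.
    by rewrite lerDr mulr1 (le_trans (ltW a0)).
  rewrite notin_setE => nS.
  have := contra_not (BadS y) nS; rewrite /Bad/= => /contrapT[_ +]; exact.
Qed.

End Integrand.

Section CellEnergy.
Variables (R : realType) (Phi : R -> R) (alpha beta : R).
Hypotheses (yPhi : young Phi) (alpha_gt0 : 0 < alpha) (alpha_le : alpha <= beta).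
Local Notation space := (space3 R).
Local Notation cyl t := (cylinder (square t) : set (space3 R)).
Local Notation mat := 'M[R]_(3, 2 + 1).
Local Notation vec := 'cV[R]_3.
Variable f : space -> mat -> R.
Hypothesis gf : good_integrand Phi alpha beta f.
Implicit Types (t : R) (A G : space -> mat) (T : set vec) (xi : 'M[R]_(3, 2)).

Definition flat_mx xi : mat := row_mx xi (0 : 'cV[R]_3).

Definition bmeas_mx A := forall i j, bmeas (fun x => A x i j).

Definition energy t A : R := \int[mu3]_(x in cyl t) f x (A x).

Lemma beta_gt0 : 0 < beta. Proof. exact: lt_le_trans alpha_le. Qed.

Lemma integrand_ge0 x (Z : mat) : 0 <= f x Z.
Proof.
have [_ _ /(_ x Z)/andP[h _]] := gf.
apply: le_trans h; apply: mulr_ge0; [exact: ltW|exact: (young_ge0 yPhi (enorm_ge0 _))].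
Qed.

Lemma bmeas_mx_bounded A : bmeas_mx A ->
  exists2 c : R, 0 <= c & forall x, enorm (A x) <= c.
Proof.
move=> bA; pose c i j := projT1 (cid (bA i j).2); have hc i j := projT2 (cid (bA i j).2).
exists (\sum_i \sum_j c i j).
  by apply: sumr_ge0 => i _; apply: sumr_ge0 => j _; apply: le_trans (hc i j 0).
move=> x; apply: le_trans (enorm_le_sum _) _.
by apply: ler_sum => i _; apply: ler_sum => j _; exact: hc.
Qed.

Lemma bmeas_integrand A : bmeas_mx A -> bmeas (fun x => f x (A x)).
Proof.
move=> bA; have [[mf cf] _ gr] := gf; split.
  exact: (@measurable_fun_caratheodory _ (leb3 R) R 3 3 setT f A measurableT mf cf
    (fun i j => (bA i j).1)).
have [c c0 hc] := bmeas_mx_bounded bA.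
exists (beta * (1 + Phi c)) => x; rewrite ger0_norm ?integrand_ge0//.
have /andP[_ h] := gr x (A x); apply: le_trans h _.
rewrite ler_wpM2l ?(ltW beta_gt0)// lerD2l; apply: (young_le yPhi) => //.
exact: enorm_ge0.
Qed.

Lemma bmeas_mx_cst (Z : mat) : bmeas_mx (fun=> Z).
Proof. by move=> i j; exact: bmeas_cst. Qed.

Lemma bmeas_mxD A G : bmeas_mx A -> bmeas_mx G -> bmeas_mx (fun x => A x + G x).
Proof.
move=> bA bG i j; have := bmeasD (bA i j) (bG i j).
by rewrite (_ : (fun x => _ + _) = fun x => (A x + G x) i j)//; apply/funext => x; rewrite mxE.
Qed.

Lemma bmeas_mxN A : bmeas_mx A -> bmeas_mx (fun x => - A x).
Proof.
move=> bA i j; have := bmeasN (bA i j).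
by rewrite (_ : (fun x => - _) = fun x => (- A x) i j)//; apply/funext => x; rewrite mxE.
Qed.

Lemma Adm_bmeas_mx T t phi G : Adm T t phi G -> bmeas_mx G.
Proof. by move=> aG i j; exact: (Adm_entry i j aG). Qed.

Lemma energy_ge0 t A : 0 <= energy t A.
Proof. by apply: Rintegral_ge0 => x _; exact: integrand_ge0. Qed.

(** The cell infimum taken in the reals and over [Adm] pairs only; [cell_ecell] shows that nothing
    is lost. *)
Definition ecell T xi t : R :=
  inf [set v | exists phi G, Adm T t phi G /\
    v = t ^- 2 * energy t (fun x => flat_mx xi + G x)].

Lemma Adm0 T t : subspace T -> Adm T t (fun=> 0) (fun=> 0).
Proof.
move=> sT; split.
- move=> i; split.
  + by move=> x; rewrite /= mxE; exact: cvg_cst.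
  + by move=> x _; rewrite mxE.
  + by under eq_fun do rewrite mxE; exact: bmeas_cst.
  + move=> j; split.
    * by under eq_fun do rewrite mxE; exact: bmeas_cst.
    * by move=> x _; rewrite mxE.
    * by rewrite !mxE; exact: wderiv0.
- by move=> _; case: sT.
- by move=> x; rewrite mulmx0.
Qed.

Lemma ecell_lbound T xi t : has_lbound [set v | exists phi G, Adm T t phi G /\
    v = t ^- 2 * energy t (fun x => flat_mx xi + G x)].
Proof.
exists 0 => _ [phi [G [_ ->]]]; rewrite mulr_ge0 ?energy_ge0//.
by rewrite invr_ge0 sqr_ge0.
Qed.

Lemma ecell_le T xi t phi G : Adm T t phi G ->
  ecell T xi t <= t ^- 2 * energy t (fun x => flat_mx xi + G x).
Proof. by move=> aG; apply: (ge_inf (ecell_lbound T xi t)); exists phi, G. Qed.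

Lemma ecell_adherent T xi t e : subspace T -> 0 < e ->
  exists phi G, Adm T t phi G /\
    t ^- 2 * energy t (fun x => flat_mx xi + G x) < ecell T xi t + e.
Proof.
move=> sT e0.
have hi : has_inf [set v | exists phi G, Adm T t phi G /\
    v = t ^- 2 * energy t (fun x => flat_mx xi + G x)].
  split; last exact: ecell_lbound.
  by eexists; exists (fun=> 0), (fun=> 0); split; [exact: Adm0|].
by have [_ [phi [G [aG ->]]] h] := inf_adherent e0 hi; exists phi, G.
Qed.

Lemma ecell_glb T xi t c : subspace T -> (forall phi G, Adm T t phi G ->
    c <= t ^- 2 * energy t (fun x => flat_mx xi + G x)) -> c <= ecell T xi t.
Proof.
move=> sT H; apply: lb_le_inf.
  by eexists; exists (fun=> 0), (fun=> 0); split; [exact: Adm0|].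
by move=> _ [phi [G [aG ->]]]; exact: (H phi G aG).
Qed.

Lemma energy_cst_le t (Z : mat) : 0 <= t ->
  energy t (fun=> Z) <= beta * (1 + Phi (enorm Z)) * t ^+ 2.
Proof.
move=> t0; rewrite -Rintegral_cyl_cst//; apply: Rintegral_cyl_le.
- exact: (bmeas_integrand (bmeas_mx_cst Z)).
- exact: bmeas_cst.
- by move=> x _; have [_ _ /(_ x Z)/andP[]] := gf.
Qed.

Lemma ecell_upper T xi t : subspace T -> 0 < t ->
  ecell T xi t <= beta * (1 + Phi (enorm xi)).
Proof.
move=> sT t0; apply: le_trans (ecell_le xi (Adm0 t sT)) _.
rewrite ler_pdivrMl ?exprn_gt0//.
rewrite (_ : (fun x => _) = fun=> flat_mx xi); last by apply/funext => x; rewrite addr0.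
by apply: le_trans (energy_cst_le _ (ltW t0)) _; rewrite enorm_row_mx0 mulrC.
Qed.

Lemma ecell_ge0 T xi t : subspace T -> 0 <= ecell T xi t.
Proof.
move=> sT; apply: ecell_glb => // phi G _.
by rewrite mulr_ge0 ?energy_ge0// invr_ge0 sqr_ge0.
Qed.

Lemma flat_mxE xi (Z : mat) : row_mx (xi + lsubmx Z) (rsubmx Z) = flat_mx xi + Z.
Proof. by rewrite -[in RHS](hsubmxK Z) add_row_mx add0r. Qed.

Lemma flat_mx_proj T xi : subspace T -> tangent_mx T xi ->
  projmx T *m flat_mx xi = flat_mx xi.
Proof. by move=> sT /(tangent_mxP sT) h; rewrite mul_mx_row h mulmx0. Qed.

Lemma measurable_integrand_cyl (g : space -> mat -> R) xi t G :
  caratheodory_fun g ->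
  (forall i j, measurable_fun (cyl t : set (leb3 R)) (fun x => G x i j)) ->
  measurable_fun (cyl t : set (leb3 R)) (fun x => g x (flat_mx xi + G x)).
Proof.
move=> [mg cg] mG.
have mZG i j : measurable_fun (cyl t : set (leb3 R)) (fun x => (flat_mx xi + G x) i j).
  have := measurable_funD (measurable_cst (flat_mx xi i j)) (mG i j).
  rewrite (_ : (fun x => _) \+ (fun x => _) = fun x => (flat_mx xi + G x) i j)//.
  by apply/funext => x; rewrite !mxE.
have mg' (Z : mat) : measurable_fun (cyl t : set (leb3 R)) (g ^~ Z).
  exact: measurable_funTS (mg Z).
exact: (@measurable_fun_caratheodory _ (leb3 R) R 3 3 (cyl t) g
  (fun x => flat_mx xi + G x) (measurable_cyl t) mg' cg mZG).
Qed.

Lemma integral_cyl_ae (w v : space -> R) t :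
  measurable_fun (cyl t : set (leb3 R)) (w : leb3 R -> R) -> bmeas v ->
  {ae mu3, forall x, cyl t x -> w x = v x} ->
  (\int[mu3]_(x in cyl t) (w x)%:E = (\int[mu3]_(x in cyl t) v x)%:E)%E.
Proof.
move=> mw bv wv; have mc := @measurable_cyl R t.
rewrite -(EFin_Rintegral mc (bmeas_cyl_integrable t bv)).
have m1 : measurable_fun (cyl t : set (leb3 R)) (fun x => (w x)%:E).
  exact/measurable_EFinP.
have m2 : measurable_fun (cyl t : set (leb3 R)) (fun x => (v x)%:E).
  by apply/measurable_EFinP; apply: measurable_funTS; exact: bv.1.
apply: (@ae_eq_integral _ _ _ [the measure _ _ of mu3] _ (fun x => (v x)%:E) _ mc m1 m2).
by apply: ae3S wv => x wx cx; rewrite wx.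
Qed.

Lemma bmeas_young A : bmeas_mx A -> bmeas (fun x => Phi (enorm (A x))).
Proof.
move=> bA; split.
  exact: (@measurable_fun_caratheodory _ (leb3 R) R 3 3 setT (fun _ Z => Phi (enorm Z)) A
    measurableT (fun Z => measurable_cst (Phi (enorm Z)))
    (fun _ => @young_enorm_continuous R Phi yPhi 3 3) (fun i j => (bA i j).1)).
have [c c0 hc] := bmeas_mx_bounded bA; exists (Phi c) => x.
by rewrite ger0_norm ?(young_ge0 yPhi (enorm_ge0 _))// (young_le yPhi) ?enorm_ge0.
Qed.

Section SameAlmostEverywhere.
Variable f0 : space -> mat -> R.
Hypotheses (cf0 : caratheodory_fun f0) (f0f : {ae mu3, forall x, f0 x = f x}).

Lemma admissible_measurable T t phi G : admissible T t phi G ->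
  forall i j, measurable_fun (cyl t : set (leb3 R)) (fun x => G x i j).
Proof. by move=> [HW _ _] i j; have [_ /(_ j)[[]]] := HW i. Qed.

(** An [Adm] pair is admissible, and an admissible pair has an [Adm] representative with the same
    gradient almost everywhere, hence the same energy. *)
Lemma cell_ecell T xi t : subspace T -> 0 < t ->
  cell f0 T xi t = (ecell T xi t)%:E.
Proof.
move=> sT t0.
apply/eqP; rewrite eq_le; apply/andP; split.
  apply/lee_addgt0Pr => e e0; have [phi [G [aG Ge]]] := ecell_adherent xi t sT e0.
  apply: (@le_trans _ _ (t ^- 2 * energy t (fun x => flat_mx xi + G x))%:E); last first.
    by rewrite -EFinD lee_fin ltW.
  apply: ereal_inf_lbound; exists phi, G; split; first exact: Adm_admissible.
  rewrite EFinM; congr (_ * _)%E.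
  have bG := Adm_bmeas_mx aG.
  have mG i j : measurable_fun (cyl t : set (leb3 R)) (fun x => G x i j).
    by apply: measurable_funTS; exact: (bG i j).1.
  under eq_integral do rewrite flat_mxE.
  have bZ := bmeas_mxD (bmeas_mx_cst (flat_mx xi)) bG.
  apply/esym/(integral_cyl_ae (measurable_integrand_cyl xi cf0 mG) (bmeas_integrand bZ)).
  by apply: ae3S f0f => x -> .
apply: le_ereal_inf_tmp => _ [phi [G [aG ->]]].
have [phi' [G' [aG' GG']]] := admissible_Adm sT t0 aG.
have bG' := Adm_bmeas_mx aG'.
under eq_integral do rewrite flat_mxE.
have bZ := bmeas_mxD (bmeas_mx_cst (flat_mx xi)) bG'.
have mG := admissible_measurable aG.
rewrite (integral_cyl_ae (measurable_integrand_cyl xi cf0 mG) (bmeas_integrand bZ)).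
  by rewrite -EFinM lee_fin; exact: ecell_le aG'.
by apply: ae3S (ae3I f0f GG') => x [-> h] cx; rewrite h.
Qed.

Lemma subspaceTT : subspace [set: vec].
Proof. by split. Qed.

Lemma fbar_cell_ecell (M : set vec) s xi t : subspace (tangent M s) ->
  tangent_mx (tangent M s) xi -> 0 < t ->
  fbar_cell f0 Phi M s xi t = (ecell (tangent M s) xi t)%:E.
Proof.
move=> sT txi t0; set T := tangent M s; have Pxi := flat_mx_proj sT txi.
have fb x (A : mat) : fbar f0 Phi M x s A =
    f0 x (projmx T *m A) + Phi (enorm (A - projmx T *m A)).
  by rewrite /fbar orthproj_mxE.
have cfb : caratheodory_fun (fun x => fbar f0 Phi M x s).
  have [mf0 cf0'] := cf0; split=> [A|x].
    under eq_fun do rewrite fb.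
    by apply: measurable_funD; [exact: mf0|exact: measurable_cst].
  have cP (Q : 'M[R]_3) : continuous (fun A : mat => Q *m A).
    apply: continuous_mx => i j.
    rewrite (_ : (fun Z : mat => (Q *m Z) i j) = fun Z => \sum_k Q i k * Z k j); last first.
      by apply/funext => Z; rewrite mxE.
    apply: continuous_sum => k; apply: continuous_mull; exact: coord_continuous.
  rewrite (_ : fbar _ _ _ _ _ = fun Z => f0 x (projmx T *m Z) +
     Phi (enorm (Z - projmx T *m Z))); last by apply/funext => Z; rewrite fb.
  move=> Z; have c1 := @continuous_comp _ _ R^o _ (f0 x) Z (cP (projmx T) Z) (cf0' x _).
  have cB : {for Z, continuous (fun Z : mat => Z - projmx T *m Z)}.
    rewrite (_ : (fun Y : mat => Y - projmx T *m Y) = mulmx (1%:M - projmx T)); first exact: cP.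
    by apply/funext => Y; rewrite mulmxBl mul1mx.
  have c2 := @continuous_comp _ _ R^o _ (fun B : mat => Phi (enorm B) : R^o) Z cB
    (@young_enorm_continuous R Phi yPhi 3 3 _).
  exact: (@cvgD R R^o _ (nbhs Z) _ _ _ _ _ c1 c2).
apply/eqP; rewrite eq_le; apply/andP; split.
  apply/lee_addgt0Pr => e e0; have [phi [G [aG Ge]]] := ecell_adherent xi t sT e0.
  apply: (@le_trans _ _ (t ^- 2 * energy t (fun x => flat_mx xi + G x))%:E); last first.
    by rewrite -EFinD lee_fin ltW.
  apply: ereal_inf_lbound; exists phi, G; split.
    by have [h1 _ h3] := Adm_admissible aG; split.
  rewrite EFinM; congr (_ * _)%E.
  have bG := Adm_bmeas_mx aG; have [_ _ PG] := aG.
  have mG i j : measurable_fun (cyl t : set (leb3 R)) (fun x => G x i j).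
    by apply: measurable_funTS; exact: (bG i j).1.
  under eq_integral do rewrite flat_mxE.
  have bZ := bmeas_mxD (bmeas_mx_cst (flat_mx xi)) bG.
  apply/esym/(integral_cyl_ae (measurable_integrand_cyl xi cfb mG) (bmeas_integrand bZ)).
  (* On tangential gradients the penalty vanishes, since Phi 0 = 0. *)
  apply: ae3S f0f => x f0x cx; rewrite fb mulmxDr Pxi PG subrr enorm0 (young0 yPhi) addr0.
  by rewrite f0x.
apply: le_ereal_inf_tmp => _ [phi [G [aG ->]]].
have [phi' [G' [aG' GG']]] := admissible_Adm subspaceTT t0 aG.
have [HA _ _] := aG'.
have aP := Adm_projection sT HA.
have PGE : (fun x => projmx T *m (\matrix_(i, j) G' x i j : mat)) = fun x => projmx T *m G' x.
  by apply/funext => x; congr (_ *m _); apply/matrixP => i j; rewrite mxE.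
rewrite PGE in aP; have bPG := Adm_bmeas_mx aP.
have mG := admissible_measurable aG.
under eq_integral do rewrite flat_mxE.
apply: (@le_trans _ _ (t ^- 2 * energy t (fun x => flat_mx xi + projmx T *m G' x))%:E).
  by rewrite lee_fin; exact: ecell_le aP.
have bZ := bmeas_mxD (bmeas_mx_cst (flat_mx xi)) (Adm_bmeas_mx aG').
have bPZ := bmeas_mxD (bmeas_mx_cst (flat_mx xi)) bPG.
(* The penalty term; as [xi] is tangential, it only sees the normal part of the gradient. It is
   discarded as nonnegative. *)
pose r x := Phi (enorm ((flat_mx xi + G' x) - (flat_mx xi + projmx T *m G' x))).
have br : bmeas r.
  have := bmeas_young (bmeas_mxD (Adm_bmeas_mx aG') (bmeas_mxN bPG)).
  rewrite (_ : (fun x => _) = r)//; apply/funext => x; rewrite /r.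
  by congr (Phi (enorm _)); rewrite opprD addrACA subrr add0r.
have bv := bmeasD (bmeas_integrand bPZ) br.
rewrite (integral_cyl_ae (measurable_integrand_cyl xi cfb mG) bv).
  rewrite -EFinM lee_fin ler_wpM2l ?invr_ge0 ?sqr_ge0//.
  apply: (Rintegral_cyl_le (bmeas_integrand bPZ) bv).
  by move=> x _; rewrite lerDl (young_ge0 yPhi (enorm_ge0 _)).
apply: ae3S (ae3I f0f GG') => x [f0x h] cx.
by rewrite fb f0x -(h cx) mulmxDr Pxi.
Qed.

End SameAlmostEverywhere.

End CellEnergy.

(** * Enlarging, translating and summing admissible pairs *)

Section AdmissibleOperations.
Variable R : realType.
Local Notation space := (space3 R).
Local Notation cyl t := (cylinder (square t) : set (space3 R)).
Local Notation vec := 'cV[R]_3.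
Local Notation mat := 'M[R]_(3, 2 + 1).
Implicit Types (t r : R) (T : set vec) (phi : space -> vec) (G : space -> mat)
  (u : space -> R) (b : space).

Lemma scalar_adm_le t r u g : t <= r -> scalar_adm t u g -> scalar_adm r u g.
Proof.
move=> tr [cu u0 bu H]; split => //.
  move=> x nx; apply: u0 => /square_norm xt; apply: nx; apply/square_norm.
  by apply: lt_le_trans xt _; rewrite ler_pM2r ?invr_gt0.
move=> j; have [bg g0 wg] := H j; split => // x nx.
by apply: g0 => cx; apply: nx; exact: cyl_le cx.
Qed.

Lemma Adm_le T t r phi G : t <= r -> Adm T t phi G -> Adm T r phi G.
Proof.
move=> tr [H1 H2 H3]; split; [|exact: H2|exact: H3].
by move=> i; exact: (scalar_adm_le tr (H1 i)).
Qed.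

Lemma scalar_adm_shift t r b u g : b.2 = 0 -> `|b.1| + t / 2 <= r / 2 ->
  scalar_adm t u g ->
  scalar_adm r (fun x => u (inplane 1 b x)) (fun j x => g j (inplane 1 b x)).
Proof.
move=> b0 btr [cu u0 bu H].
have off x : ~ square r x.1 -> ~ square t (inplane 1 b x).1.
  move=> nx /square_norm h; apply: nx; apply/square_norm.
  apply: lt_le_trans btr.
  have -> : x.1 = (inplane 1 b x).1 - b.1.
    by rewrite /inplane/=; case: x b {b0 h} => -[x1 x2] x3 [[b1 b2] b3] /=;
       rewrite !mul1r; congr (_, _); rewrite addrK.
  by apply: le_lt_trans (ler_normB _ _) _; rewrite addrC ltrD2l.
split.
- move=> x; apply: (@continuous_comp _ _ _ (inplane 1 b) (u : space -> R^o)).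
    exact: inplane_continuous.
  exact: cu.
- by move=> x /off; exact: u0.
- exact: bmeas_inplane.
- move=> j; have [bg g0 wg] := H j; split.
  + exact: bmeas_inplane.
  + move=> x nx; apply: g0 => -[h1 h2]; apply: nx; split.
      by apply: contrapT => /off.
    by move: h2; rewrite /inplane/= b0 addr0 mul1r.
  + have := wderiv_inplane ltr01 b0 bu bg wg.
    rewrite (_ : dil_factor 1 j = 1); last by rewrite /dil_factor; case: ifP.
    rewrite (_ : (fun x => 1 * g j (inplane 1 b x)) = fun x => g j (inplane 1 b x))//.
    by apply/funext => x; rewrite mul1r.
Qed.

Lemma Adm_shift T t r b phi G : b.2 = 0 -> `|b.1| + t / 2 <= r / 2 ->
  Adm T t phi G ->
  Adm T r (fun x => phi (inplane 1 b x)) (fun x => G (inplane 1 b x)).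
Proof.
move=> b0 btr [H1 H2 H3]; split.
- by move=> i; exact: (scalar_adm_shift b0 btr (H1 i)).
- by move=> x; exact: H2.
- by move=> x; exact: H3.
Qed.

Lemma Adm_sum T t (I : Type) (s : seq I) (phi : I -> space -> vec)
    (G : I -> space -> mat) : subspace T -> (forall k, Adm T t (phi k) (G k)) ->
  Adm T t (fun x => \sum_(k <- s) phi k x) (fun x => \sum_(k <- s) G k x).
Proof.
move=> sT H; split.
- move=> i; have Hi k : scalar_adm t (fun x => phi k x i 0) (fun j x => G k x i j).
    by have [+ _ _] := H k; apply.
  have := scalar_adm_sum s (fun=> 1) Hi.
  rewrite (_ : (fun x => \sum_(k <- s) _) = fun x => (\sum_(k <- s) phi k x) i 0); last first.
    by apply/funext => x; rewrite summxE; apply: eq_bigr => k _; rewrite mul1r.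
  rewrite (_ : (fun j x => \sum_(k <- s) _) = fun j x => (\sum_(k <- s) G k x) i j)//.
  apply/funext => j; apply/funext => x; rewrite summxE.
  by apply: eq_bigr => k _; rewrite mul1r.
- by move=> x; apply: subspace_sum => // k _; have [_ + _] := H k; exact.
- move=> x; rewrite mulmx_sumr; apply: eq_bigr => k _.
  by have [_ _ +] := H k; exact.
Qed.

End AdmissibleOperations.

(** * Tiling a large cell by translates of a small one *)

Section Tiles.
Variables (R : realType) (k m : nat).
Local Notation space := (space3 R).
Local Notation cyl t := (cylinder (square t) : set (space3 R)).
Local Notation n := (m.*2.+1).
Local Notation idx := ('I_n * 'I_n)%type.
Implicit Types (i j : idx) (x : space) (w : space -> R).

(** The displacement carrying the centred cell to tile i, that is the centre of the tile. The odd
    number 2m+1 of tiles per side and the integer side k make all these displacements integer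
    vectors, so periodicity applies. *)
Definition tile_corner i : int * int :=
  (k%:Z * (i.1%:Z - m%:Z), k%:Z * (i.2%:Z - m%:Z)).

Definition to_tile i : space -> space := inplane 1 (lattice R (tile_corner i)).
Definition of_tile i : space -> space :=
  inplane 1 (lattice R (- (tile_corner i).1, - (tile_corner i).2)).

Lemma to_tileK i : cancel (to_tile i) (of_tile i).
Proof.
move=> [[x1 x2] x3]; rewrite /to_tile /of_tile /inplane /lattice/= !mul1r !addr0.
by rewrite !rmorphN/= !addrK.
Qed.

Lemma of_tileK i : cancel (of_tile i) (to_tile i).
Proof.
move=> [[x1 x2] x3]; rewrite /to_tile /of_tile /inplane /lattice/= !mul1r !addr0.
by rewrite !rmorphN/= !subrK.
Qed.

Lemma tile_disjoint i j x : cyl k%:R (of_tile i x) -> cyl k%:R (of_tile j x) -> i = j.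
Proof.
move=> /cylP[] /=; rewrite !mul1r !rmorphN/= => hi1 hi2 _.
move=> /cylP[] /=; rewrite !mul1r !rmorphN/= => hj1 hj2 _.
have key (a b : 'I_n) (y : R) : `|y - (k%:Z * (a%:Z - m%:Z))%:~R| < k%:R / 2 ->
    `|y - (k%:Z * (b%:Z - m%:Z))%:~R| < k%:R / 2 -> a = b.
  rewrite !rmorphM/= !rmorphB/= => h1 h2; apply: contrapT => ab.
  have ab1 : 1 <= `|a%:R - b%:R| :> R.
    rewrite -[a%:R]/((a%:Z)%:~R) -[b%:R]/((b%:Z)%:~R) -rmorphB/= -intr_norm.
    rewrite -[1]/(1%:~R) ler_int -gtz0_ge1 normr_gt0 subr_eq0.
    by apply/negP => /eqP[] /val_inj.
  have := ler_normB (y - k%:R * (b%:R - m%:R)) (y - k%:R * (a%:R - m%:R)).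
  have -> : y - k%:R * (b%:R - m%:R) - (y - k%:R * (a%:R - m%:R)) =
    k%:R * (a%:R - b%:R) :> R by ring.
  rewrite normrM normr_nat => h3.
  have : k%:R * 1 <= k%:R * `|a%:R - b%:R| :> R by rewrite ler_wpM2l.
  move: h1 h2 h3; move: `|_ - _| `|_ - _| (k%:R * `|_|) => u v z.
  by rewrite mulr1 => *; lra.
have e1 : i.1 = j.1 := key _ _ _ hi1 hj1.
have e2 : i.2 = j.2 := key _ _ _ hi2 hj2.
by case: i j e1 e2 {hi1 hi2 hj1 hj2} => a b [c d] /= -> ->.
Qed.

Lemma tile_bound i : `|(lattice R (- (tile_corner i).1, - (tile_corner i).2)).1| + k%:R / 2 <=
  (k * n)%:R / 2 :> R.
Proof.
have key (a : 'I_n) : `|(- (k%:Z * (a%:Z - m%:Z)))%:~R| <= k%:R * m%:R :> R.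
  rewrite rmorphN normrN rmorphM/= normrM normr_nat ler_wpM2l// rmorphB/= ler_norml.
  have := ltn_ord a; rewrite ltnS => am.
  have am' : a%:R <= m%:R * 2 :> R by rewrite -natrM muln2 ler_nat.
  have a0 : 0 <= a%:R :> R by [].
  by apply/andP; split; lra.
rewrite plane_normE/=.
have : Num.max `|(- (k%:Z * (i.1%:Z - m%:Z)))%:~R| `|(- (k%:Z * (i.2%:Z - m%:Z)))%:~R| <=
  k%:R * m%:R :> R by rewrite ge_max !key.
have -> : (k * n)%:R = k%:R * m%:R * 2 + k%:R :> R.
  by rewrite natrM -addn1 natrD -muln2 natrM; ring.
by move=> h; lra.
Qed.

Lemma tile_sub i x : cyl k%:R (of_tile i x) -> cyl (k * n)%:R x.
Proof.
move=> [/= /square_norm h1 h2]; split; last by move: h2; rewrite /= mul1r addr0.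
apply/square_norm; apply: lt_le_trans (tile_bound i).
set b := (lattice R _).1.
have -> : x.1 = (of_tile i x).1 - b.
  by rewrite /of_tile /inplane/=; case: x {h1 h2} => -[x1 x2] x3 /=;
     rewrite !mul1r; congr (_, _); rewrite addrK.
by apply: le_lt_trans (ler_normB _ _) _; rewrite addrC ltrD2l.
Qed.

Lemma bmeas_comp_shift b w : bmeas w -> bmeas (fun x => w (inplane 1 b x)).
Proof. exact: bmeas_inplane. Qed.

Let D i : set space := of_tile i @^-1` cyl k%:R.

Let mD i : measurable (D i : set (leb3 R)).
Proof.
rewrite -[X in measurable X]setTI; apply: measurable_inplane => //.
exact: measurable_cyl.
Qed.

Lemma Rintegral_tile i w : bmeas w ->
  \int[mu3]_(x in cyl (k * n)%:R) (w x * \1_(D i) x) =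
  \int[mu3]_(x in cyl k%:R) w (to_tile i x).
Proof.
move=> bw; have mc := @measurable_cyl R k%:R.
have bt : bmeas (fun x => w (to_tile i x)) by exact: bmeas_comp_shift.
have E := integral_inplane (lattice R (- (tile_corner i).1, - (tile_corner i).2))
   (ltr01 : 0 < 1) mc (bmeas_cyl_integrable k%:R bt).
rewrite expr1n invr1 mul1e in E.
rewrite [RHS]/Rintegral -E -/(D i) /Rintegral; congr fine.
rewrite -[LHS]/(\int[mu3]_(x in cyl (k * n)%:R) (w x * \1_(D i) x)%:E)%E.
rewrite integral_mkcond [RHS]integral_mkcond; apply: eq_integral => x _.
rewrite !patchE; case: (boolP (x \in D i)) => [/set_mem Dx|nD].
  rewrite mem_set; last exact: tile_sub Dx.
  by rewrite indicE mem_set// mulr1 /= of_tileK.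
by case: ifP => // _; rewrite indicE (negbTE nD) mulr0.
Qed.

Lemma tile_partition x : \sum_i \1_(D i) x <= 1 :> R.
Proof.
have [[i Di]|nD] := pselect (exists i, D i x); last first.
  by rewrite big1// => i _; rewrite indicE memNset// => Di; apply: nD; exists i.
rewrite (bigD1 i)//= big1 ?addr0; first by rewrite indicE; case: (_ \in _).
move=> j ji; rewrite indicE memNset// => Dj; move: ji.
by rewrite (tile_disjoint Dj Di) eqxx.
Qed.

(** The open tiles miss the grid lines between them. The remainder [r] is nonnegative and its
    integral is the area of the large cell minus those of the tiles, that is 0; since w is bounded,
    w r integrates to 0 as well. *)
Lemma Rintegral_tiles w : bmeas w ->
  \int[mu3]_(x in cyl (k * n)%:R) w x =
  \sum_i \int[mu3]_(x in cyl k%:R) w (to_tile i x).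
Proof.
move=> bw; pose r x : R := 1 - \sum_i \1_(D i) x.
have bI i : bmeas (\1_(D i) : space -> R) := bmeas_indic (mD i).
have bS : bmeas (fun x => \sum_i \1_(D i) x : R) by exact: bmeas_sum.
have br : bmeas r := bmeasB (bmeas_cst 1) bS.
have r0 x : 0 <= r x by rewrite subr_ge0 tile_partition.
have sumI (v : space -> R) : bmeas v ->
    \int[mu3]_(x in cyl (k * n)%:R) (v x * \sum_i \1_(D i) x) =
    \sum_i \int[mu3]_(x in cyl k%:R) v (to_tile i x).
  move=> bv; under [RHS]eq_bigr do rewrite -Rintegral_tile//.
  under eq_Rintegral do rewrite mulr_sumr.
  elim: (index_enum _) => [|i s IH].
    by under eq_Rintegral do rewrite big_nil; rewrite Rintegral_cyl_cst// big_nil mul0r.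
  rewrite big_cons -IH -Rintegral_cylD; last 2 first.
  - exact: bmeasM.
  - by apply: bmeas_sum => j; exact: bmeasM.
  by apply: eq_Rintegral => x _; rewrite big_cons.
have Ir : \int[mu3]_(x in cyl (k * n)%:R) r x = 0.
  have -> : \int[mu3]_(x in cyl (k * n)%:R) r x =
      \int[mu3]_(x in cyl (k * n)%:R) 1 - \int[mu3]_(x in cyl (k * n)%:R) (1 * \sum_i \1_(D i) x).
    under [X in _ - X]eq_Rintegral do rewrite mul1r.
    rewrite -RintegralB//; [exact: measurable_cyl|exact: bmeas_cyl_integrable (bmeas_cst 1)|].
    exact: bmeas_cyl_integrable.
  rewrite (sumI (fun=> 1)); last exact: bmeas_cst.
  rewrite !Rintegral_cyl_cst// sumr_const card_prod !card_ord.
  by rewrite !mul1r -mulr_natl !natrM exprMn; ring.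
have Iwr : \int[mu3]_(x in cyl (k * n)%:R) (w x * r x) = 0.
  have [K hK] := bw.2.
  have K0 : 0 <= K := le_trans (normr_ge0 _) (hK 0).
  have bKr := bmeasM (bmeas_cst K) br; have bKNr := bmeasM (bmeas_cst (- K)) br.
  have bwr := bmeasM bw br.
  apply/eqP; rewrite eq_le; apply/andP; split.
    rewrite -[leRHS](mulr0 K) -Ir -Rintegral_cylZ//.
    apply: Rintegral_cyl_le => // x _; rewrite ler_wpM2r//.
    by apply: le_trans (hK x); exact: ler_norm.
  rewrite -[leLHS](mulr0 (- K)) -Ir -Rintegral_cylZ//.
  apply: Rintegral_cyl_le => // x _; rewrite ler_wpM2r//.
  by rewrite lerNl; apply: le_trans (hK x); rewrite -normrN ler_norm.
have -> : \int[mu3]_(x in cyl (k * n)%:R) w x =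
    \int[mu3]_(x in cyl (k * n)%:R) (w x * \sum_i \1_(D i) x) +
    \int[mu3]_(x in cyl (k * n)%:R) (w x * r x).
  rewrite -(Rintegral_cylD _ (bmeasM bw bS) (bmeasM bw br)).
  by apply: eq_Rintegral => x _; rewrite /r; ring.
by rewrite Iwr addr0 sumI.
Qed.

End Tiles.

(** * The homogenized density *)

(** Cost of the layer around n tiles per side when the cell has relative size s: (s - n)(s + n) <= 2
    (2s). *)
Lemma enlarge_arith (R : realType) (C s n e : R) : 0 <= C -> 3 <= s ->
  s - 2 <= n -> n <= s -> 8 * (C + 1) <= s * e ->
  C * (s ^+ 2 - n ^+ 2) <= s ^+ 2 * (e / 2).
Proof.
move=> C0 s3 sn ns se.
apply: (@le_trans _ _ (C * (4 * s))); first by apply: ler_wpM2l => //; nra.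
have : s * (8 * (C + 1)) <= s * (s * e) by apply: ler_wpM2l => //; lra.
by rewrite expr2 => h; nra.
Qed.

Section Homogenization.
Variables (R : realType) (Phi : R -> R) (alpha beta : R).
Hypotheses (yPhi : young Phi) (alpha_gt0 : 0 < alpha) (alpha_le : alpha <= beta).
Local Notation space := (space3 R).
Local Notation cyl t := (cylinder (square t) : set (space3 R)).
Local Notation mat := 'M[R]_(3, 2 + 1).
Local Notation vec := 'cV[R]_3.
Variable f : space -> mat -> R.
Hypothesis gf : good_integrand Phi alpha beta f.
Implicit Types (t r : R) (A G : space -> mat) (T : set vec) (xi : 'M[R]_(3, 2)).
Local Notation energy := (energy f).
Local Notation ecell := (ecell f).

Lemma integrand_periodic (ab : int * int) x Z : f (inplane 1 (lattice R ab) x) Z = f x Z.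
Proof.
have [_ per _] := gf.
have step1 (i : 'I_2) (k : nat) y : f (y.1 + basis2 i *+ k, y.2) Z = f y Z.
  elim: k y => [|k IH] y; first by rewrite mulr0n addr0; case: y.
  by rewrite mulrS addrA; have /= -> := IH (y.1 + basis2 i, y.2); exact: per.
have step2 (i : 'I_2) (k : int) y : f (y.1 + basis2 i *~ k, y.2) Z = f y Z.
  case: k => k; first exact: step1.
  rewrite NegzE mulrNz -pmulrn; have /= <- := step1 i k.+1 (y.1 - basis2 i *+ k.+1, y.2).
  by rewrite subrK; case: y.
have pairMz (p : plane2 R) (a : int) : p *~ a = (p.1 *~ a, p.2 *~ a).
  by rewrite [LHS]surjective_pairing -!raddfMz.
case: ab => a b.
have -> : inplane 1 (lattice R (a, b)) x = ((x.1 + basis2 0 *~ a) + basis2 1 *~ b, x.2).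
  rewrite !pairMz /inplane/lattice/= !mul1r !mul0rz addr0.
  case: x => -[x1 x2] x3.
  change ((x1 + a%:~R, x2 + b%:~R, x3) = (x1 + a%:~R + 0, x2 + 0 + b%:~R, x3) :> space).
  by rewrite !addr0.
by rewrite (step2 1 b (x.1 + basis2 0 *~ a, x.2)) step2.
Qed.

Lemma energy_tiles (k m : nat) T (phi : 'I_(m.*2.+1) * 'I_(m.*2.+1) -> space -> vec)
    (G : 'I_(m.*2.+1) * 'I_(m.*2.+1) -> space -> mat) : subspace T ->
  (forall i, Adm T k%:R (phi i) (G i)) ->
  exists phi' G', Adm T (k * m.*2.+1)%:R phi' G' /\ forall A, bmeas_mx A ->
    energy (k * m.*2.+1)%:R (fun x => A x + G' x) =
    \sum_i energy k%:R (fun x => A (to_tile k i x) + G i x).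
Proof.
move=> sT aG; pose G' x := \sum_i G i (of_tile k i x).
exists (fun x => \sum_i phi i (of_tile k i x)), G'.
have aG' : Adm T (k * m.*2.+1)%:R (fun x => \sum_i phi i (of_tile k i x)) G'.
  have aGi i := Adm_shift (b := lattice R (- (tile_corner k i).1, - (tile_corner k i).2))
    erefl (tile_bound R k i) (aG i).
  exact: (Adm_sum (index_enum _) sT aGi).
split => // A bA; have bZ := bmeas_mxD bA (Adm_bmeas_mx aG').
rewrite /energy (Rintegral_tiles k m (bmeas_integrand yPhi alpha_gt0 alpha_le gf bZ)).
apply: eq_bigr => i _; apply: eq_Rintegral => x /set_mem cx.
rewrite /to_tile integrand_periodic -/(to_tile k i x); congr (f x (_ + _)).
rewrite /G' (bigD1 i)//= to_tileK big1 ?addr0// => j ji.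
apply: (Adm_G0 (aG j)) => cj; move: ji.
have := @tile_disjoint R k m j i (to_tile k i x) cj.
by rewrite to_tileK => /(_ cx) ->; rewrite eqxx.
Qed.

Lemma Rintegral_cyl_enlarge t r (c : R) (w : space -> R) : 0 <= t -> t <= r ->
  bmeas w -> (forall x, cyl r x -> ~ cyl t x -> w x <= c) ->
  \int[mu3]_(x in cyl r) w x <= \int[mu3]_(x in cyl t) w x + c * (r ^+ 2 - t ^+ 2).
Proof.
move=> t0 tr bw wc; have mt := @measurable_cyl R t.
have bI := bmeas_indic mt.
have bwc := bmeasB bw (bmeas_cst c).
have bwI := bmeasM bwc bI.
have -> : \int[mu3]_(x in cyl t) w x + c * (r ^+ 2 - t ^+ 2) =
    \int[mu3]_(x in cyl r) ((w x - c) * \1_(cyl t) x + c).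
  rewrite Rintegral_cylD//; last exact: bmeas_cst.
  rewrite Rintegral_cyl_cst ?(le_trans t0)//.
  rewrite (@Rintegral_sub R (cyl t) (cyl r) (fun x => (w x - c) * \1_(cyl t) x)); last 2 first.
  - exact: cyl_le.
  - by move=> x _ nx; rewrite indicE memNset// mulr0.
  have -> : \int[mu3]_(x in cyl t) ((w x - c) * \1_(cyl t) x) =
      \int[mu3]_(x in cyl t) (w x - c).
    by apply: eq_Rintegral => x cx; rewrite indicE cx mulr1.
  rewrite Rintegral_cylD//; last exact: bmeas_cst.
  rewrite Rintegral_cyl_cst//; ring.
apply: (Rintegral_cyl_le bw (bmeasD bwI (bmeas_cst c))) => x cx.
rewrite indicE; case: (boolP (x \in cyl t)) => [_|]; first by rewrite mulr1 subrK.
by rewrite notin_setE mulr0 add0r; exact: wc.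
Qed.

Lemma ecell_enlarge T xi t r : subspace T -> 0 < t -> t <= r ->
  r ^+ 2 * ecell T xi r <= t ^+ 2 * ecell T xi t +
    beta * (1 + Phi (enorm xi)) * (r ^+ 2 - t ^+ 2).
Proof.
move=> sT t0 tr; have r0 : 0 < r := lt_le_trans t0 tr.
apply/ler_addgt0Pr => e e0.
have e1 : 0 < e / t ^+ 2 by rewrite divr_gt0// exprn_gt0.
have [phi [G [aG Ge]]] := ecell_adherent yPhi alpha_gt0 gf xi t sT e1.
have aG' := Adm_le tr aG.
have le1 := ecell_le yPhi alpha_gt0 gf xi aG'.
move: le1; rewrite ler_pdivlMl ?exprn_gt0// => le1; apply: le_trans le1 _.
have bG := bmeas_mxD (bmeas_mx_cst (flat_mx xi)) (Adm_bmeas_mx aG).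
apply: le_trans (Rintegral_cyl_enlarge (c := beta * (1 + Phi (enorm xi))) (ltW t0) tr
  (bmeas_integrand yPhi alpha_gt0 alpha_le gf bG) _) _.
  move=> x _ nx; rewrite (Adm_G0 aG nx) addr0.
  by have [_ _ /(_ x (flat_mx xi))/andP[_]] := gf; rewrite enorm_row_mx0.
rewrite addrAC lerD2r.
move: Ge; rewrite ltr_pdivrMl ?exprn_gt0// mulrDr mulrCA divff ?mulr1 => [/ltW//|].
by rewrite expf_neq0// gt_eqF.
Qed.

Lemma ecell_tile T xi (k m : nat) : subspace T -> (0 < k)%N ->
  ecell T xi (k * m.*2.+1)%:R <= ecell T xi k%:R.
Proof.
move=> sT k0; apply/ler_addgt0Pr => e e0.
have [phi [G [aG Ge]]] := ecell_adherent yPhi alpha_gt0 gf xi k%:R sT e0.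
have [phi' [G' [aG' E]]] := @energy_tiles k m T (fun=> phi) (fun=> G) sT (fun=> aG).
apply: le_trans (ecell_le yPhi alpha_gt0 gf xi aG') _.
rewrite (E (fun=> flat_mx xi)); last exact: bmeas_mx_cst.
apply: le_trans (ltW Ge); rewrite sumr_const card_prod !card_ord -[X in _ * X <= _]mulr_natl.
have k0' : k%:R != 0 :> R by rewrite pnatr_eq0 -lt0n.
rewrite le_eqVlt; apply/orP; left; apply/eqP.
rewrite !natrM; set N : R := m.*2.+1%:R; have N0 : N != 0 by rewrite pnatr_eq0.
by clearbody N; field; rewrite ?N0 ?k0'.
Qed.

Definition hom T xi : R := inf [set ecell T xi k.+1%:R | k in [set: nat]].

Lemma hom_le_ecell T xi (k : nat) : subspace T -> (0 < k)%N ->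
  hom T xi <= ecell T xi k%:R.
Proof.
move=> sT; case: k => // k _; apply: ge_inf; last by exists k.
by exists 0 => _ [j _ <-]; exact: (ecell_ge0 yPhi alpha_gt0 gf).
Qed.

Lemma hom_ge0 T xi : subspace T -> 0 <= hom T xi.
Proof.
move=> sT; apply: lb_le_inf; first by exists (ecell T xi 1%:R); exists 0%N.
by move=> _ [j _ <-]; exact: (ecell_ge0 yPhi alpha_gt0 gf).
Qed.

Lemma hom_upper T xi : subspace T -> hom T xi <= beta * (1 + Phi (enorm xi)).
Proof.
move=> sT; apply: le_trans (hom_le_ecell xi sT (ltn0Sn 0)) _.
exact: (ecell_upper yPhi alpha_gt0 alpha_le gf).
Qed.

(** Enlarge the cell to the next integer size, at most t + 1, where [hom] is a lower bound by
    definition; the layer accounts for the error. *)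
Lemma ecell_ge_hom T xi t : subspace T -> 0 < t ->
  hom T xi - beta * (1 + Phi (enorm xi)) * ((t + 1) ^+ 2 / t ^+ 2 - 1) <= ecell T xi t.
Proof.
move=> sT t0; set C := beta * _.
have C0 : 0 <= C := le_trans (hom_ge0 xi sT) (hom_upper xi sT).
pose r := (Num.truncn t).+1.
have tr : t <= r%:R by rewrite ltW// truncnS_gt.
have rt : r%:R <= t + 1 by rewrite -natr1 lerD2r truncn_le// ltW.
have h1 := ecell_enlarge xi sT t0 tr.
have h2 := hom_le_ecell xi sT (ltn0Sn (Num.truncn t)); rewrite -/r in h2.
have h0 := hom_ge0 xi sT.
have t2 : 0 < t ^+ 2 by rewrite exprn_gt0.
rewrite -(ler_pM2l t2) mulrBr.
have -> : t ^+ 2 * (C * ((t + 1) ^+ 2 / t ^+ 2 - 1)) = C * ((t + 1) ^+ 2 - t ^+ 2).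
  by field; rewrite gt_eqF.
have r2 : r%:R ^+ 2 <= (t + 1) ^+ 2 by rewrite ler_pXn2r ?nnegrE// ltW// addr_gt0.
have t2r : t ^+ 2 <= r%:R ^+ 2 by rewrite ler_pXn2r ?nnegrE// ltW.
rewrite lerBlDr.
apply: (@le_trans _ _ (r%:R ^+ 2 * ecell T xi r%:R)).
  by apply: ler_pM => //; exact: ltW.
apply: le_trans h1 _; rewrite lerD2l; apply: ler_wpM2l => //.
by rewrite lerD2r.
Qed.

Lemma ecell_le_hom T xi e : subspace T -> 0 < e ->
  exists2 t0 : R, 0 < t0 & forall t, t0 <= t -> ecell T xi t <= hom T xi + e.
Proof.
move=> sT e0; set C := beta * (1 + Phi (enorm xi)).
have C0 : 0 <= C := le_trans (hom_ge0 xi sT) (hom_upper xi sT).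
have e2 : 0 < e / 2 by rewrite divr_gt0.
have hi : has_inf [set ecell T xi k.+1%:R | k in [set: nat]].
  split; first by exists (ecell T xi 1%:R); exists 0%N.
  by exists 0 => _ [j _ <-]; exact: (ecell_ge0 yPhi alpha_gt0 gf).
have [_ [k _ <-] hk] := inf_adherent e2 hi; rewrite -/(hom T xi) in hk.
have k0 : 0 < k.+1%:R :> R by [].
(* For t >= t0 the ratio s = t / k satisfies s >= 3 and s e >= 8 (C + 1), as the layer estimate
   demands. *)
pose t0 := k.+1%:R * (8 * (C + 1) / e + 3).
have q0 : 0 < 8 * (C + 1) / e by rewrite divr_gt0// mulr_gt0// ltr_wpDl.
exists t0 => [|t tt0]; first by rewrite mulr_gt0// addr_gt0.
have t1 : 0 < t by apply: lt_le_trans tt0; rewrite mulr_gt0// addr_gt0.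
pose s := t / k.+1%:R.
have s0 : 8 * (C + 1) / e + 3 <= s by rewrite ler_pdivlMr// mulrC.
have s3 : 3 <= s by apply: le_trans s0; rewrite lerDr ltW.
(* Makes 2m+1 an odd number of tiles between s - 2 and s. *)
pose m := (Num.truncn (s - 1))./2.
have mE : (m.*2 <= Num.truncn (s - 1) < m.*2.+2)%N.
  by rewrite -[X in (_ <= X < _)%N]odd_double_half -/m; case: (odd _); rewrite ?add0n ?add1n leqnn ?leqnSn ?ltnSn.
have [m1 m2] := andP mE.
have sm : m.*2.+1%:R <= s.
  by rewrite -natr1 -lerBrDr -truncn_ge_nat// subr_ge0; lra.
have ms : s - 2 <= m.*2.+1%:R.
  have : s - 1 < (Num.truncn (s - 1)).+1%:R by rewrite truncnS_gt.
  have : (Num.truncn (s - 1)).+1%:R <= m.*2.+2%:R :> R by rewrite ler_nat.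
  rewrite -[m.*2.+2%:R]natr1; lra.
pose N : R := (k.+1 * m.*2.+1)%:R.
have N0 : 0 < N by rewrite ltr0n muln_gt0.
have Nt : N <= t by rewrite /N natrM -ler_pdivlMl// mulrC.
have h1 := ecell_enlarge xi sT N0 Nt.
have h2 := ecell_tile xi m sT (ltn0Sn k).
have h0 := ecell_ge0 yPhi alpha_gt0 gf xi k.+1%:R sT.
have t2 : 0 < t ^+ 2 by rewrite exprn_gt0.
rewrite -(ler_pM2l t2); apply: le_trans h1 _.
have NN : N ^+ 2 <= t ^+ 2 by rewrite ler_pXn2r ?nnegrE// ltW.
have key : C * (t ^+ 2 - N ^+ 2) <= t ^+ 2 * (e / 2).
  have tE : t = k.+1%:R * s by rewrite mulrC divfK// gt_eqF.
  have -> : C * (t ^+ 2 - N ^+ 2) = k.+1%:R ^+ 2 * (C * (s ^+ 2 - m.*2.+1%:R ^+ 2)).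
    by rewrite /N natrM tE; ring.
  have -> : t ^+ 2 * (e / 2) = k.+1%:R ^+ 2 * (s ^+ 2 * (e / 2)).
    by rewrite tE exprMn mulrA.
  apply: ler_wpM2l; first by rewrite exprn_ge0.
  apply: enlarge_arith => //.
  by rewrite -ler_pdivrMr//; apply: le_trans s0; rewrite lerDl.
apply: (@le_trans _ _ (t ^+ 2 * ecell T xi k.+1%:R + t ^+ 2 * (e / 2))).
  apply: lerD; last exact: key.
  by apply: ler_pM; [exact: sqr_ge0|exact: (ecell_ge0 yPhi alpha_gt0 gf)|exact: NN|exact: h2].
rewrite -mulrDr ler_pM2l//; apply: le_trans (lerD (ltW hk) (lexx _)) _.
by rewrite -addrA -splitr.
Qed.

Lemma ecell_cvg T xi : subspace T -> ecell T xi t @[t --> +oo] --> hom T xi.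
Proof.
move=> sT; set C := beta * (1 + Phi (enorm xi)).
have C0 : 0 <= C := le_trans (hom_ge0 xi sT) (hom_upper xi sT).
apply/cvgrPdist_le => e e0.
have [t0 t00 H] := ecell_le_hom xi sT e0.
(* For t >= 1 the relative area of the layer is (2t + 1)/t^2 <= 3/t, which the second term makes at
   most e / (C + 1). *)
pose t1 := Num.max t0 (3 * (C + 1) / e + 1).
exists t1; split; first exact: num_real.
move=> t /ltW; rewrite ge_max => /andP[tt0 tt1].
have t_gt0 : 0 < t := lt_le_trans t00 tt0.
have h1 := H t tt0; have h2 := ecell_ge_hom xi sT t_gt0.
rewrite ler_distl; apply/andP; split; first by lra.
have q0 : 0 < 3 * (C + 1) / e by rewrite divr_gt0// mulr_gt0// ltr_wpDl.
have key : C * ((t + 1) ^+ 2 / t ^+ 2 - 1) <= e.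
  have t2 : 0 < t ^+ 2 by rewrite exprn_gt0.
  rewrite -(ler_pM2l t2) (_ : t ^+ 2 * _ = C * (2 * t + 1)); last first.
    by field; rewrite gt_eqF.
  have : 3 * (C + 1) <= t * e.
    by rewrite -ler_pdivrMr//; apply: le_trans tt1; rewrite lerDl.
  move=> h3; apply: (@le_trans _ _ (t * (3 * (C + 1)))).
    have t1' : 1 <= t by apply: le_trans tt1; rewrite lerDr ltW.
    by clear -C0 t1'; nra.
  by rewrite expr2 -mulrA; apply: ler_wpM2l => //; exact: ltW.
by move: h2; rewrite -/C; lra.
Qed.

End Homogenization.

Section MoreAdmissible.
Variable R : realType.
Local Notation space := (space3 R).
Local Notation slab := (@slab R).
Local Notation cyl t := (cylinder (square t) : set (space3 R)).
Local Notation vec := 'cV[R]_3.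
Local Notation mat := 'M[R]_(3, 2 + 1).
Implicit Types (t b : R) (T : set vec) (phi : space -> vec) (G : space -> mat)
  (u : space -> R).

Lemma Adm_add T t phi1 G1 phi2 G2 : subspace T -> Adm T t phi1 G1 ->
  Adm T t phi2 G2 -> Adm T t (fun x => phi1 x + phi2 x) (fun x => G1 x + G2 x).
Proof.
move=> sT A1 A2.
have H (b : bool) : Adm T t (if b then phi1 else phi2) (if b then G1 else G2) by case: b.
have := Adm_sum [:: true; false] sT H.
rewrite (_ : (fun x => \sum_(k <- _) _) = fun x => phi1 x + phi2 x); last first.
  by apply/funext => x; rewrite !big_cons big_nil addr0.
rewrite (_ : (fun x => \sum_(k <- _) _) = fun x => G1 x + G2 x)//.
by apply/funext => x; rewrite !big_cons big_nil addr0.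
Qed.

Lemma basis3_norm j : `|basis3 j : space| <= 1.
Proof.
rewrite !prod_normE !ge_max /basis3/=.
by apply/andP; split; [apply/andP; split|];
  case: (_ == _); rewrite /= ?normr1 ?normr0.
Qed.

(** Entry point for explicit fields, given by a formula on the whole space; the indicator of the
    slab brings their gradient into the normal form of [scalar_adm]. *)
Lemma lipschitz_scalar_adm t b u (g : 'I_3 -> space -> R) (K : R) : b <= t / 2 ->
  continuous (u : space -> R^o) -> bmeas u -> (forall j, bmeas (g j)) ->
  (forall x, b <= `|x.1| -> u x = 0) ->
  (forall j x, b <= `|x.1| -> g j x = 0) ->
  (forall j x (h : R), `|u (x + h *: basis3 j) - u x| <= K * `|h|) ->
  (forall j, {ae mu3, forall x, is_derive (x : space) (basis3 j) (u : space -> R^o) (g j x)}) ->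
  scalar_adm t u (fun j x => \1_slab x * g j x).
Proof.
move=> bt cu bu bg u0 g0 lu du; have off x : ~ square t x.1 -> b <= `|x.1|.
  move=> nx; apply: le_trans bt _; rewrite leNgt; apply/negP => h.
  by apply: nx; apply/square_norm.
have bI := bmeas_indic (@measurable_slab R).
split; [exact: cu|by move=> x /off; exact: u0|exact: bu|].
move=> j; split; first exact: (bmeasM bI (bg j)).
  move=> x nx; have [[_ sx]|ns] := pselect (slab x); last first.
    by rewrite indicE memNset// mul0r.
  by rewrite g0 ?mulr0//; apply: off => sq; apply: nx.
have := wderiv_lipschitz bu (bg j) (lu j) (du j).
move=> H theta tth; rewrite (H theta tth); congr (- _)%E.
by apply: eq_integral => x /set_mem sx; rewrite indicE mem_set// mul1r.
Qed.

Lemma derive_zero_line (V : normedModType R) (w : V -> R^o) x v :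
  (\forall h \near (0 : R), w (h *: v + x) = w x) -> 'D_v w x = 0.
Proof.
move=> H; rewrite /derive; apply: lim_near_cst; first exact: Rhausdorff.
have {}H : \forall h \near (0 : R)^', w (h *: v + x) = w x.
  exact: cvg_within H.
by apply: filterS H => h /= ->; rewrite subrr scaler0.
Qed.

(** Test with bumps of a box of twice the in-plane side: since h <= 1/2 their plateau covers the
    square, so their in-plane derivatives vanish where u does not, and they converge to 1 on the
    cell. Vertical derivatives are excluded because u is free on the top and bottom faces. *)
Lemma scalar_adm_mean t u (g : 'I_3 -> space -> R) (j : 'I_3) : 0 < t -> (j < 2)%N ->
  scalar_adm t u g -> \int[mu3]_(x in cyl t) g j x = 0.
Proof.
move=> t0 j2 [cu u0 bu /(_ j)[bg g0 wg]].
pose a : space := ((- t, - t), - 2^-1); pose b : space := ((t, t), 2^-1).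
have nab : nondeg a b by split; rewrite /a /b/=; lra.
have sub : obox a b `<=` slab.
  by move=> x [_ /= h]; split => //.
have ctO : cyl t `<=` obox a b.
  move=> x /cylP[h1 h2 h3]; split; [split|] => /=; rewrite in_itv/= -ltr_norml//.
    by apply: lt_le_trans h1 _; lra.
  by apply: lt_le_trans h2 _; lra.
have tth n : test_function slab (bump a b n) := test_functionS sub (bump_test n nab).
have D0 n x : square t x.1 -> 'D_(basis3 j) (bump a b n) x = 0.
  move=> /squareP[h1 h2]; apply: derive_zero_line.
  have h : n.+2%:R^-1 <= 2^-1 :> R by rewrite lef_pV2 ?posrE// ler_nat.
  have P1 (y : R) : `|y| < t / 2 -> plateau ((t - - t) / 2 * (1 - n.+2%:R^-1))
      ((t - - t) / 2 * (1 - n.+2%:R^-1 / 2)) (y - (- t + t) / 2) = 1.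
    have h0 : 0 < n.+2%:R^-1 :> R by rewrite invr_gt0.
    move: (n.+2%:R^-1) h h0 => z h h0 yt; apply: plateau_eq1; first by nra.
    by rewrite addNr mul0r subr0; apply: le_trans (ltW yt) _; nra.
  pose d := Num.min (t / 2 - `|x.1.1|) (t / 2 - `|x.1.2|).
  have d0 : 0 < d by rewrite lt_min !subr_gt0 h1 h2.
  exists d => //= s; rewrite /ball_/= sub0r normrN => sd.
  have near1 (y c : R) : `|y| < t / 2 -> d <= t / 2 - `|y| -> `|c| <= 1 -> `|s * c + y| < t / 2.
    move=> yt dy c1; apply: le_lt_trans (ler_normD _ _) _.
    have : `|s * c| <= `|s| by rewrite normrM ler_piMr.
    lra.
  have /andP[/andP[b1 b2] _] : (`|(basis3 j : space).1.1| <= 1) &&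
      (`|(basis3 j : space).1.2| <= 1) && (`|(basis3 j : space).2| <= 1).
    by have := basis3_norm j; rewrite !prod_normE !ge_max.
  have E3 : (s *: (basis3 j : space) + x).2 = x.2.
    rewrite /= /basis3/= (_ : (j == 2%N :> nat) = false); last by rewrite ltn_eqF.
    by rewrite scaler0 add0r.
  have p1 : `|(s *: (basis3 j : space) + x).1.1| < t / 2.
    by apply: near1 => //; rewrite /d ge_min lexx.
  have p2 : `|(s *: (basis3 j : space) + x).1.2| < t / 2.
    by apply: near1 => //; rewrite /d ge_min lexx orbT.
  rewrite /bump; cbv zeta; rewrite E3.
  have Q1 y (yt : `|y| < t / 2) : plateau ((b.1.1 - a.1.1) / 2 * (1 - n.+2%:R^-1))
    ((b.1.1 - a.1.1) / 2 * (1 - n.+2%:R^-1 / 2)) (y - (a.1.1 + b.1.1) / 2) = 1 := P1 y yt.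
  have Q2 y (yt : `|y| < t / 2) : plateau ((b.1.2 - a.1.2) / 2 * (1 - n.+2%:R^-1))
    ((b.1.2 - a.1.2) / 2 * (1 - n.+2%:R^-1 / 2)) (y - (a.1.2 + b.1.2) / 2) = 1 := P1 y yt.
  by rewrite (Q1 _ p1) (Q2 _ p2) (Q1 _ h1) (Q2 _ h2).
have Z n : \int[mu3]_(x in cyl t) (g j x * bump a b n x) = 0.
  have := iffLR (wderivP j bu bg) wg _ (tth n).
  have -> : \int[mu3]_(x in slab) (u x * 'D_(basis3 j) (bump a b n) x) = 0.
    rewrite (@eq_Rintegral _ _ _ _ _ (fun=> 0)); last first.
      move=> x _; have [sq|sq] := pselect (square t x.1); first by rewrite D0// mulr0.
      by rewrite u0// mul0r.
    by rewrite /Rintegral integral0_eq.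
  rewrite (@Rintegral_sub R (cyl t) slab); last 2 first.
  - exact: cyl_slab.
  - by move=> x _ nx; rewrite g0// mul0r.
  by move=> /esym/eqP; rewrite oppr_eq0 => /eqP.
have [Kg hKg] := bg.2; have mc := @measurable_cyl R t; have Lc := @L3_cyl_lty R t.
have cv : \int[mu3]_(x in cyl t) (g j x * bump a b n x) @[n --> \oo] -->
    \int[mu3]_(x in cyl t) g j x.
  apply: (@bounded_convergence _ _ _ _ _ (Kg * 1) mc mc Lc).
  - by move=> n; exact: (bmeasM bg (test_bmeas (tth n))).1.
  - exact: bg.1.
  - by move=> n x _; rewrite normrM ler_pM//; exact: bump_norm.
  - by move=> n x cx /(_ cx).
  - apply: aeW => x cx; have := @bump_cvg R a b x nab.
    rewrite indicE mem_set; last exact: ctO.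
    move=> h; rewrite -[X in _ --> X]mulr1; apply: cvgM; [exact: cvg_cst|exact: h].
move: cv; rewrite (_ : (fun n => _) = fun=> 0); last by apply/funext.
by move=> cv; apply: (cvg_unique (@Rhausdorff R) cv); exact: cvg_cst.
Qed.

End MoreAdmissible.

(** * Growth and Lipschitz estimates *)

Lemma halves_le (R : realType) (u v w z y e : R) :
  w - u <= e / 2 -> v <= z + e / 2 -> u <= v + y -> w <= z + y + e.
Proof. by move=> *; lra. Qed.

Section AffineCutoff.
Variable R : realType.
Local Notation space := (space3 R).
Local Notation slab := (@slab R).
Local Notation cyl t := (cylinder (square t) : set (space3 R)).
Local Notation vec := 'cV[R]_3.
Local Notation mat := 'M[R]_(3, 2 + 1).
Implicit Types (a b t : R) (T : set vec) (zeta : 'M[R]_(3, 2)).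

Definition lin_vec zeta (x : space) : vec := x.1.1 *: col 0 zeta + x.1.2 *: col 1 zeta.

Definition cut_fun a b zeta (x : space) : vec := cutoff a b x *: lin_vec zeta x.

Definition cut_grad a b zeta (x : space) : mat := \1_slab x *:
  (cutoff a b x *: flat_mx zeta +
   lin_vec zeta x *m (\row_j 'D_(basis3 j) (cutoff a b) x)).

Lemma lin_vecE zeta x i : lin_vec zeta x i 0 = lform (zeta i 0) (zeta i 1) 0 x.
Proof. by rewrite !mxE /lform mul0r addr0 mulrC (mulrC x.1.2). Qed.

Lemma flat_mx_lform zeta i (j : 'I_3) :
  flat_mx zeta i j = lform (zeta i 0) (zeta i 1) 0 (basis3 j).
Proof.
rewrite /flat_mx mxE /lform /basis3/= mul0r addr0; case: splitP => l jl.
  rewrite jl; case: l {jl} => -[|[|l]]//= ll; rewrite ?mulr1 ?mulr0 ?addr0 ?add0r.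
    by congr (zeta _ _); exact: val_inj.
  by congr (zeta _ _); exact: val_inj.
by rewrite mxE jl /= !mulr0 addr0.
Qed.

Lemma Adm_cut T a b t zeta : subspace T -> 0 <= a -> a < b -> b < t / 2 ->
  tangent_mx T zeta -> Adm T t (cut_fun a b zeta) (cut_grad a b zeta).
Proof.
move=> sT a0 ab bt tz.
have lT x : T (lin_vec zeta x).
  by apply: (subspaceD sT); apply: (subspaceZ sT); exact: tz.
split.
- move=> i; set l := lform (zeta i 0) (zeta i 1) 0.
  pose u (x : space) : R^o := cutoff a b x * l x.
  have uE : (fun x => cut_fun a b zeta x i 0) = u.
    by apply/funext => x; rewrite mxE lin_vecE.
  pose g j (x : space) : R := cutoff a b x * l (basis3 j) + l x * 'D_(basis3 j) (cutoff a b) x.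
  have gE : (fun (j : 'I_3) x => cut_grad a b zeta x i j) = fun j x => \1_slab x * g j x.
    apply/funext => j; apply/funext => x; rewrite /g /l -(flat_mx_lform zeta i j) -lin_vecE.
    rewrite /cut_grad [LHS]mxE [X in _ * X = _]mxE; congr (_ * (_ + _)).
      by rewrite [LHS]mxE.
    by rewrite [LHS]mxE big_ord1 [X in _ * X = _]mxE.
  rewrite uE gE.
  have dl (x v : space) : derivable (l : space -> R^o) x v /\ 'D_v (l : space -> R^o) x = l v.
    have h := derive_lform (zeta i 0) (zeta i 1) 0 id x v.
    split; first by apply: (@derivable_lform _ _ _ _ id); exact: derivable_id.
    by move: h; rewrite derive_id.
  have du x v : derivable u x v /\ 'D_v u x = cutoff a b x * l v + l x * 'D_v (cutoff a b) x.
    have [d1 d2] := dl x v; have dc := @cutoff_derivable R a b x v.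
    by have := derive_prod dc d1; rewrite d2.
  have b0 : 0 <= b by rewrite (le_trans a0)// ltW.
  pose c := `|zeta i 0| + `|zeta i 1|.
  have c0 : 0 <= c by rewrite addr_ge0.
  have lx x : `|l x| <= c * `|x.1|.
    rewrite /l /lform mul0r addr0 (le_trans (ler_normD _ _))// mulrDl.
    by apply: lerD; rewrite normrM ler_wpM2l// plane_normE le_max lexx ?orbT.
  have le j : `|l (basis3 j)| <= c.
    apply: le_trans (lx _) _; rewrite ler_piMr//.
    by have := basis3_norm R j; rewrite prod_normE ge_max => /andP[].
  have [C0 C00 hC] := @cutoff_derive_bounded R.
  have Cab : 0 <= C0 / (b - a) by rewrite divr_ge0 ?subr_ge0// ltW.
  (* Where the derivative of the cutoff is nonzero, |x.1| <= b and the linear factor is at most c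
     b. *)
  pose K := c + c * b * (C0 / (b - a)).
  have gK j x : `|g j x| <= K.
    apply: le_trans (ler_normD _ _) _; apply: lerD.
      by rewrite normrM -[leRHS]mul1r ler_pM// cutoff_norm.
    have [xb|xb] := leP `|x.1| b; last first.
      by rewrite cutoff_derive_eq0r// mulr0 normr0; apply: mulr_ge0 => //; apply: mulr_ge0.
    rewrite normrM ler_pM//.
      by apply: le_trans (lx x) _; rewrite ler_wpM2l.
    apply: le_trans (hC _ _ _ _ ab) _; rewrite ler_piMr//; exact: (basis3_norm R).
  have cl : continuous (l : space -> R^o) := @lform_continuous _ _ _ _.
  have bu : bmeas u.
    split.
      apply: measurable_funM; first exact: (cutoff_bmeas a b).1.
      exact: measurable_continuous3.
    exists (c * b) => x; have [xb|xb] := leP `|x.1| b; last first.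
      by rewrite /u cutoff_eq0 ?mul0r ?normr0 ?mulr_ge0// ltW.
    rewrite normrM -[leRHS]mul1r ler_pM// ?cutoff_norm//.
    by apply: le_trans (lx x) _; rewrite ler_wpM2l.
  apply: (@lipschitz_scalar_adm R t (t / 2) u g K).
  - exact: lexx.
  - by move=> x; apply: (@cvgM R); [exact: cutoff_continuous|exact: cl].
  - exact: bu.
  - move=> j; split; last by exists K => x; exact: gK.
    apply: measurable_funD.
      apply: measurable_funM; first exact: (cutoff_bmeas a b).1.
      exact: measurable_cst.
    apply: measurable_funM; first exact: measurable_continuous3.
    exact: (cutoff_derive_bmeas (basis3 j) ab).1.
  - by move=> x xt; rewrite /u cutoff_eq0 ?mul0r// (le_trans _ xt)// ltW.
  - move=> j x xt; have xb := lt_le_trans bt xt.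
    by rewrite /g cutoff_eq0 ?cutoff_derive_eq0r// ?mul0r ?mulr0 ?addr0// ltW.
  - move=> j x h; apply: mean_value_lipschitz => y; first exact: (du y _).1.
    by rewrite (du y _).2; exact: gK.
  - move=> j; apply: aeW => x; have [d1 d2] := du x (basis3 j).
    by apply: DeriveDef.
- by move=> x; apply: (subspaceZ sT).
- move=> x; rewrite -scalemxAr; congr (_ *: _).
  rewrite mulmxDr -scalemxAr flat_mx_proj//; congr (_ + _).
  by rewrite mulmxA projmxE// orthproj_id.
Qed.

Lemma cut_grad_inside a b zeta x : a < b -> slab x -> `|x.1| < a ->
  cut_grad a b zeta x = flat_mx zeta.
Proof.
move=> ab sx xa; rewrite /cut_grad indicE mem_set// scale1r cutoff_eq1// ?ltW//.
rewrite scale1r (_ : \row_j _ = 0) ?mulmx0 ?addr0//.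
by apply/rowP => j; rewrite !mxE cutoff_derive_eq0.
Qed.

Lemma enorm_outer (v : vec) (w : 'rV[R]_(2 + 1)) (c d : R) : 0 <= c -> 0 <= d ->
  (forall i, `|v i 0| <= c) -> (forall j, `|w 0 j| <= d) -> enorm (v *m w) <= 9 * (c * d).
Proof.
move=> c0 d0 vc wd; apply: le_trans (enorm_le_sum _) _.
apply: (@le_trans _ _ (\sum_(i < 3) \sum_(j < 2 + 1) c * d)).
  apply: ler_sum => i _; apply: ler_sum => j _.
  by rewrite mxE big_ord1 normrM ler_pM.
by rewrite !sumr_const !card_ord -mulrnA mulr_natl.
Qed.

End AffineCutoff.

Section GrowthAndLipschitz.
Variables (R : realType) (Phi : R -> R) (alpha beta : R).
Hypotheses (yPhi : young Phi) (alpha_gt0 : 0 < alpha) (alpha_le : alpha <= beta).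
Local Notation space := (space3 R).
Local Notation cyl t := (cylinder (square t) : set (space3 R)).
Local Notation mat := 'M[R]_(3, 2 + 1).
Local Notation vec := 'cV[R]_3.
Variable f : space -> mat -> R.
Hypothesis gf : good_integrand Phi alpha beta f.
Implicit Types (t r : R) (A G : space -> mat) (T : set vec) (xi : 'M[R]_(3, 2)).
Local Notation energy := (energy f).
Local Notation ecell := (ecell f).
Local Notation hom := (hom f).

Lemma Rintegral_cyl_sum t (I : Type) (s : seq I) (F : I -> space -> R) :
  0 <= t -> (forall i, bmeas (F i)) ->
  \int[mu3]_(x in cyl t) (\sum_(i <- s) F i x) = \sum_(i <- s) \int[mu3]_(x in cyl t) F i x.
Proof.
move=> t0 bF; elim: s => [|i s IH].
  by under eq_Rintegral do rewrite big_nil; rewrite Rintegral_cyl_cst// mul0r big_nil.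
rewrite big_cons -IH -(Rintegral_cylD t (bF i) (bmeas_sum s xpredT bF)).
by apply: eq_Rintegral => x _; rewrite big_cons.
Qed.

(* A supporting line of Phi at |xi|, with slope c, bounds the energy below by
   an affine function of G whose linear part has zero mean. *)
Lemma energy_lower T xi t phi G : 0 < t -> Adm T t phi G ->
  alpha * Phi (enorm xi) * t ^+ 2 <= energy t (fun x => flat_mx xi + G x).
Proof.
move=> t0 aG; set Z := flat_mx xi; have sE : enorm Z = enorm xi by exact: enorm_row_mx0.
(* The slope is divided by |xi| below; for xi = 0 the bound is nonnegativity of the energy. *)
have [xi0|xi0] := eqVneq (enorm xi) 0.
  by rewrite xi0 (young0 yPhi) mulr0 mul0r; exact: (energy_ge0 yPhi alpha_gt0 gf).
have s0 : 0 < enorm xi by rewrite lt_neqAle eq_sym xi0 enorm_ge0.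
have [c c0 hc] := young_subgradient yPhi (ltW s0).
set s := enorm xi in sE xi0 s0 hc *.
have bZ := bmeas_mxD (bmeas_mx_cst Z) (Adm_bmeas_mx aG).
(* The supporting line in the direction of xi: alpha (Phi(s) + (c/s) Z.G), using Z.(Z + G) <= s |Z +
   G|. *)
pose w x := alpha * Phi s + \sum_i \sum_j (alpha * c / s * Z i j) * G x i j.
have bij i j : bmeas (fun x => (alpha * c / s * Z i j) * G x i j).
  by apply: bmeasM; [exact: bmeas_cst|exact: (Adm_bmeas_mx aG)].
have bi i : bmeas (fun x => \sum_j (alpha * c / s * Z i j) * G x i j).
  by apply: bmeas_sum => j; exact: bij.
have bs : bmeas (fun x => \sum_i \sum_j (alpha * c / s * Z i j) * G x i j).
  by apply: bmeas_sum => i; exact: bi.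
have bw : bmeas w := bmeasD (bmeas_cst _) bs.
have -> : alpha * Phi s * t ^+ 2 = \int[mu3]_(x in cyl t) w x.
  rewrite /w Rintegral_cylD//; last exact: bmeas_cst.
  rewrite Rintegral_cyl_cst ?(ltW t0)// Rintegral_cyl_sum ?(ltW t0)//.
  rewrite [X in _ + X]big1 ?addr0// => i _; rewrite Rintegral_cyl_sum ?(ltW t0)//.
  rewrite big1// => j _; rewrite Rintegral_cylZ; last exact: (Adm_bmeas_mx aG).
  have [j2|j2] := ltnP j 2.
    have [/(_ i) H _ _] := aG.
    by rewrite (scalar_adm_mean t0 j2 H) mulr0.
  (* The third column of [xi|0] is zero, so the vertical derivative, whose mean is unknown, does not
     enter. *)
  suff -> : Z i j = 0 by rewrite mulr0 mul0r.
  rewrite /Z /flat_mx mxE; case: splitP => l jl; last by rewrite mxE.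
  by move: j2; rewrite jl leqNgt ltn_ord.
apply: (Rintegral_cyl_le bw (bmeas_integrand yPhi alpha_gt0 alpha_le gf bZ)) => x _.
have [_ _ /(_ x (Z + G x))/andP[+ _]] := gf; apply: le_trans.
have h1 := hc _ (enorm_ge0 (Z + G x)).
have h2 := edot_le Z (Z + G x); rewrite edotDr -enorm_sqr sE in h2.
have -> : w x = alpha * (Phi s + c / s * edot Z (G x)).
  rewrite /w mulrDr; congr (_ + _); rewrite /edot !mulr_sumr; apply: eq_bigr => i _.
  by rewrite !mulr_sumr; apply: eq_bigr => j _; ring.
apply: ler_wpM2l; first exact: ltW.
apply: le_trans h1; rewrite lerD2l -mulrA ler_wpM2l// mulrC ler_pdivrMr//.
by rewrite mulrBl lerBrDl -expr2 (mulrC (enorm _)).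
Qed.

Lemma hom_lower T xi : subspace T -> alpha * Phi (enorm xi) <= hom T xi.
Proof.
move=> sT; apply: lb_le_inf; first by exists (ecell T xi 1%:R); exists 0%N.
move=> _ [k _ <-]; apply: (ecell_glb sT) => phi G aG.
have k0 : 0 < k.+1%:R :> R by [].
by rewrite ler_pdivlMl ?exprn_gt0// mulrC; exact: energy_lower aG.
Qed.

Hypothesis Phi_delta2 : Delta2 Phi.

(** Iterating the doubling inequality handles factors 2^n, and K <= 2^n for n = trunc K + 1. The
    second alternative is for negative K, where monotonicity of [Phi] does not apply. *)
Lemma young_dilate (K : R) : exists2 C : R, 0 < C &
  forall r, 0 <= r -> Phi (K * (1 + r)) <= C * (1 + Phi r) \/ K < 0.
Proof.
have [C C0 hC] := young_delta2 yPhi Phi_delta2.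
have H (n : nat) : exists2 C' : R, 0 < C' & forall r, 0 <= r -> Phi (2 ^+ n * (1 + r)) <= C' * (1 + Phi r).
  elim: n => [|n [C' C'0 hC']].
    exists C => // r r0; apply: le_trans (hC r r0).
    by apply: (young_le yPhi); rewrite expr0 mul1r; lra.
  exists (C * (1 + C')) => [|r r0]; first by rewrite mulr_gt0// addr_gt0.
  have P0 := young_ge0 yPhi r0.
  have q0 : 0 <= 2 ^+ n * (1 + r) by rewrite mulr_ge0 ?exprn_ge0// addr_ge0.
  apply: (@le_trans _ _ (Phi (2 * (1 + 2 ^+ n * (1 + r))))).
    apply: (young_le yPhi); first by rewrite mulr_ge0 ?exprn_ge0// addr_ge0.
    by rewrite exprS -mulrA ler_wpM2l// lerDr.
  apply: le_trans (hC _ q0) _; rewrite -mulrA ler_wpM2l ?(ltW C0)//.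
  have := hC' r r0; nra.
have [C' C'0 hC'] := H (Num.truncn K).+1; exists C' => // r r0.
have [K0|K0] := leP 0 K; [left|by right].
apply: le_trans (hC' r r0); apply: (young_le yPhi); first by rewrite mulr_ge0// addr_ge0.
rewrite ler_wpM2r ?addr_ge0//; apply: le_trans (ltW (truncnS_gt K)) _.
by rewrite -natrX ler_nat ltnW// ltn_expl.
Qed.

(* A corrector for xi on the cell of size k, surrounded by a layer of relative
   width |xi - xi'| / (2 (1 + |xi| + |xi'|)) in which the linear map
   (xi - xi') x is cut off, competes for xi' on the enlarged cell. *)
Lemma hom_lipschitz : exists2 C : R, 0 < C & forall T xi xi', subspace T ->
  tangent_mx T xi -> tangent_mx T xi' ->
  hom T xi' <= hom T xi + C * enorm (xi - xi') *
    ((1 + Phi (enorm xi + enorm xi')) / (1 + (enorm xi + enorm xi'))).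
Proof.
have b0 := beta_gt0 alpha_gt0 alpha_le.
have [C0 C00 hC0] := @cutoff_derive_bounded R.
(* In the layer the gradient is at most r plus 9 (d t) C0 / (b - a), with b - a = del t / 4 and del
   = d / (2(1 + r)); the second term equals 72 C0 (1 + r). *)
pose K := 1 + 72 * C0; have K0 : 0 < K by rewrite addr_gt0// mulr_gt0.
have [C1 C10 hC1] := young_dilate K.
pose C := beta * (1 + C1); exists C => [|T xi xi' sT txi txi'].
  by rewrite mulr_gt0// addr_gt0.
set d := enorm (xi - xi'); set r := enorm xi + enorm xi'.
have d0 : 0 <= d := enorm_ge0 _; have r0 : 0 <= r by rewrite addr_ge0 ?enorm_ge0.
have [d_eq0|d_neq0] := eqVneq d 0.
  have : xi - xi' = 0 by apply/enorm_eq0.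
  by move=> /eqP; rewrite subr_eq0 => /eqP ->; rewrite d_eq0 mulr0 mul0r addr0.
have d_gt0 : 0 < d by rewrite lt_neqAle eq_sym d_neq0.
have dr : d <= r.
  by rewrite /d /r (le_trans (enormD _ _))// enormN.
have r1 : 0 < 1 + r by rewrite ltr_wpDr.
(* Relative width of the layer, proportional to the distance of the two gradients so that its cost
   is linear in d, and less than 1 as d <= r. *)
pose del := d / (2 * (1 + r)).
have del0 : 0 < del by rewrite divr_gt0// mulr_gt0.
have del1 : del < 1.
  by rewrite ltr_pdivrMr ?mulr_gt0// mul1r; lra.
pose M := C * (1 + Phi r).
have P0 := young_ge0 yPhi r0.
have M0 : 0 <= M by rewrite mulr_ge0 ?addr_ge0// mulr_ge0 ?addr_ge0// ltW.
have step k : 0 < k -> ecell T xi' (k / (1 - del)) <= ecell T xi k + M * (2 * del).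
  move=> k0; set t := k / (1 - del).
  have t0 : 0 < t by rewrite divr_gt0// subr_gt0.
  have kt : k = t * (1 - del) by rewrite divfK// subr_eq0 eq_sym lt_eqF.
  have ltkt : k < t by rewrite kt gtr_pMr//; lra.
  (* The cutoff descends in the inner half of the layer, from k/2 to the midpoint of k/2 and t/2. *)
  pose a := k / 2; pose b := (k + t) / 4.
  have a0 : 0 <= a by rewrite divr_ge0// ltW.
  have ab : a < b by rewrite /a /b; lra.
  have bt : b < t / 2 by rewrite /b; lra.
  have tz : tangent_mx T (xi - xi').
    move=> j; rewrite linearB/=; apply: (subspaceB sT); [exact: txi|exact: txi'].
  have aC := Adm_cut sT a0 ab bt tz.
  apply/ler_addgt0Pr => e e0.
  have [phi [G [aG Ge]]] := ecell_adherent yPhi alpha_gt0 gf xi k sT e0.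
  have aS := Adm_add sT (Adm_le (ltW ltkt) aG) aC.
  apply: le_trans (ecell_le yPhi alpha_gt0 gf xi' aS) _.
  have t2 : 0 < t ^+ 2 by rewrite exprn_gt0.
  rewrite ler_pdivrMl//.
  have bZ := bmeas_mxD (bmeas_mx_cst (flat_mx xi')) (Adm_bmeas_mx aS).
  apply: le_trans (Rintegral_cyl_enlarge (c := M) (ltW k0) (ltW ltkt)
    (bmeas_integrand yPhi alpha_gt0 alpha_le gf bZ) _) _.
    move=> x ct nk; rewrite (Adm_G0 aG nk) add0r.
    have [_ _ /(_ x (flat_mx xi' + cut_grad a b (xi - xi') x))/andP[_]] := gf.
    move=> h; apply: le_trans h _; rewrite /M /C -mulrA ler_wpM2l ?(ltW b0)//.
    suff : enorm (flat_mx xi' + cut_grad a b (xi - xi') x) <= K * (1 + r).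
      move=> h; have := young_le yPhi (enorm_ge0 _) h.
      have [h1 h2|h1] := hC1 r r0; last by have := lt_trans h1 K0; rewrite ltxx.
      have := le_trans h2 h1; nra.
    have /square_norm xt : square t x.1 by case: ct.
    have sx := cyl_slab ct.
    rewrite /cut_grad indicE mem_set// scale1r addrA.
    apply: le_trans (enormD _ _) _.
    (* xi' + chi (xi - xi') is a convex combination of xi and xi'. *)
    have e1 : enorm (flat_mx xi' + cutoff a b x *: flat_mx (xi - xi')) <= r.
      have -> : flat_mx xi' + cutoff a b x *: flat_mx (xi - xi') =
          (1 - cutoff a b x) *: flat_mx xi' + cutoff a b x *: flat_mx xi.
        rewrite /flat_mx !scale_row_mx !scaler0 !add_row_mx !addr0; congr row_mx.
        by rewrite scalerBr scalerBl scale1r addrCA addrC.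
      have c0 := @cutoff_ge0 R a b x; have c1 := @cutoff_le1 R a b x.
      apply: le_trans (enormD _ _) _; rewrite !enormZ !enorm_row_mx0.
      rewrite !ger0_norm ?subr_ge0//; have := enorm_ge0 xi; have := enorm_ge0 xi'.
      rewrite /r; nra.
    have e2 : enorm (lin_vec (xi - xi') x *m (\row_j 'D_(basis3 j) (cutoff a b) x)) <=
        9 * ((d * t) * (C0 / (b - a))).
      apply: enorm_outer.
      - by rewrite mulr_ge0// ltW.
      - by rewrite divr_ge0 ?subr_ge0// ltW.
      - move=> i; rewrite !mxE.
        have h0 := normr_entry_le (xi - xi') i 0; have h1 := normr_entry_le (xi - xi') i 1.
        rewrite !mxE -/d in h0 h1.
        have [x1 x2] : `|x.1.1| < t / 2 /\ `|x.1.2| < t / 2.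
          by move: xt; rewrite plane_normE gt_max => /andP.
        apply: le_trans (ler_normD _ _) _; rewrite !normrM.
        apply: (@le_trans _ _ (t / 2 * d + t / 2 * d)); last by lra.
        by apply: lerD; apply: ler_pM => //; exact: ltW.
      - move=> j; rewrite mxE; apply: le_trans (hC0 _ _ _ _ ab) _.
        by rewrite ler_piMr ?(basis3_norm R)// divr_ge0 ?subr_ge0// ltW.
    apply: le_trans (lerD e1 e2) _.
    have -> : b - a = del * t / 4 by rewrite /b /a kt; field.
    have -> : 9 * (d * t * (C0 / (del * t / 4))) = 72 * C0 * (1 + r).
      rewrite /del; field; rewrite !gt_eqF//.
    rewrite /K; have : 0 < 72 * C0 by rewrite mulr_gt0.
    by move: (72 * C0) => c c_gt0; nra.
  have -> : \int[mu3]_(x in cyl k) f x (flat_mx xi' + (G x + cut_grad a b (xi - xi') x)) =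
      energy k (fun x => flat_mx xi + G x).
    apply: eq_Rintegral => x /set_mem ck; congr (f x _).
    rewrite cut_grad_inside//; last 2 first.
    - exact: cyl_slab ck.
    - by case: ck => /square_norm.
    rewrite addrCA addrC; congr (_ + _).
    by rewrite /flat_mx add_row_mx addr0 addrC subrK.
  have E : energy k (fun x => flat_mx xi + G x) <= k ^+ 2 * (ecell T xi k + e).
    by rewrite -ler_pdivrMl ?exprn_gt0//; exact: ltW.
  apply: le_trans (lerD E (lexx _)) _.
  have e00 := ecell_ge0 yPhi alpha_gt0 gf xi k sT.
  have : k ^+ 2 * (ecell T xi k + e) <= t ^+ 2 * (ecell T xi k + e).
    rewrite ler_wpM2r ?addr_ge0 ?(ltW e0)// ler_pXn2r ?nnegrE//; exact: ltW.
  (* The layer has relative area 1 - (1 - del)^2 <= 2 del. *)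
  have : M * (t ^+ 2 - k ^+ 2) <= t ^+ 2 * (M * (2 * del)).
    have -> : t ^+ 2 - k ^+ 2 = t ^+ 2 * (1 - (1 - del) ^+ 2) by rewrite kt; ring.
    rewrite [leRHS]mulrCA; apply: ler_wpM2l => //; apply: ler_wpM2l; first exact: ltW.
    by have := sqr_ge0 del; rewrite !expr2; lra.
  move=> h1 h2; have -> : t ^+ 2 * (ecell T xi k + M * (2 * del) + e) =
      t ^+ 2 * (ecell T xi k + e) + t ^+ 2 * (M * (2 * del)) by ring.
  exact: (lerD h2 h1).
have MdE : M * (2 * del) = C * d * ((1 + Phi r) / (1 + r)).
  by rewrite /M /del; field; rewrite gt_eqF.
rewrite -MdE; apply/ler_addgt0Pr => e e0.
have e2 : 0 < e / 2 by rewrite divr_gt0.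
have [t1 t10 H1] := ecell_le_hom yPhi alpha_gt0 alpha_le gf xi sT e2.
have cv : ecell T xi' t @[t --> +oo] --> hom T xi'.
  exact: (ecell_cvg yPhi alpha_gt0 alpha_le gf).
move/cvgrPdist_le: cv => /(_ _ e2) [t2 [t2r H2]].
(* Beyond [t1] the cell energy of xi is near its limit; beyond [t2], so is that of xi' on the larger
   cell. *)
pose k := Num.max t1 (`|t2| + 1).
have k0 : 0 < k by rewrite lt_max t10.
have k1 : k <= k / (1 - del).
  by rewrite ler_pdivlMr ?subr_gt0// ler_piMr ?(ltW k0)//; lra.
have := step k k0; have := H1 k; rewrite le_max lexx => /(_ isT).
have := H2 (k / (1 - del)) _.
move=> /(_ _) h; have /h : t2 < k / (1 - del).
  apply: lt_le_trans k1; rewrite lt_max; apply/orP; right.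
  by rewrite (le_lt_trans (ler_norm _))// ltrDl.
by rewrite ler_norml => /andP[_ h2] h1 h3; exact: halves_le h2 h1 h3.
Qed.

Lemma hom_lipschitz_abs : exists2 C : R, 0 < C & forall T xi xi', subspace T ->
  tangent_mx T xi -> tangent_mx T xi' ->
  `|hom T xi - hom T xi'| <= C * enorm (xi - xi') *
    ((1 + Phi (enorm xi + enorm xi')) / (1 + (enorm xi + enorm xi'))).
Proof.
have [C C0 H] := hom_lipschitz; exists C => // T xi xi' sT t1 t2.
have h1 := H T xi xi' sT t1 t2; have h2 := H T xi' xi sT t2 t1.
rewrite enormBC (addrC (enorm xi')) in h2.
apply/ler_normlP; split; first by rewrite opprB lerBlDl; exact: h1.
by rewrite lerBlDl; exact: h2.
Qed.

End GrowthAndLipschitz.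

(** * Local correctors and quasiconvexity *)

Lemma quarters_arith (R : realType) (u v e : R) : 0 < e -> u <= v + e / 4 ->
  u + e / 4 <= v + e.
Proof. by move=> *; lra. Qed.

Lemma window_arith (R : realType) (u v e F : R) : 0 < e -> u <= F -> 0 <= u -> 0 <= v ->
  v <= F -> - (F + F + e) <= u - v - e <= F + F + e.
Proof. by move=> *; apply/andP; split; lra. Qed.

Lemma far_arith (R : realType) (u v p q e F : R) : 0 <= p -> 0 <= v -> u <= F ->
  u - p - e - (F + q) <= v - q - e.
Proof. by move=> *; lra. Qed.

Section AbstractContinuity.
Variables (R : realType) (V : topologicalType).
Implicit Types (F g h : V -> R).

Lemma continuous_cst_real (c : R) : continuous ((fun=> c) : V -> R^o).
Proof. by move=> x; exact: cvg_cst. Qed.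

Lemma continuousB_real g h : continuous (g : V -> R^o) -> continuous (h : V -> R^o) ->
  continuous (fun x => g x - h x : R^o).
Proof. by move=> cg ch x; exact: (@cvgB R R^o _ (nbhs x) _ g h _ _ (cg x) (ch x)). Qed.

Lemma continuous_locally_lipschitz F (d n : V -> R) (z : V) (L c : R) :
  {for z, continuous (d : V -> R^o)} -> d z = 0 ->
  {for z, continuous (n : V -> R^o)} -> n z < c -> 0 <= L ->
  (forall y, n y <= c -> `|F z - F y| <= L * d y) ->
  {for z, continuous (F : V -> R^o)}.
Proof.
move=> cd d0 cn nc L0 H; apply/cvgrPdist_le => e e0.
have e1 : 0 < e / (L + 1) by rewrite divr_gt0// ltr_wpDl.
have H1 : \forall y \near z, n y < c by apply: (cn (fun y : R^o => y < c)); exact: lt_nbhsl.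
have H2 : \forall y \near z, d y < e / (L + 1).
  by apply: (cd (fun y : R^o => y < e / (L + 1))); apply: lt_nbhsl; rewrite d0.
near=> y.
have y1 : n y < c by near: y.
have y2 : d y < e / (L + 1) by near: y.
apply: le_trans (H y (ltW y1)) _; apply: le_trans (ler_wpM2l L0 (ltW y2)) _.
rewrite mulrCA ler_piMr ?(ltW e0)//.
by rewrite ler_pdivrMr ?mul1r ?ltr_wpDl// lerDl.
Unshelve. all: by end_near. Qed.

Lemma cvg_comp_continuous F (w : nat -> V) (a : V) : continuous (F : V -> R^o) ->
  w n @[n --> \oo] --> a -> F (w n) @[n --> \oo] --> F a.
Proof. by move=> cF wa; apply: (@cvg_comp _ _ _ w F _ (nbhs a)) => //; exact: cF. Qed.

End AbstractContinuity.

Section LocalCorrectors.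
Variables (R : realType) (Phi : R -> R) (alpha beta : R).
Hypotheses (yPhi : young Phi) (alpha_gt0 : 0 < alpha) (alpha_le : alpha <= beta).
Hypothesis Phi_delta2 : Delta2 Phi.
Local Notation space := (space3 R).
Local Notation cyl t := (cylinder (square t) : set (space3 R)).
Local Notation mat := 'M[R]_(3, 2 + 1).
Local Notation mat2 := 'M[R]_(3, 2).
Local Notation vec := 'cV[R]_3.
Variable f : space -> mat -> R.
Hypothesis gf : good_integrand Phi alpha beta f.
Variable T : set vec.
Hypothesis sT : subspace T.
Implicit Types (t r : R) (A G : space -> mat) (xi a : mat2) (B : space -> mat2).
Local Notation energy := (energy f).
Local Notation ecell := (ecell f).
Local Notation hom := (hom f T).

Lemma hom_lipschitz_bounded (K : R) : 0 <= K -> exists2 L : R, 0 <= L &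
  forall xi xi', tangent_mx T xi -> tangent_mx T xi' -> enorm xi <= K -> enorm xi' <= K ->
    `|hom xi - hom xi'| <= L * enorm (xi - xi').
Proof.
move=> K0; have [C C0 H] := hom_lipschitz_abs yPhi alpha_gt0 alpha_le gf Phi_delta2.
have P0 : 0 <= Phi (K + K) by apply: (young_ge0 yPhi); rewrite addr_ge0.
exists (C * (1 + Phi (K + K))) => [|xi xi' t1 t2 k1 k2].
  by rewrite mulr_ge0 ?addr_ge0// ltW.
apply: le_trans (H T xi xi' sT t1 t2) _; rewrite mulrAC; apply: ler_wpM2r; first exact: enorm_ge0.
apply: ler_wpM2l; first exact: ltW.
have r0 : 0 <= enorm xi + enorm xi' by rewrite addr_ge0 ?enorm_ge0.
have h : Phi (enorm xi + enorm xi') <= Phi (K + K) by apply: (young_le yPhi) => //; exact: lerD.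
have r1 : 0 < 1 + (enorm xi + enorm xi') by rewrite ltr_wpDr.
rewrite ler_pdivrMr//; move: (enorm xi + enorm xi') r0 h {r1} => r r0 h.
by have : 0 <= (1 + Phi (K + K)) * r; [rewrite mulr_ge0 ?addr_ge0|rewrite mulrDr mulr1 => ?; lra].
Qed.

(** The estimates on [hom] concern tangential matrices; composing with the projection gives a
    function continuous on all matrices and equal to [hom] on the tangential ones. *)
Definition homP (Z : mat2) : R := hom (projmx T *m Z).

Lemma homPE xi : tangent_mx T xi -> homP xi = hom xi.
Proof. by move=> /(tangent_mxP sT) h; rewrite /homP h. Qed.

Lemma homP_ge0 Z : 0 <= homP Z.
Proof. exact: (hom_ge0 yPhi alpha_gt0 gf). Qed.

Lemma dist_continuous a : continuous (fun Z : mat2 => enorm (Z - a) : R^o).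
Proof.
move=> Z; apply: (@continuous_comp _ _ R^o (fun Y : mat2 => Y - a) (@enorm R 3 2)); last exact: enorm_continuous.
apply: (@continuous_mx R 3 2 _ (fun Y : mat2 => Y - a)) => i j.
rewrite (_ : (fun Y : mat2 => (Y - a) i j) = fun Y => Y i j - a i j); last first.
  by apply/funext => Y; rewrite !mxE.
exact: (continuousB_real (@coord_continuous R 3 2 i j) (@continuous_cst_real R _ (a i j))).
Qed.

Lemma homP_continuous : continuous (homP : mat2 -> R^o).
Proof.
move=> Z; have K0 : 0 <= enorm Z + 1 by rewrite addr_ge0 ?enorm_ge0.
have [L L0 HL] := hom_lipschitz_bounded K0.
have tP (W : mat2) : tangent_mx T (projmx T *m W) := tangent_mx_proj sT W.
apply: (@continuous_locally_lipschitz R mat2 homP (fun Y => enorm (Y - Z)) (@enorm R 3 2) Z L (enorm Z + 1)).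
- exact: dist_continuous.
- by rewrite subrr enorm0.
- exact: enorm_continuous.
- by rewrite ltrDl.
- exact: L0.
move=> Y YZ; apply: le_trans (HL _ _ (tP Z) (tP Y) _ _) _.
- by apply: le_trans (enorm_projmx sT _) _; rewrite lerDl.
- exact: le_trans (enorm_projmx sT _) YZ.
by rewrite -mulmxBr (enormBC Y); apply: ler_wpM2l => //; exact: (enorm_projmx sT).
Qed.

Definition bmeas2 B := forall i j, bmeas (fun x => B x i j).

Lemma bmeas2_bounded B : bmeas2 B -> exists2 c : R, 0 <= c & forall x, enorm (B x) <= c.
Proof.
move=> bA; pose c i j := projT1 (cid (bA i j).2); have hc i j := projT2 (cid (bA i j).2).
exists (\sum_i \sum_j c i j).
  by apply: sumr_ge0 => i _; apply: sumr_ge0 => j _; apply: le_trans (hc i j 0).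
move=> x; apply: le_trans (enorm_le_sum _) _.
by apply: ler_sum => i _; apply: ler_sum => j _; exact: hc.
Qed.

Lemma bmeas2_measurable (F : mat2 -> R) B : continuous (F : mat2 -> R^o) -> bmeas2 B ->
  measurable_fun setT (fun x : leb3 R => F (B x) : R).
Proof.
move=> cF bB.
exact: (@measurable_fun_caratheodory _ (leb3 R) R 3 2 setT (fun _ Z => F Z) B
  measurableT (fun Z => measurable_cst (F Z)) (fun _ => cF) (fun i j => (bB i j).1)).
Qed.

Lemma bmeas_homP B : bmeas2 B -> bmeas (fun x => homP (B x)).
Proof.
move=> bB; split; first exact: bmeas2_measurable homP_continuous bB.
have [c c0 hc] := bmeas2_bounded bB; exists (beta * (1 + Phi c)) => x.
rewrite ger0_norm ?homP_ge0//; apply: le_trans (hom_upper yPhi alpha_gt0 alpha_le gf _ sT) _.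
apply: ler_wpM2l; first exact: ltW (beta_gt0 alpha_gt0 alpha_le).
rewrite lerD2l; apply: (young_le yPhi (enorm_ge0 _)).
exact: le_trans (enorm_projmx sT _) (hc x).
Qed.

Lemma bmeas2_flat B : bmeas2 B -> bmeas_mx (fun x => flat_mx (B x)).
Proof.
move=> bB i j; rewrite /flat_mx; case: (split_ordP j) => l ->.
  by under eq_fun do rewrite row_mxEl; exact: bB.
by under eq_fun do rewrite row_mxEr mxE; exact: bmeas_cst.
Qed.

Lemma bmeas2_shift b B : bmeas2 B -> bmeas2 (fun x => B (inplane 1 b x)).
Proof. by move=> bB i j; exact: (bmeas_inplane b ltr01 (bB i j)). Qed.

Lemma flat_mx_norm xi : enorm (flat_mx xi) = enorm xi.
Proof. exact: enorm_row_mx0. Qed.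

Lemma flat_mx_continuous : continuous (@flat_mx R).
Proof.
apply: continuous_mx => i j; rewrite /flat_mx; case: (split_ordP j) => l ->.
  rewrite (_ : (fun x : mat2 => _) = fun Z => Z i l); first exact: coord_continuous.
  by apply/funext => Z; rewrite row_mxEl.
rewrite (_ : (fun x : mat2 => row_mx x (0 : 'cV[R]_3) i (rshift 2 l)) = fun=> (0 : R)).
  exact: continuous_cst_real.
by apply/funext => Z; rewrite row_mxEr mxE.
Qed.

Definition bad (delta : R) a (Z : mat2) : R := (delta <= enorm (Z - a))%R%:R.

Lemma bad_ge0 delta a Z : 0 <= bad delta a Z. Proof. by rewrite /bad; case: (delta <= _). Qed.
Lemma bad_le1 delta a Z : bad delta a Z <= 1. Proof. by rewrite /bad; case: (delta <= _). Qed.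

Lemma measurable_close delta a B : bmeas2 B ->
  measurable ([set x | enorm (B x - a) < delta] : set (leb3 R)).
Proof.
move=> bB; have m := bmeas2_measurable (@dist_continuous a) bB.
rewrite (_ : [set x | _] = (fun x => enorm (B x - a)) @^-1` `]-oo, delta[); last first.
  by apply/seteqP; split=> x /=; rewrite in_itv.
by rewrite -[X in measurable X]setTI; apply: m => //; exact: measurable_itv.
Qed.

Lemma bmeas_bad delta a B : bmeas2 B -> bmeas (fun x => bad delta a (B x)).
Proof.
move=> bB; have m := bmeas_indic (measurable_close delta a bB).
have := bmeasB (bmeas_cst 1) m.
rewrite (_ : (fun x => _ - _) = fun x => bad delta a (B x))//.
apply/funext => x; rewrite /bad indicE; have [h|h] := leP delta (enorm (B x - a)).
  by rewrite memNset ?subr0//=; apply/negP; rewrite -leNgt.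
by rewrite mem_set ?subrr.
Qed.

Variables (eps K : R).
Hypotheses (eps_gt0 : 0 < eps) (K_ge0 : 0 <= K).

(** Excess of the energy density of the corrector over the homogenized density, less a tolerance eps
    and a penalty on the set where the gradient is far from a. *)
Definition lagrangian delta M a G B (x : space) : R :=
  f x (flat_mx (B x) + G x) - homP (B x) - eps - M * bad delta a (B x).

Lemma bmeas_lagrangian delta M a G B : bmeas_mx G -> bmeas2 B ->
  bmeas (lagrangian delta M a G B).
Proof.
move=> bG bB; have bA := bmeas_mxD (bmeas2_flat bB) bG.
have b1 := bmeas_integrand yPhi alpha_gt0 alpha_le gf bA.
apply: (bmeasB (bmeasB (bmeasB b1 (bmeas_homP bB)) (bmeas_cst eps))).
exact: (bmeasM (bmeas_cst M) (bmeas_bad _ _ bB)).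
Qed.

(* A corrector on the k-cell for the gradient a, still efficient for variable
   gradients B up to the set where B is far from a. *)
Definition local_corrector (k : nat) a (delta M : R) (G : space -> mat) : Prop :=
  (exists phi, Adm T k%:R phi G) /\
  forall B, bmeas2 B -> (forall x, tangent_mx T (B x)) -> (forall x, enorm (B x) <= K) ->
    \int[mu3]_(x in cyl k%:R) lagrangian delta M a G B x <= 0.

(* An almost optimal corrector works: otherwise gradients B_n violate the
   inequality with delta = 1/n, and outside the set where B_n is far from a,
   where the term M pays for everything, they converge to a uniformly. *)
Lemma local_corrector_ex a : tangent_mx T a ->
  exists m delta M G, [/\ 0 < delta, 0 <= M & local_corrector m.*2.+1 a delta M G].
Proof.
move=> ta; have e4 : 0 < eps / 4 by rewrite divr_gt0.
have [t0 t00 Ht] := ecell_le_hom yPhi alpha_gt0 alpha_le gf a sT e4.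
(* An odd size beyond the threshold of near-optimality; odd sizes are stable under tiling. *)
pose m := (Num.truncn t0).+1; pose k := m.*2.+1; exists m.
have kt : t0 <= k%:R.
  apply: le_trans (ltW (truncnS_gt t0)) _; rewrite ler_nat /k /m.
  by rewrite -addnn; apply: leqW; exact: leq_addr.
have k0 : 0 < k%:R :> R by [].
have [phi [G [aG Ge]]] := ecell_adherent yPhi alpha_gt0 gf a k%:R sT e4.
have bG := Adm_bmeas_mx aG; have [cG cG0 hG] := bmeas_mx_bounded bG.
have b0 := beta_gt0 alpha_gt0 alpha_le.
pose c := K + enorm a + cG; have c0 : 0 <= c by rewrite !addr_ge0 ?enorm_ge0.
pose F := beta * (1 + Phi c).
have F0 : 0 <= F by rewrite mulr_ge0 ?addr_ge0 ?(ltW b0)// (young_ge0 yPhi).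
have fF x (Z : mat2) : enorm Z <= K + enorm a -> f x (flat_mx Z + G x) <= F.
  move=> ZK; have [_ _ /(_ x (flat_mx Z + G x))/andP[_ h]] := gf; apply: le_trans h _.
  apply: ler_wpM2l; first exact: ltW.
  rewrite lerD2l; apply: (young_le yPhi (enorm_ge0 _)).
  by apply: le_trans (enormD _ _) _; rewrite flat_mx_norm lerD.
(* Where B is far from a it will be replaced by a. This raises the density by at most the penalty:
   [F] bounds the energy density being removed, and hom a the new homogenized density. *)
pose M := F + hom a.
have M0 : 0 <= M by rewrite addr_ge0// (hom_ge0 yPhi alpha_gt0 gf).
apply: contrapT => Hn.
have H (n : nat) : exists B, [/\ bmeas2 B, (forall x, tangent_mx T (B x)), (forall x, enorm (B x) <= K) &
    0 < \int[mu3]_(x in cyl k%:R) lagrangian n.+1%:R^-1 M a G B x].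
  apply: contrapT => HB; apply: Hn; exists n.+1%:R^-1, M, G; split => //.
  split; first by exists phi.
  move=> B bB tB KB; rewrite leNgt; apply/negP => h; apply: HB; exists B; split => //.
pose B n := projT1 (cid (H n)); have HB n := projT2 (cid (H n)).
pose S n : set (leb3 R) := [set x | enorm (B n x - a) < n.+1%:R^-1].
have bB n : bmeas2 (B n) by have [] := HB n.
have tB n x : tangent_mx T (B n x) by have [_ + _ _] := HB n; apply.
have KB n x : enorm (B n x) <= K by have [_ _ + _] := HB n; apply.
have mS n : measurable (S n) by exact: measurable_close.
(* Truncation of [B n]: within 1/(n+1) of a everywhere, so uniformly convergent to a. *)
pose B' n x : mat2 := if x \in S n then B n x else a.
have tB' n x : tangent_mx T (B' n x) by rewrite /B'; case: ifP.
have KB' n x : enorm (B' n x) <= K + enorm a.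
  by rewrite /B'; case: ifP => _; [apply: le_trans (KB n x) _; rewrite lerDl enorm_ge0|rewrite lerDr].
have bB' n : bmeas2 (B' n).
  move=> i j; have b1 := bmeasM (bB n i j) (bmeas_indic (mS n)).
  have b2 := bmeasM (bmeas_cst (a i j)) (bmeas_indic (measurableC (mS n))).
  have := bmeasD b1 b2; rewrite (_ : (fun x => _ + _) = fun x => B' n x i j)//.
  apply/funext => x; rewrite /B' !indicE in_setC.
  by case: (x \in S n); rewrite /= ?mulr1 ?mulr0 ?addr0 ?add0r.
have dB' n x i j : `|B' n x i j - a i j| <= n.+1%:R^-1.
  apply: (@le_trans _ _ (enorm (B' n x - a))).
    by have := normr_entry_le (B' n x - a) i j; rewrite !mxE.
  rewrite /B'; case: ifPn => [/set_mem/ltW//|_].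
  by rewrite subrr enorm0 invr_ge0.
have cB' x : B' n x @[n --> \oo] --> a.
  apply: cvg_mx => i j; apply/cvgrPdist_le => e e0.
  have := near_infty_natSinv_lt (PosNum e0); apply: filterS => n /= ne.
  by rewrite distrC; apply: le_trans (dB' n x i j) _; exact: ltW.
pose w n x := f x (flat_mx (B' n x) + G x) - homP (B' n x) - eps.
pose w0 x := f x (flat_mx a + G x) - homP a - eps.
have bfl n := bmeas_integrand yPhi alpha_gt0 alpha_le gf (bmeas_mxD (bmeas2_flat (bB' n)) bG).
have bw n : bmeas (w n) := bmeasB (bmeasB (bfl n) (bmeas_homP (bB' n))) (bmeas_cst eps).
have bfa := bmeas_integrand yPhi alpha_gt0 alpha_le gf (bmeas_mxD (bmeas_mx_cst (flat_mx a)) bG).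
have bw0 : bmeas w0 := bmeasB (bmeasB bfa (bmeas_cst (homP a))) (bmeas_cst eps).
have w_ge0 n : 0 <= \int[mu3]_(x in cyl k%:R) w n x.
  have [_ _ _ /ltW h] := HB n; apply: le_trans h _.
  apply: (Rintegral_cyl_le (bmeas_lagrangian _ _ _ bG (bB n)) (bw n)) => x _.
  rewrite /lagrangian /w -/(B n) /B' /bad; case: ifPn => [/set_mem xS|].
    have xS' : enorm (B n x - a) < n.+1%:R^-1 := xS.
    by rewrite [n.+1%:R^-1 <= _]leNgt xS' mulr0 subr0.
  rewrite notin_setE => /negP; rewrite -leNgt => ->; rewrite mulr1 (homPE ta).
  have h1 := fF x (B n x); have h2 := homP_ge0 (B n x).
  have h3 := integrand_ge0 yPhi alpha_gt0 gf x (flat_mx a + G x).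
  have : f x (flat_mx (B n x) + G x) <= F.
    by apply: h1; apply: le_trans (KB n x) _; rewrite lerDl enorm_ge0.
  by rewrite /M => h4; exact: far_arith.
have mc := @measurable_cyl R k%:R; have Lc := @L3_cyl_lty R k%:R.
have cv : \int[mu3]_(x in cyl k%:R) w n x @[n --> \oo] --> \int[mu3]_(x in cyl k%:R) w0 x.
  apply: (@bounded_convergence _ _ _ _ _ (F + F + eps) mc mc Lc).
  - by move=> n; exact: (bw n).1.
  - exact: bw0.1.
  - move=> n x _; have h1 := fF x _ (KB' n x).
    have h2 := integrand_ge0 yPhi alpha_gt0 gf x (flat_mx (B' n x) + G x).
    have h3 := homP_ge0 (B' n x).
    have h4 : homP (B' n x) <= F.
      rewrite homPE//; apply: le_trans (hom_upper yPhi alpha_gt0 alpha_le gf _ sT) _.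
      apply: ler_wpM2l; first exact: ltW.
      rewrite lerD2l; apply: (young_le yPhi (enorm_ge0 _)).
      by apply: le_trans (KB' n x) _; rewrite lerDl.
    rewrite ler_norml /w.
    exact: window_arith.
  - by move=> n x cx /(_ cx).
  - apply: aeW => x _; apply: cvgB; last exact: cvg_cst.
    apply: cvgB; last exact: (cvg_comp_continuous homP_continuous (cB' x)).
    have [[_ cf] _ _] := gf.
    apply: (@cvg_comp _ _ _ (fun n => flat_mx (B' n x) + G x) (f x) _ (nbhs (flat_mx a + G x))); last exact: cf.
    apply: cvg_mx => i j.
    have h := cvg_comp_continuous
      (@continuous_entry R 3 3 _ (@flat_mx R) i j flat_mx_continuous) (cB' x).
    rewrite (_ : (fun n => _) = fun n => flat_mx (B' n x) i j + G x i j); last first.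
      by apply/funext => n; rewrite mxE.
    by rewrite mxE; apply: cvgD; [exact: h|exact: cvg_cst].
have w0_ge0 : 0 <= \int[mu3]_(x in cyl k%:R) w0 x.
  rewrite -(cvg_lim (@Rhausdorff R) cv); apply: limr_ge.
    by apply/cvg_ex; eexists; exact: cv.
  by apply: nearW => n; exact: w_ge0.
have : \int[mu3]_(x in cyl k%:R) w0 x = energy k%:R (fun x => flat_mx a + G x) - (hom a + eps) * k%:R ^+ 2.
  rewrite -Rintegral_cyl_cst//.
  have bN : bmeas (fun=> - (hom a + eps)) := bmeas_cst _.
  have -> : - (\int[mu3]_(x in cyl k%:R) (hom a + eps)) = \int[mu3]_(x in cyl k%:R) (- (hom a + eps)).
    by rewrite !Rintegral_cyl_cst// mulNr.
  rewrite -Rintegral_cylD//; apply: eq_Rintegral => x _.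
  by rewrite /w0 homPE// opprD addrA.
(* In the limit the corrector would have mean energy at least hom a + eps, whereas it was chosen
   with mean energy below hom a + eps/2. *)
move=> E; move: w0_ge0; rewrite E subr_ge0 => h.
have k2 : 0 < k%:R ^+ 2 :> R by rewrite exprn_gt0.
have h1 : energy k%:R (fun x => flat_mx a + G x) < k%:R ^+ 2 * (ecell T a k%:R + eps / 4).
  by rewrite -ltr_pdivrMl.
have h2 := Ht _ kt.
have : k%:R ^+ 2 * (ecell T a k%:R + eps / 4) <= (hom a + eps) * k%:R ^+ 2.
  rewrite mulrC ler_wpM2r ?(ltW k2)//.
  exact: (quarters_arith eps_gt0 h2).
by move=> h3; have := lt_le_trans (le_lt_trans h h1) h3; rewrite ltxx.
Qed.

Lemma Adm_tiles (k m : nat) (G : 'I_(m.*2.+1) * 'I_(m.*2.+1) -> space -> mat) :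
  (forall i, exists phi, Adm T k%:R phi (G i)) ->
  exists phi' G', Adm T (k * m.*2.+1)%:R phi' G' /\
    forall i x, cyl k%:R x -> G' (to_tile k i x) = G i x.
Proof.
move=> H; pose phi i := projT1 (cid (H i)); have aG i := projT2 (cid (H i)).
have aGi i := Adm_shift (b := lattice R (- (tile_corner k i).1, - (tile_corner k i).2))
    erefl (tile_bound R k i) (aG i).
exists (fun x => \sum_i phi i (of_tile k i x)), (fun x => \sum_i G i (of_tile k i x)).
split; first exact: (Adm_sum (index_enum _) sT aGi).
move=> i x cx; rewrite (bigD1 i)//= to_tileK big1 ?addr0// => j ji.
apply: (Adm_G0 (aG j)) => cj; move: ji.
have := @tile_disjoint R k m j i (to_tile k i x) cj.
by rewrite to_tileK => /(_ cx) ->; rewrite eqxx.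
Qed.

(** The inequality holds for all B, hence for the restriction of B to each tile, translated back; a
    statement about constant gradients alone would not suffice. *)
Lemma local_corrector_tile k m a delta M G : local_corrector k a delta M G ->
  exists G', local_corrector (k * m.*2.+1) a delta M G'.
Proof.
move=> [ephi H]; have [phi' [G' [aG' HG']]] := @Adm_tiles k m (fun=> G) (fun=> ephi).
have bG' := Adm_bmeas_mx aG'.
exists G'; split; first by exists phi'.
move=> B bB tB KB; rewrite (Rintegral_tiles k m (bmeas_lagrangian _ _ _ bG' bB)).
apply: sumr_le0 => i _.
have := H (fun x => B (to_tile k i x)) (bmeas2_shift _ bB) (fun x => tB _) (fun x => KB _).
apply: le_trans; rewrite le_eqVlt; apply/orP; left; apply/eqP.
apply: eq_Rintegral => x /set_mem cx; rewrite /lagrangian HG'//.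
by rewrite {1}/to_tile (integrand_periodic gf).
Qed.

Lemma local_corrector_mono k a delta M M' G : M <= M' ->
  local_corrector k a delta M G -> local_corrector k a delta M' G.
Proof.
move=> MM [[phi aG] H]; split; first by exists phi.
move=> B bB tB KB; apply: le_trans (H B bB tB KB).
have bG := Adm_bmeas_mx aG.
apply: (Rintegral_cyl_le (bmeas_lagrangian _ _ _ bG bB) (bmeas_lagrangian _ _ _ bG bB)) => x _.
by rewrite /lagrangian lerD2l lerN2 ler_wpM2r// bad_ge0.
Qed.

(** Finitely many correctors are brought to one cell whose size is the product of their odd sizes,
    and to one penalty, the sum of theirs. *)
Lemma local_corrector_common (I : eqType) (s : seq I) (a : I -> mat2) (k : I -> nat)
    (delta M : I -> R) :
  (forall i, 0 <= M i) ->
  (forall i, exists m G, k i = m.*2.+1 /\ local_corrector m.*2.+1 (a i) (delta i) (M i) G) ->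
  exists m, forall i, i \in s ->
    exists G, local_corrector m.*2.+1 (a i) (delta i) (\sum_(j <- s) M j) G.
Proof.
move=> M0 H.
have prod_odd (m m' : nat) : exists m'' : nat, (m.*2.+1 * m'.*2.+1 = m''.*2.+1)%N.
  exists (m.*2.+1 * m'.*2.+1)./2.
  by rewrite -[LHS]odd_double_half oddM /= !odd_double.
elim: s => [|i s [m IH]]; first by exists 0%N.
have [mi [Gi [_ Hi]]] := H i.
have [m'' Em] := prod_odd m mi.
have S0 : 0 <= \sum_(j <- s) M j by apply: sumr_ge0 => j _; exact: M0.
exists m'' => j; rewrite inE big_cons => /predU1P[->|js].
  have [G' HG'] := local_corrector_tile m Hi.
  exists G'; rewrite -Em mulnC; apply: local_corrector_mono HG'.
  by rewrite lerDl.
have [G HG] := IH j js; have [G' HG'] := local_corrector_tile mi HG.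
exists G'; rewrite -Em; apply: local_corrector_mono HG'.
by rewrite lerDr.
Qed.

End LocalCorrectors.

(** * Approximation of planar sets by unions of grid squares *)

Section GridApproximation.
Variable R : realType.
Local Notation space := (space3 R).
Local Notation cyl t := (cylinder (square t) : set (space3 R)).
Implicit Types (S U : set (leb3 R)) (P : int -> int -> bool) (m n : nat) (e : R).

(** Position among the strips of width 1/n, counted from the edge -1/2 of the unit square. *)
Definition grid_index n (y : R) : int := Num.floor (n%:R * (y + 2^-1)).

Definition grid n P : set (leb3 R) :=
  [set x | P (grid_index n x.1.1) (grid_index n x.1.2)].

Lemma measurable_grid_index n (f : leb3 R -> R) (z : int) : measurable_fun setT f ->
  measurable [set x | grid_index n (f x) = z].
Proof.
move=> mf; pose g x := n%:R * (f x + 2^-1).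
have mg : measurable_fun setT g.
  apply: measurable_funM; first exact: measurable_cst.
  by apply: measurable_funD => //; exact: measurable_cst.
rewrite (_ : [set x | _] = g @^-1` `[z%:~R, (z + 1)%:~R[).
  by rewrite -[X in measurable X]setTI; apply: mg => //; exact: measurable_itv.
apply/seteqP; split=> x /=; rewrite /grid_index in_itv/=.
  by move=> <-; exact: floor_itv.
by move=> h; apply/eqP; rewrite floor_eq.
Qed.

Lemma measurable_grid n P : measurable (grid n P).
Proof.
rewrite (_ : grid n P = \bigcup_(z in [set: int * int])
   (if P z.1 z.2 then [set x | grid_index n x.1.1 = z.1] `&` [set x | grid_index n x.1.2 = z.2] else set0)).
  apply: countable_bigcupT_measurable => //= z; case: (P _ _); last exact: measurable0.
  by apply: measurableI; apply: measurable_grid_index;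
    [exact: measurable_coord1|exact: measurable_coord2].
apply/seteqP; split=> [x Px|x [z _]].
  by exists (grid_index n x.1.1, grid_index n x.1.2) => //=; rewrite Px.
by case: ifP => // Pz [/= h1 h2]; rewrite /grid/= h1 h2.
Qed.

(** Each cell of the grid refined k times lies in one cell of the coarse grid, floor(w) =
    floor(floor(k w)/k). *)
Lemma grid_index_refine n k (y : R) : (0 < k)%N ->
  grid_index n y = Num.floor ((grid_index (n * k) y)%:~R / k%:R : R).
Proof.
move=> k0; have k0' : 0 < k%:R :> R by rewrite ltr0n.
apply/esym/eqP; rewrite floor_eq /grid_index; set w := n%:R * (y + 2^-1).
have -> : (n * k)%:R * (y + 2^-1) = w * k%:R by rewrite natrM /w; ring.
have /andP[h1 h2] := floor_itv w; have /andP[g1 g2] := floor_itv (w * k%:R).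
apply/andP; split.
  rewrite ler_pdivlMr// -[k%:R]/((k%:Z)%:~R) -intrM ler_int floor_ge_int intrM.
  by rewrite ler_wpM2r.
rewrite ltr_pdivrMr//; apply: le_lt_trans g1 _.
by rewrite ltr_pM2r.
Qed.

Lemma grid_refine n k P : (0 < k)%N -> exists P', grid n P = grid (n * k) P'.
Proof.
move=> k0; exists (fun i j => P (Num.floor (i%:~R / k%:R : R)) (Num.floor (j%:~R / k%:R : R))).
by apply/seteqP; split=> x; rewrite /grid/= -!grid_index_refine.
Qed.

Definition sym_diff S U : set (leb3 R) := (S `\` U) `|` (U `\` S).

(** The grids have an odd number of cells per side so that they match the tilings of cells. *)
Definition approximable S : Prop := measurable S /\ forall e, 0 < e ->
  exists m P, (L3 (cyl 1 `&` sym_diff S (grid m.*2.+1 P)) < e%:E)%E.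

Lemma approximableC S : approximable S -> approximable (~` S).
Proof.
move=> [mS H]; split; first exact: measurableC.
move=> e e0; have [m [P h]] := H e e0; exists m, (fun i j => ~~ P i j).
rewrite (_ : sym_diff _ _ = sym_diff S (grid m.*2.+1 P))//.
have gC : grid m.*2.+1 (fun i j => ~~ P i j) = ~` grid m.*2.+1 P.
  by apply/seteqP; split=> x; rewrite /grid/= => /negP.
by rewrite gC /sym_diff !setDE !setCK setUC (setIC _ S) (setIC (~` S)).
Qed.

Lemma odd_mul m m' : exists m'', (m.*2.+1 * m'.*2.+1 = m''.*2.+1)%N.
Proof.
exists (m.*2.+1 * m'.*2.+1)./2.
by rewrite -[LHS]odd_double_half oddM /= !odd_double.
Qed.

Lemma grid_common m m' P P' : exists m'' Q Q',
  grid m.*2.+1 P = grid m''.*2.+1 Q /\ grid m'.*2.+1 P' = grid m''.*2.+1 Q'.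
Proof.
have [m'' E] := odd_mul m m'.
have [Q HQ] := grid_refine (k := m'.*2.+1) m.*2.+1 P isT.
have [Q' HQ'] := grid_refine (k := m.*2.+1) m'.*2.+1 P' isT.
by exists m'', Q, Q'; rewrite HQ HQ' E mulnC E.
Qed.

Lemma L3_union_lt (A B : set space) (a b : R) : (L3 A < a%:E)%E -> (L3 B < b%:E)%E ->
  (L3 (A `|` B) < (a + b)%:E)%E.
Proof.
move=> h1 h2; apply: le_lt_trans (outer_measureU2 _ _ _) _.
by rewrite EFinD; apply: lteD.
Qed.

Lemma approximableU S S' : approximable S -> approximable S' -> approximable (S `|` S').
Proof.
move=> [mS H] [mS' H']; split; first exact: measurableU.
move=> e e0; have e2 : 0 < e / 2 by rewrite divr_gt0.
have [m [P h]] := H _ e2; have [m' [P' h']] := H' _ e2.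
have [m'' [Q [Q' [EQ EQ']]]] := grid_common m m' P P'.
exists m'', (fun i j => Q i j || Q' i j).
have gU : grid m''.*2.+1 (fun i j => Q i j || Q' i j) = grid m''.*2.+1 Q `|` grid m''.*2.+1 Q'.
  by apply/seteqP; split=> x; rewrite /grid/= => /orP.
rewrite gU -EQ -EQ' [e]splitr; apply: le_lt_trans (L3_union_lt h h').
apply: le_outer_measure => x [cx]; rewrite /sym_diff.
have [|] := pselect (S x); have [|] := pselect (S' x); have [|] := pselect (grid m.*2.+1 P x);
  have [|] := pselect (grid m'.*2.+1 P' x) => u1 u2 u3 u4 [[d1 d2]|[d1 d2]];
  by [exfalso; apply: d2; [left|right]| case: d1 | exfalso; apply: d2; left
     | exfalso; apply: d2; right
     | left; split => //; left; split | right; split => //; left; split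
     | left; split => //; right; split | right; split => //; right; split].
Qed.

(** Inside the unit cylinder, of finite measure, the union is exhausted in measure by finite unions,
    each of which is approximable. *)
Lemma approximable_bigcup (F : nat -> set (leb3 R)) : (forall n, approximable (F n)) ->
  approximable (\bigcup_n F n).
Proof.
move=> HF; have mF n : measurable (F n) by case: (HF n).
have mU : measurable (\bigcup_n F n) by exact: bigcupT_measurable.
split => // e e0; have e2 : 0 < e / 2 by rewrite divr_gt0.
pose V n := \big[setU/set0]_(i < n) F i.
have aV n : approximable (V n).
  rewrite /V; elim: n => [|n IH]; last by rewrite big_ord_recr; exact: approximableU.
  rewrite big_ord0; split; first exact: measurable0.
  move=> e' e'0; exists 0%N, (fun _ _ => false).
  rewrite (_ : _ `&` _ = set0) ?outer_measure0//.
  by rewrite -subset0 => x [_ [[]|[]]].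
have mV n : measurable (V n) by case: (aV n).
have mc := @measurable_cyl R 1; have Lc := @L3_cyl_lty R 1.
have cv : \int[mu3]_(x in cyl 1) (\1_(\bigcup_n F n) x - \1_(V n) x) @[n --> \oo] -->
    \int[mu3]_(x in cyl 1) (0 : R).
  apply: (@bounded_convergence _ _ _ _ _ 2 mc mc Lc).
  - by move=> n; exact: (bmeasB (bmeas_indic mU) (bmeas_indic (mV n))).1.
  - exact: (bmeas_cst 0).1.
  - move=> n x _; rewrite !indicE; case: (_ \in _); case: (_ \in _) => /=;
      rewrite ?subrr ?subr0 ?sub0r ?normrN ?normr0 ?normr1//; lra.
  - by move=> n x cx /(_ cx).
  - apply: aeW => x _; apply: cvg_near_cst.
    have [[k _ Fx]|nU] := pselect ((\bigcup_n F n) x).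
      exists k.+1 => // n /= kn; rewrite !indicE !mem_set ?subrr//.
        by rewrite /V -bigcup_mkord; exists k.
      by exists k.
    apply: nearW => n; rewrite !indicE !memNset ?subrr// /V -bigcup_mkord => -[i _ Fx].
    by apply: nU; exists i.
rewrite Rintegral_cyl_cst// mul0r in cv.
move/cvgrPdist_lt: cv => /(_ _ e2) [n _ /(_ n (leqnn n))].
rewrite sub0r normrN => hn.
have dE : L3 (cyl 1 `&` ((\bigcup_n F n) `\` V n)) =
    (\int[mu3]_(x in cyl 1) (\1_(\bigcup_n F n) x - \1_(V n) x))%:E.
  have mD : measurable ((\bigcup_n F n) `\` V n) by exact: measurableD.
  have E : \int[mu3]_(x in cyl 1) (\1_(\bigcup_n F n) x - \1_(V n) x) =
      \int[mu3]_(x in cyl 1) (\1_((\bigcup_n F n) `\` V n) x).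
    apply: eq_Rintegral => x _; rewrite !indicE in_setD.
    case: (boolP (x \in V n)) => [/set_mem Vx|_]; last by rewrite andbT subr0.
    rewrite andbF mem_set ?subrr//; move: Vx; rewrite /V -bigcup_mkord => -[i _ Fx].
    by exists i.
  rewrite E -EFin_Rintegral//; last exact: (bmeas_cyl_integrable 1 (bmeas_indic mD)).
  by rewrite integral_indic// setIC.
have [m [P h]] := (aV n).2 _ e2.
exists m, P.
have h2 : (L3 (cyl 1 `&` ((\bigcup_n F n) `\` V n)) < (e / 2)%:E)%E.
  rewrite dE lte_fin; apply: le_lt_trans hn; exact: ler_norm.
rewrite [e]splitr; apply: le_lt_trans (L3_union_lt h2 h).
apply: le_outer_measure => x [cx [[Ux nG]|[Gx nU]]].
  have [Vx|nV] := pselect (V n x); first by right; split => //; left.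
  by left; split.
right; split => //; right; split => // Vx; apply: nU.
by move: Vx; rewrite /V -bigcup_mkord => -[i _ Fx]; exists i.
Qed.

(** A half-plane differs from a union of strips only inside the strip that contains s, whose measure
    in the cell is at most 1/n. *)
Lemma approximable_half (c : bool) (s : R) :
  approximable [set x | (if c then x.1.1 else x.1.2) < s].
Proof.
have mf : measurable_fun setT (fun x : leb3 R => if c then x.1.1 else x.1.2).
  by case: c; [exact: measurable_coord1|exact: measurable_coord2].
split.
  rewrite (_ : [set x | _] = (fun x => if c then x.1.1 else x.1.2) @^-1` `]-oo, s[).
    by rewrite -[X in measurable X]setTI; apply: mf => //; exact: measurable_itv.
  by apply/seteqP; split=> x /=; rewrite in_itv.
move=> e e0.
pose m := (Num.truncn (2 / e)).+1; pose n := m.*2.+1.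
have ne : n%:R^-1 < e.
  rewrite invf_plt ?posrE//; apply: lt_trans (_ : m%:R < n%:R); last first.
    by rewrite ltr_nat /n -addnn ltnS leq_addr.
  apply: lt_trans (truncnS_gt (2 / e)); rewrite ltr_pdivlMr// mulVf ?gt_eqF//; lra.
have n0 : 0 < n%:R :> R by [].
pose z := grid_index n s.
exists m, (fun i j => (if c then i else j) < z).
apply: le_lt_trans (_ : (L3 (cyl 1 `&` [set x | grid_index n (if c then x.1.1 else x.1.2) = z]) < e%:E)%E).
  apply: le_outer_measure => x [cx H]; split => //=.
  set y := if c then x.1.1 else x.1.2 in H *.
  have PE : (if c then grid_index n x.1.1 else grid_index n x.1.2) = grid_index n y.
    by rewrite /y; case: (c).
  have mono (u v : R) : u <= v -> grid_index n u <= grid_index n v.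
    by move=> uv; apply: le_floor; rewrite ler_wpM2l// lerD2r.
  case: H => -[]; rewrite /grid/= -/n PE -/y.
    move=> ys /negP; rewrite -leNgt => zy; apply/eqP; rewrite eq_le zy andbT.
    by apply: mono; exact: ltW.
  move=> yz /negP; rewrite -leNgt => sy.
  by have := lt_le_trans yz (mono _ _ sy); rewrite ltxx.
pose lo : R := z%:~R / n%:R - 2^-1; pose hi : R := (z + 1)%:~R / n%:R - 2^-1.
pose A1 : set (measurableTypeR R) := if c then `[lo, hi[%classic else `](- (1 / 2)), (1 / 2)[%classic.
pose A2 : set (measurableTypeR R) := if c then `](- (1 / 2)), (1 / 2)[%classic else `[lo, hi[%classic.
pose A3 : set (measurableTypeR R) := `](- 2^-1), 2^-1[%classic.
have mA1 : measurable A1 by rewrite /A1; case: (c); exact: measurable_itv.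
have mA2 : measurable A2 by rewrite /A2; case: (c); exact: measurable_itv.
have mA3 : measurable A3 by exact: measurable_itv.
apply: le_lt_trans (_ : (L3 ((A1 `*` A2) `*` A3) < e%:E)%E).
  apply: le_outer_measure => x [[[/= h1 h2] h3] /= gz].
  have itv (y : R) : grid_index n y = z -> y \in `[lo, hi[.
    move=> yz; have := floor_itv (n%:R * (y + 2^-1)); rewrite -/(grid_index n y) yz.
    rewrite in_itv/= /lo /hi => /andP[k1 k2]; rewrite lerBlDr ltrBrDr.
    by rewrite ler_pdivrMr// ltr_pdivlMr// (mulrC _ n%:R) k1.
  split => //; rewrite /A1 /A2; move: gz; case: (c) => gz; split => //; exact: itv.
rewrite L3_Borel; last by apply: measurableX => //; exact: measurableX.
rewrite sfprodE//; last exact: measurableX.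
rewrite sfprodE// /= /sflam/=.
have L1 : lebesgue_measure A3 = 1%E.
  rewrite /A3 lebesgue_measure_itv/= lte_fin; have -> : - 2^-1 < 2^-1 :> R by lra.
  by rewrite -EFinB; congr EFin; lra.
have Lq : lebesgue_measure (`](- (1 / 2)), (1 / 2)[ : set (measurableTypeR R)) = 1%E.
  rewrite lebesgue_measure_itv/= lte_fin; have -> : - (1 / 2) < 1 / 2 :> R by lra.
  by rewrite -EFinB; congr EFin; lra.
have Lg : (lebesgue_measure (`[lo, hi[ : set (measurableTypeR R)) < e%:E)%E.
  rewrite lebesgue_measure_itv/= lte_fin; case: ifP => _; last by rewrite lte_fin.
  rewrite -EFinB lte_fin /lo /hi intrD.
  by apply: le_lt_trans ne; rewrite le_eqVlt; apply/orP; left; apply/eqP; field; rewrite gt_eqF.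
by rewrite L1 mule1 /A1 /A2; case: (c); rewrite Lq ?mule1 ?mul1e.
Qed.

(** Approximable sets form a sigma-algebra, and half-planes generate the planar Borel sets. *)
Lemma approximable_cylinder (A : set (borel2 R)) : measurable A ->
  approximable [set x | A x.1].
Proof.
pose fam := [set D : set (borel2 R) | approximable [set x : leb3 R | D x.1]].
have samp : sigma_algebra setT fam.
  split.
  - have := approximable_bigcup (fun n : nat => _); rewrite /fam/=.
    rewrite (_ : [set x : leb3 R | set0 x.1] = set0)// => _.
    split; first exact: measurable0.
    move=> e' e'0; exists 0%N, (fun _ _ => false).
    rewrite (_ : _ `&` _ = set0) ?outer_measure0//.
    by rewrite -subset0 => x [_ [[]|[]]].
  - move=> D /approximableC; rewrite /fam/=.
    rewrite (_ : [set x : leb3 R | (setT `\` D) x.1] = ~` [set x | D x.1])//.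
    by apply/seteqP; split=> x /=; [move=> []|].
  - by move=> F HF; exact: (approximable_bigcup HF).
have half (c : bool) (B : set (measurableTypeR R)) : measurable B ->
    fam [set y | B (if c then y.1 else y.2)].
  move=> mB.
  pose famB := [set D : set (measurableTypeR R) | fam [set y : borel2 R | D (if c then y.1 else y.2)]].
  have [f0 fC fU] := samp.
  have sB : sigma_algebra setT famB.
    split.
    - by rewrite /famB/= (_ : [set y : borel2 R | set0 (if c then y.1 else y.2)] = set0).
    - move=> D /fC; rewrite /famB/=.
      by rewrite (_ : setT `\` _ = [set y : borel2 R | (setT `\` D) (if c then y.1 else y.2)]).
    - move=> F HF.
      have := fU (fun n => [set y : borel2 R | F n (if c then y.1 else y.2)]) HF.
      by rewrite (_ : \bigcup_n _ = [set y : borel2 R | (\bigcup_n F n) (if c then y.1 else y.2)]).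
  move: mB; rewrite RGenInftyO.measurableE => mB.
  apply: (smallest_sub sB _ mB) => _ [s ->]; rewrite /famB /fam/=.
  have := approximable_half c s.
  by rewrite (_ : [set x : leb3 R | (if c then x.1.1 else x.1.2) < s] =
    [set x : leb3 R | (if c then x.1.1 else x.1.2) \in `]-oo, s[]).
rewrite measurable_prod_measurableType => HA.
apply: (smallest_sub samp _ HA) => _ [A1 mA1 [A2 mA2 <-]].
have h1 : approximable [set x : leb3 R | A1 x.1.1] := half true A1 mA1.
have h2 : approximable [set x : leb3 R | A2 x.1.2] := half false A2 mA2.
have := approximableC (approximableU (approximableC h1) (approximableC h2)).
rewrite setCU !setCK.
by rewrite (_ : _ `&` _ = [set x : leb3 R | (A1 `*` A2) x.1]).
Qed.

End GridApproximation.

(** * Rescaling a field of the unit cell to a large cell *)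

Section Scaling.
Variable R : realType.
Local Notation space := (space3 R).
Local Notation cyl t := (cylinder (square t) : set (space3 R)).
Local Notation vec := 'cV[R]_3.
Local Notation mat := 'M[R]_(3, 2 + 1).
Implicit Types (t : R) (T : set vec) (u w : space -> R).

Definition shrink t : space -> space := inplane t^-1 0.

Lemma shrinkE t x : shrink t x = ((t^-1 * x.1.1, t^-1 * x.1.2), x.2).
Proof. by rewrite /shrink /inplane/= !addr0 mul1r. Qed.

Lemma shrink_square t x : 0 < t -> square 1 (shrink t x).1 <-> square t x.1.
Proof.
move=> t0; rewrite !squareP shrinkE/= !normrM !(@ger0_norm _ t^-1) ?invr_ge0 ?(ltW t0)//.
by rewrite !(ltr_pdivrMl _ _ t0) mulrA mulr1.
Qed.

Lemma shrink_cyl t x : 0 < t -> cyl 1 (shrink t x) <-> cyl t x.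
Proof.
by move=> t0; split=> -[/(shrink_square x t0) h1 h2]; split => //;
  move: h2; rewrite shrinkE.
Qed.

Lemma Rintegral_shrink t w : 0 < t -> bmeas w ->
  \int[mu3]_(x in cyl t) w (shrink t x) = t ^+ 2 * \int[mu3]_(x in cyl 1) w x.
Proof.
move=> t0 bw; have it0 : 0 < t^-1 by rewrite invr_gt0.
have E := integral_inplane (0 : space) it0 (@measurable_cyl R 1) (bmeas_cyl_integrable 1 bw).
have cE : inplane t^-1 (0 : space) @^-1` cyl 1 = cyl t.
  by apply/seteqP; split=> x; rewrite /preimage/= -/(shrink t x) => /(shrink_cyl x t0).
rewrite cE exprVn invrK in E; rewrite /Rintegral E fineM//.
by apply: integrable_fin_num; [exact: measurable_cyl|exact: bmeas_cyl_integrable].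
Qed.

Lemma bmeas_shrink t w : 0 < t -> bmeas w -> bmeas (fun x => w (shrink t x)).
Proof. by move=> t0; apply: bmeas_inplane; rewrite invr_gt0. Qed.

Lemma Adm_scale T t (psi : space -> vec) (G : space -> mat) : subspace T -> 0 < t ->
  (forall x, rsubmx (G x) = 0) -> Adm T 1 psi G ->
  Adm T t (fun x => t *: psi (shrink t x)) (fun x => G (shrink t x)).
Proof.
move=> sT t0 G3 [H1 H2 H3]; have it0 : 0 < t^-1 by rewrite invr_gt0.
split; last by move=> x; exact: H3.
- move=> i; have [cu u0 bu Hg] := H1 i; split.
  + rewrite (_ : (fun x => _) = fun x => t * psi (shrink t x) i 0); last first.
      by apply/funext => x; rewrite mxE.
    apply: continuous_mull => x.
    apply: (@continuous_comp _ _ R^o (shrink t) (fun x => psi x i 0)); last exact: cu.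
    exact: inplane_continuous.
  + by move=> x nx; rewrite mxE u0 ?mulr0// => /(shrink_square x t0).
  + rewrite (_ : (fun x => _) = fun x => t * psi (shrink t x) i 0).
      by apply: bmeasM; [exact: bmeas_cst|exact: (bmeas_shrink t0 bu)].
    by apply/funext => x; rewrite mxE.
  + move=> j; have [bg g0 wg] := Hg j; split.
    * exact: (bmeas_shrink t0 bg).
    * by move=> x nx; apply: g0 => /(shrink_cyl x t0).
    * have b0 := bmeas_cst (0 : R).
      have bd := bmeasM (bmeas_cst (dil_factor t^-1 j)) (bmeas_shrink t0 bg).
      have := wderiv_lin t (bmeas_shrink t0 bu) bd b0 b0
        (@wderiv_inplane R t^-1 0 j _ _ it0 erefl bu bg wg) (wderiv0 j).
      rewrite (_ : (fun x => t * psi (shrink t x) i 0 + 0) = fun x => (t *: psi (shrink t x)) i 0); last first.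
        by apply/funext => x; rewrite mxE addr0.
      rewrite (_ : (fun x => t * (_ * G _ i j) + 0) = fun x => G (shrink t x) i j)//.
      apply/funext => x; rewrite addr0 /dil_factor; case: (eqVneq (j : nat) 2%N) => j2.
        have := congr1 (fun Z : 'cV[R]_3 => Z i 0) (G3 (shrink t x)); rewrite !mxE.
        rewrite (_ : rshift 2 0 = j); last by apply: val_inj; rewrite /= j2.
        by rewrite /shrink => ->; rewrite !mulr0.
      by rewrite mulrA divff ?mul1r// gt_eqF.
- by move=> x; exact: (subspaceZ sT).
Qed.

End Scaling.

Lemma tiled_arith (R : realType) (t I W J e : R) : W <= 0 -> J <= e / 2 ->
  W + t ^+ 2 * I + e / 2 * t ^+ 2 + t ^+ 2 * J <= t ^+ 2 * (I + e).
Proof. by move=> w0 J0; have := ler_wpM2l (sqr_ge0 t) J0; nra. Qed.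

Section MatrixBall.
Variable R : realType.
Local Notation mat2 := 'M[R]_(3, 2).

Lemma matrix_ball_compact (K : R) : exists2 C : set mat2, compact C &
  forall Z : mat2, enorm Z <= K -> C Z.
Proof.
pose D := [set v : 'rV[R]_(3 * 2) | `|v| <= K].
have cD : compact D.
  apply: bounded_closed_compact.
    exists K; split; first exact: num_real.
    by move=> x Kx v /= vK; apply: le_trans vK (ltW Kx).
  apply: (@closed_comp _ _ (fun v : 'rV[R]_(3 * 2) => `|v| : R^o) [set y | y <= K]).
    by move=> v _; exact: norm_continuous.
  exact: closed_le.
have cv : continuous (vec_mx : 'rV[R]_(3 * 2) -> mat2).
  apply: continuous_mx => i j.
  rewrite (_ : (fun v : 'rV[R]_(3 * 2) => vec_mx v i j) = fun v => v 0 (mxvec_index i j)).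
    exact: coord_continuous.
  by apply/funext => v; rewrite mxE.
exists (vec_mx @` D); first exact: (continuous_compact (continuous_subspaceT cv) cD).
move=> Z ZK; exists (mxvec Z); last exact: mxvecK.
have K0 : 0 <= K := le_trans (enorm_ge0 Z) ZK.
apply: norm_mx_le => // i j; rewrite ord1; case/mxvec_indexP: j => a b.
by rewrite mxvecE; apply: le_trans (normr_entry_le _ _ _) ZK.
Qed.

Lemma finite_matrix_cover (K : R) (F : mat2 -> mat2 -> R) (delta : mat2 -> R) :
  (forall Z, continuous (F Z : mat2 -> R^o)) -> (forall Z, F Z Z < delta Z) ->
  exists s : seq mat2, forall Y, enorm Y <= K -> exists2 Z, Z \in s & F Z Y < delta Z.
Proof.
move=> cF FZ; have [C cC KC] := matrix_ball_compact K.
move: cC; rewrite compact_cover => cC.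
have oU Z : [set: mat2] Z -> open [set Y | F Z Y < delta Z].
  move=> _; apply: (@open_comp _ _ (F Z : mat2 -> R^o) [set y | y < delta Z]).
    by move=> y _; exact: cF.
  exact: open_lt.
have cov : C `<=` cover [set: mat2] (fun Z => [set Y | F Z Y < delta Z]).
  by move=> Y _; exists Y => //=.
have [D _ HD] := cC _ _ _ oU cov.
exists (finmap.enum_fset D); move=> Y YK; have [Z ZD FY] := HD Y (KC Y YK).
by exists Z => //; exact: ZD.
Qed.

End MatrixBall.

Section CommonGrid.
Variable R : realType.
Local Notation cyl t := (cylinder (square t) : set (space3 R)).

Lemma approximable_common (I : eqType) (s : seq I) (S : I -> set (leb3 R)) (e : R) :
  (forall i, approximable (S i)) -> 0 < e ->
  exists m, forall i, i \in s -> exists P,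
    (L3 (cyl 1 `&` sym_diff (S i) (grid m.*2.+1 P)) < e%:E)%E.
Proof.
move=> H e0; elim: s => [|i s [m IH]]; first by exists 0%N.
have [m' [P' h']] := (H i).2 e e0.
have [m'' E] := odd_mul m m'.
exists m'' => j; rewrite inE => /predU1P[->|js].
  have [Q HQ] := @grid_refine R m'.*2.+1 m.*2.+1 P' isT.
  by exists Q; rewrite -E mulnC -HQ.
have [P h] := IH j js; have [Q HQ] := @grid_refine R m.*2.+1 m'.*2.+1 P isT.
by exists Q; rewrite -E -HQ.
Qed.

Lemma L3_seq_union (I : Type) (s : seq I) (A : I -> set (space3 R)) (e : R) :
  (forall i, L3 (A i) <= e%:E)%E ->
  (L3 (\big[setU/set0]_(i <- s) A i) <= ((size s)%:R * e)%:E)%E.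
Proof.
move=> H; elim: s => [|i s IH]; first by rewrite big_nil outer_measure0 mul0r.
rewrite big_cons /= -natr1 mulrDl mul1r addrC EFinD.
by apply: le_trans (outer_measureU2 _ _ _) _; apply: leeD.
Qed.

(** The two discretizations agree: after shrinking to unit size, tile i of the large cell is cell i
    of the grid. *)
Lemma grid_index_tile (k m : nat) (i : 'I_(m.*2.+1) * 'I_(m.*2.+1)) (x : space3 R) :
  (0 < k)%N -> cyl k%:R x ->
  let y := shrink (k * m.*2.+1)%:R (to_tile k i x) in
  grid_index m.*2.+1 y.1.1 = i.1%:Z /\ grid_index m.*2.+1 y.1.2 = i.2%:Z.
Proof.
move=> k0 /cylP[h1 h2 _] y; have k0' : 0 < k%:R :> R by rewrite ltr0n.
have key (a : 'I_(m.*2.+1)) (z : R) : `|z| < k%:R / 2 ->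
    grid_index m.*2.+1 (((k * m.*2.+1)%:R)^-1 * (1 * z + (k%:Z * (a%:Z - m%:Z))%:~R)) = a%:Z :> int.
  move=> zk; apply/eqP; rewrite /grid_index floor_eq.
  have -> : m.*2.+1%:R * (((k * m.*2.+1)%:R)^-1 * (1 * z + (k%:Z * (a%:Z - m%:Z))%:~R) + 2^-1) =
      z / k%:R + 2^-1 + a%:R :> R.
    rewrite intrM intrB natrM mul1r.
    have n0 : m.*2.+1%:R != 0 :> R by rewrite pnatr_eq0.
    have nE : m.*2.+1%:R = 2 * m%:R + 1 :> R by rewrite -natr1 -muln2 natrM; ring.
    have k1 : k%:R != 0 :> R by rewrite gt_eqF.
    rewrite -[a%:Z%:~R]/(a%:R) -[m%:Z%:~R]/(m%:R) -[k%:Z%:~R]/(k%:R).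
    rewrite nE in n0 *; field; rewrite ?n0 ?k1//.
  have : `|z / k%:R| < 2^-1.
    by rewrite normrM normfV (ger0_norm (ltW k0')) ltr_pdivrMr// mulrC.
  rewrite ltr_norml => /andP[g1 g2]; rewrite intrD -[a%:Z%:~R]/(a%:R).
  by apply/andP; split; lra.
by rewrite /y shrinkE/=; split; apply: key.
Qed.

End CommonGrid.

(** * Quasiconvexity against fields independent of the vertical variable *)

Section Quasiconvexity.
Variables (R : realType) (Phi : R -> R) (alpha beta : R).
Hypotheses (yPhi : young Phi) (alpha_gt0 : 0 < alpha) (alpha_le : alpha <= beta).
Hypothesis Phi_delta2 : Delta2 Phi.
Local Notation space := (space3 R).
Local Notation cyl t := (cylinder (square t) : set (space3 R)).
Local Notation mat := 'M[R]_(3, 2 + 1).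
Local Notation mat2 := 'M[R]_(3, 2).
Local Notation vec := 'cV[R]_3.
Variable f : space -> mat -> R.
Hypothesis gf : good_integrand Phi alpha beta f.
Variable T : set vec.
Hypothesis sT : subspace T.
Local Notation energy := (energy f).
Local Notation ecell := (ecell f).
Local Notation hom := (hom f T).
Local Notation homP := (homP f T).

Lemma hom_quasiconvex_int (xi : mat2) (psi : space -> vec) (Gp : space -> mat)
    (G0 : plane2 R -> mat2) : tangent_mx T xi -> Adm T 1 psi Gp ->
  (forall x, cyl 1 x -> Gp x = flat_mx (G0 x.1)) ->
  (forall i j, measurable_fun setT (fun y : borel2 R => G0 y i j)) ->
  hom xi <= \int[mu3]_(x in cyl 1) homP (xi + lsubmx (Gp x)).
Proof.
move=> txi aG GE mG0.
have Gflat x : Gp x = flat_mx (lsubmx (Gp x)).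
  have [cx|ncx] := pselect (cyl 1 x); first by rewrite GE// row_mxKl.
  by rewrite (Adm_G0 aG ncx) linear0 /flat_mx row_mx0.
have G3 x : rsubmx (Gp x) = 0 by rewrite Gflat row_mxKr.
pose B1 x := xi + lsubmx (Gp x).
have bB1 : bmeas2 B1.
  move=> i j; have := bmeasD (bmeas_cst (xi i j)) (Adm_bmeas_mx aG i (lshift 1 j)).
  rewrite (_ : (fun x => _ + _) = fun x => B1 x i j)//.
  by apply/funext => x; rewrite /B1 !mxE.
have tB1 x : tangent_mx T (B1 x).
  apply/(tangent_mxP sT); rewrite mulmxDr (iffLR (tangent_mxP sT xi) txi); congr (_ + _).
  have [_ _ /(_ x) PG] := aG.
  by rewrite -[in RHS]PG mulmx_lsub.
have [K K0 KB1] := bmeas2_bounded bB1.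
apply/ler_addgt0Pr => e e0; have e2 : 0 < e / 2 by rewrite divr_gt0.
pose P Z : mat2 := projmx T *m Z.
have tP Z : tangent_mx T (P Z) := tangent_mx_proj sT Z.
have HL Z := local_corrector_ex yPhi alpha_gt0 alpha_le Phi_delta2 gf sT e2 K0 (tP Z).
pose mZ Z := projT1 (cid (HL Z)); have HL1 Z := projT2 (cid (HL Z)).
pose dZ Z := projT1 (cid (HL1 Z)); have HL2 Z := projT2 (cid (HL1 Z)).
pose MZ Z := projT1 (cid (HL2 Z)); have HL3 Z := projT2 (cid (HL2 Z)).
have d0 Z : 0 < dZ Z by have [G [+ _ _]] := HL3 Z.
have M0 Z : 0 <= MZ Z by have [G [_ + _]] := HL3 Z.
have cP (A : 'M[R]_3) : continuous (fun Z : mat2 => A *m Z).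
  apply: continuous_mx => i j.
  rewrite (_ : (fun Z : mat2 => (A *m Z) i j) = fun Z => \sum_k A i k * Z k j); last first.
    by apply/funext => Z; rewrite mxE.
  by apply: continuous_sum => k; apply: continuous_mull; exact: coord_continuous.
(* Finitely many centres suffice, since the gradients stay in a compact ball. *)
have [s Hs] : exists s : seq mat2, forall Y, enorm Y <= K ->
    exists2 Z, Z \in s & enorm (P Y - P Z) < dZ Z.
  apply: (@finite_matrix_cover R K (fun Z Y => enorm (P Y - P Z)) dZ) => Z.
    move=> Y; apply: (@continuous_comp _ _ R^o P (fun W => enorm (W - P Z))); first exact: cP.
    exact: dist_continuous.
  by rewrite subrr enorm0.
(* A default centre, for grid cells that receive no label. *)
have [Zd Zds _] : exists2 Z, Z \in s & enorm (P 0 - P Z) < dZ Z.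
  by apply: Hs; rewrite enorm0.
have HL4 Z : exists m G, (mZ Z).*2.+1 = m.*2.+1 /\
    local_corrector f T (e / 2) K m.*2.+1 (P Z) (dZ Z) (MZ Z) G.
  by have [G [_ _ h]] := HL3 Z; exists (mZ Z), G.
have [mk Hk] := local_corrector_common yPhi alpha_gt0 alpha_le Phi_delta2 gf sT s M0 HL4.
pose k := mk.*2.+1; pose M := \sum_(j <- s) MZ j; rewrite -/k -/M in Hk.
have M_ge0 : 0 <= M by apply: sumr_ge0.
(* Chosen so that the penalty M on an exceptional set of measure at most (size s) e' costs at most
   e/2. *)
pose e' := e / 2 / (M * (size s)%:R + 1).
have N0 : 0 < M * (size s)%:R + 1 by rewrite ltr_wpDl// mulr_ge0.
have e'0 : 0 < e' by rewrite divr_gt0.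
pose S Z : set (leb3 R) := [set x | enorm (xi + G0 x.1 - P Z) < dZ Z].
have aS Z : approximable (S Z).
  apply: (@approximable_cylinder R [set y | enorm (xi + G0 y - P Z) < dZ Z]).
  have m1 : measurable_fun setT (fun y : borel2 R => enorm (G0 y - (P Z - xi))).
    exact: (@measurable_fun_caratheodory _ (borel2 R) R 3 2 setT
      (fun _ W => enorm (W - (P Z - xi))) G0 measurableT
      (fun W => measurable_cst (enorm (W - (P Z - xi))))
      (fun _ => @dist_continuous R (P Z - xi)) mG0).
  rewrite (_ : [set y | _] = (fun y : borel2 R => enorm (G0 y - (P Z - xi))) @^-1` `]-oo, dZ Z[).
    by rewrite -[X in measurable X]setTI; apply: m1 => //; exact: measurable_itv.
  apply/seteqP; split=> y /=; rewrite in_itv/=.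
    by rewrite opprB addrCA addrA.
  by rewrite opprB addrCA addrA.
have [mg Hg] := approximable_common s aS e'0.
pose n := mg.*2.+1; rewrite -/n in Hg.
have HP Z : exists Q, Z \in s -> (L3 (cyl 1 `&` sym_diff (S Z) (grid n Q)) < e'%:E)%E.
  have [Zs|nZs] := boolP (Z \in s); last by exists (fun _ _ => false).
  by have [Q h] := Hg Z Zs; exists Q.
pose Q Z := projT1 (cid (HP Z)); have HQ Z := projT2 (cid (HP Z)).
(* The first centre whose grid approximation contains cell i. Cells without any lie in the
   exceptional set, since every gradient is close to some centre. *)
pose lab (i : 'I_n * 'I_n) := if has (fun Z => Q Z i.1%:Z i.2%:Z) s
  then nth 0 s (find (fun Z => Q Z i.1%:Z i.2%:Z) s) else Zd.
have labs i : lab i \in s.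
  by rewrite /lab; case: ifPn => // h; apply: mem_nth; rewrite -has_find.
have HG Z : exists G, Z \in s -> local_corrector f T (e / 2) K k (P Z) (dZ Z) M G.
  have [Zs|nZs] := boolP (Z \in s); last by exists (fun=> 0).
  by have [G h] := Hk Z Zs; exists G.
pose G Z := projT1 (cid (HG Z)); have HGs Z := projT2 (cid (HG Z)).
have HGl i := HGs _ (labs i).
have [phi' [G' [aG' G'E]]] := @Adm_tiles R T sT k mg (fun i => G (lab i)) (fun i => (HGl i).1).
pose t : R := (k * n)%:R; rewrite -/n -/t in aG'.
have t0 : 0 < t by rewrite ltr0n muln_gt0.
have t2 : 0 < t ^+ 2 by rewrite exprn_gt0.
have aG2 := Adm_add sT (Adm_scale sT t0 G3 aG) aG'.
have bG' := Adm_bmeas_mx aG'.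
(* The exceptional set: points of the unit cell where some set [S Z] and its grid approximation
   disagree. *)
pose E : set (leb3 R) := \big[setU/set0]_(Z <- s)
  (if Z \in s then cyl 1 `&` sym_diff (S Z) (grid n (Q Z)) else set0).
have mE : measurable E.
  apply: bigsetU_measurable => Z _; case: ifP => _; last exact: measurable0.
  apply: measurableI; first exact: measurable_cyl.
  have mS := (aS Z).1; have mg' := @measurable_grid R n (Q Z).
  by apply: measurableU; exact: measurableD.
have LE : (L3 E <= ((size s)%:R * e')%:E)%E.
  apply: L3_seq_union => Z; case: ifPn => Zs; last by rewrite outer_measure0 lee_fin ltW.
  exact: ltW (HQ Z Zs).
have EZ x Z : Z \in s -> cyl 1 x -> sym_diff (S Z) (grid n (Q Z)) x -> E x.
  move=> Zs cx dx; rewrite /E -bigcup_seq; exists Z => //=.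
  by rewrite Zs; split.
pose B x := B1 (shrink t x).
have bB : bmeas2 B by move=> i j; exact: (bmeas_shrink t0 (bB1 i j)).
have bI := bmeas_indic mE.
have bh := bmeas_homP yPhi alpha_gt0 alpha_le Phi_delta2 gf sT bB.
have bf := bmeas_integrand yPhi alpha_gt0 alpha_le gf (bmeas_mxD (bmeas2_flat bB) bG').
have bIt := bmeas_shrink t0 bI.
(* The lagrangian of the glued correctors, with the indicator of the rescaled exceptional set in
   place of [bad], which it dominates on every tile. *)
pose w x := f x (flat_mx (B x) + G' x) - homP (B x) - e / 2 - M * \1_E (shrink t x).
have bw : bmeas w.
  apply: (bmeasB (bmeasB (bmeasB bf bh) (bmeas_cst (e / 2)))).
  exact: (bmeasM (bmeas_cst M) bIt).
have w_le0 : \int[mu3]_(x in cyl t) w x <= 0.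
  rewrite (Rintegral_tiles k mg bw); apply: sumr_le0 => i _.
  have bBi : bmeas2 (fun x => B (to_tile k i x)).
    by move=> i' j'; exact: (bmeas_inplane _ ltr01 (bB i' j')).
  have bwi : bmeas (fun x => w (to_tile k i x)) by exact: (bmeas_inplane _ ltr01 bw).
  have bGi : bmeas_mx (G (lab i)) by have [phi a] := (HGl i).1; exact: (Adm_bmeas_mx a).
  have bl := bmeas_lagrangian yPhi alpha_gt0 alpha_le Phi_delta2 gf sT (e / 2)
    (dZ (lab i)) M (P (lab i)) bGi bBi.
  apply: le_trans ((HGl i).2 _ bBi (fun x => tB1 _) (fun x => KB1 _)).
  apply: (Rintegral_cyl_le bwi bl) => x cx.
  rewrite /w /lagrangian G'E// {1}/to_tile (integrand_periodic gf).
  rewrite lerD2l lerN2; apply: ler_wpM2l => //.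
  set y := shrink t (to_tile k i x).
  rewrite indicE; have [yE|nyE] := pselect (E y); first by rewrite mem_set// bad_le1.
  rewrite memNset// /bad lern0 -leqn0.
  have cy : cyl 1 y.
    apply/(shrink_cyl _ t0); apply: (@tile_sub R k mg i); by rewrite to_tileK.
  have [gi1 gi2] := grid_index_tile i (isT : (0 < k)%N) cx.
  have gQ Z : grid n (Q Z) y <-> Q Z i.1%:Z i.2%:Z by rewrite /grid/= gi1 gi2.
  have SE Z : S Z y <-> enorm (B1 y - P Z) < dZ Z.
    by rewrite /S /B1/= GE// row_mxKl.
  have agree Z : Z \in s -> S Z y <-> Q Z i.1%:Z i.2%:Z.
    move=> Zs; split=> h.
      by apply/gQ; apply: contrapT => nq; apply: nyE; apply: (EZ _ Z) => //; left.
    by apply: contrapT => nS; apply: nyE; apply: (EZ _ Z) => //; right; split => //; apply/gQ.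
  have [Z Zs ZY] := Hs _ (KB1 y).
  have PB1 : P (B1 y) = B1 y by exact: (iffLR (tangent_mxP sT _) (tB1 y)).
  rewrite PB1 in ZY.
  have hasQ : has (fun Z => Q Z i.1%:Z i.2%:Z) s.
    by apply/hasP; exists Z => //; apply/(agree Z Zs); apply/SE.
  have Ql : Q (lab i) i.1%:Z i.2%:Z by rewrite /lab hasQ; exact: (@nth_find _ 0 (fun Z => Q Z i.1%:Z i.2%:Z) s hasQ).
  have /SE h := iffRL (agree _ (labs i)) Ql.
  (* Off the exceptional set, belonging to the cell of a label means being close to its centre, so
     [bad] is 0. *)
  by rewrite leNgt /B -/y h.
have h1 : hom xi <= ecell T xi t.
  by apply: (hom_le_ecell yPhi alpha_gt0 gf) => //; rewrite muln_gt0.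
apply: le_trans h1 _.
apply: le_trans (ecell_le yPhi alpha_gt0 gf xi aG2) _.
rewrite ler_pdivrMl//.
have -> : energy t (fun x => flat_mx xi + (Gp (shrink t x) + G' x)) =
    \int[mu3]_(x in cyl t) f x (flat_mx (B x) + G' x).
  apply: eq_Rintegral => x _; congr (f x _); rewrite addrA; congr (_ + _).
  by rewrite /B /B1 Gflat /flat_mx add_row_mx addr0 row_mxKl.
have bR := bmeasD (bmeasD (bmeasD bw bh) (bmeas_cst (e / 2))) (bmeasM (bmeas_cst M) bIt).
have -> : \int[mu3]_(x in cyl t) f x (flat_mx (B x) + G' x) =
    \int[mu3]_(x in cyl t) (w x + homP (B x) + e / 2 + M * \1_E (shrink t x)).
  by apply: eq_Rintegral => x _; rewrite /w; ring.
rewrite (Rintegral_cylD _ (bmeasD (bmeasD bw bh) (bmeas_cst (e / 2))) (bmeasM (bmeas_cst M) bIt)).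
rewrite (Rintegral_cylD _ (bmeasD bw bh) (bmeas_cst (e / 2))) (Rintegral_cylD _ bw bh).
rewrite Rintegral_cyl_cst ?(ltW t0)// Rintegral_cylZ//.
rewrite (Rintegral_shrink t0 bI).
rewrite (@Rintegral_shrink R t (fun x => homP (B1 x)) t0); last first.
  exact: (bmeas_homP yPhi alpha_gt0 alpha_le Phi_delta2 gf sT bB1).
have IE : \int[mu3]_(x in cyl 1) \1_E x <= (size s)%:R * e'.
  rewrite /Rintegral integral_indic//; last exact: measurable_cyl.
  rewrite -[leRHS]/(fine ((size s)%:R * e')%:E) fine_le//.
    rewrite ge0_fin_numE//; apply: le_lt_trans (@L3_cyl_lty R 1).
    by apply: le_outer_measure; exact: subIsetr.
  by apply: le_trans LE; apply: le_outer_measure; exact: subIsetl.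
have MIE : M * \int[mu3]_(x in cyl 1) \1_E x <= e / 2.
  apply: le_trans (ler_wpM2l M_ge0 IE) _; rewrite mulrA /e'.
  rewrite mulrCA ler_piMr ?(ltW e2)// ler_pdivrMr// mul1r lerDl//.
set I := \int[mu3]_(x in cyl 1) homP (B1 x).
move: w_le0 MIE; set W := \int[mu3]_(x in cyl t) w x; set J := M * _ => w0 J0.
rewrite [M * (_ * _)]mulrCA -/J -/I.
have AA := @tiled_arith R t I W J e w0 J0.
apply: le_trans AA _; exact: lexx.
Qed.

End Quasiconvexity.

(** * Lifting two-dimensional test fields *)

Section CaratheodoryIntegral.
Context d (T : measurableType d) (R : realType) (mu : {measure set T -> \bar R}).
Local Notation mx := [the {outer_measure set T -> \bar R} of (mu^*)%mu].
Local Notation ct := (caratheodory_type mx).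
Local Notation cmu := (mx : set ct -> \bar R).

Lemma caratheodory_sub (A : set T) : measurable A -> measurable (A : set ct).
Proof. by move=> mA; apply: (@sub_caratheodory _ _ _ mu); exact: sub_sigma_algebra. Qed.

Lemma measurable_caratheodory_id : measurable_fun [set: ct] (id : ct -> T).
Proof. by move=> _ B mB; rewrite setTI; exact: caratheodory_sub. Qed.

Lemma measurable_fun_caratheodoryT d' (T' : measurableType d') (h : T -> T') :
  measurable_fun setT h -> measurable_fun setT (h : ct -> T').
Proof. by move=> mh; apply: (measurableT_comp mh measurable_caratheodory_id). Qed.

(** A Borel function has the same integral for a measure and for its completion: the identity pushes
    the latter forward to the former. *)
Lemma ge0_integral_caratheodory (D : set T) (h : T -> \bar R) : measurable D ->
  measurable_fun setT h -> (forall x, 0 <= h x)%E ->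
  (\int[cmu]_(x in D) h x = \int[mu]_(x in D) h x)%E.
Proof.
move=> mD mh h0.
pose P : {measure set T -> \bar R} :=
  measure_function_pushforward__canonical__measure_function_Measure
    [the measure _ _ of cmu] measurable_caratheodory_id.
have E := @ge0_integral_pushforward _ _ ct T R id measurable_caratheodory_id
  [the measure _ _ of cmu] D h mD (measurable_funTS mh) (fun x _ => h0 x).
apply: etrans (esym E) _; apply: (@eq_measure_integral _ T R D mu P h) => A mA _.
by have := measurable_mu_extE mu mA.
Qed.

Lemma integral_caratheodory (D : set T) (h : T -> \bar R) : measurable D ->
  measurable_fun setT h ->
  (\int[cmu]_(x in D) h x = \int[mu]_(x in D) h x)%E.
Proof.
move=> mD mh.
have pE := ge0_integral_caratheodory mD (measurable_funepos mh) (fun x => funepos_ge0 h x).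
have nE := ge0_integral_caratheodory mD (measurable_funeneg mh) (fun x => funeneg_ge0 h x).
apply: etrans (@integralE _ ct R [the measure _ _ of cmu] D h) _.
by apply: etrans (esym (@integralE _ T R mu D h)); rewrite pE nE.
Qed.

(** Completeness: every subset of the exceptional null set is measurable. *)
Lemma measurable_fun_caratheodory_ae d' (T' : measurableType d') (D : set T)
    (g h : T -> T') : measurable (D : set ct) ->
  measurable_fun (D : set ct) (g : ct -> T') -> {ae cmu, forall x, D x -> h x = g x} ->
  measurable_fun (D : set ct) (h : ct -> T').
Proof.
move=> mD mg [N [mN N0 sN]] _ B mB.
have nul (S : set T) : S `<=` N -> measurable (S : set ct).
  move=> SN; apply: null_caratheodory; apply/eqP; rewrite eq_le outer_measure_ge0 andbT.
  by rewrite -N0; exact: le_outer_measure.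
rewrite (_ : D `&` _ = (D `&` g @^-1` B) `\` N `|` (D `&` h @^-1` B) `&` N).
  apply: measurableU; first by apply: measurableD => //; exact: mg.
  by apply: nul; exact: subIsetr.
have gh x : ~ N x -> D x -> h x = g x.
  by move=> nN; apply: contrapT => nP; apply: nN; exact: sN.
apply/seteqP; split=> x /=.
  move=> [Dx Bx]; have [Nx|nN] := pselect (N x); first by right.
  by left; split => //; split => //; rewrite -gh.
move=> [[[Dx Bx] nN]|[]//]; split => //.
by rewrite gh.
Qed.

(** The function is rebuilt from its sublevel sets {g < q}, q rational, each replaced by a Borel
    hull: g0(x) is the infimum of the q, truncated to [-c, c], whose hull contains x. Off the
    countably many null differences the hulls are the sublevel sets. *)
Lemma borel_version (D : set T) (g : T -> R) (c : R) : measurable D ->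
  (mu D < +oo)%E -> measurable_fun (D : set ct) (g : ct -> R) -> 0 <= c ->
  exists g0 : T -> R, [/\ measurable_fun setT g0, forall x, `|g0 x| <= c &
    {ae cmu, forall x, D x -> `|g x| <= c -> g0 x = g x}].
Proof.
move=> mD Doo mg c0.
pose A (q : rat) : set T := D `&` g @^-1` `]-oo, ratr q[.
have mA q : (mu^*)%mu.-caratheodory (A q).
  by have := mg (caratheodory_sub mD) _ (measurable_itv `]-oo, ratr q[).
have Afin q : ((mu^*)%mu (A q) < +oo)%E.
  apply: le_lt_trans Doo; rewrite -(measurable_mu_extE mu mD).
  by apply: le_mu_ext; exact: subIsetl.
have HB q := cid2 (caratheodory_hull (mA q) (Afin q)).
pose B q := s2val (HB q); have [mB AB] : (forall q, measurable (B q)) /\ (forall q, A q `<=` B q).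
  by split=> q; have [] := s2valP (HB q).
have B0 q : (mu^*)%mu (B q `\` A q) = 0%E := s2valP' (HB q).
pose cl (y : R) := Num.max (- c) (Num.min c y).
have cl_le y : `|cl y| <= c.
  rewrite ler_norml /cl le_max lexx/= ge_max ge_min lexx/= andbT.
  by rewrite (le_trans _ c0)// oppr_le0.
(* Enumerates the rationals; the value c, neutral for the infimum, is used when x is not in the hull
   or n codes no rational. *)
pose h (n : nat) x := if (choice.unpickle n : option rat) is Some q then
  (if x \in B q then cl (ratr q) else c) else c.
have h_le n x : `|h n x| <= c.
  rewrite /h; case: choice.unpickle => [q|]; last by rewrite ger0_norm.
  by case: ifP => _; [exact: cl_le|rewrite ger0_norm].
have hlb x : has_lbound (range (h ^~ x)).
  by exists (- c) => _ [n _ <-]; have := h_le n x; rewrite ler_norml => /andP[].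
have hinf x : has_inf (range (h ^~ x)) by split; [exists (h 0%N x), 0%N|exact: hlb].
pose g0 x := inf (range (h ^~ x)).
exists g0; split.
- have -> : g0 = fun x => infs (h ^~ x) 0%N.
    apply/funext => x; rewrite /infs /g0; congr inf.
    by apply/seteqP; split=> [_ [n _ <-]|_ [n _ <-]]; exists n.
  apply: measurable_fun_infs => [x _|n]; first exact: hlb.
  rewrite /h; case: choice.unpickle => [q|]; last exact: measurable_cst.
  rewrite (_ : (fun x => _) = fun x => c + (cl (ratr q) - c) * \1_(B q) x); last first.
    apply/funext => x; rewrite indicE; case: (x \in B q); rewrite ?mulr1 ?mulr0 ?addr0//.
    by rewrite addrC subrK.
  apply: measurable_funD; first exact: measurable_cst.
  by apply: measurable_funM; [exact: measurable_cst|exact: measurable_indic].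
- move=> x; rewrite ler_norml; apply/andP; split.
    apply: lb_le_inf; first by have [] := hinf x.
    by move=> _ [n _ <-]; have := h_le n x; rewrite ler_norml => /andP[].
  apply: le_trans (ge_inf (hlb x) (ex_intro2 _ _ 0%N I erefl)) _.
  exact: le_trans (ler_norm _) (h_le _ _).
- pose N := \bigcup_n (if (choice.unpickle n : option rat) is Some q then B q `\` A q else set0).
  exists N; split.
  + apply: bigcupT_measurable => n; case: choice.unpickle => [q|]; last exact: measurable0.
    exact: (null_caratheodory (B0 q)).
  + apply/eqP; rewrite eq_le outer_measure_ge0 andbT.
    apply: le_trans (outer_measure_sigma_subadditive mx _) _.
    rewrite eseries0// => n _ _; case: choice.unpickle => [q|]; last exact: outer_measure0.
    exact: B0.
  + move=> x /= H; apply: contrapT => nN; apply: H => Dx gc.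
    have BA q : B q x -> A q x.
      move=> Bx; apply: contrapT => nA; apply: nN; exists (choice.pickle q); first exact: I.
      by rewrite choice.pickleK.
    apply/eqP; rewrite eq_le; apply/andP; split; last first.
      apply: lb_le_inf; first by have [] := hinf x.
      move=> _ [n _ <-]; rewrite /h.
      have gcc := le_trans (ler_norm _) gc.
      case: choice.unpickle => [q|//]; case: ifPn => // /set_mem /BA [_ /=].
      by rewrite in_itv/= => gq; rewrite le_max le_min gcc (ltW gq) orbT.
    have [gc'|cg] := ltP (g x) c; last first.
      apply: le_trans cg; apply: le_trans (ge_inf (hlb x) (ex_intro2 _ _ 0%N I erefl)) _.
      exact: le_trans (ler_norm _) (h_le _ _).
    apply/ler_addgt0Pr => e e0.
    have [q] : exists q, ratr q \in `](g x), (Num.min c (g x + e))[.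
      by apply: rat_in_itvoo; rewrite lt_min gc' ltrDl.
    rewrite in_itv/= lt_min => /and3P[gq qc qe].
    have qB : B q x by apply: AB; split => //=; rewrite in_itv.
    apply: le_trans (ge_inf (hlb x) (ex_intro2 _ _ (choice.pickle q) I erefl)) _.
    rewrite /h choice.pickleK mem_set// /cl ge_max ge_min (ltW qe) orbT andbT.
    apply: le_trans (_ : g x <= _); last by rewrite lerDl ltW.
    by move: gc; rewrite ler_norml => /andP[].
Qed.

End CaratheodoryIntegral.

Lemma integral_vanish d (T : measurableType d) (R : realType)
    (mu : {measure set T -> \bar R}) (D : set T) (h : T -> \bar R) :
  (forall x, ~ D x -> h x = 0%E) ->
  (\int[mu]_(x in D) h x = \int[mu]_x h x)%E.
Proof.
move=> h0; rewrite integral_mkcond; apply: eq_integral => x _.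
by rewrite patchE; case: ifPn => //; rewrite notin_setE => /h0.
Qed.

Notation leb2 R := (caratheodory_type (@L2 R)).
Notation mu2 := (L2 : set (leb2 _) -> \bar _).

(** * Horizontal slices and Fubini's theorem *)

Section Slices.
Variable R : realType.
Local Notation space := (space3 R).
Local Notation plane := (plane2 R).
Local Notation cyl t := (cylinder (square t) : set (space3 R)).
Implicit Types (t : R).

Lemma measurable_Borel_square t : measurable (square t : set (borel2 R)).
Proof. by apply: measurableX; exact: measurable_itv. Qed.

Lemma measurable_square t : measurable (square t : set (leb2 R)).
Proof. exact: (@caratheodory_sub _ _ _ (B2 R) _ (measurable_Borel_square t)). Qed.

Lemma measurable_Borel_cyl t : measurable (cyl t : set (borel3 R)).
Proof.
by apply: measurableX; [exact: measurable_Borel_square|exact: measurable_itv].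
Qed.

Lemma L3_cylinder (A : set plane) : measurable (A : set (borel2 R)) ->
  L3 (cylinder A : set space) = B2 R A.
Proof.
move=> mA; rewrite L3_Borel; last by apply: measurableX => //; exact: measurable_itv.
have -> : B3 R (cylinder A) = (B2 R A * sflam R `](- 2^-1)%R, 2^-1%R[%classic)%E.
  exact: (sfprodE (B2 R) (sflam R) mA (measurable_itv _)).
rewrite -[RHS]mule1 /= /sflam/= lebesgue_measure_itv/= lte_fin ifT; last by lra.
by congr (_ * _)%E; rewrite -EFinD; congr (_%:E); lra.
Qed.

Lemma B2_square_lty t : (B2 R (square t) < +oo)%E.
Proof.
by rewrite -L3_cylinder; [exact: L3_cyl_lty|exact: measurable_Borel_square].
Qed.

Lemma L2_square_lty t : (L2 (square t) < +oo :> \bar R)%E.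
Proof.
have -> : L2 (square t) = B2 R (square t) :> \bar R.
  exact: (@measurable_mu_extE _ _ _ (B2 R)) (measurable_Borel_square t).
exact: B2_square_lty.
Qed.

Lemma integral_mu3_Borel t (v : space -> R) : measurable_fun setT (v : borel3 R -> R) ->
  (\int[mu3]_(x in cyl t) (v x)%:E = \int[B3 R]_(x in cyl t) (v x)%:E)%E.
Proof.
move=> mv; apply: (@integral_caratheodory _ _ _ (B3 R) _ (EFin \o v)).
  exact: measurable_Borel_cyl.
exact/measurable_EFinP.
Qed.

Lemma integral_mu2_Borel t (v : plane -> R) : measurable_fun setT (v : borel2 R -> R) ->
  (\int[mu2]_(x in square t) (v x)%:E = \int[B2 R]_(x in square t) (v x)%:E)%E.
Proof.
move=> mv; apply: (@integral_caratheodory _ _ _ (B2 R) _ (EFin \o v)).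
  exact: measurable_Borel_square.
exact/measurable_EFinP.
Qed.

Lemma slab_fubini t (v : space -> R) (c : R) : measurable_fun setT (v : borel3 R -> R) ->
  (forall x, `|v x| <= c) -> (forall x, ~ cyl t x -> v x = 0) ->
  (\int[mu3]_(x in cyl t) (v x)%:E =
   \int[sflam R]_z \int[B2 R]_y (v (y, z))%:E)%E.
Proof.
move=> mv vc v0; rewrite (integral_mu3_Borel t mv).
rewrite (@integral_vanish _ _ _ (B3 R) (cyl t) (EFin \o v)); last first.
  by move=> x /v0 /= ->.
apply/esym; apply: (@integral21_prod_meas1 _ _ _ _ R (B2 R) (sflam R) (EFin \o v)).
have /integrableP[m1 i1] : (B3 R).-integrable (cyl t) (EFin \o v).
  apply: measurable_bounded_integrable; first exact: measurable_Borel_cyl.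
  - by have := @L3_cyl_lty R t; rewrite (L3_Borel (measurable_Borel_cyl t)).
  - exact: measurable_funTS.
  - exists c; split; first exact: num_real.
    by move=> y cy x _; exact: le_trans (vc x) (ltW cy).
apply/integrableP; split; first exact/measurable_EFinP.
by rewrite -(@integral_vanish _ _ _ (B3 R) (cyl t))// => x /v0 /= ->; rewrite normr0.
Qed.

Definition plane_incl (y : plane) : space := (y, 0).

Lemma plane_incl_linear : linear plane_incl.
Proof.
move=> a y y'; rewrite /plane_incl.
change ((a *: y + y', 0) = (a *: y + y', a * 0 + 0) :> space).
by rewrite mulr0 addr0.
Qed.

HB.instance Definition _ :=
  GRing.isLinear.Build R plane space _ plane_incl plane_incl_linear.

Lemma plane_inclE (y : plane) (z : R) : ((0, z) : space) + plane_incl y = (y, z).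
Proof.
change ((0 + y, z + 0) = (y, z) :> space); by rewrite add0r addr0.
Qed.

Lemma pair_continuous (z : R) : continuous (fun y : plane => (y, z) : space).
Proof.
have cc : continuous ((fun=> z) : plane -> R^o) by move=> y; exact: cvg_cst.
have ci : continuous (id : plane -> plane) by move=> y; exact: cvg_id.
exact: (@continuous_pair plane plane R^o _ _ ci cc).
Qed.

(** The support of the slice is contained in the slice of the support, which is relatively compact
    as part of its projection on the plane. *)
Lemma test_slice (Om : set plane) theta (z : R) :
  test_function (cylinder Om : set space) theta ->
  test_function Om (fun y => theta (y, z) : R^o).
Proof.
move=> [sth cK sK]; have cz := @pair_continuous z.
have sub : closure [set y | theta (y, z) != 0] `<=`
    [set y | closure [set x | theta x != 0] (y, z)].
  rewrite closureE; apply: smallest_sub; last by move=> y /= h; exact: subset_closure.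
  by apply: (closed_comp _ (@closed_closure _ _)) => y _; exact: cz.
split.
- move=> k; have ci : continuous plane_incl by exact: pair_continuous.
  have := @Ck_affine _ _ _ _ plane_incl (0, z) theta setT k ci (sth k).
  rewrite preimage_setT (_ : (fun y => _) = (fun y => theta (y, z)))//.
  by apply/funext => y; rewrite plane_inclE.
- have ccl : compact (fst @` closure [set x | theta x != 0] : set plane).
    by apply: continuous_compact cK; apply: continuous_subspaceT => x; exact: cvg_fst.
  apply: (subclosed_compact _ ccl); first exact: closed_closure.
  by move=> y /sub h; exists (y, z).
- by move=> y /sub /sK [].
Qed.

Lemma derive_slice (theta : space -> R^o) (j : 'I_2) (y : plane) (z : R) :
  'D_(basis2 j) (fun y => theta (y, z) : R^o) y = 'D_(basis3 (lshift 1 j)) theta (y, z).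
Proof.
have E (g g' : R -> R^o) : g = g' -> lim (g h @[h --> (0 : R)^']) = lim (g' h @[h --> (0 : R)^']).
  by move=> ->.
apply: E; apply/funext => h /=; congr (_ *: (theta _ - _)).
change (((h *: basis2 j + y), z) = (h *: basis2 j + y, h * ((lshift 1 j == 2%N :> nat)%:R) + z) :> space).
congr (_, _).
by rewrite (_ : (lshift 1 j == 2%N :> nat) = false) ?mulr0 ?add0r//; case: j => -[|[|k]].
Qed.

End Slices.

Section Lifting.
Variable R : realType.
Local Notation vec := 'cV[R]_3.
Local Notation mat := ('M[R]_(3, 2 + 1)).
Local Notation mat2 := 'M[R]_(3, 2).
Local Notation space := (space3 R).
Local Notation plane := (plane2 R).
Local Notation cyl t := (cylinder (square t) : set (space3 R)).
Implicit Types (t : R).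

Lemma borel3_fst (u : plane -> R) : measurable_fun setT (u : borel2 R -> R) ->
  measurable_fun setT ((fun x => u x.1) : borel3 R -> R).
Proof. by move=> mu; exact: (measurableT_comp mu measurable_fst). Qed.

Lemma bmeas_fst (u : plane -> R) (c : R) : measurable_fun setT (u : borel2 R -> R) ->
  (forall y, `|u y| <= c) -> bmeas (fun x => u x.1).
Proof.
move=> mu uc; split; last by exists c.
exact: Borel_measurable_funT (borel3_fst mu).
Qed.

Lemma borel2_slice (v : space -> R) (z : R) : measurable_fun setT (v : borel3 R -> R) ->
  measurable_fun setT ((fun y => v (y, z)) : borel2 R -> R).
Proof. by move=> mv; exact: (measurableT_comp mv (measurable_pair2 z)). Qed.

Lemma test_off (Om : set space) theta v x : test_function Om theta -> ~ Om x ->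
  theta x = 0 /\ 'D_v theta x = 0.
Proof.
move=> tth nx; split; last exact: test_derive_eq0 tth nx.
have [_ _ sO] := tth.
exact: nbhs_singleton (supp_open (test_continuous tth) (fun h => nx (sO _ h))).
Qed.

(** By Fubini the identity is checked at each height z, where the slice of the test function is a
    planar test function. Fubini is applied to the Borel versions [u0] and [g0], the weak identity
    is known for u and g. *)
Lemma lift_weak t (j : 'I_2) (u g u0 g0 : plane -> R) (c : R) :
  measurable_fun setT (u0 : borel2 R -> R) -> (forall y, `|u0 y| <= c) ->
  measurable_fun setT (g0 : borel2 R -> R) -> (forall y, `|g0 y| <= c) ->
  weak_derivative L2 (square t) (basis2 j) u g ->
  (forall y, square t y -> u0 y = u y) ->
  measurable_fun (square t : set (leb2 R)) (g : leb2 R -> R) ->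
  {ae mu2, forall y, square t y -> g0 y = g y} ->
  weak_derivative L3 (cyl t) (basis3 (lshift 1 j)) (fun x => u0 x.1) (fun x => g0 x.1).
Proof.
move=> mu0 u0c mg0 g0c wug u0u mg g0g.
have bu := bmeas_fst mu0 u0c; have bg := bmeas_fst mg0 g0c.
apply/(weak_derivativeP _ (measurable_cyl t) (@cyl_slab R t) bu bg) => theta tth.
set e := basis3 (lshift 1 j).
have [mth [cth hth]] := test_bmeas tth; have [mdth [cdth hdth]] := test_derive_bmeas e tth.
have bth : measurable_fun setT (theta : borel3 R -> R).
  exact: (measurable_continuous_Borel3 (test_continuous tth)).
have bdth : measurable_fun setT ((fun x => 'D_e theta x) : borel3 R -> R).
  exact: (measurable_continuous_Borel3 (@test_derive_continuous _ _ _ e tth)).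
pose v1 x := u0 x.1 * 'D_e theta x; pose v2 x := - (g0 x.1 * theta x).
have mv1 : measurable_fun setT (v1 : borel3 R -> R).
  by apply: measurable_funM; [exact: borel3_fst|].
have mv2 : measurable_fun setT (v2 : borel3 R -> R).
  by apply: measurableT_comp => //; apply: measurable_funM; [exact: borel3_fst|].
have v10 x : ~ cyl t x -> v1 x = 0.
  by move=> nx; rewrite /v1 (test_off e tth nx).2 mulr0.
have v20 x : ~ cyl t x -> v2 x = 0.
  by move=> nx; rewrite /v2 (test_off e tth nx).1 mulr0 oppr0.
have v1c x : `|v1 x| <= c * cdth by rewrite normrM ler_pM.
have v2c x : `|v2 x| <= c * cth by rewrite normrN normrM ler_pM.
have E : \int[mu3]_(x in cyl t) v1 x = \int[mu3]_(x in cyl t) v2 x.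
  rewrite /Rintegral (slab_fubini mv1 v1c v10) (slab_fubini mv2 v2c v20).
  congr fine; apply: eq_integral => z _.
  have slice v : (forall x, ~ cyl t x -> v x = 0) ->
      measurable_fun setT (v : borel3 R -> R) ->
      (\int[B2 R]_y (v (y, z))%:E = \int[mu2]_(y in square t) (v (y, z))%:E)%E.
    move=> v0 mv; rewrite (integral_mu2_Borel t (borel2_slice z mv)).
    rewrite (@integral_vanish _ _ _ (B2 R) (square t))// => y ny.
    by rewrite v0// => -[].
  rewrite (slice _ v10 mv1) (slice _ v20 mv2).
  have tz := test_slice z tth.
  transitivity (\int[mu2]_(y in square t) (u y * 'D_(basis2 j) (fun y => theta (y, z) : R^o) y)%:E)%E.
    by apply: eq_integral => y /set_mem sy; rewrite /v1 u0u// derive_slice.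
  rewrite (wug _ tz).
  have msq := @measurable_square R t.
  have mz : measurable_fun (square t : set (leb2 R)) ((fun y => theta (y, z)) : leb2 R -> R).
    apply: measurable_funTS.
    exact: (@measurable_fun_caratheodoryT _ _ _ (B2 R) _ _ _ (borel2_slice z bth)).
  have mg0z : measurable_fun (square t : set (leb2 R)) (fun y : leb2 R => g0 y).
    apply: measurable_funTS.
    exact: (@measurable_fun_caratheodoryT _ _ _ (B2 R) _ _ _ mg0).
  have m1 : measurable_fun (square t : set (leb2 R)) (fun y : leb2 R => (g0 y * theta (y, z))%:E).
    by apply/measurable_EFinP; apply: measurable_funM.
  have m2 : measurable_fun (square t : set (leb2 R)) (fun y : leb2 R => (g y * theta (y, z))%:E).
    by apply/measurable_EFinP; apply: measurable_funM.
  have -> : (\int[mu2]_(y in square t) (g y * theta (y, z))%:E =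
             \int[mu2]_(y in square t) (g0 y * theta (y, z))%:E)%E.
    apply: (@ae_eq_integral _ _ _ [the measure _ _ of mu2] _ (fun y => (g0 y * theta (y, z))%:E) _ msq m2 m1).
    apply: (@filterS _ _ (ae_filter_ringOfSetsType [the measure _ _ of mu2]) _ _ _ g0g).
    by move=> y gy sy; rewrite gy.
  have i1 : [the measure _ _ of mu2].-integrable (square t : set (leb2 R))
      (EFin \o (fun y : leb2 R => g0 y * theta (y, z))).
    apply: measurable_bounded_integrable; first exact: msq.
    - exact: L2_square_lty.
    - exact/measurable_EFinP.
    - exists (c * cth); split; first exact: num_real.
      by move=> K cK y _; apply: le_trans (ltW cK); rewrite normrM ler_pM.
  apply: etrans (esym (integralN (integrable_add_def msq i1))) _.
  by apply: eq_integral.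
rewrite [LHS]E /v2.
have bgt := bmeasM bg (test_bmeas tth).
have := Rintegral_cylZ t (-1) bgt; rewrite mulN1r => <-.
by apply: eq_Rintegral => x _; rewrite mulN1r.
Qed.

End Lifting.

Section AlmostEverywhere2.
Variable R : realType.

Lemma ae2S (P Q : leb2 R -> Prop) : (forall x, P x -> Q x) ->
  {ae mu2, forall x, P x} -> {ae mu2, forall x, Q x}.
Proof.
by move=> PQ; apply: (@filterS _ _ (ae_filter_ringOfSetsType [the measure _ _ of mu2])).
Qed.

Lemma ae2I (P Q : leb2 R -> Prop) :
  {ae mu2, forall x, P x} -> {ae mu2, forall x, Q x} ->
  {ae mu2, forall x, P x /\ Q x}.
Proof. exact: (@filterI _ _ (ae_filter_ringOfSetsType [the measure _ _ of mu2])). Qed.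

Lemma ae2_fin (I : finType) (P : I -> leb2 R -> Prop) :
  (forall i, {ae mu2, forall x, P i x}) -> {ae mu2, forall x, forall i, P i x}.
Proof. exact: (@filter_forall _ _ _ _ (ae_filter_ringOfSetsType [the measure _ _ of mu2])). Qed.

Lemma is_derive_zero_line (V : normedModType R) (w : V -> R^o) x v :
  (forall h : R, w (h *: v + x) = w x) -> is_derive x v w 0.
Proof.
move=> H; have E : (fun h : R => h^-1 *: ((w \o shift x) (h *: v) - w x)) = fun=> (0 : R^o).
  by apply/funext => h /=; rewrite H subrr scaler0.
apply: DeriveDef; last by apply: derive_zero_line; apply: (@filterE _ (nbhs (0 : R))) => h; exact: H.
by rewrite /derivable E; exact: is_cvg_cst.
Qed.

End AlmostEverywhere2.

Section LiftAdm.
Variable R : realType.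
Local Notation vec := 'cV[R]_3.
Local Notation mat := ('M[R]_(3, 2 + 1)).
Local Notation mat2 := 'M[R]_(3, 2).
Local Notation space := (space3 R).
Local Notation plane := (plane2 R).
Local Notation cyl t := (cylinder (square t) : set (space3 R)).
Implicit Types (t : R).

(** The cylinder over the planar exceptional set has the same measure as its base, the height being
    1; null sets of the slab thus descend to the plane. *)
Lemma ae_cylinder t (P : plane -> Prop) :
  measurable ([set y | square t y /\ ~ P y] : set (borel2 R)) ->
  {ae mu3, forall x, cyl t x -> P (x : space).1} -> {ae mu2, forall y, square t y -> P y}.
Proof.
move=> mN /ae_null N0; set N := [set y | _] in mN.
have BN : B2 R N = 0%E.
  rewrite -(L3_cylinder mN); apply/eqP; rewrite eq_le outer_measure_ge0 andbT -N0.
  apply: le_outer_measure => x [[sx nP] x2] /=; apply: contra_not nP; apply.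
  by split.
have LN : L2 N = 0%E :> \bar R.
  by rewrite -BN; exact: (@measurable_mu_extE _ _ _ (B2 R)) mN.
exists N; split; [exact: (@caratheodory_sub _ _ _ (B2 R) _ mN)|exact: LN|].
move=> y /= /not_implyP[sy nP]; by split.
Qed.

Variable T : set vec.
Hypothesis sT : subspace T.

Lemma closure_square t (x : space) : closure (cyl t) x -> closure (square t) x.1.
Proof.
have cf : continuous (fst : space -> plane) by move=> y; exact: cvg_fst.
have : closure (cyl t) `<=` [set x | closure (square t) x.1].
  rewrite closureE; apply: smallest_sub; last by move=> y [sy _]; exact: subset_closure.
  by apply: (closed_comp _ (@closed_closure _ _)) => y _; exact: cf.
exact.
Qed.

(** The planar field is clamped and made constant in the vertical variable, with Borel versions of
    its derivatives and vertical derivative 0, then projected on [T]. That the projection does not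
    change the gradient almost everywhere follows from uniqueness of weak gradients on the cylinder,
    brought back to the plane. *)
Lemma lift_Adm t (psi : plane -> vec) (G : plane -> mat2) : 0 < t ->
  W1oo L2 basis2 (square t) psi G -> (forall y, square t y -> T (psi y)) ->
  zero_on (square t) (frontier (square t)) psi ->
  exists (phi : space -> vec) (Gp : space -> mat) (G0 : plane -> mat2),
    [/\ Adm T t phi Gp, forall x, cyl t x -> Gp x = flat_mx (G0 x.1),
        forall i j, measurable_fun setT (fun y : borel2 R => G0 y i j),
        forall y, projmx T *m G0 y = G0 y
      & {ae mu2, forall y, square t y -> G0 y = G y}].
Proof.
move=> t0 HW HT [cpsi psi0]; have t0' := ltW t0.
pose U x : vec := psi (clamp t x).1.
have Uoff x : ~ square t x.1 -> U x = 0.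
  by move=> nx; apply: psi0; apply: frontier_square => //; exact: clamp_out.
have Uid x : cyl t x -> U x = psi x.1 by move=> cx; rewrite /U clamp_id.
have Uz y (z z' : R) : U (y, z) = U (y, z') by [].
have Usq x : square t x.1 -> U x = psi x.1.
  move=> sx; have -> : U x = U (x.1, 0) by [].
  rewrite Uid//; apply/cylP; have /squareP[h1 h2] := sx.
  by split; rewrite //= normr0 invr_gt0.
have TU x : T (U x).
  have [sx|nx] := pselect (square t x.1); first by rewrite Usq//; exact: HT.
  by rewrite Uoff//; case: sT.
have cU i : continuous (fun x => U x i 0 : R^o).
  apply: (@continuous_entry R 3 1 _ U i 0) => x.
  apply: (@within_continuous_cvg _ _ _ _ _ (nbhs x) _ (fun x => (clamp t x).1) _ cpsi).
  - by apply: closure_square; exact: clamp_closure.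
  - by move=> y; apply: closure_square; exact: clamp_closure.
  - apply: (@continuous_comp _ _ _ (clamp t) (fst : space -> plane)); first exact: clamp_continuous.
    exact: cvg_fst.
have bU i : bmeas (fun x => U x i 0).
  by apply: (compact_comp_clamp_bounded t0' (cU i)) => x; rewrite /U clampK.
have mU i : measurable_fun setT ((fun y => U (y, 0) i 0) : borel2 R -> R).
  exact: (borel2_slice 0 (measurable_continuous_Borel3 (cU i))).
have HG (i : 'I_3) (j : 'I_2) : exists g0 : plane -> R, [/\ measurable_fun setT (g0 : borel2 R -> R),
    exists c : R, forall y, `|g0 y| <= c &
    {ae mu2, forall y, square t y -> g0 y = G y i j}].
  have [_ /(_ j)[[mg [c gc]] _]] := HW i.
  have [g0 [mg0 g0c g0g]] := @borel_version _ _ R (B2 R) (square t) (fun y => G y i j) `|c|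
    (@measurable_Borel_square R t) (@B2_square_lty R t) mg (normr_ge0 c).
  exists g0; split; [exact: mg0|exists `|c|; exact: g0c|].
  apply: ae2S (ae2I g0g gc) => y [h1 h2] sy; apply: h1 => //.
  exact: le_trans (h2 sy) (ler_norm c).
pose g0 i j := projT1 (cid (HG i j)); have Hg0 i j := projT2 (cid (HG i j)).
pose Gb y : mat2 := \matrix_(i, j) g0 i j y.
pose g1 i (j : 'I_3) x : R := \1_(cyl t) x * flat_mx (Gb x.1) i (j : 'I_(2 + 1)).
have bI := bmeas_indic (@measurable_cyl R t).
have aU i : scalar_adm t (fun x => U x i 0) (g1 i).
  split; [exact: cU|by move=> x nx; rewrite Uoff ?mxE|exact: bU|].
  move=> j; have g10 x : ~ cyl t x -> g1 i j x = 0.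
    by move=> nx; rewrite /g1 indicE memNset// mul0r.
  case: (split_ordP (j : 'I_(2 + 1))) => l jl.
  - have [mg [c gc] gae] := Hg0 i l.
    have g1E : g1 i j = fun x => \1_(cyl t) x * g0 i l x.1.
      by apply/funext => x; rewrite /g1 jl row_mxEl mxE.
    have bg : bmeas (g1 i j) by rewrite g1E; exact: (bmeasM bI (bmeas_fst mg gc)).
    split; [exact: bg|exact: g10|].
    apply: (zero_extension t0 (cU i) _ (bU i) bg g10); first by move=> x nx; rewrite Uoff ?mxE.
    have [_ [c' hc']] := bU i.
    have [_ /(_ l)[[mG _] wG]] := HW i.
    have h1 y : `|U (y, 0) i 0| <= Num.max c c' by rewrite le_max hc' orbT.
    have h2 y : `|g0 i l y| <= Num.max c c' by rewrite le_max gc.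
    have h3 y : square t y -> U (y, 0) i 0 = psi y i 0 by move=> sy; rewrite (Usq (y, 0)).
    move=> theta tth; rewrite jl.
    rewrite (@lift_weak R t l _ _ _ _ _ (mU i) h1 mg h2 wG h3 mG gae theta tth).
    congr (- _)%E; apply: eq_integral => x /set_mem cx.
    by rewrite -jl g1E indicE mem_set// mul1r.
  - have g1E : g1 i j = fun=> 0.
      by apply/funext => x; rewrite /g1 jl row_mxEr mxE mulr0.
    have x1E x (h : R) : (x + h *: basis3 j).1 = x.1.
      case: x => -[x1 x2] x3; rewrite jl.
      change ((x1 + h * 0%:R, x2 + h * 0%:R) = (x1, x2) :> plane).
      by rewrite mulr0 !addr0.
    have UE x (h : R) : U (x + h *: basis3 j) = U x.
      have -> : U (x + h *: basis3 j) = U ((x + h *: basis3 j).1, x.2) by [].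
      by rewrite x1E.
    rewrite g1E; split; [exact: bmeas_cst|by []|].
    apply: (@wderiv_lipschitz R j _ _ 0 (bU i) (bmeas_cst 0)).
      by move=> x h; rewrite UE subrr normr0 mul0r.
    by apply: aeW => x; apply: is_derive_zero_line => h; rewrite addrC UE.
have aG := Adm_projection sT aU.
exists (fun x => projmx T *m U x),
  (fun x => projmx T *m (\matrix_(i, j) g1 i j x : mat)), (fun y => projmx T *m Gb y).
have g1Gb x : cyl t x -> (\matrix_(i, j) g1 i j x : mat) = flat_mx (Gb x.1).
  by move=> cx; apply/matrixP => i j; rewrite mxE /g1 indicE mem_set// mul1r.
have mGb i j : measurable_fun setT (fun y : borel2 R => Gb y i j).
  have [mg _ _] := Hg0 i j; rewrite (_ : (fun y => _) = g0 i j)//.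
  by apply/funext => y; rewrite mxE.
have mPG i j : measurable_fun setT (fun y : borel2 R => (projmx T *m Gb y) i j).
  rewrite (_ : (fun y => _) = fun y => \sum_k projmx T i k * Gb y k j); last first.
    by apply/funext => y; rewrite mxE.
  apply: measurable_sum => k; apply: measurable_funM; last exact: mGb.
  exact: measurable_cst.
split.
- exact: aG.
- by move=> x cx; rewrite g1Gb// /flat_mx mul_mx_row mulmx0.
- exact: mPG.
- by move=> y; apply/(tangent_mxP sT); exact: (tangent_mx_proj sT).
- have PU x : projmx T *m U x = U x by rewrite projmxE// orthproj_id.
  have Gbae : {ae mu2, forall y, square t y -> Gb y = G y}.
    have := ae2_fin (fun i => ae2_fin (fun j => let: And3 _ _ h := Hg0 i j in h)).
    apply: ae2S => y h sy; apply/matrixP => i j; rewrite mxE; exact: h.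
  have Pae i j : {ae mu2, forall y, square t y -> (projmx T *m Gb y) i j = Gb y i j}.
    apply: ae_cylinder.
      rewrite (_ : [set y | _] = square t `&`
          (fun y : borel2 R => (projmx T *m Gb y) i j - Gb y i j) @^-1` (~` [set 0])).
        apply: measurableI; first exact: measurable_Borel_square.
        rewrite -[X in measurable X]setTI.
        apply: (measurable_funB (mPG i j) (mGb i j)); first exact: measurableT.
        exact: measurableC.
      apply/seteqP; split=> y /= [sy h]; split => //.
        by move=> /eqP; rewrite subr_eq0 => /eqP.
      by move=> e; apply: h; rewrite e subrr.
    have [/(_ i) ai _ _] := aG.
    have ai' : scalar_adm t (fun x => U x i 0) (fun j x =>
        (projmx T *m (\matrix_(i, j) g1 i j x : mat)) i j).
      by rewrite (_ : (fun x => U x i 0) = fun x => (projmx T *m U x) i 0)//;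
        apply/funext => x; rewrite PU.
    have := scalar_adm_unique ai' (aU i) (lshift 1 j); apply: ae3S => x h cx.
    have := h cx; rewrite g1Gb// /flat_mx mul_mx_row row_mxEl => ->.
    by rewrite /g1 indicE mem_set// mul1r /flat_mx row_mxEl.
  apply: ae2S (ae2I Gbae (ae2_fin (fun i => ae2_fin (fun j => Pae i j)))) => y [h1 h2] sy.
  rewrite -(h1 sy); apply/matrixP => i j; exact: h2.
Qed.

End LiftAdm.

Section FlatIntegral.
Variable R : realType.
Local Notation space := (space3 R).
Local Notation plane := (plane2 R).
Local Notation cyl t := (cylinder (square t) : set (space3 R)).

Lemma integral_cyl_fst t (w : plane -> R) (c : R) :
  measurable_fun setT (w : borel2 R -> R) -> 0 <= c ->
  (forall y, square t y -> `|w y| <= c) ->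
  (\int[mu3]_(x in cyl t) (w x.1)%:E = \int[mu2]_(y in square t) (w y)%:E)%E.
Proof.
move=> mw c0 wc; pose v (x : space) := \1_(cyl t) x * w x.1.
have vE x : cyl t x -> v x = w x.1 by move=> cx; rewrite /v indicE mem_set// mul1r.
have v0 x : ~ cyl t x -> v x = 0 by move=> nx; rewrite /v indicE memNset// mul0r.
have mv : measurable_fun setT (v : borel3 R -> R).
  apply: measurable_funM; last exact: borel3_fst.
  exact: measurable_indic (@measurable_Borel_cyl R t).
have vc x : `|v x| <= c.
  have [cx|nx] := pselect (cyl t x); last by rewrite v0// normr0.
  by rewrite vE//; apply: wc; case: cx.
transitivity (\int[mu3]_(x in cyl t) (v x)%:E)%E.
  by apply: eq_integral => x /set_mem cx; rewrite vE.
rewrite (slab_fubini mv vc v0) (integral_mu2_Borel t mw).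
set C := (\int[B2 R]_(y in square t) (w y)%:E)%E.
pose J : set (measurableTypeR R) := `](- 2^-1), 2^-1[%classic.
have mJ : measurable J by exact: measurable_itv.
transitivity (\int[sflam R]_(z in J) C)%E.
  rewrite [RHS]integral_mkcond; apply: eq_integral => z _; rewrite patchE.
  case: ifPn => [/set_mem Jz|]; last first.
    rewrite notin_setE => nJ; apply: integral0_eq => y _.
    by rewrite v0// => -[_ Jz].
  rewrite -(@integral_vanish _ _ _ (B2 R) (square t)); last first.
    by move=> y ny; rewrite v0// => -[].
  by apply: eq_integral => y /set_mem sy; rewrite vE.
have := @integral_cst _ _ R (sflam R) J mJ C; move=> ->.
rewrite -[RHS]mule1; congr (_ * _)%E.
rewrite /= /sflam/= lebesgue_measure_itv/= lte_fin ifT; last by lra.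
by rewrite -EFinD; congr (_%:E); lra.
Qed.

End FlatIntegral.

Section TangentialQuasiconvexity.
Variables (R : realType) (Phi : R -> R) (alpha beta : R).
Hypotheses (yPhi : young Phi) (alpha_gt0 : 0 < alpha) (alpha_le : alpha <= beta).
Hypothesis Phi_delta2 : Delta2 Phi.
Local Notation vec := 'cV[R]_3.
Local Notation mat := ('M[R]_(3, 2 + 1)).
Local Notation mat2 := 'M[R]_(3, 2).
Local Notation space := (space3 R).
Local Notation plane := (plane2 R).
Local Notation cyl t := (cylinder (square t) : set (space3 R)).
Variable f : space -> mat -> R.
Hypothesis gf : good_integrand Phi alpha beta f.
Variable T : set vec.
Hypothesis sT : subspace T.
Local Notation hom := (hom f T).
Local Notation homP := (homP f T).

(** [xi + G y] is tangential only for almost every y, so h is related to [hom] on tangential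
    matrices only; measurability of the integrand is deduced from its almost everywhere equality
    with the Borel function [w]. *)
Lemma hom_quasiconvex (h : mat2 -> \bar R) xi (psi : plane -> vec) (G : plane -> mat2) :
  (forall Z, tangent_mx T Z -> h Z = (hom Z)%:E) -> tangent_mx T xi ->
  W1oo L2 basis2 (square 1) psi G -> (forall y, square 1 y -> T (psi y)) ->
  zero_on (square 1) (frontier (square 1)) psi ->
  ((hom xi)%:E <= \int[mu2]_(y in square 1) h (xi + G y)%R)%E.
Proof.
move=> hE txi HW HT Hz.
have [phi [Gp [G0 [aG GE mG0 PG0 G0G]]]] := lift_Adm sT ltr01 HW HT Hz.
pose w y := homP (xi + G0 y).
have bB : bmeas2 (fun x => xi + lsubmx (Gp x)).
  move=> i j; have := bmeasD (bmeas_cst (xi i j)) (Adm_bmeas_mx aG i (lshift 1 j)).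
  rewrite (_ : (fun x => _ + _) = fun x => (xi + lsubmx (Gp x)) i j)//.
  by apply/funext => x; rewrite !mxE.
have bw := bmeas_homP yPhi alpha_gt0 alpha_le Phi_delta2 gf sT bB.
have wE x : cyl 1 x -> homP (xi + lsubmx (Gp x)) = w x.1.
  by move=> cx; rewrite (GE x cx) row_mxKl.
have mw : measurable_fun setT (w : borel2 R -> R).
  have mB i j : measurable_fun setT (fun y : borel2 R => (xi + G0 y) i j).
    rewrite (_ : (fun y => _) = fun y : borel2 R => xi i j + G0 y i j); last first.
      by apply/funext => y; rewrite mxE.
    by apply: measurable_funD; [exact: measurable_cst|exact: mG0].
  have cH := homP_continuous yPhi alpha_gt0 alpha_le Phi_delta2 gf sT.
  exact: (@measurable_fun_caratheodory _ (borel2 R) R 3 2 setT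
      (fun _ W => homP W) _ measurableT (fun W => measurable_cst (homP W)) (fun _ => cH) mB).
have [_ [c wc]] := bw.
have c0 : 0 <= c := le_trans (normr_ge0 _) (wc 0).
have wc1 y : square 1 y -> `|w y| <= c.
  move=> sy; have cy : cyl 1 (y, 0).
    by apply/cylP; have /squareP[h1 h2] := sy; split; rewrite //= normr0 invr_gt0.
  by have := wc (y, 0); rewrite wE.
have := hom_quasiconvex_int yPhi alpha_gt0 alpha_le Phi_delta2 gf sT txi aG GE mG0.
rewrite -lee_fin => /le_trans; apply.
rewrite -(EFin_Rintegral (measurable_cyl 1) (bmeas_cyl_integrable 1 bw)).
have -> : (\int[mu3]_(x in cyl 1) (homP (xi + lsubmx (Gp x)))%:E =
           \int[mu3]_(x in cyl 1) (w x.1)%:E)%E.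
  by apply: eq_integral => x /set_mem cx; rewrite wE.
rewrite (integral_cyl_fst mw c0 wc1).
have ms := @measurable_square R 1.
have mw2 : measurable_fun (square 1 : set (leb2 R)) (fun y : leb2 R => (w y)%:E).
  apply/measurable_EFinP; apply: measurable_funTS.
  exact: (@measurable_fun_caratheodoryT _ _ _ (B2 R) _ _ _ mw).
have hw : {ae mu2, forall y, square 1 y -> h (xi + G y) = (w y)%:E}.
  apply: ae2S G0G => y E sy; rewrite -(E sy) /w.
  have tG0 : tangent_mx T (xi + G0 y).
    by apply/(tangent_mxP sT); rewrite mulmxDr PG0 (iffLR (tangent_mxP sT xi) txi).
  by rewrite (hE _ tG0) (homPE _ sT).
have mh : measurable_fun (square 1 : set (leb2 R)) (fun y : leb2 R => h (xi + G y)).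
  exact: (@measurable_fun_caratheodory_ae _ _ _ (B2 R) _ _ _ _ _ ms mw2 hw).
rewrite le_eqVlt; apply/orP; left; apply/eqP.
apply: (@ae_eq_integral _ _ _ [the measure _ _ of mu2] _ (fun y => h (xi + G y)) _ ms mw2 mh).
by apply: ae2S hw => y e sy; rewrite e.
Qed.

End TangentialQuasiconvexity.

(** * Rank-one convexity *)

Section NullLines.
Variable R : realType.
Local Notation space := (space3 R).

Lemma borel2_null (P : set (borel2 R)) : measurable P ->
  (forall x, lebesgue_measure (xsection P x) = 0%E) \/
  (forall y, lebesgue_measure (ysection P y) = 0%E) -> B2 R P = 0%E.
Proof.
move=> mP h.
have E : (B2 R P = \int[sflam R]_x fubini_F (sflam R) (EFin \o \1_P) x)%E.
  rewrite -(indic_fubini_tonelli1 (sflam R) (sflam R) mP).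
  by rewrite (integral_indic (B2 R) measurableT mP) setIT.
rewrite E; case: h => h.
  rewrite (indic_fubini_tonelli_FE (sflam R) mP); apply: integral0_eq => x _.
  exact: h.
rewrite (indic_fubini_tonelli (sflam R) (sflam R) mP).
rewrite (indic_fubini_tonelli_GE (sflam R) mP); apply: integral0_eq => x _.
exact: h.
Qed.

Lemma lebesgue_subset1 (A : set R) (a : R) : A `<=` [set a] ->
  lebesgue_measure A = 0%E :> \bar R.
Proof.
move=> /subset_set1[->|->]; first exact: measure0.
exact: lebesgue_measure_set1.
Qed.

Lemma ae_line (n1 n2 v : R) : (n1 != 0) || (n2 != 0) ->
  {ae mu3, forall x, lform n1 n2 0 x <> v}.
Proof.
move=> n0; pose P : set (borel2 R) := [set y | lform n1 n2 0 (y, 0) = v].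
have mP : measurable P.
  have mw := borel2_slice 0 (measurable_continuous_Borel3 (@lform_continuous R n1 n2 0)).
  by have := mw measurableT _ (measurable_set1 v); rewrite setTI.
have P0 : B2 R P = 0%E.
  apply: borel2_null mP _; case/orP: n0 => n0; [right=> y|left=> x].
    apply: (@lebesgue_subset1 _ ((v - n2 * y) / n1)) => x.
    rewrite /ysection /= inE /P /lform/= mul0r addr0 => <-.
    by rewrite addrK mulrC mulKf.
  apply: (@lebesgue_subset1 _ ((v - n1 * x) / n2)) => y.
  rewrite /xsection /= inE /P /lform/= mul0r addr0 => <-.
  by rewrite addrAC subrr add0r mulrC mulKf.
exists (P `*` [set: measurableTypeR R]); split.
- by apply: Borel_measurable; exact: measurableX.
- change (L3 (P `*` [set: measurableTypeR R]) = 0%E).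
  rewrite L3_Borel; last exact: measurableX.
  rewrite (_ : B3 R _ = (B2 R P * sflam R setT)%E); last exact: (sfprodE (B2 R) (sflam R)).
  by rewrite P0 mul0e.
- move=> x /= /contrapT xv; split => //=.
  by rewrite /P /= -xv /lform /= !mul0r.
Qed.

End NullLines.

Section Zigzag.
Variable R : realType.
Local Notation space := (space3 R).
Variables n1 n2 c : R.
Local Notation l := (lform n1 n2 0).

(* Folding w to `|w| - max/2 halves its amplitude and keeps its slope. *)
Fixpoint zigzag k x : R :=
  if k is k'.+1 then `|zigzag k' x| - c / 2 ^+ k else l x.

(** Slope with respect to the linear form, a product of signs; the convention 1 at the kinks only
    matters on a null set. *)
Fixpoint zigslope k x : R :=
  if k is k'.+1 then (if 0 <= zigzag k' x then 1 else -1) * zigslope k' x else 1.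

Lemma zigzag_bound k x : `|l x| <= c -> `|zigzag k x| <= c / 2 ^+ k.
Proof.
move=> lc; elim: k => [|k IH] /=; first by rewrite divr1.
have h0 := normr_ge0 (zigzag k x); move: (`|zigzag k x|) h0 IH => z h0.
rewrite exprS invfM mulrCA; move: (c / 2 ^+ k) => d zd.
by rewrite ler_norml; apply/andP; split; lra.
Qed.

Lemma zigzag_lipschitz k x y : `|zigzag k x - zigzag k y| <= `|l x - l y|.
Proof.
elim: k => [|k IH]//=; apply: le_trans IH.
by rewrite opprB addrA subrK; exact: ler_dist_dist.
Qed.

Lemma zigzag_continuous k : continuous (zigzag k : space -> R^o).
Proof.
elim: k => [|k IH]; first exact: lform_continuous.
move=> x /=; apply: (@cvgB _ R^o); last exact: cvg_cst.
by apply: (@cvg_norm _ R^o); exact: IH.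
Qed.

Lemma zigslope_norm k x : `|zigslope k x| = 1.
Proof.
elim: k => [|k IH] /=; first exact: normr1.
by rewrite normrM IH mulr1; case: ifP => _; rewrite ?normrN normr1.
Qed.

Lemma zigslope_measurable k : measurable_fun setT (zigslope k : borel3 R -> R).
Proof.
elim: k => [|k IH]; first exact: measurable_cst.
apply: measurable_funM => //; apply: measurable_fun_ifT; [|exact: measurable_cst|exact: measurable_cst].
have mz := measurable_continuous_Borel3 (@zigzag_continuous k).
by apply: (measurable_fun_ler (measurable_cst (0 : R)) mz).
Qed.

Lemma zigzag_fst k x : zigzag k x = zigzag k (x.1, 0).
Proof. by elim: k => [|k /= ->]//=; rewrite /lform !mul0r. Qed.

Lemma zigslope_fst k x : zigslope k x = zigslope k (x.1, 0).
Proof. by elim: k => [|k /= ->]//=; rewrite zigzag_fst. Qed.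

Hypothesis n0 : (n1 != 0) || (n2 != 0).

(** A level set of a folded function lies in two level sets of the previous one, whence the
    induction over all levels v. The kinks, zeros of the previous functions, are therefore
    negligible. *)
Lemma ae_zigzag k v : {ae mu3, forall x, zigzag k x <> v}.
Proof.
elim: k v => [|k IH] v; first exact: ae_line.
apply: ae3S (ae3I (IH (v + c / 2 ^+ k.+1)) (IH (- (v + c / 2 ^+ k.+1)))) => x [h1 h2] /= /eqP.
rewrite subr_eq => /eqP E; have [z0|z0] := leP 0 (zigzag k x).
  by apply: h1; rewrite -E ger0_norm.
by apply: h2; rewrite -E ltr0_norm ?opprK.
Qed.

Lemma ae_zigzag_derive k : {ae mu3, forall x, forall e : space,
  is_derive (x : space) e (zigzag k : space -> R^o) (zigslope k x * l e)}.
Proof.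
elim: k => [|k IH].
  apply: aeW => x e; rewrite mul1r; apply: DeriveDef.
    by apply: (@derivable_lform _ _ _ _ id); exact: derivable_id.
  by have := derive_lform n1 n2 0 id x e; rewrite derive_id.
apply: ae3S (ae3I IH (ae_zigzag k 0)) => x [dz z0] e; have := dz e => {}dz /=.
set s := if _ then _ else _.
have nE : \forall y \near x, s * zigzag k y - c / 2 ^+ k.+1 = `|zigzag k y| - c / 2 ^+ k.+1.
  have cz := @zigzag_continuous k x.
  rewrite /s; have [zx|zx] := leP 0 (zigzag k x).
    have zx0 : 0 < zigzag k x by rewrite lt_neqAle zx andbT eq_sym; apply/eqP.
    apply: filterS (cvgr_gt _ cz _ zx0) => y y0.
    by rewrite mul1r gtr0_norm.
  by apply: filterS (cvgr_lt _ cz _ zx) => y y0; rewrite mulN1r ltr0_norm.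
apply: (near_eq_is_derive nE); rewrite -mulrA.
have h := is_deriveB (is_deriveZ s dz) (is_derive_cst (c / 2 ^+ k.+1 : R^o) x e).
rewrite subr0 in h; exact: h.
Qed.

End Zigzag.

Section ZigzagTest.
Variable R : realType.
Local Notation space := (space3 R).
Local Notation mat := ('M[R]_(3, 2 + 1)).
Local Notation vec := 'cV[R]_3.
Local Notation cyl t := (cylinder (square t) : set (space3 R)).
Local Notation slab := (@slab R).
Variables n1 n2 : R.
Local Notation l := (lform n1 n2 0).
Let c := `|n1| + `|n2|.
Let c0 : 0 <= c. Proof. exact: addr_ge0. Qed.

Lemma lform_bound x : `|l x| <= c * `|x.1|.
Proof.
rewrite /lform mul0r addr0 (le_trans (ler_normD _ _))// mulrDl.
by apply: lerD; rewrite normrM ler_wpM2l// plane_normE le_max lexx ?orbT.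
Qed.

Lemma lform_basis j : `|l (basis3 j)| <= c.
Proof.
apply: le_trans (lform_bound _) _; rewrite ler_piMr//.
by have := basis3_norm R j; rewrite prod_normE ge_max => /andP[].
Qed.

Variables (r b : R) (k : nat).
Hypotheses (rb : r < b) (b2 : b < 2^-1).
Hypothesis n0 : (n1 != 0) || (n2 != 0).
Local Notation chi := (cutoff r b).
Local Notation z := (zigzag n1 n2 c k).
Local Notation s := (zigslope n1 n2 c k).

Definition zigtest x : R := chi x * z x.

Definition ziggrad (j : 'I_3) x : R :=
  chi x * (s x * l (basis3 j)) + z x * 'D_(basis3 j) chi x.

Lemma zigzag_le x : `|x.1| <= 2^-1 -> `|z x| <= c / 2 ^+ k.
Proof.
move=> xh; apply: zigzag_bound; apply: le_trans (lform_bound x) _.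
by rewrite ler_piMr// (le_trans xh)// invf_le1// ler1n.
Qed.

Lemma zigzag_lec x : `|x.1| <= 2^-1 -> `|z x| <= c.
Proof.
move=> /zigzag_le/le_trans; apply; rewrite ler_pdivrMr ?exprn_gt0//.
by rewrite ler_peMr// exprn_ege1// ler1n.
Qed.

(** The first term is at most the slope c; the second carries the amplitude c / 2^k, so that k can
    later be chosen to offset the steepness D of the cutoff. *)
Lemma ziggrad_le (D : R) j x : 0 <= D ->
  (forall x j, `|'D_(basis3 j) chi x| <= D) ->
  `|ziggrad j x| <= c + c / 2 ^+ k * D.
Proof.
move=> D0 hD; apply: le_trans (ler_normD _ _) _; apply: lerD.
  rewrite normrM [X in _ * X]normrM zigslope_norm mul1r -[leRHS]mul1r.
  by apply: ler_pM => //; [exact: cutoff_norm|exact: lform_basis].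
have ck : 0 <= c / 2 ^+ k by rewrite divr_ge0// exprn_ge0.
have [xb|xb] := leP `|x.1| b; last first.
  by rewrite cutoff_derive_eq0r// mulr0 normr0; exact: mulr_ge0.
by rewrite normrM; apply: ler_pM => //; apply: zigzag_le; exact: le_trans xb (ltW b2).
Qed.

Lemma cutoff_derive_le : exists2 D : R, 0 <= D &
  forall x j, `|'D_(basis3 j) (chi : space -> R^o) x| <= D.
Proof.
have [C0 C00 hC] := @cutoff_derive_bounded R.
have Cab : 0 <= C0 / (b - r) by rewrite divr_ge0 ?subr_ge0 ?ltW.
exists (C0 / (b - r)) => // x j; apply: le_trans (hC _ _ _ _ rb) _.
by rewrite ler_piMr//; exact: (basis3_norm R).
Qed.

Lemma ziggrad_fst j x : ziggrad j x = ziggrad j (x.1, 0).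
Proof.
by rewrite /ziggrad zigzag_fst zigslope_fst; congr (_ + _ * _).
Qed.

Lemma ziggrad3 x : ziggrad (rshift 2 ord0 : 'I_(2 + 1)) x = 0.
Proof.
have l3 : l (basis3 (rshift 2 ord0 : 'I_(2 + 1))) = 0.
  by rewrite /lform /basis3/= !mulr0 mul0r !addr0.
rewrite /ziggrad l3 !mulr0 add0r.
rewrite (@derive_val _ _ _ _ _ _ _ (@is_derive_zero_line R _ _ x _ _)) ?mulr0// => h.
rewrite /cutoff; case: x => -[x1 x2] x3.
change (plateau r b (h * 0%:R + x1) * plateau r b (h * 0%:R + x2) =
  plateau r b x1 * plateau r b x2).
by rewrite mulr0 !add0r.
Qed.

Lemma ziggrad_Borel j : measurable_fun setT (ziggrad j : borel3 R -> R).
Proof.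
apply: measurable_funD.
  apply: measurable_funM; first exact: (measurable_continuous_Borel3 (@cutoff_continuous R r b)).
  by apply: measurable_funM; [exact: zigslope_measurable|exact: measurable_cst].
apply: measurable_funM; first exact: (measurable_continuous_Borel3 (@zigzag_continuous R n1 n2 c k)).
exact: (measurable_continuous_Borel3 (@cutoff_derive_continuous R r b (basis3 j))).
Qed.

Lemma ziggrad_bmeas j : bmeas (ziggrad j).
Proof.
have [D D0 hD] := cutoff_derive_le.
split; first exact: Borel_measurable_funT (ziggrad_Borel j).
by exists (c + c / 2 ^+ k * D) => x; exact: ziggrad_le.
Qed.

Lemma ziggrad_core j x : `|x.1| < r -> ziggrad j x = s x * l (basis3 j).
Proof.
move=> xr; rewrite /ziggrad cutoff_eq1 ?(ltW xr)// cutoff_derive_eq0// mulr0 addr0.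
by rewrite mul1r.
Qed.

Lemma zig_scalar_adm : scalar_adm 1 zigtest (fun j x => \1_slab x * ziggrad j x).
Proof.
have cz := @zigzag_continuous R n1 n2 c k.
have [D D0 hD] := cutoff_derive_le.
have h12 : (2^-1 : R) <= 1 / 2 by rewrite mul1r.
have bu : bmeas zigtest.
  split.
    apply: measurable_funM; first exact: (cutoff_bmeas r b).1.
    exact: measurable_continuous3.
  exists c => x; have [xb|xb] := leP `|x.1| b; last first.
    by rewrite /zigtest cutoff_eq0 ?mul0r ?normr0// ltW.
  rewrite normrM -[leRHS]mul1r; apply: ler_pM => //; first exact: cutoff_norm.
  by apply: zigzag_lec; exact: le_trans xb (ltW b2).
have chiL j x (h : R) : `|chi (x + h *: basis3 j) - chi x| <= D * `|h|.
  by apply: mean_value_lipschitz => y; [exact: cutoff_derivable|exact: hD].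
have zL j x (h : R) : `|z (x + h *: basis3 j) - z x| <= c * `|h|.
  apply: le_trans (zigzag_lipschitz _ _ _ _ _ _) _.
  rewrite linearD linearZ addrAC subrr add0r normrM mulrC ler_wpM2r//.
  exact: lform_basis.
apply: (@lipschitz_scalar_adm R 1 2^-1 zigtest ziggrad (c + c * D)).
- exact: h12.
- by move=> x; apply: (@cvgM R); [exact: cutoff_continuous|exact: cz].
- exact: bu.
- exact: ziggrad_bmeas.
- by move=> x xt; rewrite /zigtest cutoff_eq0 ?mul0r// ltW// (lt_le_trans b2 xt).
- move=> j x xt; have xb := lt_le_trans b2 xt.
  by rewrite /ziggrad cutoff_eq0 ?(ltW xb)// cutoff_derive_eq0r// mul0r mulr0 addr0.
- move=> j x h; rewrite /zigtest mulrDl.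
  (* The zigzag is controlled by c only over the unit square, so the increment of the product is
     expanded around whichever of the two points lies within the support; if neither does, it is
     0. *)
  set y := x + _; have [xb|xb] := ltP `|x.1| b.
    rewrite (_ : _ - _ = chi y * (z y - z x) + z x * (chi y - chi x)); last by ring.
    apply: le_trans (ler_normD _ _) _; apply: lerD; rewrite normrM.
      by rewrite -[leRHS]mul1r; apply: ler_pM => //; [exact: cutoff_norm|exact: zL].
    by rewrite -mulrA; apply: ler_pM => //; [apply: zigzag_lec; exact: ltW (lt_trans _ b2)|exact: chiL].
  have [yb|yb] := ltP `|y.1| b; last first.
    rewrite !cutoff_eq0// !mul0r subrr normr0 -mulrDl mulr_ge0// addr_ge0// mulr_ge0//.
  rewrite (_ : _ - _ = chi x * (z y - z x) + z y * (chi y - chi x)); last by ring.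
  apply: le_trans (ler_normD _ _) _; apply: lerD; rewrite normrM.
    by rewrite -[leRHS]mul1r; apply: ler_pM => //; [exact: cutoff_norm|exact: zL].
  by rewrite -mulrA; apply: ler_pM => //; [apply: zigzag_lec; exact: ltW (lt_trans _ b2)|exact: chiL].
- move=> j; apply: ae3S (ae_zigzag_derive c n0 k) => x dz.
  have dx := dz (basis3 j).
  have [d1 d2] := derive_prod (@cutoff_derivable R r b x (basis3 j)) (@ex_derive _ _ _ _ _ _ _ dx).
  by apply: DeriveDef; [exact: d1|rewrite [LHS]d2 (@derive_val _ _ _ _ _ _ _ dx)].
Qed.

End ZigzagTest.

(* A bound m on [0, 1] improves to m / 2, since each point is the midpoint of
   another one and of an end of [0, 1]. *)
Lemma midpoint_convex_le0 (R : realType) (g : R -> R) (m : R) :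
  (forall x, 0 <= x <= 1 -> g x <= m) -> g 0 <= 0 -> g 1 <= 0 ->
  (forall x y, 0 <= x <= 1 -> 0 <= y <= 1 -> g ((x + y) / 2) <= (g x + g y) / 2) ->
  forall x, 0 <= x <= 1 -> g x <= 0.
Proof.
move=> gm g0 g1 mid; have half n : forall x, 0 <= x <= 1 -> g x <= m / 2 ^+ n.
  have m0 : 0 <= Num.max m 0 by rewrite le_max lexx orbT.
  elim: n => [|n IH] x x01; first by rewrite divr1; exact: gm.
  have E : m / 2 ^+ n.+1 = (m / 2 ^+ n) / 2 by rewrite exprS invfM mulrCA mulrC.
  move: IH; rewrite E; move: (m / 2 ^+ n) => d IH.
  have [/andP[x0 x1] h] : 0 <= x <= 1 /\ (x <= 1 / 2 \/ 1 / 2 <= x).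
    by split => //; have [|/ltW] := leP x (1 / 2); [left|right].
  case: h => xh.
    have h2 : 0 <= 2 * x <= 1 by apply/andP; split; lra.
    have := mid 0 (2 * x) _ h2; rewrite lexx ler01 => /(_ isT).
    rewrite (_ : (0 + 2 * x) / 2 = x); last by field.
    by have := IH _ h2; lra.
  have h2 : 0 <= 2 * x - 1 <= 1 by apply/andP; split; lra.
  have := mid 1 (2 * x - 1) _ h2; rewrite lexx ler01 => /(_ isT).
  rewrite (_ : (1 + (2 * x - 1)) / 2 = x); last by field.
  by have := IH _ h2; lra.
move=> x x01; apply/ler_addgt0Pr => e e0; rewrite add0r.
have [n me] : exists n, m / 2 ^+ n <= e.
  have [n hn] : exists n, `|m| / e <= n%:R.
    by exists (Num.truncn (`|m| / e)).+1; apply: ltW; apply: truncnS_gt.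
  exists n; rewrite ler_pdivrMr ?exprn_gt0// (le_trans (ler_norm m))//.
  move: hn; rewrite ler_pdivrMr// mulrC => /le_trans; apply.
  by rewrite ler_pM2l// -natrX ler_nat ltnW// ltn_expl.
exact: le_trans (half n x x01) me.
Qed.

Lemma rank_le1 (R : realType) (A : 'M[R]_(3, 2)) : (\rank A <= 1)%N -> A != 0 ->
  exists (a : 'cV[R]_3) (n : 'rV[R]_2), A = a *m n.
Proof.
move=> rA A0; have r1 : \rank A = 1%N.
  by apply/eqP; rewrite eqn_leq rA lt0n mxrank_eq0.
have := mulmx_base A; move: (col_base A) (row_base A); rewrite r1 => a n E.
by exists a, n.
Qed.

(** The square of half side 1/2 - d leaves an area 1 - (1 - 2d)^2 <= 4d. *)
Lemma layer_arith (R : realType) (H d e : R) : 0 <= H -> 0 <= d ->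
  8 * (H + 1) * d <= e -> 2 * H * (1 - (2 * (2^-1 - d)) ^+ 2) <= e.
Proof.
move=> H0 d0; apply: le_trans; have := mulr_ge0 H0 (sqr_ge0 d).
rewrite (_ : 2 * H * _ = 8 * (H * d) - 8 * (H * d ^+ 2)); last by field.
by move: (H * d ^+ 2) => u; rewrite mulrDr mulr1 mulrDl -mulrA; move: (H * d) => v; lra.
Qed.

Definition zigrow (R : realType) (n1 n2 r b : R) k x : 'rV[R]_2 :=
  \row_(j < 2) ziggrad n1 n2 r b k (lshift 1 j) x.

Section RankOne.
Variables (R : realType) (Phi : R -> R) (alpha beta : R).
Hypotheses (yPhi : young Phi) (alpha_gt0 : 0 < alpha) (alpha_le : alpha <= beta).
Hypothesis Phi_delta2 : Delta2 Phi.
Local Notation vec := 'cV[R]_3.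
Local Notation mat := ('M[R]_(3, 2 + 1)).
Local Notation mat2 := 'M[R]_(3, 2).
Local Notation space := (space3 R).
Local Notation plane := (plane2 R).
Local Notation cyl t := (cylinder (square t) : set (space3 R)).
Variable f : space -> mat -> R.
Hypothesis gf : good_integrand Phi alpha beta f.
Variable T : set vec.
Hypothesis sT : subspace T.
Local Notation hom := (hom f T).
Local Notation homP := (homP f T).

Section Zigzag.
Variables (n1 n2 r b : R) (k : nat).
Hypotheses (rb : r < b) (b2 : b < 2^-1).
Hypothesis n0 : (n1 != 0) || (n2 != 0).
Local Notation zg := (ziggrad n1 n2 r b k).

Local Notation N := (zigrow n1 n2 r b k).

Lemma bmeas2_zig (zeta : mat2) (a : vec) : bmeas2 (fun x => zeta + a *m N x).
Proof.
move=> i j; rewrite (_ : (fun x => _) = fun x => zeta i j + a i 0 * zg (lshift 1 j : 'I_(2 + 1)) x).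
  apply: bmeasD; first exact: bmeas_cst.
  by apply: bmeasM; [exact: bmeas_cst|exact: ziggrad_bmeas].
by apply/funext => x; rewrite !mxE big_ord1 mxE.
Qed.

Lemma zig_quasiconvex (zeta : mat2) (a : vec) : tangent_mx T zeta -> T a ->
  hom zeta <= \int[mu3]_(x in cyl 1) homP (zeta + a *m N x).
Proof.
move=> tz Ta.
pose row x : 'rV[R]_(2 + 1) := \row_j (\1_(@slab R) x * zg j x).
have aS := zig_scalar_adm k rb b2 n0.
have Pa : projmx T *m a = a by rewrite projmxE// orthproj_id.
have aG : Adm T 1 (fun x => zigtest n1 n2 r b k x *: a) (fun x => a *m row x).
  split.
  - move=> i; have := scalar_adm_sum (index_enum 'I_1) (fun=> a i 0) (fun=> aS).
    rewrite (_ : (fun x => \sum_(k <- _) _) = fun x => (zigtest n1 n2 r b k x *: a) i 0); last first.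
      by apply/funext => x; rewrite big_ord1 mxE mulrC.
    rewrite (_ : (fun j x => \sum_(k <- _) _) = fun j x => (a *m row x) i j)//.
    by apply/funext => j; apply/funext => x; rewrite big_ord1 [RHS]mxE big_ord1 mxE.
  - by move=> x; exact: (subspaceZ sT).
  - by move=> x; rewrite mulmxA Pa.
have rowE x : cyl 1 x -> lsubmx (a *m row x) = a *m N x.
  move=> /cyl_slab sx; rewrite -mulmx_lsub; congr (_ *m _).
  by apply/rowP => j; rewrite !mxE indicE mem_set// mul1r.
have flat x : cyl 1 x -> a *m row x = flat_mx (a *m N (x.1, 0)).
  move=> cx; apply: etrans (esym (@hsubmxK R 3 2 1 (a *m row x))) _.
  rewrite (rowE x cx); apply: (congr2 (@row_mx R 3 2 1)).
    by apply: (congr1 (mulmx a)); apply/rowP => j; rewrite !mxE; exact: ziggrad_fst.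
  rewrite -mulmx_rsub (_ : rsubmx (row x) = 0) ?mulmx0//.
  by apply/rowP => j; rewrite !mxE ord1 ziggrad3 ?mulr0.
have mG i j : measurable_fun setT (fun y : borel2 R => (a *m N (y, 0)) i j).
  rewrite (_ : (fun y => _) = fun y : borel2 R => a i 0 * zg (lshift 1 j : 'I_(2 + 1)) (y, 0)); last first.
    by apply/funext => y; rewrite mxE big_ord1 mxE.
  apply: measurable_funM; first exact: measurable_cst.
  exact: (borel2_slice 0 (@ziggrad_Borel R n1 n2 r b k _)).
apply: le_trans (hom_quasiconvex_int yPhi alpha_gt0 alpha_le Phi_delta2 gf sT
  (G0 := fun y => a *m N (y, 0)) tz aG flat mG) _.
rewrite le_eqVlt; apply/orP; left; apply/eqP; apply: eq_Rintegral => x /set_mem cx.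
by rewrite rowE.
Qed.

End Zigzag.

Lemma hom_midpoint (zeta : mat2) (a : vec) (n : 'rV[R]_2) : tangent_mx T zeta -> T a ->
  2 * hom zeta <= hom (zeta + a *m n) + hom (zeta - a *m n).
Proof.
move=> tz Ta; have [n0|n0] := eqVneq n 0.
  by rewrite n0 mulmx0 addr0 subr0 mulrDl mul1r.
have TNa : T (- a) by rewrite -scaleN1r; exact: (subspaceZ sT).
set n1 := n 0 0; set n2 := n 0 1.
have n120 : (n1 != 0) || (n2 != 0).
  rewrite -negb_and; apply: contra n0 => /andP[/eqP h1 /eqP h2].
  apply/eqP/rowP => -[[|[|j]]//= lt]; rewrite mxE.
    by rewrite -[RHS]h1; congr (n _ _); exact: val_inj.
  by rewrite -[RHS]h2; congr (n _ _); exact: val_inj.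
pose c := `|n1| + `|n2|; have c0 : 0 <= c by exact: addr_ge0.
(* Entrywise bound for the outer product of a with the gradient of the cut-off zigzag: c for its
   slope, 1 for the cutoff term once k is large. It depends neither on r nor on k. *)
pose B := \sum_(i < 3) \sum_(j < 2) `|a i 0| * (c + 1).
have B0 : 0 <= B by apply: sumr_ge0 => i _; apply: sumr_ge0 => j _; rewrite mulr_ge0// addr_ge0.
pose H := beta * (1 + Phi (enorm zeta + B)).
have b0 := beta_gt0 alpha_gt0 alpha_le.
have homPH Z : enorm Z <= enorm zeta + B -> homP Z <= H.
  move=> hZ; apply: le_trans (hom_upper yPhi alpha_gt0 alpha_le gf _ sT) _.
  apply: ler_wpM2l; first exact: ltW.
  rewrite lerD2l; apply: (young_le yPhi (enorm_ge0 _)).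
  exact: le_trans (enorm_projmx sT _) hZ.
have H0 : 0 <= H.
  apply: le_trans (homPH 0 _); first exact: (homP_ge0 yPhi alpha_gt0 gf).
  by rewrite enorm0 addr_ge0 ?enorm_ge0.
have H20 : 0 <= 2 * H := mulr_ge0 (ler0n R 2) H0.
set S := _ + _.
have S0 : 0 <= S by apply: addr_ge0; exact: (hom_ge0 yPhi alpha_gt0 gf).
have tan (s : R) : tangent_mx T (zeta + s *: (a *m n)).
  apply/(tangent_mxP sT); rewrite mulmxDr (iffLR (tangent_mxP sT zeta) tz); congr (_ + _).
  by rewrite -scalemxAr mulmxA projmxE// orthproj_id.
(* On the core of half side r the two integrands add up to S exactly; on the rest each is at most
   H. *)
have key r : 0 <= r -> r < 2^-1 -> 2 * hom zeta <= S + 2 * H * (1 - (2 * r) ^+ 2).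
  move=> r0 r2; have r21 : 2 * r <= 1 by lra.
  pose b := (r + 2^-1) / 2.
  have rb : r < b by rewrite /b; lra.
  have b2 : b < 2^-1 by rewrite /b; lra.
  have [D D0 hD] := @cutoff_derive_le R r b rb.
  (* The number of foldings is chosen after the cutoff, so that the amplitude compensates its
     derivative bound D. *)
  have [k hk] : exists k, c / 2 ^+ k * D <= 1.
    exists (Num.truncn (c * D)).+1; rewrite mulrAC ler_pdivrMr ?exprn_gt0// mul1r.
    apply: le_trans (ltW (truncnS_gt _)) _.
    by rewrite -natrX ler_nat ltnW// ltn_expl.
  pose N := zigrow n1 n2 r b k.
  have NB x : enorm (a *m N x) <= B.
    apply: le_trans (enorm_le_sum _) _; apply: ler_sum => i _; apply: ler_sum => j _.
    rewrite mxE big_ord1 mxE normrM ler_wpM2l//.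
    apply: le_trans (ziggrad_le n1 n2 k rb b2 (lshift 1 j : 'I_(2 + 1)) x D0 hD) _.
    by rewrite lerD2l.
  have bp := bmeas_homP yPhi alpha_gt0 alpha_le Phi_delta2 gf sT (bmeas2_zig n1 n2 k rb b2 zeta a).
  have bm := bmeas_homP yPhi alpha_gt0 alpha_le Phi_delta2 gf sT (bmeas2_zig n1 n2 k rb b2 zeta (- a)).
  have h1 := zig_quasiconvex k rb b2 n120 tz Ta.
  have h2 := zig_quasiconvex k rb b2 n120 tz TNa.
  pose E : set (leb3 R) := cyl 1 `\` cyl (2 * r).
  have mE : measurable E by apply: measurableD; exact: measurable_cyl.
  have bI := bmeas_indic mE.
  have bR := bmeasD (bmeas_cst S) (bmeasM (bmeas_cst (2 * H)) bI).
  rewrite mulrDl mul1r; apply: le_trans (lerD h1 h2) _.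
  rewrite -(Rintegral_cylD 1 bp bm).
  apply: (@le_trans _ _ (\int[mu3]_(x in cyl 1) (S + 2 * H * \1_E x))); last first.
    rewrite (Rintegral_cylD 1 (bmeas_cst S) (bmeasM (bmeas_cst (2 * H)) bI)).
    rewrite Rintegral_cyl_cst// expr1n mulr1 Rintegral_cylZ// lerD2l; apply: (ler_wpM2l H20).
    rewrite /Rintegral integral_indic//; last exact: measurable_cyl.
    rewrite setIidl; last by move=> x [].
    by rewrite (L3_layer r0 r21) expr1n.
  apply: (Rintegral_cyl_le (bmeasD bp bm) bR) => x cx.
  have [xr|xr] := pselect (cyl (2 * r) x); last first.
    rewrite indicE mem_set; last by split.
    rewrite mulr1 ler_wpDl// [2 * H]mulrDl mul1r; apply: lerD; apply: homPH.
      by apply: le_trans (enormD _ _) _; rewrite lerD2l; exact: NB.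
    by apply: le_trans (enormD _ _) _; rewrite lerD2l mulNmx enormN; exact: NB.
  rewrite indicE memNset; last by move=> [].
  rewrite mulr0 addr0.
  have xr1 : `|x.1| < r.
    by case: xr => /square_norm; rewrite mulrAC divff// mul1r.
  have NE : zigrow n1 n2 r b k x = zigslope n1 n2 c k x *: n.
    apply/rowP => j; rewrite !mxE (ziggrad_core n1 n2 k rb _ xr1); congr (_ * _).
    rewrite /lform /basis3 /=; case: j => -[|[|j]]//= lt; rewrite ?mulr1 ?mulr0 ?mul0r ?addr0 ?add0r.
      by rewrite /n1; congr (n _ _); exact: val_inj.
    by rewrite /n2; congr (n _ _); exact: val_inj.
  rewrite NE (mulNmx a) -scalemxAr -scaleNr (homPE f sT (tan _)) (homPE f sT (tan _)).
  (* Slopes are +1 or -1, so the gradients from a and from -a are the two endpoints, in one order or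
     the other. *)
  have [E1|E1] : zigslope n1 n2 c k x = 1 \/ zigslope n1 n2 c k x = -1.
    have := zigslope_norm n1 n2 c k x.
    by case: (ger0P (zigslope n1 n2 c k x)) => _ h; [left|right; rewrite -h opprK].
  - by rewrite E1 scale1r scaleN1r; exact: lexx.
  - by rewrite E1 opprK scale1r scaleN1r [X in X <= _]addrC; exact: lexx.
apply/ler_addgt0Pr => e e0.
pose d := Num.min (2^-1) (e / (8 * (H + 1))).
have H1 : 0 < 8 * (H + 1) by rewrite mulr_gt0// ltr_wpDl.
have d0 : 0 < d by rewrite lt_min invr_gt0 ltr0n/= divr_gt0.
have d2 : d <= 2^-1 by rewrite ge_min lexx.
have de : 8 * (H + 1) * d <= e by rewrite mulrC -ler_pdivlMr// ge_min lexx orbT.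
have rr0 : 0 <= 2^-1 - d by rewrite subr_ge0.
have rr2 : 2^-1 - d < 2^-1 by rewrite gtrBl.
apply: le_trans (key _ rr0 rr2) _; rewrite lerD2l.
exact: layer_arith H0 (ltW d0) de.
Qed.

Lemma hom_rank_one_convex (xi eta : mat2) (la : R) :
  tangent_mx T xi -> tangent_mx T eta -> (\rank (xi - eta)%R <= 1)%N ->
  0 <= la <= 1 -> hom (la *: xi + (1 - la) *: eta) <= la * hom xi + (1 - la) * hom eta.
Proof.
move=> txi teta rk la01; have [E|ne] := eqVneq (xi - eta) 0.
  move/eqP: E; rewrite subr_eq0 => /eqP ->.
  by rewrite -scalerDl -mulrDl [la + _]addrC subrK scale1r mul1r.
have [a [n E]] := rank_le1 rk ne.
(* The column factor may be normal to [T]; projecting it leaves the product unchanged, because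
   [xi - eta] is tangential. *)
have Ta : exists (a' : vec) (n' : 'rV[R]_2), T a' /\ xi - eta = a' *m n'.
  exists (projmx T *m a), n; split; first by rewrite projmxE//; exact: (orthprojP sT _).1.
  rewrite -mulmxA -E mulmxBr (iffLR (tangent_mxP sT _) txi).
  by rewrite (iffLR (tangent_mxP sT _) teta).
move: Ta => [a' [n' [Ta' E']]].
pose p (x : R) := x *: xi + (1 - x) *: eta.
have tp x : tangent_mx T (p x).
  apply/(tangent_mxP sT); rewrite mulmxDr -!scalemxAr.
  by rewrite (iffLR (tangent_mxP sT _) txi) (iffLR (tangent_mxP sT _) teta).
(* Gap between [hom] along the segment and its chord: zero at both ends, bounded above, and midpoint
   convex. *)
pose g x := hom (p x) - (x * hom xi + (1 - x) * hom eta).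
have b0 := beta_gt0 alpha_gt0 alpha_le.
pose K := enorm xi + enorm eta.
have gm x : 0 <= x <= 1 -> g x <= beta * (1 + Phi K).
  move=> /andP[x0 x1]; have x1' : 0 <= 1 - x by rewrite subr_ge0.
  have h : 0 <= x * hom xi + (1 - x) * hom eta.
    by apply: addr_ge0; apply: mulr_ge0 => //; exact: (hom_ge0 yPhi alpha_gt0 gf).
  apply: (@le_trans _ _ (hom (p x))); first by rewrite /g gerBl.
  apply: le_trans (hom_upper yPhi alpha_gt0 alpha_le gf _ sT) _.
  apply: ler_wpM2l; first exact: ltW.
  rewrite lerD2l; apply: (young_le yPhi (enorm_ge0 _)).
  apply: le_trans (enormD _ _) _; rewrite !enormZ !ger0_norm//.
  by apply: lerD; rewrite ler_piMl ?enorm_ge0// gerBl.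
suff : g la <= 0 by rewrite /g subr_le0.
apply: (midpoint_convex_le0 gm) la01.
- by rewrite /g /p scale0r add0r !subr0 scale1r mul0r mul1r add0r subrr.
- by rewrite /g /p subrr scale0r addr0 scale1r mul0r mul1r addr0 subrr.
- move=> x y _ _; have := @hom_midpoint (p ((x + y) / 2)) a' (((x - y) / 2) *: n') (tp _) Ta'.
  rewrite -scalemxAr -E'.
  have -> : p ((x + y) / 2) + ((x - y) / 2) *: (xi - eta) = p x.
    by apply/matrixP => i j; rewrite !mxE; field.
  have -> : p ((x + y) / 2) - ((x - y) / 2) *: (xi - eta) = p y.
    by apply/matrixP => i j; rewrite !mxE; field.
  rewrite /g; move: (hom _) (hom _) (hom _) (hom _) (hom _) => u1 u2 u3 u4 u5 h.
  have -> : (x + y) / 2 * u2 + (1 - (x + y) / 2) * u1 =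
    (x * u2 + (1 - x) * u1) / 2 + (y * u2 + (1 - y) * u1) / 2 by field.
  by lra.
Qed.

End RankOne.

(** * The cell formulas *)

Lemma limf_einf_cvg (R : realType) (c : R -> \bar R) (e : R -> R) (l : R) :
  (forall t, 0 < t -> c t = (e t)%:E) -> e t @[t --> +oo] --> l ->
  limf_einf c (pinfty_nbhs R) = l%:E.
Proof.
move=> ce el; rewrite limf_einfE; apply/eqP; rewrite eq_le; apply/andP; split.
  apply: ge_ereal_sup => _ [V FV <-]; apply/lee_addgt0Pr => d d0.
  have near2 : \forall t \near +oo, 0 < t /\ e t <= l + d.
    apply: filterI; first exact: nbhs_pinfty_gt.
    by apply: (cvgr_le _ el); rewrite ltrDl.
  have [t [Vt [t0 et]]] := filter_ex (filterI FV near2).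
  apply: le_trans (ereal_inf_lbound (_ : _ (c t))) _; first by exists t.
  by rewrite ce// lee_fin.
apply/lee_subgt0Pr => d d0.
have near2 : \forall t \near +oo, 0 < t /\ l - d <= e t.
  apply: filterI; first exact: nbhs_pinfty_gt.
  by apply: (cvgr_ge _ el); rewrite gtrBl.
apply: le_trans (ereal_sup_ubound (_ : _ (ereal_inf (c @` [set t | 0 < t /\ l - d <= e t])))); last first.
  by exists [set t | 0 < t /\ l - d <= e t].
by apply: le_ereal_inf_tmp => _ [t [t0 et] <-]; rewrite ce// lee_fin.
Qed.

Lemma density_arith (R : realType) (r P p : R) : 0 <= P -> 0 <= p -> 0 <= r ->
  P <= r * p -> 1 + P <= (1 + p) * (1 + r).
Proof. by move=> P0 p0 r0 h; rewrite mulrDl mul1r mulrDr mulr1 (mulrC p); move: (r * p) h => q h; lra. Qed.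

Section Final.
Variables (R : realType) (Phi : R -> R) (M : set 'cV[R]_3) (alpha beta : R).
Variables (f f' : space3 R -> 'M[R]_3 -> R).
Hypotheses (yPhi : young Phi) (alpha_gt0 : 0 < alpha) (alpha_le : alpha <= beta).
Hypotheses (hM : submanifold M) (cf : caratheodory_fun f).
Hypotheses (gf : good_integrand Phi alpha beta f')
  (ff' : {ae mu3, forall x, f x = f' x}).

Lemma Tfhom_hom s (xi : 'M[R]_(3, 2)) : M s ->
  Tfhom f M s xi = (hom f' (tangent M s) xi)%:E.
Proof.
move=> Ms; have sT := tangent_subspace hM Ms.
apply: (@limf_einf_cvg _ _ (ecell f' (tangent M s) xi)).
  by move=> t t0; exact: (cell_ecell yPhi alpha_gt0 alpha_le gf cf ff' xi sT t0).
exact: (@ecell_cvg R Phi alpha beta yPhi alpha_gt0 alpha_le f' gf _ xi sT).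
Qed.

Lemma fbar_cell_cvg s (xi : 'M[R]_(3, 2)) : M s -> tangent_mx (tangent M s) xi ->
  fbar_cell f Phi M s xi t @[t --> +oo] --> (hom f' (tangent M s) xi)%:E.
Proof.
move=> Ms txi; have sT := tangent_subspace hM Ms.
have ev : \forall t \near +oo, (ecell f' (tangent M s) xi t)%:E = fbar_cell f Phi M s xi t.
  near=> t; apply/esym.
  by apply: (fbar_cell_ecell yPhi alpha_gt0 alpha_le gf cf ff' sT txi); near: t; exact: nbhs_pinfty_gt.
apply: cvg_trans (near_eq_cvg ev) _.
apply: cvg_EFin; first exact: nearW.
exact: (@ecell_cvg R Phi alpha beta yPhi alpha_gt0 alpha_le f' gf _ xi sT).
Unshelve. all: by end_near. Qed.

End Final.

Theorem proposition4p1 (R : realType) (Phi : R -> R) (M : set 'cV[R]_3)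
    (f : space3 R -> 'M[R]_3 -> R)
    (hPhi : young Phi) (hDelta : Delta2 Phi) (hNabla : Nabla2 Phi)
    (hM : submanifold M) (hf : caratheodory_fun f)
    (H1 : inplane_periodic f) (H2 : Phi_growth Phi f) :
  [/\ (* (i) *)
      forall s (xi : 'M[R]_(3, 2)), M s -> tangent_mx (tangent M s) xi ->
        cvg (fbar_cell f Phi M s xi t @[t --> +oo]) /\
        Tfhom f M s xi = fbarhom f Phi M s xi,
      (* (ii) *)
      tangentially_quasiconvex M (Tfhom f M) /\
      (forall s, M s -> rank_one_convex (tangent M s) (Tfhom f M s)),
      (* (iii) *)
      exists alpha' beta' : R, 0 < alpha' < beta' /\
        forall s (xi : 'M[R]_(3, 2)), M s -> tangent_mx (tangent M s) xi ->
          ((alpha' * Phi (enorm xi))%:E <= Tfhom f M s xi /\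
           Tfhom f M s xi <= (beta' * (1 + Phi (enorm xi)))%:E)%E
    & forall phi : R -> R, young_density Phi phi ->
      exists2 C : R, 0 < C &
        forall s (xi xi' : 'M[R]_(3, 2)), M s ->
          tangent_mx (tangent M s) xi -> tangent_mx (tangent M s) xi' ->
          (`|Tfhom f M s xi - Tfhom f M s xi'| <=
           (C * enorm (xi - xi') * (1 + phi (enorm xi + enorm xi')))%:E)%E].
Proof.
have [alpha [beta [ab gr]]] := H2; have [f' gf ff'] := regularize hPhi ab hf H1 gr.
have /andP[a0 al] := ab.
have TE := Tfhom_hom hPhi a0 al hM hf gf ff'.
have sub s : M s -> subspace (tangent M s) by exact: tangent_subspace.
split.
- move=> s xi Ms txi; have h := fbar_cell_cvg hPhi a0 al hM hf gf ff' Ms txi.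
  split; first exact: cvgP h.
  by rewrite TE// /fbarhom (cvg_lim _ h).
- split=> [s Ms xi txi psi G HW HT Hz|s Ms xi eta txi teta rk la la01].
    rewrite (TE s xi Ms).
    exact: (hom_quasiconvex hPhi a0 al hDelta gf (sub s Ms) (fun Z _ => TE s Z Ms) txi HW HT Hz).
  rewrite !(TE s _ Ms) -!EFinM -EFinD lee_fin.
  exact: (hom_rank_one_convex hPhi a0 al hDelta gf (sub s Ms) txi teta rk la01).
(* The strict inequality between the two constants is obtained by adding 1, as only alpha <= beta is
   given. *)
- exists alpha, (beta + 1); rewrite a0 (le_lt_trans al) ?ltrDl//; split => // s xi Ms txi.
  rewrite (TE s xi Ms) !lee_fin; split.
    exact: (hom_lower hPhi a0 al gf xi (sub s Ms)).
  apply: le_trans (hom_upper hPhi a0 al gf xi (sub s Ms)) _.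
  rewrite ler_wpM2r ?lerDl// addr_ge0//.
  exact: (young_ge0 hPhi (enorm_ge0 _)).
- move=> phi dphi; have [C C0 HC] := hom_lipschitz_abs hPhi a0 al gf hDelta.
  exists C => // s xi xi' Ms txi txi'; rewrite !(TE s _ Ms) -EFinB /= lee_fin.
  apply: le_trans (HC _ _ _ (sub s Ms) txi txi') _.
  apply: ler_wpM2l; first by rewrite mulr_ge0 ?enorm_ge0// ltW.
  set r := enorm xi + enorm xi'; have r0 : 0 <= r by rewrite addr_ge0 ?enorm_ge0.
  have [p0 pr] := young_density_le dphi r0.
  (* (1 + Phi(r))/(1 + r) <= 1 + phi(r), from Phi(r) <= r phi(r). *)
  rewrite ler_pdivrMr ?ltr_wpDr//.
  exact: density_arith (young_ge0 hPhi r0) p0 r0 pr.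
Qed.
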